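(* Let $v\ge 3$ and $1\le i\le v$ be integers and let $A$ be a point set in almost convex position with parameters $(v,i)$. Let $p$ be one of its interior points and let $(q,r)$ be the convex hull edge which has $p$ next to it. Let $B=A\setminus\{p\}$, and let $C$ be the point set obtained from $A$ by moving $p$ to convex position across the edge $(q,r)$. Then for every $W\subseteq A_I$ not containing $p$ (so that $W$ is also a set of interior points of $B$ and of $C$): (1) $|\mathcal{PT}_W(A)| = |\mathcal{PT}_W(C)| - |\mathcal{PT}_W(B)|$. (2) $|\mathcal{PT}_{W\cup\{p\}}(A)| = 2\,|\mathcal{PT}_W(C)| - |\mathcal{PT}_W(B)|$. (3) $|\mathcal{PT}_{W\cup\{p\}}(A)| = 2\,|\mathcal{PT}_{W}(A)| + |\mathcal{PT}_{W}(B)|$. In particular, $|\mathcal{PT}_{U}(A)|\ge |\mathcal{PT}_{U\setminus\{s\}}(A)|$ for every $U\subseteq A_I$ and every $s\in U$.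
   Context: All point sets are finite planar sets in general position (no three points collinear). A pseudo-triangle is a planar simple polygon with exactly three convex vertices (internal angle less than $\pi$). A pseudo-triangulation of a point set $A$ is a partition of $\operatorname{conv}(A)$ into pseudo-triangles whose vertex set is exactly $A$. A vertex is pointed if it has an incident angle greater than $\pi$ (convex hull vertices are always pointed). $A_I$ is the set of points of $A$ in the interior of $\operatorname{conv}(A)$. For $W\subseteq A_I$, $\mathcal{PT}_W(A)$ is the set of pseudo-triangulations of $A$ in which the points of $W$ are pointed and those of $A_I\setminus W$ are non-pointed. A point set $A$ is in almost convex position with parameters $(v,i)$ if it consists of $v$ points forming the vertex set of a convex $v$-gon and $i$ interior points placed sufficiently close to $i$ different edges of the $v$-gon. An interior point $p$ is sufficiently close to the edge $(r,q)$ of the $v$-gon if no segment connecting two points of $A$ can separate $p$ from $(r,q)$ (that is, no such segment passes between $p$ and the edge, through the interior of the triangle $pqr$). For $i=0$ this means $v$ points in convex position. ''Moving $p$ to convex position across $(q,r)$'' means that $p$ is replaced by a point on the other side of the line $qr$, just outside the hull edge $(q,r)$, so that the orientation of the triple $p,q,r$ is reversed and the orientations of all other triples of points are unchanged; thus $C$ is in almost convex position with parameters $(v+1,i-1)$. *)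

(* Defs.v *)
From HB Require Import structures.
From mathcomp Require Import all_boot all_order all_algebra finmap.
From mathcomp Require Import all_classical all_reals all_analysis.

Set Implicit Arguments.
Unset Strict Implicit.
Unset Printing Implicit Defensive.

Import Order.TTheory GRing.Theory Num.Theory.
Import numFieldNormedType.Exports.

Local Open Scope classical_set_scope.
Local Open Scope ring_scope.

Notation plane R := (R * R)%type.

Section PointSets.
Context {R : realType}.
Implicit Types (x y z p q r : plane R) (A : {fset plane R}).

(* Twice the signed area of the triangle xyz: positive iff counterclockwise. *)
Definition orient x y z : R :=
  (y.1 - x.1) * (z.2 - x.2) - (y.2 - x.2) * (z.1 - x.1).

Definition general_position A : Prop :=
  {in A & &, forall x y z,
    x != y -> y != z -> x != z -> orient x y z != 0}.

Definition conv A : set (plane R) :=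
  [set x | exists w : plane R -> R,
     [/\ {in A, forall a, 0 <= w a},
         \sum_(a <- A) w a = 1
       & x = \sum_(a <- A) w a *: a]].

Definition interior_points A : {fset plane R} :=
  [fset x in A | `[< interior (conv A) x >]]%fset.

Definition hull_edge A q r : Prop :=
  [/\ q \in A, r \in A, q != r
    & {in A &, forall x y, x \notin [fset q; r]%fset ->
         y \notin [fset q; r]%fset -> 0 < orient q r x * orient q r y}].

(* The segment xy is conv [fset x; y]. *)
Definition close_to_edge A p q r : Prop :=
  {in A &, forall x y,
    conv [fset x; y]%fset `&` interior (conv [fset p; q; r]%fset) = set0}.

(* e x is the set of endpoints of the edge that the interior point x is close
   to; in general position the points of A outside interior_points A are
   exactly the vertices of the convex polygon conv A. *)
Definition almost_convex A (v i : nat)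
    (e : plane R -> {fset plane R}) : Prop :=
  [/\ general_position A,
      #|` (A `\` interior_points A)%fset| = v,
      #|` interior_points A| = i,
      {in interior_points A &, injective e}
    & {in interior_points A, forall x, exists q r,
         [/\ e x = [fset q; r]%fset, hull_edge A q r
           & close_to_edge A x q r]}].

(* p' can replace p: in A `\ p all points, hence all triples avoiding p,
   stay where they are. *)
Definition moved_across A p q r p' : Prop :=
  Num.sg (orient p' q r) = - Num.sg (orient p q r) /\
  {in (A `\ p)%fset &, forall x y, [fset x; y]%fset != [fset q; r]%fset ->
     Num.sg (orient p' x y) = Num.sg (orient p x y)}.

End PointSets.

Section Polygons.
Context {R : realType}.

(* A polygon is encoded by its set of edges, an edge being the set of its two
   endpoints.  This is independent of the choice of a starting vertex and of a
   direction of traversal, so that counting edge sets counts polygons. *)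
Definition polygon := {fset {fset plane R}}.

Implicit Types (P Q : polygon) (x : plane R) (A W : {fset plane R}).

Definition vertices P : {fset plane R} := fcover P.

Definition simple_polygon P : Prop :=
  (exists s : seq (plane R),
     [/\ (2 < size s)%N, uniq s
       & P = [fset [fset x; next s x] | x in s]%fset]) /\
  {in P &, forall e f, e != f -> conv e `&` conv f = [set` (e `&` f)%fset]}.

Definition boundary P : set (plane R) := \bigcup_(e in [set` P]) conv e.

(* The bounded side of the Jordan curve boundary P. *)
Definition inside P : set (plane R) :=
  [set x | ~ boundary P x /\
           bounded_set (connected_component (~` boundary P) x)].

Definition region P : set (plane R) := boundary P `|` inside P.

(* The internal angle at x is less than pi: near x, the convex sector spanned
   by the two edges at x is inside the polygon, rather than its complement. *)
Definition convex_vertex P x : Prop :=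
  exists a b (eps : R),
    [/\ a != b, [fset x; a]%fset \in P, [fset x; b]%fset \in P, 0 < eps
      & forall s t : R, 0 < s < eps -> 0 < t < eps ->
          inside P (x + s *: (a - x) + t *: (b - x))].

(* If no three vertices are collinear, no internal angle equals pi. *)
Definition reflex_vertex P x : Prop :=
  x \in vertices P /\ ~ convex_vertex P x.

Definition pseudo_triangle P : Prop :=
  simple_polygon P /\
  #|` [fset x in vertices P | `[< convex_vertex P x >]]%fset| = 3%N.

Definition pseudo_triangulation A (T : {fset polygon}) : Prop :=
  [/\ {in T, forall P, pseudo_triangle P},
      \bigcup_(P in [set` T]) region P = conv A,
      {in T &, forall P Q, P != Q -> inside P `&` inside Q = set0}
    & (\bigcup_(P <- T) vertices P)%fset = A].

(* At a convex hull vertex the angle outside conv A is greater than pi. *)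
Definition pointed A (T : {fset polygon}) x : Prop :=
  x \notin interior_points A \/ exists2 P, P \in T & reflex_vertex P x.

(* The polygons of a pseudo-triangulation of A have all their vertices in A,
   so restricting to the iterated powerset of A loses nothing. *)
Definition PT A W : {fset {fset polygon}} :=
  [fset T in fpowerset (fpowerset (fpowerset A)) |
    `[< pseudo_triangulation A T /\
        {in interior_points A, forall x, pointed A T x <-> x \in W} >]]%fset.

End Polygons.

Arguments polygon R : clear implicits.

(* Main.v *)
From mathcomp Require Import all_boot all_order all_algebra finmap.
From mathcomp Require Import all_classical all_reals all_analysis.
From mathcomp Require Import ring lra zify.
Require Import Defs.
Set Implicit Arguments.
Unset Strict Implicit.
Unset Printing Implicit Defensive.
Import Order.TTheory GRing.Theory Num.Theory.
Import numFieldNormedType.Exports.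

(** Why the theorem is true.

    Let p lie next to the hull edge qr, with q, r, p counterclockwise, and look
    at the pseudo-triangle at the hull edge qr. Counting convex vertices on both
    sides of the chords pq and pr shows that it is the triangle q r p, or a
    polygon with consecutive vertices q, r, p, or one with consecutive vertices
    p, q, r, without other adjacencies among the three ([ear_polygon]). In the
    last two cases its angle at p is larger than pi.

    - If p is not pointed, the triangle is present. It can be merged with the
      polygon behind its edge qp or with the one behind its edge pr, and both
      moves make p pointed and can be undone ([card_flip_q], [card_flip_r]).
    - If p is pointed and the triangle is present, the large angle at p is the
      complement of the triangle's, in a polygon q p r t. Nothing else touches
      p, so that filling the triangle into this polygon gives a
      pseudo-triangulation of B, and every one of B arises ([card_carve]).

    Together these moves give (3), which is [count_pointed].

    In C, the triangle over qr with apex p' is a hull ear. If it is a polygon of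
    the pseudo-triangulation, it can be removed, which leaves one of B
    ([card_fill]). If not, then no polygon depends on the orientation of the
    triple p', q, r, the only one that changes when p' is pushed back to p. The
    polygons stay pseudo-triangles, and the triangle q r p that becomes
    uncovered is added ([card_rename]). Hence |PT_W(C)| = |PT_W(A)| + |PT_W(B)|,
    which is (1), and (2) follows from (1) and (3).

    These moves are verified without topology. A polygon is walked
    counterclockwise, so that it becomes a cyclic list s of points; psi s says
    that s bounds a pseudo-triangle, and its convex vertices are its left turns
    ([convex_vertexP]). A family of such polygons is a pseudo-triangulation iff
    its arcs add up to those of the hull polygon: for all x and y, the number of
    polygons walked from x to y, minus the number of those walked from y to x,
    is 1, -1 or 0 according to whether xy, yx or none of them is a hull arc
    ([chain], [chain_of_tile], [tile_of_chain], [PTP]). One direction compares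
    the two sides of a generic point of xy. Conversely, the winding numbers of
    the polygons add up to that of the hull, which is 1 at a generic point of
    the hull.

    The passage from regions to lists rests on the Jordan curve theorem for
    polygons ([jordan], [inside_edges]). Winding numbers are defined by counting
    crossings of a vertical ray. Inserting a vertex adds the winding number of a
    triangle ([wind_ins]), so that the local behaviour at edges and vertices is
    that of triangles. Pairing the winding number with any other function that
    is constant on components, one sees two limit values at a boundary point and,
    since the polygon is connected, the same two along the whole polygon
    ([two_values]); a second bounded component would add a third. *)

(** * The plane: orientations, neighbourhoods and segments *)

Section PlaneBasics.
Local Open Scope classical_set_scope.
Local Open Scope ring_scope.
Context {R : realType}.
Implicit Types (x y z a b c m : plane R) (k t : R).

Lemma pD1 x y : (x + y).1 = x.1 + y.1. Proof. by []. Qed.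
Lemma pD2 x y : (x + y).2 = x.2 + y.2. Proof. by []. Qed.
Lemma pN1 x : (- x).1 = - x.1. Proof. by []. Qed.
Lemma pN2 x : (- x).2 = - x.2. Proof. by []. Qed.
Lemma pZ1 k x : (k *: x).1 = k * x.1. Proof. by []. Qed.
Lemma pZ2 k x : (k *: x).2 = k * x.2. Proof. by []. Qed.
Definition pE := (pD1, pD2, pN1, pN2, pZ1, pZ2).

Lemma plane_eq x y : x.1 = y.1 -> x.2 = y.2 -> x = y.
Proof. by case: x y => [? ?] [? ?] /= -> ->. Qed.

Lemma orientC x y z : orient x y z = orient y z x.
Proof. rewrite /orient; ring. Qed.

Lemma orientN x y z : orient y x z = - orient x y z.
Proof. rewrite /orient; ring. Qed.

Lemma orientxx x y : orient x x y = 0.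
Proof. rewrite /orient; ring. Qed.

Lemma orientxyx x y : orient x y x = 0.
Proof. rewrite /orient; ring. Qed.

Lemma orientxyy x y : orient x y y = 0.
Proof. rewrite /orient; ring. Qed.

Lemma orient_cvx x y a b t :
  orient x y (a + t *: (b - a)) = (1 - t) * orient x y a + t * orient x y b.
Proof. rewrite /orient !pE; ring. Qed.

Definition box m (e : R) : set (plane R) :=
  [set y | `|y.1 - m.1| < e /\ `|y.2 - m.2| < e].

Lemma nearP m (P : set (plane R)) :
  (\forall y \near m, P y) <-> exists2 e : R, 0 < e & box m e `<=` P.
Proof.
have E e : ball m e = box m e.
  apply/seteqP; split=> y; rewrite /ball /= /prod_ball /ball /=;
    by rewrite (distrC m.1) (distrC m.2).
split.
  by move=> /nbhs_ballP[e /= e0 H]; exists e => //; rewrite -E.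
by move=> [e e0 H]; apply/nbhs_ballP; exists e => //; rewrite E.
Qed.

Lemma near_pos (f : plane R -> R) m :
  {for m, continuous f} -> 0 < f m -> \forall y \near m, 0 < f y.
Proof. by move=> cf f0; exact: (@cvgr_gt R _ (nbhs m) _ f (f m) cf). Qed.

Lemma orient_continuous a b : continuous (orient a b).
Proof.
move=> m; rewrite /orient.
apply: cvgB; apply: cvgM; try exact: cvg_cst; apply: cvgB; try exact: cvg_cst.
  exact: cvg_snd.
exact: cvg_fst.
Qed.

Lemma near_orient_gt0 a b m : 0 < orient a b m ->
  \forall y \near m, 0 < orient a b y.
Proof. by apply: near_pos; exact: orient_continuous. Qed.

Lemma near_orient_lt0 a b m : orient a b m < 0 ->
  \forall y \near m, orient a b y < 0.
Proof.
rewrite -oppr_gt0 -orientN => /near_orient_gt0; apply: filterS => y.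
by rewrite orientN oppr_gt0.
Qed.

Lemma near_ray m d (P : set (plane R)) : (\forall y \near m, P y) ->
  exists2 e : R, 0 < e & forall t, `|t| < e -> P (m + t *: d).
Proof.
move=> /nearP[e e0 H]; set M := 1 + `|d.1| + `|d.2|.
have M0 : 0 < M by rewrite /M; have := normr_ge0 d.1; have := normr_ge0 d.2; lra.
exists (e / M); first exact: divr_gt0.
move=> t; rewrite ltr_pdivlMr // => tM; apply: H.
have h (u : R) : `|u| <= M -> `|t * u| < e.
  by move=> uM; rewrite normrM; apply: le_lt_trans tM; apply: ler_wpM2l.
have := normr_ge0 d.1; have := normr_ge0 d.2 => d1 d2.
split; rewrite !pE.
  by rewrite addrAC subrr add0r; apply: h; rewrite /M; lra.
by rewrite addrAC subrr add0r; apply: h; rewrite /M; lra.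
Qed.

Lemma near_all (T : eqType) (s : seq T) m (P : T -> set (plane R)) :
  (forall e, e \in s -> \forall y \near m, P e y) ->
  \forall y \near m, forall e, e \in s -> P e y.
Proof.
elim: s => [|e s IH] H; first by apply: filterE => y e; rewrite in_nil.
have H1 := H e (mem_head _ _).
have H2 : \forall y \near m, forall e0, e0 \in s -> P e0 y.
  by apply: IH => e0 es; apply: H; rewrite in_cons es orbT.
near=> y => e0; rewrite in_cons => /orP[/eqP->|]; first by near: y.
by move: e0; near: y.
Unshelve. all: by end_near. Qed.

(** The fibres of F are relatively open and closed. *)
Lemma connected_const (U : topologicalType) (T : Type) (E : set U) (F : U -> T) :
  connected E ->
  (forall x : U, E x -> \forall y \near x, E y -> F y = F x) ->
  forall x y : U, E x -> E y -> F x = F y.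
Proof.
move=> cE lF x y Ex Ey.
have op (G : set T) : exists2 C, open C & E `&` (F @^-1` G) = E `&` C.
  exists (interior [set z | E z -> G (F z)]); first exact: open_interior.
  apply/seteqP; split=> z [Ez] /=.
    move=> Gz; split=> //; have := lF _ Ez.
    by rewrite /interior /=; apply: filterS => u Hu Eu; rewrite (Hu Eu).
  by move=> /interior_subset /= H; split=> //; exact: H.
suff : E `&` (F @^-1` [set F x]) = E.
  by move=> H; have [_ /=] : (E `&` (F @^-1` [set F x])) y by rewrite H.
apply: cE.
- by exists x.
- exact: op.
have [C oC EC] := op (~` [set F x]).
exists (~` C); first exact: open_closedC.
apply/seteqP; split=> z [Ez] /=.
  move=> Fz; split=> // Cz.
  by have [_] : (E `&` (F @^-1` (~` [set F x]))) z by rewrite EC.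
move=> nC; split=> //; apply: contrapT => Fz; apply: nC.
by have [] : (E `&` C) z by rewrite -EC.
Qed.

Definition seg a b : set (plane R) :=
  [set z | exists t, [/\ 0 <= t, t <= 1 & z = a + t *: (b - a)]].

Lemma seg_l a b : seg a b a.
Proof. by exists 0; split=> //; rewrite scale0r addr0. Qed.

Lemma seg_r a b : seg a b b.
Proof. by exists 1; split=> //; rewrite scale1r addrC subrK. Qed.

Lemma segC a b : seg a b = seg b a.
Proof.
have H u v : seg u v `<=` seg v u.
  move=> z [t [t0 t1 ->]]; exists (1 - t); split; [lra|lra|].
  by apply: plane_eq; rewrite !pE; ring.
by apply/seteqP; split.
Qed.

Lemma seg_connected a b : connected (seg a b).
Proof.
have -> : seg a b = (fun t : R => a + t *: (b - a)) @` `[0, 1].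
  apply/seteqP; split=> z /=.
    by move=> [t [t0 t1 ->]]; exists t => //; rewrite /= in_itv /= t0 t1.
  by move=> [t]; rewrite /= in_itv /= => /andP[t0 t1] <-; exists t; split.
apply: connected_continuous_connected; first exact: segment_connected.
apply: continuous_subspaceT => t.
by apply: cvgD; [exact: cvg_cst|apply: cvgZr_tmp; exact: cvg_id].
Qed.

Lemma seg_closed a b : closed (seg a b).
Proof.
have -> : seg a b = (fun t : R => a + t *: (b - a)) @` `[0, 1].
  apply/seteqP; split=> z /=.
    by move=> [t [t0 t1 ->]]; exists t => //; rewrite /= in_itv /= t0 t1.
  by move=> [t]; rewrite /= in_itv /= => /andP[t0 t1] <-; exists t; split.
apply: compact_closed; first exact: norm_hausdorff.
apply: continuous_compact; last exact: segment_compact.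
apply: continuous_subspaceT => t.
by apply: cvgD; [exact: cvg_cst|apply: cvgZr_tmp; exact: cvg_id].
Qed.

Lemma near_notin_seg a b m : ~ seg a b m -> \forall y \near m, ~ seg a b y.
Proof.
by move=> H; apply: (open_nbhs_nbhs (conj (closed_openC (@seg_closed a b)) H)).
Qed.

End PlaneBasics.

(** * Winding numbers of closed polygonal chains *)

Section Winding.
Local Open Scope classical_set_scope.
Local Open Scope ring_scope.
Context {R : realType}.
Implicit Types (x y z a b c m v : plane R) (k t : R) (s : seq (plane R)).

Fixpoint pth x s : seq (plane R * plane R) :=
  if s is y :: s' then (x, y) :: pth y s' else [::].

Definition arcs s := if s is x :: s' then pth x (rcons s' x) else [::].

Lemma pth_cat x s1 s2 : pth x (s1 ++ s2) = pth x s1 ++ pth (last x s1) s2.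
Proof. by elim: s1 x => //= y s1 IH x; rewrite IH. Qed.

Lemma pth_rcons x s y : pth x (rcons s y) = rcons (pth x s) (last x s, y).
Proof. by rewrite -cats1 pth_cat /= cats1. Qed.

Lemma arcs_catC s1 s2 : perm_eq (arcs (s1 ++ s2)) (arcs (s2 ++ s1)).
Proof.
case: s1 s2 => [|x s1] [|y s2]; rewrite ?cats0 //=.
rewrite !rcons_cat /= !pth_cat /= !pth_rcons -!cats1.
set u := _ :: _; set v := _ :: _.
have -> : pth x s1 ++ u = (pth x s1 ++ [:: (last x s1, y)])
    ++ (pth y s2 ++ [:: (last y s2, x)]) by rewrite -catA.
have -> : pth y s2 ++ v = (pth y s2 ++ [:: (last y s2, x)])
    ++ (pth x s1 ++ [:: (last x s1, y)]) by rewrite -catA.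
by rewrite perm_catC.
Qed.

Lemma arcs_rot n s : perm_eq (arcs (rot n s)) (arcs s).
Proof. by rewrite /rot -{3}(cat_take_drop n s) arcs_catC. Qed.

(** Signed crossing of the arc from a to b with the upward vertical ray from z;
    the half-open rule for vertices on the ray makes sums over closed chains
    come out right even when the ray passes through vertices. *)
Definition kap a b z : int :=
  if (a.1 <= z.1) == (b.1 <= z.1) then 0
  else if b.1 <= z.1 then Posz (0 < orient a b z)%R else - Posz (0 < orient b a z)%R.

Definition wind s z : int := \sum_(e <- arcs s) kap e.1 e.2 z.

Definition bd s : set (plane R) := [set z | exists2 e, e \in arcs s & seg e.1 e.2 z].

Lemma kapC a b z : kap b a z = - kap a b z.
Proof.
rewrite /kap eq_sym; case: (a.1 <= z.1); case: (b.1 <= z.1) => //=;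
  by rewrite ?oppr0 ?opprK.
Qed.

Lemma seg_between a b x : orient a b x = 0 -> a.1 != b.1 ->
  (a.1 - x.1) * (b.1 - x.1) <= 0 -> seg a b x.
Proof.
case: a b x => [a1 a2] [b1 b2] [x1 x2] /=.
rewrite /orient /= => o ab le0.
have ab' : b1 - a1 != 0 by rewrite subr_eq0 eq_sym.
have q : 0 < (b1 - a1) ^+ 2 by rewrite exprn_even_gt0.
have E : (x1 - a1) / (b1 - a1) = (x1 - a1) * (b1 - a1) / (b1 - a1) ^+ 2.
  by field.
exists ((x1 - a1) / (b1 - a1)); split.
- by rewrite E divr_ge0 ?(ltW q) //; nra.
- by rewrite E ler_pdivrMr //; nra.
apply: plane_eq; rewrite !pE /=; first by field.
have -> : x2 = a2 + (b2 - a2) * (x1 - a1) / (b1 - a1).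
  apply/(mulIf ab'); rewrite mulrDl divfK //; lra.
by field.
Qed.

Lemma seg_vertical a b x : a.1 = x.1 -> b.1 = x.1 ->
  (a.2 - x.2) * (b.2 - x.2) <= 0 -> seg a b x.
Proof.
case: a b x => [a1 a2] [b1 b2] [x1 x2] /= -> -> le0.
have [ab|ab] := eqVneq a2 b2.
  have -> : x2 = a2.
    apply/eqP; rewrite -subr_eq0 -sqrf_eq0 eq_le sqr_ge0 andbT.
    by move: le0; rewrite -ab; congr (_ <= _); ring.
  exact: seg_l.
have ab' : b2 - a2 != 0 by rewrite subr_eq0 eq_sym.
have q : 0 < (b2 - a2) ^+ 2 by rewrite exprn_even_gt0.
have E : (x2 - a2) / (b2 - a2) = (x2 - a2) * (b2 - a2) / (b2 - a2) ^+ 2.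
  by field.
exists ((x2 - a2) / (b2 - a2)); split.
- by rewrite E divr_ge0 ?(ltW q) //; nra.
- by rewrite E ler_pdivrMr //; nra.
by apply: plane_eq; rewrite !pE /=; field.
Qed.

Definition jump x y v : int :=
  if [&& v.1 == x.1, y.1 < v.1 & x.2 < v.2] then -1 else 0.

Lemma near_fst x v : \forall y \near x, v.1 != x.1 -> (v.1 <= y.1) = (v.1 <= x.1).
Proof.
have [vx|vx|vx] := ltgtP v.1 x.1; last by apply: filterE.
  have : \forall y \near x, 0 < y.1 - v.1.
    apply: near_pos; last by rewrite subr_gt0.
    by apply: cvgB; [exact: cvg_fst|exact: cvg_cst].
  by apply: filterS => y; rewrite subr_gt0 => /ltW -> _.
have : \forall y \near x, 0 < v.1 - y.1.
  apply: near_pos; last by rewrite subr_gt0.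
  by apply: cvgB; [exact: cvg_cst|exact: cvg_fst].
by apply: filterS => y; rewrite subr_gt0 => vy _; rewrite leNgt vy.
Qed.

Lemma near_orient_sg a b x : orient a b x != 0 ->
  \forall y \near x, (0 < orient a b y) = (0 < orient a b x) /\
     (orient a b y < 0) = (orient a b x < 0).
Proof.
have [h|h|//] := ltgtP (orient a b x) 0 => _.
  apply: filterS (near_orient_lt0 h) => y hy.
  by rewrite hy (lt_gtF hy).
apply: filterS (near_orient_gt0 h) => y hy.
by rewrite hy (lt_gtF hy).
Qed.

Lemma mulr_sgn (u v : R) : u != 0 -> v != 0 ->
  (0 < u * v) = ((0 < u) == (0 < v)) /\ (u * v < 0) = ((0 < u) != (0 < v)).
Proof.
case: (ltgtP u 0) => // hu _; case: (ltgtP v 0) => // hv _ /=.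
- by rewrite nmulr_rgt0 // nmulr_rlt0 // hv (lt_gtF hv).
- by rewrite nmulr_rgt0 // nmulr_rlt0 // hv (lt_gtF hv).
- by rewrite pmulr_rgt0 // pmulr_rlt0 // hv (lt_gtF hv).
by rewrite pmulr_rgt0 // pmulr_rlt0 // hv (lt_gtF hv).
Qed.

(** The crossing number of a single arc is not locally constant off the arc,
    but its variation is a difference of vertex terms, which telescopes along a
    closed chain. *)
Lemma kap_near a b x : ~ seg a b x ->
  \forall y \near x, kap a b y - kap a b x = jump x y b - jump x y a.
Proof.
move=> nseg.
have nO : \forall y \near x, orient a b x != 0 ->
    (0 < orient a b y) = (0 < orient a b x) /\
    (orient a b y < 0) = (orient a b x < 0).
  have [->|ne] := eqVneq (orient a b x) 0; first exact: filterE.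
  by apply: filterS (near_orient_sg ne) => y h _.
near=> y.
have ha : a.1 != x.1 -> (a.1 <= y.1) = (a.1 <= x.1) by near: y; exact: near_fst.
have hb : b.1 != x.1 -> (b.1 <= y.1) = (b.1 <= x.1) by near: y; exact: near_fst.
have hO : orient a b x != 0 -> (0 < orient a b y) = (0 < orient a b x) /\
    (orient a b y < 0) = (orient a b x < 0) by near: y.
rewrite /jump /kap ![orient b a _]orientN !oppr_gt0.
have [ax|ax] := eqVneq a.1 x.1; have [bx|bx] := eqVneq b.1 x.1 => /=.
- rewrite ax bx eqxx eqxx /= subrr.
  have -> : (x.2 < a.2) = (x.2 < b.2); last by rewrite subrr.
  apply: contrapT => H; apply: nseg; apply: seg_vertical => //.
  by have [h1|h1] := ltP x.2 a.2; have [h2|h2] := ltP x.2 b.2;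
    rewrite ?h1 ?h2 // in H *; nra.
- have O : orient a b x = (b.1 - x.1) * (x.2 - a.2).
    by rewrite /orient ax; ring.
  have nx : a.2 != x.2.
    by apply: contra_not_neq nseg => E; rewrite -(plane_eq ax E); exact: seg_l.
  have O0 : orient a b x != 0.
    by rewrite O mulf_neq0 // subr_eq0 // eq_sym.
  have d1 : b.1 - x.1 != 0 by rewrite subr_eq0.
  have d2 : x.2 - a.2 != 0 by rewrite subr_eq0 // eq_sym.
  have [m1 m2] := mulr_sgn d1 d2; rewrite -O in m1 m2.
  have [s1 s2] := hO O0; rewrite s1 s2 m1 m2 !subr_gt0 (hb bx) ax lexx.
  move: bx nx; case: (ltgtP b.1 x.1) => // bx _; case: (ltgtP x.2 a.2) => // xa _;
  case: (leP x.1 y.1) => xy //=.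
- have O : orient a b x = (a.1 - x.1) * (b.2 - x.2).
    by rewrite /orient bx; ring.
  have nx : b.2 != x.2.
    by apply: contra_not_neq nseg => E; rewrite -(plane_eq bx E); exact: seg_r.
  have O0 : orient a b x != 0.
    by rewrite O mulf_neq0 // subr_eq0 // eq_sym.
  have d1 : a.1 - x.1 != 0 by rewrite subr_eq0.
  have d2 : b.2 - x.2 != 0 by rewrite subr_eq0 // eq_sym.
  have [m1 m2] := mulr_sgn d1 d2; rewrite -O in m1 m2.
  have [s1 s2] := hO O0; rewrite s1 s2 m1 m2 !subr_gt0 (ha ax) bx lexx.
  move: ax nx; case: (ltgtP a.1 x.1) => // ax _; case: (ltgtP x.2 b.2) => // xb _;
  case: (leP x.1 y.1) => xy //=.
rewrite (ha ax) (hb bx) subrr.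
case: ifP => [|hab]; first by rewrite subrr.
have O0 : orient a b x != 0.
  apply: contra_not_neq nseg => O; apply: seg_between => //.
    by apply/eqP => E; move: hab; rewrite E eqxx.
  by move: hab ax bx; case: (ltgtP a.1 x.1) => // ha1; case: (ltgtP b.1 x.1) => // hb1 _ _ _;
    nra.
by have [-> ->] := hO O0; rewrite subrr.
Unshelve. all: by end_near. Qed.

Lemma sum_pth (F : plane R -> int) x s :
  \sum_(e <- pth x s) (F e.2 - F e.1) = F (last x s) - F x.
Proof.
elim: s x => [|y s IH] x /=; first by rewrite big_nil subrr.
by rewrite big_cons IH /=; ring.
Qed.

Lemma sum_arcs (F : plane R -> int) s : \sum_(e <- arcs s) (F e.2 - F e.1) = 0.
Proof.
case: s => [|x s]; first by rewrite big_nil.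
by rewrite sum_pth last_rcons subrr.
Qed.

(** The vertex terms of [kap_near] cancel along a closed chain. *)
Lemma wind_near s x : ~ bd s x -> \forall y \near x, wind s y = wind s x.
Proof.
move=> nb.
have : \forall y \near x, forall e, e \in arcs s ->
    kap e.1 e.2 y - kap e.1 e.2 x = jump x y e.2 - jump x y e.1.
  by apply: near_all => e es; apply: kap_near => he; apply: nb; exists e.
apply: filterS => y H; apply/eqP; rewrite -subr_eq0 /wind -sumrB.
rewrite big_seq (eq_bigr (fun e => jump x y e.2 - jump x y e.1)) //.
by rewrite -big_seq sum_arcs.
Qed.

Lemma near_notin_bd s x : ~ bd s x -> \forall y \near x, ~ bd s y.
Proof.
move=> nb.
have : \forall y \near x, forall e, e \in arcs s -> ~ seg e.1 e.2 y.
  by apply: near_all => e es; apply: near_notin_seg => he; apply: nb; exists e.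
by apply: filterS => y H [e es]; exact: H.
Qed.

Lemma wind_perm s s' z : perm_eq (arcs s) (arcs s') -> wind s z = wind s' z.
Proof. by move=> p; rewrite /wind (perm_big _ p). Qed.

Lemma bd_perm s s' : perm_eq (arcs s) (arcs s') -> bd s = bd s'.
Proof.
move=> p; apply/seteqP; split=> z [e es h]; exists e => //.
  by rewrite -(perm_mem p).
by rewrite (perm_mem p).
Qed.

Lemma wind_const s (E : set (plane R)) x y : connected E -> E `<=` ~` bd s ->
  E x -> E y -> wind s x = wind s y.
Proof.
move=> cE sub; apply: connected_const => // z Ez.
by apply: filterS (wind_near (sub _ Ez)).
Qed.

End Winding.

(** * Winding numbers far away and around triangles *)

Section WindingFacts.
Local Open Scope classical_set_scope.
Local Open Scope ring_scope.
Context {R : realType}.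
Implicit Types (x y z a b c m v u : plane R) (k t : R) (s : seq (plane R)).

Definition dot u x : R := u.1 * x.1 + u.2 * x.2.

Lemma seq_bound (T : eqType) (f : T -> R) (s : seq T) :
  exists2 M : R, 0 < M & forall v : T, v \in s -> f v < M.
Proof.
elim: s => [|w s [M M0 HM]]; first by exists 1.
exists (M + `|f w|) => [|v]; first by have := normr_ge0 (f w); lra.
have := normr_ge0 (f w); have := ler_norm (f w).
rewrite in_cons => h1 h2 /orP[/eqP->|/HM]; lra.
Qed.

Lemma pth_mem x s e : e \in pth x s -> e.1 \in x :: s /\ e.2 \in s.
Proof.
elim: s x => //= y s IH x; rewrite in_cons => /orP[/eqP-> /=|/IH[h1 h2]].
  by rewrite !mem_head.
by rewrite in_cons h1 orbT in_cons h2 orbT.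
Qed.

Lemma arcs_mem s e : e \in arcs s -> e.1 \in s /\ e.2 \in s.
Proof.
case: s => //= x s /pth_mem[]; rewrite !in_cons !mem_rcons !in_cons.
by move=> h1 h2; rewrite h2; split=> //; case/orP: h1 => [->|].
Qed.

Lemma cvx_lt t (A B k : R) : 0 <= t -> t <= 1 -> A < k -> B < k ->
  (1 - t) * A + t * B < k.
Proof.
move=> t0 t1 Ak Bk; have [AB|BA] := leP A B.
  by apply: le_lt_trans Bk; nra.
by apply: le_lt_trans Ak; nra.
Qed.

Lemma seg_dot_lt u a b z k : dot u a < k -> dot u b < k -> seg a b z -> dot u z < k.
Proof.
move=> ha hb [t [t0 t1 ->]].
have -> : dot u (a + t *: (b - a)) = (1 - t) * dot u a + t * dot u b.
  by rewrite /dot !pE; ring.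
exact: cvx_lt.
Qed.

Lemma bd_dot_lt u s z k : (forall v, v \in s -> dot u v < k) -> bd s z -> dot u z < k.
Proof. by move=> H [e /arcs_mem[/H h1 /H h2]]; exact: seg_dot_lt. Qed.

Lemma wind_far s z : (forall v, v \in s -> v.1 < z.1) \/ (forall v, v \in s -> z.1 < v.1) ->
  wind s z = 0.
Proof.
move=> H; rewrite /wind big_seq big1 // => e /arcs_mem[h1 h2]; rewrite /kap.
case: H => H; first by rewrite !(ltW (H _ _)).
by rewrite !leNgt !(H _ _).
Qed.

(** Moving z horizontally away from s never meets s, and far out no arc crosses
    the ray. *)
Lemma wind_halfplane u s z : (forall v, v \in s -> dot u v < dot u z) -> wind s z = 0.
Proof.
move=> H.
have [M M0 HM] := @seq_bound _ (fun v => `|v.1| + `|z.1|) s.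
have main (k : R) : 0 <= u.1 * k -> (k = M \/ k = - M) -> wind s z = 0.
  move=> uk kM; set z' := z + (k, 0).
  have [zE1 zE2] : z'.1 = z.1 + k /\ z'.2 = z.2 + 0 by [].
  clearbody z'.
  have -> : wind s z = wind s z'.
    apply: (@wind_const _ s (seg z z')); first exact: seg_connected.
    - move=> x [t [t0 t1 ->]] /(bd_dot_lt H).
      rewrite /dot !pE zE1 zE2; nra.
    - exact: seg_l.
    - exact: seg_r.
  apply: wind_far; rewrite zE1; case: kM => ->; [left|right] => v /HM;
    have := ler_norm v.1; have := ler_norm (- v.1); have := ler_norm (- z.1);
    have := ler_norm z.1; rewrite ?normrN; lra.
have [u0|u0] := leP 0 u.1; first by apply: (main M); [nra|left].
by apply: (main (- M)); [nra|right].
Qed.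

Lemma lincomb_le0 (g1 g2 g3 A B C : R) : 0 < g1 -> 0 < g2 -> 0 <= g3 ->
  A <= 0 -> B <= 0 -> g3 * C <= 0 -> g1 * A + g2 * B + g3 * C = 0 ->
  A = 0 /\ B = 0.
Proof.
move=> p1 p2 p3 hA hB hC E.
have nA : g1 * A <= 0 by rewrite pmulr_rle0.
have nB : g2 * B <= 0 by rewrite pmulr_rle0.
have /eqP : g1 * A = 0 by lra.
have /eqP : g2 * B = 0 by lra.
by rewrite !mulf_eq0 (gt_eqF p1) (gt_eqF p2) /= => /eqP -> /eqP ->.
Qed.

(** To be applied to the barycentric relation between the vertices of a triangle
    and a point, read in the first coordinate. *)
Lemma lincomb_sg_le (g1 g2 g3 A B C : R) : g1 * A + g2 * B + g3 * C = 0 ->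
  A <= 0 -> B <= 0 -> 0 < C ->
  (0 < g1 -> 0 < g2 -> 0 <= g3) /\ (g1 < 0 -> g2 < 0 -> g3 <= 0).
Proof.
move=> E hA hB hC; split=> p1 p2.
  have nA : g1 * A <= 0 by rewrite pmulr_rle0.
  have nB : g2 * B <= 0 by rewrite pmulr_rle0.
  have : 0 <= g3 * C by lra.
  by rewrite pmulr_lge0.
have nA : 0 <= g1 * A by rewrite nmulr_rge0.
have nB : 0 <= g2 * B by rewrite nmulr_rge0.
have : g3 * C <= 0 by lra.
by rewrite pmulr_lle0.
Qed.

Lemma lincomb_sg_gt (g1 g2 g3 A B C : R) : g1 * A + g2 * B + g3 * C = 0 ->
  0 < A -> 0 < B -> C <= 0 ->
  (0 < g1 -> 0 < g2 -> 0 < g3) /\ (g1 < 0 -> g2 < 0 -> g3 < 0).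
Proof.
move=> E hA hB hC; split=> p1 p2.
  have nA : 0 < g1 * A by rewrite pmulr_rgt0.
  have nB : 0 < g2 * B by rewrite pmulr_rgt0.
  have : g3 * C < 0 by lra.
  rewrite le_eqVlt in hC; case/orP: hC => [/eqP ->|hC]; first by rewrite mulr0 ltxx.
  by rewrite nmulr_llt0.
have nA : g1 * A < 0 by rewrite nmulr_rlt0.
have nB : g2 * B < 0 by rewrite nmulr_rlt0.
have : 0 < g3 * C by lra.
rewrite le_eqVlt in hC; case/orP: hC => [/eqP ->|hC]; first by rewrite mulr0 ltxx.
by rewrite nmulr_lgt0.
Qed.

(** Two vertices on the same side of the vertical line through z leave at most
    two arcs that cross this line; up to rotation this is always the case. *)
Lemma wind_tri_core a b c z : 0 < orient a b c -> ~ bd [:: a; b; c] z ->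
  (a.1 <= z.1) = (b.1 <= z.1) ->
  wind [:: a; b; c] z =
  Posz [&& 0 < orient a b z, 0 < orient b c z & 0 < orient c a z]%R.
Proof.
move=> abc nb hab.
have n1 : ~ seg a b z.
  by move=> h; apply: nb; exists (a, b); rewrite ?in_cons ?eqxx ?orbT.
have n2 : ~ seg b c z.
  by move=> h; apply: nb; exists (b, c); rewrite ?in_cons ?eqxx ?orbT.
have n3 : ~ seg c a z.
  by move=> h; apply: nb; exists (c, a); rewrite ?in_cons ?eqxx ?orbT.
rewrite /wind !big_cons big_nil addr0 /= {1}/kap hab eqxx add0r /kap.
have E1 : orient b c z * (a.1 - z.1) + orient c a z * (b.1 - z.1)
          + orient a b z * (c.1 - z.1) = 0 by rewrite /orient; ring.
have E2 : orient b c z + orient c a z + orient a b z = orient a b c.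
  by rewrite /orient; ring.
rewrite (orientN b c) (orientN c a) !oppr_gt0.
move: hab; case: (leP a.1 z.1) => ha; case: (leP c.1 z.1) => hc /= hab.
- rewrite -hab eqxx /= add0r.
  set B := [&& _, _ & _]; suff -> : B = false by []; apply/negP.
  move=> /and3P[g3 g1 g2].
  have hb : b.1 <= z.1 by [].
  have [] := lincomb_le0 g1 g2 (ltW g3) _ _ _ E1; rewrite ?pmulr_rle0 ?subr_le0 //.
  move=> /subr0_eq z1 /subr0_eq z2.
  have [] := lincomb_le0 g1 g3 (ltW g2) _ _ _ (etrans (addrAC _ _ _) E1);
    rewrite ?pmulr_rle0 ?subr_le0 //.
  by move=> _ /subr0_eq z3; move: abc; rewrite /orient z1 z2 z3 !subrr mulr0 mul0r subrr ltxx.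
- have hb : b.1 <= z.1 by [].
  rewrite -hab /=.
  have A0 : a.1 - z.1 <= 0 by rewrite subr_le0.
  have B0 : b.1 - z.1 <= 0 by rewrite subr_le0.
  have C0 : 0 < c.1 - z.1 by rewrite subr_gt0.
  have g1 : orient b c z != 0.
    apply: contra_not_neq n2 => o; apply: seg_between => //; last by rewrite pmulr_lle0.
    by rewrite lt_eqF // (le_lt_trans hb).
  have g2 : orient c a z != 0.
    apply: contra_not_neq n3 => o; apply: seg_between => //; last by rewrite pmulr_rle0.
    by rewrite gt_eqF // (le_lt_trans ha).
  have [S1 S2] := lincomb_sg_le E1 A0 B0 C0.
  case: (ltgtP (orient b c z) 0) g1 => // g1 _;
    case: (ltgtP (orient c a z) 0) g2 => // g2 _; rewrite /= ?andbF //.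
    by exfalso; have := S2 g1 g2; clear -E2 abc g1 g2; lra.
  have := S1 g1 g2.
  rewrite le_eqVlt => /orP[/eqP g3|->] //; exfalso; apply: n1.
  have [] := lincomb_le0 g1 g2 _ A0 B0 _ E1; rewrite -?g3 ?mul0r //.
  move=> /subr0_eq z1 /subr0_eq z2.
  apply: seg_vertical => //.
  have q1 : orient b c z = (c.1 - z.1) * (z.2 - b.2) by rewrite /orient z2; ring.
  have q2 : orient c a z = (c.1 - z.1) * (a.2 - z.2) by rewrite /orient z1; ring.
  rewrite q1 pmulr_rgt0 // in g1; rewrite q2 pmulr_rgt0 // in g2.
  by apply: mulr_ge0_le0; [exact: ltW|rewrite subr_le0 -subr_ge0 ltW].
- have hb : z.1 < b.1 by rewrite ltNge -hab.
  rewrite -hab /=.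
  have A0 : 0 < a.1 - z.1 by rewrite subr_gt0.
  have B0 : 0 < b.1 - z.1 by rewrite subr_gt0.
  have C0 : c.1 - z.1 <= 0 by rewrite subr_le0.
  have g1 : orient b c z != 0.
    apply: contra_not_neq n2 => o; apply: seg_between => //; last by rewrite pmulr_rle0.
    by rewrite gt_eqF // (le_lt_trans hc).
  have g2 : orient c a z != 0.
    apply: contra_not_neq n3 => o; apply: seg_between => //; last by rewrite pmulr_lle0.
    by rewrite lt_eqF // (le_lt_trans hc).
  have [S1 S2] := lincomb_sg_gt E1 A0 B0 C0.
  case: (ltgtP (orient b c z) 0) g1 => // g1 _;
    case: (ltgtP (orient c a z) 0) g2 => // g2 _; rewrite /= ?andbF //.
    by exfalso; have := S2 g1 g2; clear -E2 abc g1 g2; lra.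
  by rewrite S1.
have hb : z.1 < b.1 by rewrite ltNge -hab.
rewrite -hab /= addr0.
set B := [&& _, _ & _]; suff -> : B = false by []; apply/negP.
move=> /and3P[g3 g1 g2].
have : 0 < orient b c z * (a.1 - z.1) by rewrite mulr_gt0 // subr_gt0.
have : 0 < orient c a z * (b.1 - z.1) by rewrite mulr_gt0 // subr_gt0.
have : 0 < orient a b z * (c.1 - z.1) by rewrite mulr_gt0 // subr_gt0.
by clear -E1; lra.
Qed.

Lemma wind_tri a b c z : 0 < orient a b c -> ~ bd [:: a; b; c] z ->
  wind [:: a; b; c] z =
  Posz [&& 0 < orient a b z, 0 < orient b c z & 0 < orient c a z]%R.
Proof.
move=> abc nb.
have [hab|hab] := eqVneq (a.1 <= z.1) (b.1 <= z.1); first exact: wind_tri_core.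
have rotE (x y w : plane R) : perm_eq (arcs [:: y; w; x]) (arcs [:: x; y; w]).
  exact: (@arcs_rot _ 1 [:: x; y; w]).
have rot1 := rotE a b c; have rot2 := rotE b c a.
have [hbc|hbc] := eqVneq (b.1 <= z.1) (c.1 <= z.1).
  rewrite -(wind_perm z rot1) wind_tri_core //.
  - by do 3!case: (0 < _).
  - by rewrite -orientC.
  - by rewrite (bd_perm rot1).
rewrite -(wind_perm z rot1) -(wind_perm z rot2) wind_tri_core //.
- by do 3!case: (0 < _).
- by rewrite orientC.
- by rewrite (bd_perm rot2) (bd_perm rot1).
by case: (a.1 <= z.1) (b.1 <= z.1) (c.1 <= z.1) hab hbc => [] [] [].
Qed.

End WindingFacts.

(** * A simple polygon near one of its vertices *)

Section LocalStructure.
Local Open Scope classical_set_scope.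
Local Open Scope ring_scope.
Context {R : realType}.
Implicit Types (x y z a b c d h m v u : plane R) (s t : seq (plane R)).

Definition gpos s : Prop := {in s & &, forall x y z,
  x != y -> y != z -> x != z -> orient x y z != 0}.

Definition meet_at_ends (e f : plane R * plane R) : Prop :=
  forall z, seg e.1 e.2 z -> seg f.1 f.2 z ->
    z \in [:: e.1; e.2] /\ z \in [:: f.1; f.2].

Definition simple s : Prop :=
  [/\ uniq s, (2 < size s)%N, gpos s
    & {in arcs s &, forall e f, e != f -> meet_at_ends e f}].

Lemma eq_mem_simple s s' : s =i s' -> uniq s' -> size s' = size s ->
  (forall e, (e \in arcs s') = (e \in arcs s)) -> simple s -> simple s'.
Proof.
move=> ss us zs es [_ h2 h3 h4]; split=> //; first by rewrite zs.
  by move=> x y z; rewrite -!ss; exact: h3.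
by move=> e f; rewrite !es; exact: h4.
Qed.

Lemma simple_rot n s : simple s -> simple (rot n s).
Proof.
move=> H; apply: eq_mem_simple (H); rewrite ?size_rot //.
- by move=> x; rewrite mem_rot.
- by rewrite rot_uniq; case: H.
by move=> e; apply: perm_mem; exact: arcs_rot.
Qed.

Lemma rot_head s x : x \in s -> exists n t, rot n s = x :: t.
Proof. by move=> /rot_to[n t E]; exists n, t. Qed.

Lemma rot_vertex s h : (2 < size s)%N -> h \in s ->
  exists n a b t, rot n s = [:: a, h, b & t].
Proof.
move=> s2 /rot_head[n [t E]]; move: s2; rewrite -(size_rot n) E.
case: t E => [|b t] // E; case/lastP: t E => [|t a] // E _.
exists (rot_add s n (size (rot n s) - 1)), a, b, t.
by rewrite -rot_rot_add -/(rotr 1 (rot n s)) E -!rcons_cons rotr1_rcons.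
Qed.

Lemma pth_src x t y e : e \in pth x (rcons t y) -> e.1 \in x :: t.
Proof.
elim: t x => [|z t IH] x /=; first by rewrite inE => /eqP->; rewrite mem_head.
by rewrite inE => /orP[/eqP->|/IH he]; rewrite ?mem_head // in_cons he orbT.
Qed.

Lemma pth_tgt x t e : e \in pth x t -> e.2 \in t.
Proof.
elim: t x => [|z t IH] x //=.
by rewrite inE => /orP[/eqP->|/IH he]; rewrite ?mem_head // in_cons he orbT.
Qed.

Lemma rot_arc s a b : uniq s -> (1 < size s)%N -> (a, b) \in arcs s ->
  exists n t, rot n s = [:: a, b & t].
Proof.
move=> us s2 ab; have [/= /rot_head[n [t E]] _] := arcs_mem ab.
move: ab us s2; rewrite -(perm_mem (arcs_rot n s)) -(rot_uniq n) -(size_rot n) E.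
case: t E => [|c t] // E /=.
rewrite inE => /orP[/eqP[->] _ _|]; first by exists n, t.
by move=> /pth_src /= ac; rewrite ac.
Qed.

(** Inserting a vertex adds the winding number of a triangle; this reduces all
    local questions about polygons to triangles. *)
Lemma wind_ins a h b t z :
  wind [:: a, h, b & t] z = wind [:: a, b & t] z + wind [:: a; h; b] z.
Proof.
rewrite /wind /= !big_cons big_nil (kapC a b); ring.
Qed.

Lemma wind_rev3 a b c z : wind [:: a; c; b] z = - wind [:: a; b; c] z.
Proof.
by rewrite /wind /= !big_cons !big_nil (kapC b a) (kapC a c) (kapC c b); ring.
Qed.

(** The coordinates of x - h in the basis a - h, b - h. *)
Lemma frame x h a b : orient a h b != 0 ->
  x = h + (orient h b x / orient a h b) *: (a - h)
        + (orient a h x / orient a h b) *: (b - h).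
Proof.
move=> n0.
move: n0; case: x h a b => [x1 x2] [h1 h2] [a1 a2] [b1 b2]; rewrite /orient /= => n0.
by apply: plane_eq; rewrite !pE /=; field.
Qed.

(** Near h, the points to the left of the path from a over h to b. *)
Definition wedge a h b x : bool :=
  if 0 < orient a h b then (0 < orient a h x) && (0 < orient h b x)
  else (0 < orient a h x) || (0 < orient h b x).

(** By [wind_ins] the winding number near h is that of the triangle ahb, up to
    the one of the polygon without h, which is constant near h. *)
Lemma near_vertex a h b t : simple [:: a, h, b & t] ->
  exists k : int, \forall x \near h,
    [/\ 0 < orient a h b -> (bd [:: a, h, b & t] x <->
          ~ ((0 < orient a h x /\ 0 < orient h b x) \/
             (orient a h x < 0 \/ orient h b x < 0))),
        orient a h b < 0 -> (bd [:: a, h, b & t] x <->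
          ~ ((0 > orient a h x /\ 0 > orient h b x) \/
             (orient a h x > 0 \/ orient h b x > 0)))
      & ~ bd [:: a, h, b & t] x ->
        wind [:: a, h, b & t] x = k + Posz (wedge a h b x)].
Proof.
move=> [us s2 gs ds]; move: us => /= /and4P[ua uh ub ut].
have [ah ab hb] : [/\ a != h, a != b & h != b].
  by move: ua uh; rewrite !inE !negb_or => /and3P[? ? _] /andP[? _].
have o0 : orient a h b != 0 by apply: gs => //; rewrite !inE eqxx ?orbT.
have arcsE : arcs [:: a, h, b & t] = [:: (a, h), (h, b) & pth b (rcons t a)] by [].
have others e : e \in pth b (rcons t a) -> ~ seg e.1 e.2 h.
  move=> et he.
  have ehb : e != (h, b).
    by apply: contraNneq uh => eE; move: (pth_src et); rewrite eE.
  have e1 : e \in arcs [:: a, h, b & t] by rewrite arcsE !inE et !orbT.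
  have e2 : (h, b) \in arcs [:: a, h, b & t] by rewrite arcsE !inE eqxx orbT.
  have [] := ds e (h, b) e1 e2 ehb h he (seg_l h b).
  rewrite !inE => /orP[/eqP E|/eqP E] _.
    by move: (pth_src et); rewrite -E (negbTE uh).
  move: (pth_tgt et); rewrite -E mem_rcons inE eq_sym (negbTE ah) /= => ht.
  by move: uh; rewrite inE ht orbT.
have nbd : ~ bd [:: a, b & t] h.
  move=> [e]; rewrite /= inE => /orP[/eqP-> /=|/others//].
  move=> [u [_ _ hE]]; move: o0; rewrite -(orientC b a h) orientN.
  by rewrite [in orient a b h]hE orient_cvx orientxyx orientxyy !mulr0 addr0 oppr0 eqxx.
have N1 := near_notin_bd nbd; have N2 := wind_near nbd.
have N3 : \forall x \near h, (0 < orient b a x) = (0 < orient a h b) /\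
    (orient b a x < 0) = (orient a h b < 0).
  by rewrite !(orientC a h b) !(orientC h b a); apply: near_orient_sg; rewrite -orientC -orientC.
exists (wind [:: a, b & t] h - Posz (orient a h b < 0)%R).
near=> x.
have n1 : ~ bd [:: a, b & t] x by near: x.
have n2 : wind [:: a, b & t] x = wind [:: a, b & t] h by near: x.
have [n3 n4] : (0 < orient b a x) = (0 < orient a h b) /\
    (orient b a x < 0) = (orient a h b < 0) by near: x.
have bdE : bd [:: a, h, b & t] x <-> seg a h x \/ seg h b x.
  split.
    move=> [e]; rewrite arcsE !inE => /or3P[/eqP->|/eqP->|et]; [by left|by right|].
    by move=> hx; case: n1; exists e => //; rewrite /= inE et orbT.
  by move=> [hx|hx]; [exists (a, h)|exists (h, b)]; rewrite // arcsE !inE eqxx ?orbT.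
have xE := frame x o0.
have sumE : orient a h x + orient h b x + orient b a x = orient a h b.
  by rewrite /orient; ring.
have sum1 : orient a h x / orient a h b + orient h b x / orient a h b
    + orient b a x / orient a h b = 1 by rewrite -!mulrDl sumE divff.
have seg1 : orient a h x = 0 -> 0 <= orient h b x / orient a h b ->
    0 <= orient b a x / orient a h b -> seg a h x.
  move=> E h1 h2; rewrite segC; exists (orient h b x / orient a h b); split=> //.
    by move: sum1 h2; rewrite E mul0r; clear; lra.
  by rewrite {1}xE E mul0r scale0r addr0.
have seg2 : orient h b x = 0 -> 0 <= orient a h x / orient a h b ->
    0 <= orient b a x / orient a h b -> seg h b x.
  move=> E h1 h2; exists (orient a h x / orient a h b); split=> //.
    by move: sum1 h2; rewrite E mul0r; clear; lra.
  by rewrite {1}xE E mul0r scale0r addr0.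
have seg1' : seg a h x -> orient a h x = 0 /\ exists2 u, 0 <= u & orient h b x = u * orient a h b.
  move=> [u [u0 u1 ->]]; rewrite !orient_cvx orientxyx orientxyy !mulr0 addr0; split=> //.
  by exists (1 - u); rewrite ?subr_ge0 // (orientC a h b) orientxyx mulr0 addr0.
have seg2' : seg h b x -> orient h b x = 0 /\ exists2 u, 0 <= u & orient a h x = u * orient a h b.
  move=> [u [u0 u1 ->]]; rewrite !orient_cvx orientxyx orientxyy !mulr0 addr0; split=> //.
  by exists u; rewrite // orientxyy mulr0 add0r.
have poscase : 0 < orient a h b -> (bd [:: a, h, b & t] x <->
    ~ ((0 < orient a h x /\ 0 < orient h b x) \/
       (orient a h x < 0 \/ orient h b x < 0))).
  move=> op; rewrite bdE; split.
    by move=> [/seg1'[-> [u u0 ->]]|/seg2'[-> [u u0 ->]]]; rewrite ltxx => -[[]//|[]//];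
      rewrite ltNge mulr_ge0 // ltW.
  have o3 : 0 <= orient b a x / orient a h b by rewrite divr_ge0 // ltW // n3.
  move=> /not_orP[h1 /not_orP[/negP + /negP]]; rewrite -!leNgt => h2 h3.
  have [E|o1] := eqVneq (orient a h x) 0.
    by left; apply: seg1 => //; rewrite divr_ge0 // ltW.
  right; apply: seg2 => //; last by rewrite divr_ge0 // ltW.
  apply/eqP; rewrite eq_le h3 andbT leNgt; apply/negP => o2; apply: h1.
  by rewrite o2 lt_neqAle eq_sym o1 h2.
have negcase : orient a h b < 0 -> (bd [:: a, h, b & t] x <->
    ~ ((0 > orient a h x /\ 0 > orient h b x) \/
       (orient a h x > 0 \/ orient h b x > 0))).
  move=> op; rewrite bdE; split.
    by move=> [/seg1'[-> [u u0 ->]]|/seg2'[-> [u u0 ->]]]; rewrite ltxx => -[[]//|[]//];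
      rewrite ltNge mulr_ge0_le0 // ltW.
  have o3 : 0 <= orient b a x / orient a h b by rewrite ler_ndivlMr // mul0r ltW // n4.
  move=> /not_orP[h1 /not_orP[/negP + /negP]]; rewrite -!leNgt => h2 h3.
  have [E|o1] := eqVneq (orient a h x) 0.
    by left; apply: seg1 => //; rewrite ler_ndivlMr // mul0r.
  right; apply: seg2 => //; last by rewrite ler_ndivlMr // mul0r.
  apply/eqP; rewrite eq_le h3 /= leNgt; apply/negP => o2; apply: h1.
  by rewrite o2 lt_neqAle o1 h2.
split=> // nb.
have nt : ~ bd [:: a; h; b] x.
  move=> [e] /=; rewrite !inE => /or3P[/eqP->|/eqP->|/eqP-> /= hx].
  - by move=> hx; apply: nb; rewrite bdE; left.
  - by move=> hx; apply: nb; rewrite bdE; right.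
  by apply: n1; exists (a, b); rewrite ?inE ?eqxx //= segC.
rewrite wind_ins n2 -addrA; congr (_ + _); rewrite /wedge.
case: (ltgtP (orient a h b) 0) o0 => // op _; last first.
  by rewrite wind_tri // n3 op andbT -[Posz false]/(0 : int) oppr0 add0r.
rewrite wind_rev3 wind_tri; last first.
- by move=> [e eE hx]; apply: nt; exists (e.2, e.1); rewrite /= 1?segC //;
    move: eE; rewrite !inE => /or3P[] /eqP -> /=; rewrite eqxx ?orbT.
- by rewrite orientN oppr_gt0 orientC.
rewrite (orientN h b) (orientN a h) (orientN b a) !oppr_gt0 n4 op /=.
have /contrapT : ~ ~ ((0 > orient a h x /\ 0 > orient h b x) \/
             (orient a h x > 0 \/ orient h b x > 0)) by move=> /(negcase op).
case: (ltgtP (orient a h x) 0) => h1; case: (ltgtP (orient h b x) 0) => h2 //=;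
  by case=> [[]|[]].
Unshelve. all: by end_near. Qed.

End LocalStructure.

(** * The two sides of a simple polygon *)

Section TwoValues.
Local Open Scope classical_set_scope.
Local Open Scope ring_scope.
Context {R : realType}.
Implicit Types (x y z a b c d h m v u p q : plane R) (s t : seq (plane R)) (k : int).

(** With a third point z beside the edge, [wind_ins] compares the polygon to the
    one that makes a detour over z and thus avoids m. *)
Lemma near_edge a b t (t0 : R) m : simple [:: a, b & t] -> 0 < t0 -> t0 < 1 ->
  m = a + t0 *: (b - a) ->
  exists k, \forall x \near m,
    (bd [:: a, b & t] x <-> orient a b x = 0) /\
    (~ bd [:: a, b & t] x ->
       wind [:: a, b & t] x = k + Posz (0 < orient a b x)%R).
Proof.
move=> [us s2 gs ds] t00 t01 mE; move: us => /= /and3P[ua ub ut].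
have ab : a != b by move: ua; rewrite inE negb_or => /andP[].
pose z : plane R := (a.1 - (b.2 - a.2), a.2 + (b.1 - a.1)).
set N := orient a b z.
have NE : N = (b.1 - a.1) ^+ 2 + (b.2 - a.2) ^+ 2 by rewrite /N /orient /=; ring.
have N0 : 0 < N.
  rewrite NE lt_neqAle addr_ge0 ?sqr_ge0 // andbT eq_sym paddr_eq0 ?sqr_ge0 //.
  rewrite !sqrf_eq0 !subr_eq0; apply: contra ab => /andP[/eqP h1 /eqP h2].
  by apply/eqP; apply: plane_eq.
have arcsE : arcs [:: a, b & t] = (a, b) :: pth b (rcons t a) by [].
have om : orient a b m = 0 by rewrite mE orient_cvx orientxyx orientxyy !mulr0 addr0.
have ma : m <> a.
  move=> E; have /eqP : t0 *: (b - a) = 0 by apply/(addrI a); rewrite -mE E addr0.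
  by rewrite scaler_eq0 subr_eq0 (eq_sym b) (negbTE ab) gt_eqF.
have mb : m <> b.
  move=> E; have /eqP : (1 - t0) *: (b - a) = 0.
    by apply/(addrI (t0 *: (b - a))); rewrite -scalerDl addrC subrK scale1r addr0;
      apply/(addrI a); rewrite -mE E addrC subrK.
  by rewrite scaler_eq0 !subr_eq0 (eq_sym b) (negbTE ab) gt_eqF.
have others e : e \in pth b (rcons t a) -> ~ seg e.1 e.2 m.
  move=> et he.
  have eab : e != (a, b).
    apply: contraNneq ua => eE; move: (pth_src et).
    by rewrite eE.
  have e1 : e \in arcs [:: a, b & t] by rewrite arcsE inE et orbT.
  have e2 : (a, b) \in arcs [:: a, b & t] by rewrite arcsE inE eqxx.
  have hab : seg a b m by exists t0; split => //; exact: ltW.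
  have [_] := ds e (a, b) e1 e2 eab m he hab.
  by rewrite !inE => /orP[]/eqP.
have on1 : orient b z m = (1 - t0) * N.
  by rewrite mE orient_cvx orientxyx mulr0 addr0 -(orientC a b z).
have on2 : orient z a m = t0 * N.
  by rewrite mE orient_cvx orientxyy mulr0 add0r (orientC z a b).
have nbd : ~ bd [:: a, z, b & t] m.
  move=> [e] /=; rewrite !inE => /or3P[/eqP-> /=|/eqP-> /=|/others//].
    move=> [w [_ _ E]]; have := om; rewrite E orient_cvx orientxyx mulr0 add0r.
    move=> /eqP; rewrite -/N mulf_eq0 (gt_eqF N0) orbF => /eqP w0.
    by apply: ma; rewrite E w0 scale0r addr0.
  move=> [w [_ _ E]]; have := om; rewrite E orient_cvx orientxyy mulr0 addr0.
  move=> /eqP; rewrite -/N mulf_eq0 (gt_eqF N0) orbF subr_eq0 => /eqP w0.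
  by apply: mb; rewrite E -w0 scale1r addrC subrK.
have N1 := near_notin_bd nbd; have N2 := wind_near nbd.
have N3 : \forall x \near m, 0 < orient b z x.
  by apply: near_orient_gt0; rewrite on1 mulr_gt0 // subr_gt0.
have N4 : \forall x \near m, 0 < orient z a x.
  by apply: near_orient_gt0; rewrite on2 mulr_gt0.
exists (wind [:: a, z, b & t] m); near=> x.
have n1 : ~ bd [:: a, z, b & t] x by near: x.
have n2 : wind [:: a, z, b & t] x = wind [:: a, z, b & t] m by near: x.
have n3 : 0 < orient b z x by near: x.
have n4 : 0 < orient z a x by near: x.
have bdE : bd [:: a, b & t] x <-> seg a b x.
  split; last by move=> hx; exists (a, b); rewrite // arcsE inE eqxx.
  move=> [e]; rewrite arcsE inE => /orP[/eqP->//|et] hx.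
  by case: n1; exists e => //=; rewrite !inE et !orbT.
have segE : seg a b x <-> orient a b x = 0.
  split=> [[w [_ _ ->]]|E]; first by rewrite orient_cvx orientxyx orientxyy !mulr0 addr0.
  have o0 : orient b a z != 0 by rewrite orientN oppr_eq0 gt_eqF.
  have sumE : orient b a x + orient a z x + orient z b x = orient b a z.
    by rewrite /orient; ring.
  move: sumE; rewrite (orientN a b x) E oppr0 add0r (orientN z a) (orientN b z) (orientN a b z).
  rewrite -/N => sumE.
  have q1 : orient z a x / N <= 1 by rewrite ler_pdivrMr // mul1r; lra.
  exists (orient z a x / N); split=> //; first by rewrite divr_ge0 // ltW.
  have := frame x o0; rewrite (orientN a b x) E oppr0 mul0r scale0r addr0.
  by rewrite (orientN z a) (orientN a b z) -/N mulNr invrN mulrN opprK.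
split; first by rewrite bdE segE.
move=> nb.
have nt : ~ bd [:: a; b; z] x.
  move=> [e] /=; rewrite !inE => /or3P[/eqP->|/eqP->|/eqP-> /= hx].
  - by move=> hx; apply: nb; rewrite bdE.
  - by move=> /= hx; apply: n1; exists (z, b); rewrite ?inE ?eqxx ?orbT //= segC.
  by apply: n1; exists (a, z); rewrite ?inE ?eqxx //= segC.
have := wind_ins a z b t x; rewrite n2 wind_rev3 wind_tri // n3 n4 !andbT => ->.
by rewrite subrK.
Unshelve. all: by end_near. Qed.

Definition adj (k l : int) : bool := (k == l + 1) || (l == k + 1).

Lemma adjxx k : adj k k = false.
Proof. by rewrite /adj orbb -subr_eq0 opprD addrA subrr add0r oppr_eq0. Qed.

(** Near a boundary point a polygon looks like a straight or bent line: it
    separates an intersection of two open half-planes from a union of two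
    opposite ones, and the winding numbers of the two sides differ by one. *)
Definition two_sided s m : Prop := exists p1 q1 p2 q2 d k1 k2,
  [/\ orient p1 q1 m = 0 /\ orient p2 q2 m = 0,
      0 < orient p1 q1 (m + d) /\ 0 < orient p2 q2 (m + d),
      adj k1 k2
    & \forall x \near m,
        [/\ bd s x <-> ~ ((0 < orient p1 q1 x /\ 0 < orient p2 q2 x) \/
                       (orient p1 q1 x < 0 \/ orient p2 q2 x < 0)),
            ~ bd s x -> 0 < orient p1 q1 x /\ 0 < orient p2 q2 x -> wind s x = k1
          & ~ bd s x -> orient p1 q1 x < 0 \/ orient p2 q2 x < 0 -> wind s x = k2]].

Lemma two_sided_perm s s' m : perm_eq (arcs s) (arcs s') ->
  two_sided s m -> two_sided s' m.
Proof.
move=> p [p1 [q1 [p2 [q2 [d [k1 [k2 [H1 H2 H3 H4]]]]]]]].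
exists p1, q1, p2, q2, d, k1, k2; split=> //; apply: filterS H4 => x.
by rewrite (bd_perm p) (wind_perm x p).
Qed.

Lemma bd_two_sided s m : simple s -> bd s m -> two_sided s m.
Proof.
move=> ss [[a b] ab /= [t0 [h0 h1 mE]]]; case: (ss) => us s2 gs ds.
have vertex v : v \in s -> two_sided s v.
  move=> /(rot_vertex s2)[n [a' [b' [t E]]]].
  apply: (two_sided_perm (arcs_rot n s)); rewrite E.
  have := simple_rot n ss; rewrite E => ss'; have [us' s2' gs' _] := ss'.
  have [k H] := near_vertex ss'.
  have o0 : orient a' v b' != 0.
    move: us' => /=; rewrite !inE !negb_or => /andP[/and3P[h2 h3 _] /andP[/andP[h4 _] _]].
    by apply: gs' => //; rewrite !inE eqxx ?orbT.
  case: (ltgtP (orient a' v b') 0) o0 => // op _.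
    exists b', v, v, a', (a' + b' - v - v), k, (k + 1); split.
    - by rewrite orientxyy orientxyx.
    - have -> : orient b' v (v + (a' + b' - v - v)) = - orient a' v b'.
        by rewrite /orient !pE; ring.
      have -> : orient v a' (v + (a' + b' - v - v)) = - orient a' v b'.
        by rewrite /orient !pE; ring.
      by rewrite oppr_gt0.
    - by rewrite /adj eqxx orbT.
    apply: filterS H => x [_ /(_ op) H1 H2].
    rewrite !(orientN v b') !(orientN a' v) !oppr_gt0 !oppr_lt0; split.
    - rewrite H1; split=> h3 h4; apply: h3; case: h4 => [[]|[]]; by auto.
    - move=> nb [h2 h3]; rewrite (H2 nb) /wedge (lt_gtF op) (lt_gtF h2) (lt_gtF h3).
      by rewrite addr0.
    move=> nb; rewrite (H2 nb) /wedge (lt_gtF op) => -[->|->//]; by rewrite ?orbT.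
  exists a', v, v, b', (a' + b' - v - v), (k + 1), k; split.
  - by rewrite orientxyy orientxyx.
  - have -> : orient a' v (v + (a' + b' - v - v)) = orient a' v b'.
      by rewrite /orient !pE; ring.
    have -> : orient v b' (v + (a' + b' - v - v)) = orient a' v b'.
      by rewrite /orient !pE; ring.
    by [].
  - by rewrite /adj eqxx.
  apply: filterS H => x [/(_ op) H1 _ H2]; split=> //.
    by move=> nb [h2 h3]; rewrite (H2 nb) /wedge op h2 h3.
  move=> nb h; rewrite (H2 nb) /wedge op.
  by case: h => h; rewrite (lt_gtF h) ?andbF addr0.
have [/= sa sb] := arcs_mem ab.
move: h0; rewrite le_eqVlt => /orP[/eqP h0|h0].
  by rewrite mE -h0 scale0r addr0; exact: vertex.
move: h1; rewrite le_eqVlt => /orP[/eqP h1|h1].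
  by rewrite mE h1 scale1r addrC subrK; exact: vertex.
have [n [t E]] := rot_arc us (ltnW s2) ab.
apply: (two_sided_perm (arcs_rot n s)); rewrite E.
have := simple_rot n ss; rewrite E => ss'.
have [k H] := near_edge ss' h0 h1 mE.
exists a, b, a, b, (a.2 - b.2, b.1 - a.1), (k + 1), k.
have ab' : a != b by case: ss' => /= /andP[]; rewrite inE negb_or => /andP[].
have om : orient a b m = 0 by rewrite mE orient_cvx orientxyx orientxyy !mulr0 addr0.
have on : 0 < orient a b (m + (a.2 - b.2, b.1 - a.1)).
  have -> : orient a b (m + (a.2 - b.2, b.1 - a.1)) =
     orient a b m + ((b.1 - a.1) ^+ 2 + (b.2 - a.2) ^+ 2).
    by rewrite /orient !pE /=; ring.
  rewrite om add0r lt_neqAle addr_ge0 ?sqr_ge0 // andbT eq_sym paddr_eq0 ?sqr_ge0 //.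
  rewrite !sqrf_eq0 !subr_eq0; apply: contra ab' => /andP[/eqP g1 /eqP g2].
  by apply/eqP; apply: plane_eq.
split=> //; first by rewrite /adj eqxx.
apply: filterS H => x [H1 H2]; split.
- rewrite H1; split=> [->|]; first by rewrite ltxx => -[[]//|[]//].
  by case: (ltgtP (orient a b x) 0) => // h3 h4; case: h4; auto.
- by move=> nb [h3 _]; rewrite (H2 nb) h3.
by move=> nb h; rewrite (H2 nb) lt_gtF ?addr0 //; case: h.
Qed.

(** Constancy on the components of the complement implies this, and it is all
    that the limit argument uses. *)
Definition component_invariant s (T : Type) (F : plane R -> T) : Prop :=
  forall x y, seg x y `<=` ~` bd s -> F x = F y.

Lemma seg_box m (e : R) x y z : box m e x -> box m e y -> seg x y z -> box m e z.
Proof.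
move=> [h1 h2] [h3 h4] [w [w0 w1 ->]]; split; rewrite !pE.
  have -> : x.1 + w * (y.1 - x.1) - m.1 = (1 - w) * (x.1 - m.1) + w * (y.1 - m.1) by ring.
  move: h1 h3; rewrite !ltr_norml => /andP[h5 h6] /andP[h7 h8]; apply/andP; split.
    rewrite -[X in - e < X]opprK ltrN2.
    have -> : - ((1 - w) * (x.1 - m.1) + w * (y.1 - m.1)) =
      (1 - w) * - (x.1 - m.1) + w * - (y.1 - m.1) by ring.
    by apply: cvx_lt => //; rewrite ltrNl.
  exact: cvx_lt.
have -> : x.2 + w * (y.2 - x.2) - m.2 = (1 - w) * (x.2 - m.2) + w * (y.2 - m.2) by ring.
move: h2 h4; rewrite !ltr_norml => /andP[h5 h6] /andP[h7 h8]; apply/andP; split.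
  rewrite -[X in - e < X]opprK ltrN2.
  have -> : - ((1 - w) * (x.2 - m.2) + w * (y.2 - m.2)) =
    (1 - w) * - (x.2 - m.2) + w * - (y.2 - m.2) by ring.
  by apply: cvx_lt => //; rewrite ltrNl.
exact: cvx_lt.
Qed.

Lemma component_invariant_near s T (F : plane R -> T) x :
  component_invariant s F -> ~ bd s x -> \forall y \near x, F y = F x.
Proof.
move=> ci nb; have /nearP[e e0 H] := near_notin_bd nb.
apply/nearP; exists e => // y hy; apply/esym/ci => z hz; apply: H.
by apply: (seg_box _ hy hz); rewrite /box /= !subrr normr0.
Qed.

Lemma wind_invariant s : component_invariant s (wind s).
Proof.
by move=> x y H; apply: (wind_const (seg_connected (a:=x) (b:=y)) H);
  [exact: seg_l|exact: seg_r].
Qed.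

Lemma orient_seg_gt0 a b x y z : 0 < orient a b x -> 0 < orient a b y ->
  seg x y z -> 0 < orient a b z.
Proof.
move=> h1 h2 [w [w0 w1 ->]]; rewrite orient_cvx -oppr_lt0 opprD -!mulrN.
by apply: cvx_lt => //; rewrite oppr_lt0.
Qed.

Lemma orient_seg_lt0 a b x y z : orient a b x < 0 -> orient a b y < 0 ->
  seg x y z -> orient a b z < 0.
Proof. by move=> h1 h2 [w [w0 w1 ->]]; rewrite orient_cvx; exact: cvx_lt. Qed.

Section Limits.
Variables (s : seq (plane R)) (T : Type) (F : plane R -> T).
Hypotheses (ss : simple s) (ci : component_invariant s F).

Let G x : T * int := (F x, wind s x).

Let ciG : component_invariant s G.
Proof. by move=> x y H; rewrite /G (ci H) (wind_invariant H). Qed.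

(** The winding number accompanies F because it tells the two sides of the
    polygon apart: the pair has exactly two limit values even if F has one. *)
Definition limit_values m : set (T * int) := [set g |
  forall P : set (plane R), (\forall y \near m, P y) ->
    exists y, [/\ P y, ~ bd s y & (F y, wind s y) = g]].

Lemma limit_valuesE m : bd s m -> exists g1 g2,
  [/\ adj g1.2 g2.2, limit_values m = [set g1; g2]
    & \forall y \near m, ~ bd s y -> G y = g1 \/ G y = g2].
Proof.
move=> /(bd_two_sided ss)[p1 [q1 [p2 [q2 [d [k1 [k2 [[z1 z2] [d1 d2] kk /nearP[e e0 H]]]]]]]]].
have od p q (w : R) : orient p q m = 0 -> orient p q (m + w *: d) = w * orient p q (m + d).
  move=> E; have -> : orient p q (m + w *: d) =
    (1 - w) * orient p q m + w * orient p q (m + d).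
    by rewrite -orient_cvx; congr (orient p q _); rewrite addrAC subrr add0r.
  by rewrite E mulr0 add0r.
have [e' e'0 He'] : exists2 e' : R, 0 < e' & forall w : R, `|w| < e' -> box m e (m + w *: d).
  by apply: near_ray; apply/nearP; exists e.
set x1 := m + (e' / 2) *: d; set x2 := m + (- (e' / 2)) *: d.
have e2 : 0 < e' / 2 by lra.
have b1 : box m e x1 by apply: He'; rewrite ger0_norm; lra.
have b2 : box m e x2 by apply: He'; rewrite normrN ger0_norm; lra.
have x1E : 0 < orient p1 q1 x1 /\ 0 < orient p2 q2 x1.
  by rewrite !od // !mulr_gt0.
have x2E : orient p1 q1 x2 < 0 /\ orient p2 q2 x2 < 0.
  by rewrite !od // !mulNr !oppr_lt0 !mulr_gt0.
have n1 x : box m e x -> 0 < orient p1 q1 x /\ 0 < orient p2 q2 x -> ~ bd s x.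
  by move=> /H[-> _ _] h; apply; left.
have n2 x : box m e x -> orient p1 q1 x < 0 \/ orient p2 q2 x < 0 -> ~ bd s x.
  by move=> /H[-> _ _] h; apply; right.
have v1 x : box m e x -> 0 < orient p1 q1 x /\ 0 < orient p2 q2 x -> G x = G x1.
  move=> bx [h1 h2]; apply: ciG => z hz; apply: n1; first exact: seg_box hz.
  by case: x1E => h3 h4; split; [exact: orient_seg_gt0 hz|exact: orient_seg_gt0 hz].
have v2 x : box m e x -> orient p1 q1 x < 0 \/ orient p2 q2 x < 0 -> G x = G x2.
  move=> bx h; apply: ciG => z hz; apply: n2; first exact: seg_box hz.
  by case: x2E => h3 h4; case: h => h; [left|right]; exact: orient_seg_lt0 hz.
have cases x : box m e x -> ~ bd s x -> G x = G x1 \/ G x = G x2.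
  move=> bx nb; have [E _ _] := H _ bx; move: nb; rewrite E => /contrapT[h|h].
    by left; exact: v1.
  by right; exact: v2.
exists (G x1), (G x2); split.
- rewrite /G /=; have [_ E1 _] := H _ b1; have [_ _ E2] := H _ b2.
  by rewrite (E1 (n1 _ b1 x1E)) // (E2 (n2 _ b2 _)) //; left; case: x2E.
- apply/seteqP; split=> g /=.
    move=> /(_ (box m e)) []; first by apply/nearP; exists e.
    by move=> y [by_ nb <-]; case: (cases _ by_ nb) => h; [left|right]; exact: h.
  move=> gE P nP.
  have nP2 : \forall y \near m, P y /\ box m e y.
    near=> y; split; near: y => //; by apply/nearP; exists e.
  have [w w0 Hw] := near_ray d nP2.
  have w2 : 0 < w / 2 by lra.
  case: gE => ->.
    have [Py by_] : P (m + (w / 2) *: d) /\ box m e (m + (w / 2) *: d).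
      by apply: Hw; rewrite ger0_norm; lra.
    have yE : 0 < orient p1 q1 (m + (w / 2) *: d) /\ 0 < orient p2 q2 (m + (w / 2) *: d).
      by rewrite !od // !mulr_gt0.
    by exists (m + (w / 2) *: d); split=> //; [exact: n1|exact: v1].
  have [Py by_] : P (m + (- (w / 2)) *: d) /\ box m e (m + (- (w / 2)) *: d).
    by apply: Hw; rewrite normrN ger0_norm; lra.
  have yE : orient p1 q1 (m + (- (w / 2)) *: d) < 0 \/ orient p2 q2 (m + (- (w / 2)) *: d) < 0.
    by left; rewrite !od // !mulNr !oppr_lt0 !mulr_gt0.
  by exists (m + (- (w / 2)) *: d); split=> //; [exact: n2|exact: v2].
by apply/nearP; exists e.
Unshelve. all: by end_near. Qed.

(** The limit values at m' are among those at m, and both pairs differ in their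
    second components. *)
Lemma limit_values_near m : bd s m ->
  \forall m' \near m, bd s m' -> limit_values m' = limit_values m.
Proof.
move=> bm; have [g1 [g2 [g12 -> Hn]]] := limit_valuesE bm.
apply: filterS (nbhs_interior Hn) => m' Hm' bm'.
have [h1 [h2 [h12 E _]]] := limit_valuesE bm'.
have sub (g : T * int) : limit_values m' g -> g = g1 \/ g = g2.
  by move=> /(_ _ Hm')[y [Hy nb <-]]; exact: Hy.
have [e1|e1] : h1 = g1 \/ h1 = g2 by apply: sub; rewrite E; left.
  have [e2|e2] : h2 = g1 \/ h2 = g2 by apply: sub; rewrite E; right.
    by move: h12; rewrite e1 e2 adjxx.
  by rewrite E e1 e2.
have [e2|e2] : h2 = g1 \/ h2 = g2 by apply: sub; rewrite E; right.
  by rewrite E e1 e2; apply/seteqP; split=> x /= [|]; auto.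
by move: h12; rewrite e1 e2 adjxx.
Qed.

Lemma limit_values_const m m' : bd s m -> bd s m' -> limit_values m = limit_values m'.
Proof.
have one e x y : e \in arcs s -> seg e.1 e.2 x -> seg e.1 e.2 y ->
    limit_values x = limit_values y.
  move=> es; apply: (connected_const (@seg_connected _ e.1 e.2)) => z hz.
  have bz : bd s z by exists e.
  by apply: filterS (limit_values_near bz) => w Hw hw; apply: Hw; exists e.
have pthc x t : {subset pth x t <= arcs s} ->
    forall e, e \in pth x t -> limit_values e.1 = limit_values x.
  elim: t x => [|y t IH] x //= sub e; rewrite inE => /orP[/eqP->//|et].
  rewrite (IH y) //; last by move=> f ft; apply: sub; rewrite inE ft orbT.
  have xy : (x, y) \in arcs s by apply: sub; rewrite inE eqxx.
  by apply: (one (x, y)) => //; [exact: seg_r|exact: seg_l].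
case: ss => _ ; case E: s => [//|x0 t] _ _ _; rewrite -E.
have base e z : e \in arcs s -> seg e.1 e.2 z -> limit_values z = limit_values x0.
  move=> es hz; rewrite (one e z e.1) //; last exact: seg_l.
  by apply: (pthc _ (rcons t x0)); [rewrite E|move: es; rewrite E].
by move=> [e es hm] [f fs hm']; rewrite (base e) // (base f).
Qed.

(** Along a segment from x to m the value of G can only change at the boundary,
    where it is a limit value until then. *)
Lemma value_is_limit m x : bd s m -> ~ bd s x -> limit_values m (G x).
Proof.
move=> bm nx; apply: contrapT => nl.
have H : forall z, seg x m z -> \forall y \near z, seg x m y ->
    (~ bd s y /\ G y = G x) = (~ bd s z /\ G z = G x).
  move=> z _; have [bz|nz] := pselect (bd s z).
    have [g1 [g2 [_ E Hn]]] := limit_valuesE bz.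
    apply: filterS Hn => y Hy _; apply/propext; split=> -[nb Ey]; last by case: nb.
    case: nl; rewrite (limit_values_const bm bz) E.
    by case: (Hy nb) => h; [left|right]; exact: etrans (esym Ey) h.
  near=> y => _.
  have nb : ~ bd s y by near: y; exact: near_notin_bd.
  have Ey : G y = G z by near: y; exact: (component_invariant_near ciG nz).
  by rewrite Ey; apply/propext; split=> -[].
have := connected_const (@seg_connected _ x m) H (seg_l x m) (seg_r x m) => E.
have : ~ bd s x /\ G x = G x by [].
by rewrite E => -[].
Unshelve. all: by end_near. Qed.

(** The polygon is connected, so its limit values are the same at all points;
    every value of G is one of them. *)
Lemma two_values : exists g1 g2,
  [/\ adj g1.2 g2.2, forall x, ~ bd s x -> G x = g1 \/ G x = g2
    & forall m P, bd s m -> (\forall y \near m, P y) ->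
        (exists y, [/\ P y, ~ bd s y & G y = g1]) /\
        (exists y, [/\ P y, ~ bd s y & G y = g2])].
Proof.
have [m bm] : exists m, bd s m.
  case: ss => _; case E: s => [//|x0 [//|y t]] _ _ _.
  by exists x0; exists (x0, y); [rewrite /= mem_head|exact: seg_l].
have [g1 [g2 [g12 E _]]] := limit_valuesE bm.
exists g1, g2; split=> //.
  by move=> x /(value_is_limit bm); rewrite E.
move=> m' P bm' nP; split.
  have : limit_values m' g1 by rewrite (limit_values_const bm' bm) E; left.
  by apply.
have : limit_values m' g2 by rewrite (limit_values_const bm' bm) E; right.
by apply.
Qed.

End Limits.

End TwoValues.

(** * Counterclockwise polygons and extreme vertices *)

Section Jordan.
Local Open Scope classical_set_scope.
Local Open Scope ring_scope.
Context {R : realType}.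
Implicit Types (x y z a b c d h m v u p q n : plane R) (s t : seq (plane R)) (k : int).

Lemma adj0 k : adj 0 k -> k = 1 \/ k = -1.
Proof.
rewrite /adj => /orP[/eqP E|/eqP->]; [right|by left].
by apply: (addIr 1); rewrite -E.
Qed.

Lemma far_right s (M : R) : exists z, [/\ M < z.1, ~ bd s z & wind s z = 0].
Proof.
have [M' M'0 H] := seq_bound (fun v : plane R => v.1) s.
have H' v : v \in s -> v.1 < `|M| + M' + 1.
  by move=> /H; have := normr_ge0 M; lra.
exists (`|M| + M' + 1, 0); split=> /=; first by have := ler_norm M; lra.
- move=> /(@bd_dot_lt _ (1, 0) _ _ (`|M| + M' + 1)); rewrite /dot /= !mul1r !mul0r !addr0 ltxx.
  by move=> F; apply: notF; apply: F => v vs; rewrite mul1r mul0r addr0; exact: H'.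
by apply: wind_far; left.
Qed.

(** Far away the winding number is 0; the other value is adjacent to it. *)
Lemma wind_values s : simple s -> exists k, [/\ k = 1 \/ k = -1,
  forall x, ~ bd s x -> wind s x = 0 \/ wind s x = k
  & forall m P, bd s m -> (\forall y \near m, P y) ->
     (exists y, [/\ P y, ~ bd s y & wind s y = 0]) /\
     (exists y, [/\ P y, ~ bd s y & wind s y = k])].
Proof.
move=> ss; have [g1 [g2 [g12 H1 H2]]] :=
  two_values ss (F := fun=> tt) (fun _ _ _ => erefl).
have [z [_ nz wz]] := far_right s 0.
have W x : ~ bd s x -> wind s x = g1.2 \/ wind s x = g2.2.
  by move=> /H1[<-|<-]; [left|right].
have main (k1 k2 : int) : adj k1 k2 -> k1 = 0 ->
    (forall x, ~ bd s x -> wind s x = k1 \/ wind s x = k2) ->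
    (forall m P, bd s m -> (\forall y \near m, P y) ->
      (exists y, [/\ P y, ~ bd s y & wind s y = k1]) /\
      (exists y, [/\ P y, ~ bd s y & wind s y = k2])) ->
    exists k, [/\ k = 1 \/ k = -1,
      forall x, ~ bd s x -> wind s x = 0 \/ wind s x = k
      & forall m P, bd s m -> (\forall y \near m, P y) ->
         (exists y, [/\ P y, ~ bd s y & wind s y = 0]) /\
         (exists y, [/\ P y, ~ bd s y & wind s y = k])].
  by move=> a12 E; rewrite E in a12 * => h1 h2; exists k2; split=> //; exact: adj0.
have K m P : bd s m -> (\forall y \near m, P y) ->
      (exists y, [/\ P y, ~ bd s y & wind s y = g1.2]) /\
      (exists y, [/\ P y, ~ bd s y & wind s y = g2.2]).
  move=> bm nP; have [[y1 [h1 h2 h3]] [y2 [h4 h5 h6]]] := H2 m P bm nP.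
  by split; [exists y1; rewrite -h3|exists y2; rewrite -h6].
case: (W z nz); rewrite wz => /esym E; first exact: (main g1.2 g2.2).
apply: (main g2.2 g1.2) => //; first by rewrite /adj orbC.
  by move=> x /W[]; auto.
by move=> m P bm nP; have [] := K m P bm nP.
Qed.

Definition ccw s := forall x, ~ bd s x -> 0 <= wind s x.

Lemma ccw_values s : simple s -> ccw s ->
  (forall x, ~ bd s x -> wind s x = 0 \/ wind s x = 1) /\
  (forall m P, bd s m -> (\forall y \near m, P y) ->
     (exists y, [/\ P y, ~ bd s y & wind s y = 0]) /\
     (exists y, [/\ P y, ~ bd s y & wind s y = 1])).
Proof.
move=> ss cs; have [k [kE H1 H2]] := wind_values ss; case: kE H1 H2 => -> H1 H2.
  by split.
have [x0 bx0] : exists m, bd s m.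
  case: ss => _; case E: s => [//|y0 [//|y t]] _ _ _.
  by exists y0; exists (y0, y); [rewrite /= mem_head|exact: seg_l].
have [_ [y [_ nb E]]] := H2 x0 setT bx0 filterT.
by have := cs y nb; rewrite E.
Qed.

Lemma cw_values s : simple s -> ~ ccw s ->
  (forall x, ~ bd s x -> wind s x = 0 \/ wind s x = -1) /\
  (forall m P, bd s m -> (\forall y \near m, P y) ->
     (exists y, [/\ P y, ~ bd s y & wind s y = 0]) /\
     (exists y, [/\ P y, ~ bd s y & wind s y = -1])).
Proof.
move=> ss cs; have [k [kE H1 H2]] := wind_values ss; case: kE H1 H2 => -> H1 H2.
  by case: cs => x /H1[] ->.
by split.
Qed.

Lemma ccw_perm s s' : perm_eq (arcs s) (arcs s') -> ccw s -> ccw s'.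
Proof. by move=> p H x; rewrite -(bd_perm p) -(wind_perm x p); exact: H. Qed.

Lemma bd_vertex s v : v \in s -> bd s v.
Proof.
move=> /rot_head[n [t E]]; rewrite -(bd_perm (arcs_rot n s)) E.
case: t {E} => [|w t]; first by exists (v, v); [rewrite /= mem_head|exact: seg_l].
by exists (v, w); [rewrite /= mem_head|exact: seg_l].
Qed.

(** A ccw polygon has both values 0 and 1 near m, which leaves no room for k. *)
Lemma shift_eq0 s m (B : plane R -> bool) k : simple s -> ccw s -> bd s m ->
  (\forall x \near m, ~ bd s x -> wind s x = k + Posz (B x)) -> k = 0.
Proof.
move=> ss cs bm H; have [_ H2] := ccw_values ss cs.
have [[y [Hy ny E]] [y' [Hy' ny' E']]] := H2 m _ bm H.
move: (Hy ny) (Hy' ny'); rewrite E E'; case: (B y); case: (B y') => /=.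
- by lia.
- by lia.
- by lia.
by lia.
Qed.

Lemma ccw_near_vertex a h b t : simple [:: a, h, b & t] -> ccw [:: a, h, b & t] ->
  \forall x \near h, ~ bd [:: a, h, b & t] x ->
    wind [:: a, h, b & t] x = Posz (wedge a h b x).
Proof.
move=> ss cs; have [k H] := near_vertex ss.
have H' : \forall x \near h, ~ bd [:: a, h, b & t] x ->
    wind [:: a, h, b & t] x = k + Posz (wedge a h b x).
  by apply: filterS H => x [].
have bh : bd [:: a, h, b & t] h by apply: bd_vertex; rewrite !inE eqxx orbT.
have k0 := shift_eq0 ss cs bh H'.
by apply: filterS H' => x; rewrite k0 add0r.
Qed.

Lemma ccw_near_edge a b t (t0 : R) m : simple [:: a, b & t] -> ccw [:: a, b & t] ->
  0 < t0 -> t0 < 1 -> m = a + t0 *: (b - a) ->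
  \forall x \near m, (bd [:: a, b & t] x <-> orient a b x = 0) /\
    (~ bd [:: a, b & t] x -> wind [:: a, b & t] x = Posz (0 < orient a b x)%R).
Proof.
move=> ss cs h0 h1 mE; have [k H] := near_edge ss h0 h1 mE.
have H' : \forall x \near m, ~ bd [:: a, b & t] x ->
    wind [:: a, b & t] x = k + Posz (0 < orient a b x)%R.
  by apply: filterS H => x [].
have bh : bd [:: a, b & t] m.
  by exists (a, b); [rewrite /= mem_head|exists t0; split=> //; exact: ltW].
have k0 := shift_eq0 ss cs bh H'.
by apply: filterS H => x; rewrite k0 add0r.
Qed.

Lemma orient_ray1 a h d (w : R) : orient a h (h + w *: d) = w * orient a h (h + d).
Proof. by rewrite /orient !pE; ring. Qed.

Lemma orient_ray2 h b d (w : R) : orient h b (h + w *: d) = w * orient h b (h + d).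
Proof. by rewrite /orient !pE; ring. Qed.

Lemma wedge_ray a h b d (w : R) : 0 < w -> wedge a h b (h + w *: d) = wedge a h b (h + d).
Proof. by move=> w0; rewrite /wedge orient_ray1 orient_ray2 !pmulr_rgt0. Qed.

Lemma near_ray_bd a h b t d : simple [:: a, h, b & t] ->
  orient a h (h + d) != 0 -> orient h b (h + d) != 0 ->
  \forall x \near h, (exists2 w : R, 0 < w & x = h + w *: d) -> ~ bd [:: a, h, b & t] x.
Proof.
move=> ss d1 d2; have [us s2 gs ds] := ss.
have o0 : orient a h b != 0.
  move: us => /=; rewrite !inE !negb_or => /andP[/and3P[h2 h3 _] /andP[/andP[h4 _] _]].
  by apply: gs => //; rewrite !inE eqxx ?orbT.
have [k H] := near_vertex ss.
apply: filterS H => x [H1 H2 _] [w w0 xE].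
have e1 : orient a h x = w * orient a h (h + d) by rewrite xE orient_ray1.
have e2 : orient h b x = w * orient h b (h + d) by rewrite xE orient_ray2.
case: (ltgtP (orient a h b) 0) o0 => // op _.
  rewrite (H2 op) e1 e2; apply: contrapT.
  rewrite !pmulr_rgt0 // !pmulr_rlt0 // => N; apply: N => N; apply: N.
  by case: (ltgtP (orient a h (h + d)) 0) d1 => // l1 _;
    case: (ltgtP (orient h b (h + d)) 0) d2 => // l2 _; auto.
rewrite (H1 op) e1 e2; apply: contrapT.
rewrite !pmulr_rgt0 // !pmulr_rlt0 // => N; apply: N => N; apply: N.
by case: (ltgtP (orient a h (h + d)) 0) d1 => // l1 _;
  case: (ltgtP (orient h b (h + d)) 0) d2 => // l2 _; auto.
Qed.

(** At an extreme vertex h, some point close to h is separated from s by a line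
    and has winding number 0; [near_vertex] then decides the other side. *)
Lemma extreme_ccw a h b t u : simple [:: a, h, b & t] ->
  {in [:: a, h, b & t], forall v, v != h -> dot u v < dot u h} ->
  ccw [:: a, h, b & t] <-> 0 < orient a h b.
Proof.
move=> ss ext; have [us s2 gs ds] := ss.
have [ah ab hb] : [/\ a != h, a != b & h != b].
  by move: us => /=; rewrite !inE !negb_or; case/andP=> /and3P[? ? _] /andP[/andP[? _] _].
have o0 : orient a h b != 0 by apply: gs => //; rewrite !inE eqxx ?orbT.
have ua : dot u a < dot u h by apply: ext; rewrite // inE eqxx.
have ub : dot u b < dot u h by apply: ext; rewrite ?inE ?eqxx ?orbT // eq_sym.
have u0 : 0 < dot u u.
  rewrite /dot lt_neqAle addr_ge0 -?expr2 ?sqr_ge0 // andbT eq_sym paddr_eq0 ?sqr_ge0 //.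
  rewrite !sqrf_eq0; apply/negP => /andP[/eqP h1 /eqP h2].
  by move: ua; rewrite /dot h1 h2 !mul0r !addr0 ltxx.
have [k H] := near_vertex ss.
have [e e0 He] := near_ray u H.
set x := h + (e / 2) *: u.
have [H1 H2 H3] : _ := He (e / 2) ltac:(rewrite ger0_norm; lra).
have e2 : 0 < e / 2 by lra.
have ux v : v \in [:: a, h, b & t] -> dot u v < dot u x.
  have -> : dot u x = dot u h + e / 2 * dot u u by rewrite /x /dot !pE; ring.
  have : 0 < e / 2 * dot u u by exact: mulr_gt0.
  move=> p0 vs; have [->|/(ext _ vs)] := eqVneq v h; lra.
have nx : ~ bd [:: a, h, b & t] x by move=> /(bd_dot_lt ux); rewrite ltxx.
have wx := wind_halfplane ux.
have fr := frame x o0.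
have dE : dot u x - dot u h = orient h b x / orient a h b * (dot u a - dot u h)
   + orient a h x / orient a h b * (dot u b - dot u h).
  by rewrite {1}fr /dot !pE; ring.
have dx : 0 < dot u x - dot u h by rewrite subr_gt0 ux // !inE eqxx orbT.
have some : orient h b x / orient a h b < 0 \/ orient a h x / orient a h b < 0.
  have [l1|l1] := ltP (orient h b x / orient a h b) 0; first by left.
  have [l2|l2] := ltP (orient a h x / orient a h b) 0; first by right.
  exfalso; move: dx; rewrite dE ltNge => /negP; apply.
  by rewrite -[leRHS]addr0; apply: lerD; apply: mulr_ge0_le0 => //; rewrite subr_le0 ltW.
pose d := a + b - h - h.
have d1 : orient a h (h + d) = orient a h b by rewrite /orient /d !pE; ring.
have d2 : orient h b (h + d) = orient a h b by rewrite /orient /d !pE; ring.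
have nd : \forall y \near h, ((exists2 w : R, 0 < w & y = h + w *: d) -> ~ bd [:: a, h, b & t] y)
     /\ (~ bd [:: a, h, b & t] y ->
        wind [:: a, h, b & t] y = k + Posz (wedge a h b y)).
  near=> y; split; near: y; first by apply: near_ray_bd; rewrite ?d1 ?d2.
  by apply: filterS H => y [].
have [e' e'0 He'] := near_ray d nd.
have e'2 : 0 < e' / 2 by lra.
have [H4 H5] := He' (e' / 2) ltac:(rewrite ger0_norm; lra).
have ny : ~ bd [:: a, h, b & t] (h + (e' / 2) *: d) by apply: H4; exists (e' / 2).
have := H5 ny; rewrite wedge_ray // /wedge d1 d2.
have := H3 nx; rewrite wx /wedge.
case: (ltgtP (orient a h b) 0) o0 some => // op _ some /=.
  have -> : (0 < orient a h x) || (0 < orient h b x).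
    case: some; last rewrite orbC; rewrite ltr_ndivrMr // mul0r => ->; by rewrite ?orbT.
  move=> k0 wy; split=> // cs; have := cs _ ny; rewrite wy.
  have -> : k = -1 by apply: (addIr 1); rewrite -k0.
  by [].
have -> : (0 < orient a h x) && (0 < orient h b x) = false.
  case: some => l; move: l; rewrite ltr_pdivrMr // mul0r => /lt_gtF ->; by rewrite ?andbF.
rewrite addr0 => <-; rewrite add0r => wy; split=> // _.
apply: contrapT => /(cw_values ss)[H6 _].
by case: (H6 _ ny); rewrite wy.
Unshelve. all: by end_near. Qed.

Lemma seq_argmax (T : eqType) (f : T -> R) (S : seq T) w : w \in S ->
  exists2 h : T, h \in S & forall y : T, y \in S -> f y <= f h.
Proof.
elim: S w => [//|w0 S IH] w _; case: S IH => [|w1 S] IH.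
  by exists w0; rewrite ?mem_head // => y; rewrite inE => /eqP->.
have [h hS Hh] := IH w1 (mem_head _ _).
have [l|l] := leP (f h) (f w0).
  exists w0; rewrite ?mem_head // => y; rewrite in_cons => /orP[/eqP->//|/Hh].
  by move=> l'; exact: le_trans l.
exists h; first by rewrite in_cons hS orbT.
by move=> y; rewrite in_cons => /orP[/eqP->|/Hh//]; exact: ltW.
Qed.

(** Maximizing a large multiple of an affine form plus the squared norm: the
    strict convexity of the latter makes the maximizer a vertex of the hull. *)
Lemma extreme_exists (S : seq (plane R)) n (c : R) v0 : v0 \in S -> c < dot n v0 ->
  exists h u, [/\ h \in S, c < dot n h &
    {in S, forall v, v != h -> dot u v < dot u h}].
Proof.
move=> v0S v0p.
have [M M0 HM] := seq_bound (fun v : plane R => dot v v) S.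
have p0 : 0 < dot n v0 - c by rewrite subr_gt0.
pose K := M / (dot n v0 - c).
have K0 : 0 < K by apply: divr_gt0.
pose F v := K * (dot n v - c) + dot v v.
have [h hS Hh] := seq_argmax F v0S.
exists h, (K *: n + h + h); split=> //.
  rewrite ltNge; apply/negP => hc.
  have : F v0 <= F h by apply: Hh.
  rewrite /F /K divfK ?gt_eqF //.
  have : K * (dot n h - c) <= 0 by rewrite pmulr_rle0 // subr_le0.
  rewrite -/K; have := HM _ hS.
  have : 0 <= dot v0 v0 by rewrite /dot addr_ge0 // -expr2 sqr_ge0.
  by move=> *; lra.
move=> v vS vh; have := Hh _ vS; rewrite /F.
have : 0 < dot (v - h) (v - h).
  rewrite /dot lt_neqAle addr_ge0 -?expr2 ?sqr_ge0 // andbT eq_sym paddr_eq0 ?sqr_ge0 //.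
  rewrite !sqrf_eq0 !pE !subr_eq0; apply: contra vh => /andP[/eqP h1 /eqP h2].
  by apply/eqP; apply: plane_eq.
have -> : dot (v - h) (v - h) = dot v v - dot h v - dot h v + dot h h by rewrite /dot !pE; ring.
have -> : dot (K *: n + h + h) v = K * dot n v + dot h v + dot h v by rewrite /dot !pE; ring.
have -> : dot (K *: n + h + h) h = K * dot n h + dot h h + dot h h by rewrite /dot !pE; ring.
by move=> l1 l2; lra.
Qed.

End Jordan.

(** * Edge sets and the Jordan curve theorem *)

Section Edges.
Local Open Scope fset_scope.
Local Open Scope classical_set_scope.
Local Open Scope ring_scope.
Context {R : realType}.
Implicit Types (x y z a b c d h m v u p q : plane R) (n : nat) (s t : seq (plane R)) (P : polygon R).

Lemma next_mid a h b t : uniq [:: a, h, b & t] -> next [:: a, h, b & t] h = b.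
Proof.
move=> /= /andP[]; rewrite !inE !negb_or eq_sym => /and3P[/negbTE -> _ _] _.
by rewrite eqxx.
Qed.

Lemma prev_mid a h b t : uniq [:: a, h, b & t] -> prev [:: a, h, b & t] h = a.
Proof.
move=> us; have E : next [:: a, h, b & t] a = h by rewrite /= eqxx.
by have := prev_next us a; rewrite E.
Qed.

Lemma map_fst_arcs s : [seq e.1 | e <- arcs s] = s.
Proof.
case: s => //= x s; suff H y z : [seq e.1 | e <- pth y (rcons s z)] = y :: s by [].
by elim: s y => [|w s IH] y //=; rewrite IH.
Qed.

Lemma arcs_uniq s : uniq s -> uniq (arcs s).
Proof. by move=> us; apply: (@map_uniq _ _ (fun e => e.1)); rewrite map_fst_arcs. Qed.

Lemma arcs_next s x y : uniq s -> (1 < size s)%N ->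
  ((x, y) \in arcs s) = (x \in s) && (y == next s x).
Proof.
move=> us s2; apply/idP/idP.
  move=> xy; have [/= xs _] := arcs_mem xy; rewrite xs /=.
  have [n [t E]] := rot_arc us s2 xy.
  by rewrite -(next_rot n us) E /= eqxx.
move=> /andP[/rot_head[n [t E]] /eqP->].
rewrite -(next_rot n us) -(perm_mem (arcs_rot n s)).
move: s2; rewrite -(size_rot n) E; case: t E => // b t E _.
by rewrite /= eqxx mem_head.
Qed.

Lemma arcs_prev s x y : uniq s -> (1 < size s)%N ->
  ((x, y) \in arcs s) = (y \in s) && (x == prev s y).
Proof.
move=> us s2; rewrite arcs_next //; apply/andP/andP => -[xs /eqP->].
  by rewrite mem_next prev_next.
by rewrite mem_prev next_prev.
Qed.

Definition left s x : bool := 0 < orient (prev s x) x (next s x).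

Lemma left_rot n s x : uniq s -> left (rot n s) x = left s x.
Proof. by move=> us; rewrite /left next_rot // prev_rot. Qed.

Lemma left_mid a h b t : uniq [:: a, h, b & t] ->
  left [:: a, h, b & t] h = (0 < orient a h b).
Proof. by move=> us; rewrite /left next_mid // prev_mid. Qed.

Lemma left_arcs s a x b : uniq s -> (1 < size s)%N -> (a, x) \in arcs s ->
  (x, b) \in arcs s -> left s x = (0 < orient a x b).
Proof.
move=> us s2; rewrite arcs_prev // arcs_next // => /andP[_ /eqP->] /andP[_ /eqP->].
by [].
Qed.

Lemma arcs_rev s e : uniq s -> (1 < size s)%N ->
  ((e.1, e.2) \in arcs (rev s)) = ((e.2, e.1) \in arcs s).
Proof.
move=> us s2; rewrite arcs_next ?rev_uniq ?size_rev // mem_rev next_rev //.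
by rewrite arcs_prev.
Qed.

Lemma arcs_rev_perm s : uniq s -> (1 < size s)%N ->
  perm_eq (arcs (rev s)) [seq (e.2, e.1) | e <- arcs s].
Proof.
move=> us s2; apply: uniq_perm; first by rewrite arcs_uniq ?rev_uniq.
  rewrite map_inj_uniq ?arcs_uniq //.
  by move=> [? ?] [? ?] [-> ->].
move=> [x y]; rewrite (arcs_rev (x, y)) //=; apply/idP/mapP.
  by move=> h; exists (y, x).
by move=> [[y' x'] h [-> ->]].
Qed.

Lemma wind_rev s x : uniq s -> (1 < size s)%N -> wind (rev s) x = - wind s x.
Proof.
move=> us s2; rewrite /wind (perm_big _ (arcs_rev_perm us s2)) big_map -sumrN.
by apply: eq_bigr => e _; rewrite kapC.
Qed.

Lemma bd_rev s : uniq s -> (1 < size s)%N -> bd (rev s) = bd s.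
Proof.
move=> us s2; apply/seteqP; split=> z [[a b] e hz].
  by exists (b, a); rewrite -?(arcs_rev (a, b)) //= segC.
by exists (b, a); rewrite ?(arcs_rev (b, a)) //= segC.
Qed.

Lemma meet_at_endsC (e f : plane R * plane R) : meet_at_ends e f -> meet_at_ends f e.
Proof. by move=> H z h1 h2; have [] := H z h2 h1. Qed.

Lemma simple_rev s : simple s -> simple (rev s).
Proof.
move=> [us s2 gs ds]; have s1 := ltnW s2.
split; rewrite ?rev_uniq ?size_rev //.
  by move=> x y z; rewrite !mem_rev; exact: gs.
move=> [a b] [c d]; rewrite (arcs_rev (a, b)) // (arcs_rev (c, d)) //= => h1 h2 ne.
have ne' : (b, a) != (d, c) by apply: contra_neq ne => -[-> ->].
have H := ds _ _ h1 h2 ne'; move=> z /=; rewrite (segC a) (segC c) => hz1 hz2.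
have [] := H z hz1 hz2.
by rewrite /= !inE => h3 h4; rewrite orbC h3 orbC h4.
Qed.

Lemma ccw_or_rev s : simple s -> exists s',
  [/\ simple s', ccw s', uniq s', s' =i s & s' = s \/ s' = rev s].
Proof.
move=> ss; have [us s2 _ _] := ss.
have [cs|cs] := pselect (ccw s); first by exists s; split=> //; left.
exists (rev s); split; [exact: simple_rev| | by rewrite rev_uniq| |by right].
  move=> x; rewrite bd_rev ?(ltnW s2) // wind_rev ?(ltnW s2) // => nx.
  by have [H _] := cw_values ss cs; case: (H x nx) => ->.
by move=> x; rewrite mem_rev.
Qed.

Definition edges s : polygon R := [fset [fset x; next s x] | x in s]%fset.

Lemma mem_edges s e : uniq s -> (1 < size s)%N ->
  reflect (exists2 f, f \in arcs s & e = [fset f.1; f.2]%fset) (e \in edges s).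
Proof.
move=> us s2; apply: (iffP idP).
  move=> /imfsetP[x /= xs ->]; exists (x, next s x) => //.
  by rewrite arcs_next // xs eqxx.
move=> [[x y]]; rewrite arcs_next // => /andP[xs /eqP->] ->.
by apply/imfsetP; exists x.
Qed.

Lemma edges_eq_arcs s s' : uniq s -> (1 < size s)%N -> uniq s' -> (1 < size s')%N ->
  arcs s =i arcs s' -> edges s = edges s'.
Proof.
move=> us s2 us' s2' E; apply/fsetP => e; apply/mem_edges/mem_edges => // -[f fs ->].
  by exists f; rewrite // -E.
by exists f; rewrite // E.
Qed.

Lemma edges_rot n s : uniq s -> (1 < size s)%N -> edges (rot n s) = edges s.
Proof.
move=> us s2; apply: edges_eq_arcs; rewrite ?rot_uniq ?size_rot //.
by apply: perm_mem; exact: arcs_rot.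
Qed.

Lemma fset2C x y : [fset x; y]%fset = [fset y; x]%fset.
Proof. by apply/fsetP => z; rewrite !inE orbC. Qed.

Lemma edges_rev s : uniq s -> (1 < size s)%N -> edges (rev s) = edges s.
Proof.
move=> us s2; apply/fsetP => e.
apply/mem_edges/mem_edges; rewrite ?rev_uniq ?size_rev // => -[[x y] h ->].
  by exists (y, x); rewrite -?(arcs_rev (x, y)) //= fset2C.
by exists (y, x); rewrite ?(arcs_rev (y, x)) //= fset2C.
Qed.

Lemma fset2_eq x y z w : [fset x; y]%fset = [fset z; w]%fset ->
  (x = z /\ y = w) \/ (x = w /\ y = z).
Proof.
move=> E.
have : x \in [fset z; w]%fset by rewrite -E !inE eqxx.
have : y \in [fset z; w]%fset by rewrite -E !inE eqxx orbT.
have : z \in [fset x; y]%fset by rewrite E !inE eqxx.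
have : w \in [fset x; y]%fset by rewrite E !inE eqxx orbT.
rewrite !inE => /orP[]/eqP e1 /orP[]/eqP e2 /orP[]/eqP e3 /orP[]/eqP e4;
  first [left; split; congruence|right; split; congruence].
Qed.

Lemma arcs_antisym s x y : uniq s -> (2 < size s)%N -> (x, y) \in arcs s ->
  (y, x) \in arcs s = false.
Proof.
move=> us s2 xy; apply/negP; have [n [t E]] := rot_arc us (ltnW s2) xy.
rewrite arcs_next // ?(ltnW s2) // -(next_rot n us) E => /andP[_].
move: us s2; rewrite -(rot_uniq n) -(size_rot n) E => us.
case: t E us => // z t E us _.
by rewrite next_mid //; move: us => /= /andP[]; rewrite !inE !negb_or => /and3P[_ /negbTE ->].
Qed.

Lemma arcs_edge_inj s e f : uniq s -> (2 < size s)%N -> e \in arcs s -> f \in arcs s ->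
  [fset e.1; e.2]%fset = [fset f.1; f.2]%fset -> e = f.
Proof.
case: e f => [a b] [c d] us s2 h1 h2 /= /fset2_eq[[-> ->]//|[E1 E2]].
by move: E1 E2 h2 => /= <- <-; rewrite (arcs_antisym us s2 h1).
Qed.

Lemma conv2 a b : conv [fset a; b]%fset = seg a b.
Proof.
have [<-|ab] := eqVneq a b.
  have -> : [fset a; a]%fset = [fset a]%fset by apply/fsetP => z; rewrite !inE orbb.
  apply/seteqP; split=> z.
    move=> [w [_ + ->]]; rewrite !big_seq_fset1 => ->.
    by rewrite scale1r; exact: seg_l.
  move=> [t [_ _ ->]]; rewrite subrr scaler0 addr0; exists (fun=> 1).
  by split; rewrite ?big_seq_fset1 ?scale1r // => *; exact: ler01.
have nab : a \notin [fset b]%fset by rewrite inE.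
apply/seteqP; split=> z.
  move=> [w [w0 + ->]]; rewrite !big_fsetU1 //= !big_seq_fset1 => w1.
  have wa : 0 <= w a by apply: w0; rewrite !inE eqxx.
  have wb : 0 <= w b by apply: w0; rewrite !inE eqxx orbT.
  exists (w b); split=> //; first by lra.
  have -> : w a = 1 - w b by lra.
  by apply: plane_eq; rewrite !pE; ring.
move=> [t [t0 t1 ->]]; exists (fun x => if x == a then 1 - t else t); split.
- by move=> x _; case: ifP => _; rewrite // subr_ge0.
- by rewrite !big_fsetU1 //= !big_seq_fset1 eqxx eq_sym (negbTE ab) subrK.
rewrite !big_fsetU1 //= !big_seq_fset1 eqxx eq_sym (negbTE ab).
by apply: plane_eq; rewrite !pE; ring.
Qed.

Lemma boundary_edges s : uniq s -> (1 < size s)%N -> boundary (edges s) = bd s.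
Proof.
move=> us s2; apply/seteqP; split=> z.
  move=> [e /= /(mem_edges _ us s2)[f fs ->]]; rewrite conv2 => hz.
  by exists f.
move=> [f fs hz]; exists [fset f.1; f.2]%fset; last by rewrite conv2.
by apply/mem_edges => //; exists f.
Qed.

Lemma vertices_edges s : uniq s -> (1 < size s)%N -> vertices (edges s) =i s.
Proof.
move=> us s2 x; apply/bigfcupP/idP.
  move=> [e]; rewrite andbT => /(mem_edges _ us s2)[f /arcs_mem[h1 h2] ->].
  by rewrite !inE => /orP[]/eqP->.
move=> xs; exists [fset x; next s x]%fset; last by rewrite !inE eqxx.
by rewrite andbT; apply/mem_edges => //; exists (x, next s x); rewrite // arcs_next // xs eqxx.
Qed.

(** Jordan curve theorem: two far points and a bounded component with winding
    number 0 would give three limit values of the pair formed by the winding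
    number and the indicator function of the component. *)
Lemma jordan s x : simple s -> ~ bd s x ->
  (bounded_set (connected_component (~` bd s) x) <-> wind s x <> 0).
Proof.
move=> ss nx; split.
  move=> [M [_ HM]] wx.
  have [z [z1 nz wz]] := far_right s (`|M| + 1).
  pose K := connected_component (~` bd s) x.
  have ci : component_invariant s K.
    move=> y y' H; have yy' : connected_component (~` bd s) y y'.
      by apply: (connected_component_max (B := seg y y')) => //;
        [exact: seg_l|exact: seg_connected|exact: seg_r].
    apply/propext; split=> h; apply: connected_component_trans h _ => //.
    exact: connected_component_sym.
  have [g1 [g2 [g12 H _]]] := two_values ss ci.
  have E : K x = K z.
    have := H x nx; have := H z nz; rewrite wx wz => Hz Hx.
    case: Hx => E1; case: Hz => E2.
    - by have [] : (K x, 0 : int) = (K z, 0) by rewrite E1 E2.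
    - by move: g12; rewrite -E1 -E2 adjxx.
    - by move: g12; rewrite -E1 -E2 adjxx.
    by have [] : (K x, 0 : int) = (K z, 0) by rewrite E1 E2.
  have Kz : K z by rewrite -E; exact: connected_component_refl.
  have lM : M < `|M| + 1 by have := ler_norm M; lra.
  have := HM _ lM z Kz; rewrite /= prod_normE ge_max => /andP[l2 _].
  by have := ler_norm z.1; lra.
move=> wx.
have [M M0 HM] := seq_bound (fun v : plane R => `|v.1| + `|v.2|) s.
have K y : connected_component (~` bd s) x y -> wind s y <> 0.
  move=> hy; rewrite (@wind_const _ s (connected_component (~` bd s) x) y x) //.
  - exact: component_connected.
  - exact: connected_component_sub.
  exact: connected_component_refl.
exists M; split; first exact: num_real.
move=> M' MM' y /K wy; rewrite /= prod_normE ge_max.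
apply/andP; split; rewrite leNgt; apply/negP => l; apply: wy.
  have [y1|y1] := leP 0 y.1.
    apply: (@wind_halfplane _ (1, 0)) => v /HM; rewrite /dot /= !mul1r !mul0r !addr0.
    rewrite ger0_norm // in l; have := ler_norm v.1; have := normr_ge0 v.2; lra.
  apply: (@wind_halfplane _ (-1, 0)) => v /HM; rewrite /dot /= !mulN1r !mul0r !addr0.
  rewrite ltr0_norm // in l; have := ler_norm (- v.1); rewrite normrN; have := normr_ge0 v.2; lra.
have [y1|y1] := leP 0 y.2.
  apply: (@wind_halfplane _ (0, 1)) => v /HM; rewrite /dot /= !mul1r !mul0r !add0r.
  rewrite ger0_norm // in l; have := ler_norm v.2; have := normr_ge0 v.1; lra.
apply: (@wind_halfplane _ (0, -1)) => v /HM; rewrite /dot /= !mulN1r !mul0r !add0r.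
rewrite ltr0_norm // in l; have := ler_norm (- v.2); rewrite normrN; have := normr_ge0 v.1; lra.
Qed.

Lemma inside_edges s x : simple s -> ccw s ->
  (inside (edges s) x <-> ~ bd s x /\ wind s x = 1).
Proof.
move=> ss cs; have [us s2 _ _] := ss.
rewrite /inside /= boundary_edges ?(ltnW s2) //.
have [H _] := ccw_values ss cs.
split=> -[nx h]; split=> //.
  by move: h => /(jordan ss nx) h; case: (H x nx).
by apply/(jordan ss nx); rewrite h.
Qed.

End Edges.

(** * Convex vertices and pseudo-triangles *)

Section PseudoTriangles.
Local Open Scope fset_scope.
Local Open Scope classical_set_scope.
Local Open Scope ring_scope.
Context {R : realType}.
Implicit Types (x y z a b c d h m v u p q : plane R) (n : nat) (s t : seq (plane R)).
Implicit Types (P : polygon R) (A : {fset plane R}).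

Lemma simple_size1 s : simple s -> (1 < size s)%N.
Proof. by move=> [_ /ltnW]. Qed.

Lemma simple_uniq s : simple s -> uniq s.
Proof. by case. Qed.

Lemma rot_arcs2 s a h b : simple s -> (a, h) \in arcs s -> (h, b) \in arcs s ->
  exists n t, rot n s = [:: a, h, b & t].
Proof.
move=> ss; have [us s2 _ _] := ss.
move=> ah hb; have [/= _ hs] := arcs_mem ah.
have [n [a' [b' [t E]]]] := rot_vertex s2 hs.
move: ah hb; rewrite arcs_prev ?simple_size1 // arcs_next ?simple_size1 //.
move=> /andP[_ /eqP aE] /andP[_ /eqP bE]; exists n, t; rewrite E.
have ur : uniq [:: a', h, b' & t] by rewrite -E rot_uniq.
by rewrite aE bE -(prev_rot n us) -(next_rot n us) E prev_mid // next_mid.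
Qed.

Lemma arcs_turn s a h b : simple s -> (a, h) \in arcs s -> (h, b) \in arcs s ->
  [/\ orient a h b != 0, a != h, h != b & a != b].
Proof.
move=> ss ah hb; have [n [t E]] := rot_arcs2 ss ah hb.
have := simple_rot n ss; rewrite E => -[us _ gs _].
have [? ? ?] : [/\ a != h, a != b & h != b].
  by move: us => /=; rewrite !inE !negb_or; case/andP=> /and3P[? ? _] /andP[/andP[? _] _].
by split=> //; apply: gs => //; rewrite !inE eqxx ?orbT.
Qed.

Lemma vertex_arcs s h : simple s -> h \in s ->
  exists a b, (a, h) \in arcs s /\ (h, b) \in arcs s.
Proof.
move=> ss hs; have s1 := simple_size1 ss; have us := simple_uniq ss.
exists (prev s h), (next s h).
by rewrite arcs_prev // arcs_next // hs !eqxx.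
Qed.

Lemma near_arc s a b (t0 : R) m : simple s -> ccw s -> (a, b) \in arcs s ->
  0 < t0 -> t0 < 1 -> m = a + t0 *: (b - a) ->
  \forall x \near m, (bd s x <-> orient a b x = 0) /\
    (~ bd s x -> wind s x = Posz (0 < orient a b x)%R).
Proof.
move=> ss cs ab h0 h1 mE.
have [n [t E]] := rot_arc (simple_uniq ss) (simple_size1 ss) ab.
have pr := arcs_rot n s; rewrite perm_sym in pr.
have := simple_rot n ss; have := ccw_perm pr cs; rewrite E => cs' ss'.
have := ccw_near_edge ss' cs' h0 h1 mE; apply: filterS => x.
by rewrite -E -(bd_perm pr) -(wind_perm x pr).
Qed.

Lemma near_wedge s a h b : simple s -> ccw s -> (a, h) \in arcs s -> (h, b) \in arcs s ->
  \forall x \near h, ~ bd s x -> wind s x = Posz (wedge a h b x).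
Proof.
move=> ss cs ah hb.
have [n [t E]] := rot_arcs2 ss ah hb.
have pr := arcs_rot n s; rewrite perm_sym in pr.
have := simple_rot n ss; have := ccw_perm pr cs; rewrite E => cs' ss'.
have := ccw_near_vertex ss' cs'; apply: filterS => x.
by rewrite -E -(bd_perm pr) -(wind_perm x pr).
Qed.

Lemma near_wedge_ray s a h b d : simple s -> ccw s ->
  (a, h) \in arcs s -> (h, b) \in arcs s ->
  orient a h (h + d) != 0 -> orient h b (h + d) != 0 ->
  exists2 e : R, 0 < e & forall w : R, 0 < w < e ->
    ~ bd s (h + w *: d) /\ wind s (h + w *: d) = Posz (wedge a h b (h + d)).
Proof.
move=> ss cs ah hb d1 d2.
have [n [t E]] := rot_arcs2 ss ah hb.
have pr := arcs_rot n s; rewrite perm_sym in pr.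
have := simple_rot n ss; rewrite E => ss'.
have N1 := near_ray_bd ss' d1 d2; have N2 := near_wedge ss cs ah hb.
have N : \forall x \near h, ((exists2 w : R, 0 < w & x = h + w *: d) -> ~ bd s x) /\
     (~ bd s x -> wind s x = Posz (wedge a h b x)).
  near=> x; split; near: x; last exact: N2.
  by rewrite (bd_perm pr) E.
have [e e0 He] := near_ray d N; exists e => // w /andP[w0 we].
have [H1 H2] := He w ltac:(by rewrite ger0_norm // ltW).
have nb : ~ bd s (h + w *: d) by apply: H1; exists w.
by split=> //; rewrite (H2 nb) wedge_ray.
Unshelve. all: by end_near. Qed.

Lemma edges_nbr s a h b y : simple s -> (a, h) \in arcs s -> (h, b) \in arcs s ->
  [fset h; y]%fset \in edges s -> y = a \/ y = b.
Proof.
move=> ss ah hb; have us := simple_uniq ss; have s1 := simple_size1 ss.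
move=> /(mem_edges _ us s1)[[f1 f2] /= fs /fset2_eq[[E1 E2]|[E1 E2]]]; subst.
  right; move: fs hb; rewrite !arcs_next // => /andP[_ /eqP->] /andP[_ /eqP->] //.
by left; move: fs ah; rewrite !arcs_prev // => /andP[_ /eqP->] /andP[_ /eqP->].
Qed.

(** The polygon fills the wedge at x by [near_wedge], and this wedge is the sector
    spanned by the two edges iff the turn at x is a left one. *)
Lemma convex_vertexP s x : simple s -> ccw s -> x \in s ->
  convex_vertex (edges s) x <-> left s x.
Proof.
move=> ss cs xs; have us := simple_uniq ss; have s1 := simple_size1 ss.
have [a [b [ax xb]]] := vertex_arcs ss xs.
have [no0 _ _ ab] := arcs_turn ss ax xb.
rewrite (left_arcs us s1 ax xb).
have cone (a' b' : plane R) (w w' : R) :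
    orient a x (x + w *: (a' - x) + w' *: (b' - x)) =
    w * orient a x a' + w' * orient a x b'.
  by rewrite /orient !pE; ring.
have cone' (a' b' : plane R) (w w' : R) :
    orient x b (x + w *: (a' - x) + w' *: (b' - x)) =
    w * orient x b a' + w' * orient x b b'.
  by rewrite /orient !pE; ring.
split.
  move=> [a' [b' [e [ab' ea eb e0 H]]]].
  have Na := edges_nbr ss ax xb ea; have Nb := edges_nbr ss ax xb eb.
  have sumE (w : R) : x + w *: (a' - x) + w *: (b' - x) = x + w *: (a + b - x - x).
    by case: Na Nb ab' => -> [] ->; rewrite ?eqxx //= => _; apply: plane_eq; rewrite !pE; ring.
  rewrite lt_neqAle eq_sym no0 leNgt; apply/negP => on.
  have d1 : orient a x (x + (a + b - x - x)) = orient a x b by rewrite /orient !pE; ring.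
  have d2 : orient x b (x + (a + b - x - x)) = orient a x b by rewrite /orient !pE; ring.
  have [e' e'0 He'] := near_wedge_ray ss cs ax xb (d := a + b - x - x)
    ltac:(by rewrite d1) ltac:(by rewrite d2).
  pose w := Num.min e e' / 2.
  have m0 : 0 < Num.min e e' by rewrite lt_min e0.
  have w0 : 0 < w by apply: divr_gt0.
  have wm : w < Num.min e e' by rewrite /w; lra.
  have we : w < e by apply: lt_le_trans wm _; rewrite ge_min lexx.
  have we' : w < e' by apply: lt_le_trans wm _; rewrite ge_min lexx orbT.
  have := H w w; rewrite w0 we => /(_ isT isT); rewrite sumE => /(inside_edges _ ss cs)[_].
  have [|_ ->] := He' w; first by rewrite w0.
  by rewrite /wedge d1 d2 (lt_gtF on).
move=> op; exists a, b.
have N1 := near_wedge ss cs ax xb.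
have [n [t E]] := rot_arcs2 ss ax xb.
have := simple_rot n ss; rewrite E => /near_vertex[k N2].
have N : \forall z \near x, (0 < orient a x z -> 0 < orient x b z -> ~ bd s z) /\
     (~ bd s z -> wind s z = Posz (wedge a x b z)).
  near=> z; split; near: z; last exact: N1.
  apply: filterS N2 => z [/(_ op) H _ _]; rewrite -(bd_perm (arcs_rot n s)) E.
  by move=> h1 h2 /H; apply; left.
have /nearP[e e0 He] := N.
pose M := 1 + `|(a - x).1| + `|(a - x).2| + `|(b - x).1| + `|(b - x).2|.
have := normr_ge0 (a - x).1; have := normr_ge0 (a - x).2.
have := normr_ge0 (b - x).1; have := normr_ge0 (b - x).2 => n1 n2 n3 n4.
have M0 : 0 < M by rewrite /M; lra.
have Mb (w w' A B : R) : 0 < w < e / M -> 0 < w' < e / M -> `|A| + `|B| <= M ->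
    `|w * A + w' * B| < e.
  move=> /andP[w0 we] /andP[w'0 we'] AB.
  pose W := Num.max w w'.
  have W1 : w <= W by rewrite le_max lexx.
  have W2 : w' <= W by rewrite le_max lexx orbT.
  have We : W * M < e by rewrite -ltr_pdivlMr // gt_max we.
  have t1 : `|w * A| <= W * `|A| by rewrite normrM (ger0_norm (ltW w0)) ler_wpM2r.
  have t2 : `|w' * B| <= W * `|B| by rewrite normrM (ger0_norm (ltW w'0)) ler_wpM2r.
  have t3 : W * (`|A| + `|B|) <= W * M.
    by rewrite ler_wpM2l // (le_trans _ W1) // ltW.
  have := ler_normD (w * A) (w' * B); rewrite mulrDr in t3; lra.
exists (e / M); split=> //.
- by apply/(mem_edges _ us s1); exists (a, x); rewrite //= fset2C.
- by apply/(mem_edges _ us s1); exists (x, b).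
- exact: divr_gt0.
move=> w w' wE w'E.
have [] : _ /\ _ := He (x + w *: (a - x) + w' *: (b - x)) _.
  split; rewrite ?pD1 ?pD2 ?pZ1 ?pZ2.
    have -> : x.1 + w * (a - x).1 + w' * (b - x).1 - x.1 = w * (a - x).1 + w' * (b - x).1 by ring.
    by apply: Mb => //; rewrite /M; lra.
  have -> : x.2 + w * (a - x).2 + w' * (b - x).2 - x.2 = w * (a - x).2 + w' * (b - x).2 by ring.
  by apply: Mb => //; rewrite /M; lra.
rewrite cone cone' orientxyx orientxyy mulr0 add0r mulr0 addr0 -(orientC a x b).
move: wE w'E => /andP[w0 _] /andP[w'0 _].
have p1 : 0 < w' * orient a x b by exact: mulr_gt0.
have p2 : 0 < w * orient a x b by exact: mulr_gt0.
move=> /(_ p1 p2) nb /(_ nb) wE; apply/(inside_edges _ ss cs); split=> //.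
rewrite wE /wedge op cone cone' orientxyx orientxyy mulr0 add0r mulr0 addr0 -(orientC a x b).
by rewrite p1 p2.
Unshelve. all: by end_near. Qed.

(** A pseudo-triangle, given by its vertices in counterclockwise order. *)
Definition psi s : Prop := [/\ simple s, ccw s & count (left s) s = 3%N].

Lemma psi_rot n s : psi s -> psi (rot n s).
Proof.
move=> [ss cs ls]; have us := simple_uniq ss; split; first exact: simple_rot.
  by apply: ccw_perm cs; rewrite perm_sym; exact: arcs_rot.
rewrite (eq_count (a2 := left s)); last by move=> x; exact: left_rot.
by rewrite -ls; apply/permP; rewrite perm_rot.
Qed.

Lemma card_convex s : simple s -> ccw s ->
  #|` [fset x in vertices (edges s) | `[< convex_vertex (edges s) x >]]%fset| =
  count (left s) s.
Proof.
move=> ss cs; have us := simple_uniq ss; have s1 := simple_size1 ss.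
rewrite -size_filter; apply/perm_size/uniq_perm; rewrite ?fset_uniq ?filter_uniq //.
move=> x; rewrite mem_filter !inE /= vertices_edges // andbC.
case xs: (x \in s); rewrite ?andbF //= !andbT.
by apply/asboolP/idP => /(convex_vertexP ss cs xs).
Qed.

Lemma pseudo_triangle_edges s : psi s -> pseudo_triangle (edges s).
Proof.
move=> [ss cs ls]; split; last by rewrite card_convex.
have [us s2 gs ds] := ss; have s1 := simple_size1 ss.
split; first by exists s.
move=> e f /(mem_edges _ us s1)[[a b] ab ->] /(mem_edges _ us s1)[[c d] cd ->] /= ne.
rewrite !conv2; apply/seteqP; split=> z /=.
  move=> [h1 h2]; have ne' : (a, b) != (c, d) by apply: contra_neq ne => -[-> ->].
  have [] := ds _ _ ab cd ne' z h1 h2.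
  by rewrite !inE => -> ->.
by rewrite !inE => /andP[/orP[]/eqP-> /orP[]/eqP->]; split; (exact: seg_l || exact: seg_r).
Qed.

Lemma pseudo_triangleP A P : general_position A -> pseudo_triangle P ->
  (vertices P `<=` A)%fset -> exists s, [/\ psi s, P = edges s & {subset s <= A}].
Proof.
move=> gA [[[s0 [s2 us PE]] dP] cP] sub.
have s1 := ltnW s2; have {}PE : P = edges s0 by [].
have sA : {subset s0 <= A}.
  by move=> x xs; apply: (fsubsetP sub); rewrite PE vertices_edges.
have ss0 : simple s0.
  split=> //; first by move=> x y z xs ys zs; apply: gA; exact: sA.
  move=> e f es fs ne z h1 h2.
  have ne' : [fset e.1; e.2]%fset != [fset f.1; f.2]%fset.
    by apply: contra_neq ne => /(arcs_edge_inj us s2 es fs).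
  have eP : [fset e.1; e.2]%fset \in P by rewrite PE; apply/(mem_edges _ us s1); exists e.
  have fP : [fset f.1; f.2]%fset \in P by rewrite PE; apply/(mem_edges _ us s1); exists f.
  have := dP _ _ eP fP ne'; rewrite !conv2 => E.
  have : (seg e.1 e.2 `&` seg f.1 f.2) z by [].
  by rewrite E /= !inE => /andP[].
have [s [ss cs us' se sE]] := ccw_or_rev ss0.
have PE' : P = edges s by case: sE => ->; rewrite ?edges_rev.
exists s; split=> //; last by move=> x; rewrite se; exact: sA.
by split=> //; rewrite -card_convex // -PE'.
Qed.

Lemma reflex_edges s x : psi s -> reflex_vertex (edges s) x <-> (x \in s /\ ~~ left s x).
Proof.
move=> [ss cs ls]; have us := simple_uniq ss; have s1 := simple_size1 ss.
rewrite /reflex_vertex vertices_edges //; split=> -[xs h]; split=> //.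
  by apply/negP => /(convex_vertexP ss cs xs).
by move=> /(convex_vertexP ss cs xs); exact/negP.
Qed.

Definition onorm a b : plane R := (a.2 - b.2, b.1 - a.1).

Lemma orient_dot a b z : orient a b z = dot (onorm a b) z - dot (onorm a b) a.
Proof. by rewrite /orient /dot /=; ring. Qed.

(** The vertices beyond the line include an extreme one, which is convex. *)
Lemma extreme_left s w (c : R) v0 : simple s -> ccw s -> v0 \in s -> c < dot w v0 ->
  exists h, [/\ h \in s, c < dot w h & left s h].
Proof.
move=> ss cs v0s cv; have [h [u [hs ch ext]]] := extreme_exists v0s cv.
exists h; split=> //; have us := simple_uniq ss.
have [_ s2 _ _] := ss; have [n [a [b [t E]]]] := rot_vertex s2 hs.
have pr := arcs_rot n s; rewrite perm_sym in pr.
have := simple_rot n ss; have := ccw_perm pr cs; rewrite E => cs' ss'.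
rewrite -(left_rot n) // E left_mid ?(simple_uniq ss') //.
apply/(extreme_ccw ss' (u := u)) => //.
by move=> v; rewrite -E mem_rot; exact: ext.
Qed.

Lemma extreme_left_orient s a b v0 : simple s -> ccw s -> v0 \in s -> 0 < orient a b v0 ->
  exists h, [/\ h \in s, 0 < orient a b h & left s h].
Proof.
move=> ss cs vs; rewrite orient_dot subr_gt0 => /(extreme_left ss cs vs)[h [hs hc hl]].
by exists h; rewrite orient_dot subr_gt0.
Qed.

(** The direction of traversal can be read off at a single extreme vertex. *)
Lemma ccw_transfer s a h b u : simple s -> (a, h) \in arcs s -> (h, b) \in arcs s ->
  {in s, forall v, v != h -> dot u v < dot u h} ->
  ccw s <-> 0 < orient a h b.
Proof.
move=> ss ah hb ext; have [n [t E]] := rot_arcs2 ss ah hb.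
have := simple_rot n ss; rewrite E => ss'.
have pr := arcs_rot n s.
have ext' : {in [:: a, h, b & t], forall v, v != h -> dot u v < dot u h}.
  by move=> v; rewrite -E mem_rot; exact: ext.
rewrite -(extreme_ccw ss' ext') -E; split; apply: ccw_perm => //.
by rewrite perm_sym.
Qed.

End PseudoTriangles.

(** * Convex hulls of finite sets *)

Section ConvexHull.
Local Open Scope fset_scope.
Local Open Scope classical_set_scope.
Local Open Scope ring_scope.
Context {R : realType}.
Implicit Types (x y z a b c d h m v u p q w : plane R) (s t : seq (plane R)).
Implicit Types (A : {fset plane R}).

Lemma big_delta (V : nmodType) A x (F : plane R -> V) : x \in A ->
  \sum_(a <- A) (if a == x then F a else 0) = F x.
Proof.
move=> xA; rewrite (bigD1_seq x) ?fset_uniq //= eqxx big1 ?addr0 //.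
by move=> a /negbTE ->.
Qed.

Lemma dotD w x y : dot w (x + y) = dot w x + dot w y.
Proof. by rewrite /dot !pE; ring. Qed.

Lemma dotZ w (k : R) x : dot w (k *: x) = k * dot w x.
Proof. by rewrite /dot !pE; ring. Qed.

Lemma dot0 w : dot w 0 = 0.
Proof. by rewrite /dot /= !mulr0 addr0. Qed.

Lemma conv_ge A w (c : R) z : (forall a, a \in A -> c <= dot w a) -> conv A z -> c <= dot w z.
Proof.
move=> H [f [f0 f1 ->]]; rewrite (big_morph _ (dotD w) (dot0 w)).
rewrite -[c]mul1r -f1 mulr_suml big_seq [leRHS]big_seq; apply: ler_sum => a aA.
by rewrite dotZ ler_wpM2l ?f0 ?H.
Qed.

Lemma conv_neq0 A z : conv A z -> exists a, a \in A.
Proof.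
move=> [f [_ f1 _]]; apply: contrapT => N; move: f1.
rewrite big_seq big1 => [/esym/eqP|a aA]; first by rewrite oner_eq0.
by case: N; exists a.
Qed.

Lemma conv_gt A w (c : R) z : (forall a, a \in A -> c < dot w a) -> conv A z -> c < dot w z.
Proof.
move=> H cz; have [a0 a0A] := conv_neq0 cz.
have [h hA Hh] := seq_argmax (fun a => - dot w a) a0A.
apply: lt_le_trans (H h hA) _; apply: conv_ge cz => a /Hh.
by rewrite lerN2.
Qed.

Lemma conv_orient_ge0 A a b z : (forall v, v \in A -> 0 <= orient a b v) ->
  conv A z -> 0 <= orient a b z.
Proof.
move=> H; rewrite orient_dot subr_ge0; apply: conv_ge => v /H.
by rewrite orient_dot subr_ge0.
Qed.

Lemma conv_pt A a : a \in A -> conv A a.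
Proof.
move=> aA; exists (fun x => if x == a then 1 else 0); split.
- by move=> x _; case: ifP.
- by rewrite (big_delta (fun=> 1)).
rewrite -[LHS](big_delta id aA); apply: eq_bigr => x _.
by case: ifP; rewrite ?scale1r ?scale0r.
Qed.

Lemma conv_cvx A x y z : conv A x -> conv A y -> seg x y z -> conv A z.
Proof.
move=> [f [f0 f1 ->]] [g [g0 g1 ->]] [t [t0 t1 ->]].
exists (fun a => (1 - t) * f a + t * g a); split.
- by move=> a aA; rewrite addr_ge0 // mulr_ge0 ?subr_ge0 ?f0 ?g0.
- by rewrite big_split /= -!mulr_sumr f1 g1 !mulr1 subrK.
rewrite [RHS](eq_bigr (fun a => (1 - t) *: (f a *: a) + t *: (g a *: a))); last first.
  by move=> a _; apply: plane_eq; rewrite !pE; ring.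
rewrite big_split /= -!scaler_sumr.
by apply: plane_eq; rewrite !pE; ring.
Qed.

Lemma conv_seg A x y z : x \in A -> y \in A -> seg x y z -> conv A z.
Proof. by move=> xA yA; apply: conv_cvx; exact: conv_pt. Qed.

Lemma conv_tri A x y u z : x \in A -> y \in A -> u \in A -> 0 < orient x y u ->
  0 <= orient x y z -> 0 <= orient y u z -> 0 <= orient u x z -> conv A z.
Proof.
move=> xA yA uA o0 oxy oyu oux.
have on0 : orient x y u != 0 by rewrite gt_eqF.
have fr := frame z on0.
set al := orient y u z / orient x y u in fr; set be := orient x y z / orient x y u in fr.
have al0 : 0 <= al by rewrite divr_ge0 // ltW.
have be0 : 0 <= be by rewrite divr_ge0 // ltW.
have sumE : al + be + orient u x z / orient x y u = 1.
  rewrite /al /be -!mulrDl; apply/(mulIf on0); rewrite divfK // mul1r /orient; ring.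
have ga0 : 0 <= orient u x z / orient x y u by rewrite divr_ge0 // ltW.
have [be1|be1] := eqVneq be 1.
  have al0' : al = 0 by lra.
  have -> : z = u by rewrite fr be1 al0' scale0r scale1r addr0 addrC subrK.
  exact: conv_pt.
have be1' : be < 1 by rewrite lt_neqAle be1 /=; lra.
have b1 : 1 - be != 0 by rewrite subr_eq0 eq_sym.
have cp : conv A (y + (al / (1 - be)) *: (x - y)).
  apply: (conv_seg yA xA); exists (al / (1 - be)); split=> //.
    by rewrite divr_ge0 // subr_ge0 ltW.
  by rewrite ler_pdivrMr ?subr_gt0 // mul1r; lra.
apply: (conv_cvx cp (conv_pt uA)); exists be; split=> //; first exact: ltW.
by rewrite fr; apply: plane_eq; rewrite !pE; field.
Qed.

(** The arc from x to y is an edge of the convex hull of A, counterclockwise. *)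
Definition hull A x y : bool := [&& x \in A, y \in A, x != y &
  all (fun z => [|| z == x, z == y | 0 < orient x y z]) A].

Lemma hullP A x y : reflect [/\ x \in A, y \in A, x != y & forall z, z \in A ->
   z != x -> z != y -> 0 < orient x y z] (hull A x y).
Proof.
apply: (iffP and4P) => -[xA yA xy H]; split=> //.
  by move=> z zA zx zy; have := allP H z zA; rewrite (negbTE zx) (negbTE zy).
apply/allP => z zA; have [//|zx] := eqVneq z x; have [//|zy] := eqVneq z y.
exact: H.
Qed.

Lemma hull_ge0 A x y z : hull A x y -> z \in A -> 0 <= orient x y z.
Proof.
move=> /hullP[_ _ _ H] zA; have [->|zx] := eqVneq z x; first by rewrite orientxyx.
have [->|zy] := eqVneq z y; first by rewrite orientxyy.
by rewrite ltW ?H.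
Qed.

Lemma hull_conv_ge0 A x y z : hull A x y -> conv A z -> 0 <= orient x y z.
Proof. by move=> hxy; apply: conv_orient_ge0 => v; exact: hull_ge0. Qed.

Lemma onorm_gt0 x y : x != y -> 0 < dot (onorm x y) (onorm x y).
Proof.
move=> xy; rewrite /dot lt_neqAle addr_ge0 -?expr2 ?sqr_ge0 // andbT eq_sym.
rewrite paddr_eq0 ?sqr_ge0 // !sqrf_eq0 /= !subr_eq0.
by apply: contra xy => /andP[/eqP h1 /eqP h2]; apply/eqP; apply: plane_eq.
Qed.

Lemma orient_onorm x y z (k : R) :
  orient x y (z + k *: onorm x y) = orient x y z + k * dot (onorm x y) (onorm x y).
Proof. by rewrite /orient /dot !pE /=; ring. Qed.

(** Just outside the edge there is no point of the hull. *)
Lemma hull_not_interior A x y : hull A x y -> ~ interior (conv A) x /\ ~ interior (conv A) y.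
Proof.
move=> hxy; have xy : x != y by case/hullP: hxy.
have n0 := onorm_gt0 xy.
have main z : orient x y z = 0 -> ~ interior (conv A) z.
  move=> oz H; have [e e0 He] := near_ray (onorm x y) H.
  have /hull_conv_ge0 : conv A (z + (- (e / 2)) *: onorm x y).
    by apply: He; rewrite normrN ger0_norm; lra.
  move=> /(_ _ _ hxy); rewrite orient_onorm oz add0r mulNr oppr_ge0 leNgt.
  by rewrite mulr_gt0 //; lra.
by split; apply: main; rewrite ?orientxyx ?orientxyy.
Qed.

Lemma interior_triangle A x y u z : x \in A -> y \in A -> u \in A -> 0 < orient x y u ->
  0 < orient x y z -> 0 < orient y u z -> 0 < orient u x z -> interior (conv A) z.
Proof.
move=> xA yA uA o0 h1 h2 h3; rewrite /interior /=.
have N : \forall v \near z, 0 < orient x y v /\ (0 < orient y u v /\ 0 < orient u x v).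
  near=> v; split; [|split]; near: v; exact: near_orient_gt0.
apply: filterS N => v [g1 [g2 g3]].
by apply: (conv_tri xA yA uA) => //; exact: ltW.
Unshelve. all: by end_near. Qed.

Lemma fset3_third A x y : (2 < #|` A|)%N -> exists u, [/\ u \in A, u != x & u != y].
Proof.
move=> A2; apply: contrapT => N.
have sub : (A `<=` [fset x; y])%fset.
  apply/fsubsetP => z zA; rewrite !inE; apply: contrapT => /negP.
  by rewrite negb_or => /andP[zx zy]; apply: N; exists z.
have := fsubset_leq_card sub; rewrite cardfs2 => h.
by move: (leq_trans A2 h); case: (x != y).
Qed.

(** Rotating clockwise from an arbitrary direction, the first point z after
    turning less than pi must have some point behind it, and three points around
    x form a triangle containing x. *)
Lemma interior_of_nohull A x : general_position A -> (2 < #|` A|)%N -> x \in A ->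
  (forall y, ~ hull A x y) -> interior (conv A) x.
Proof.
move=> gA A2 xA H.
have right y : y \in A -> y != x -> exists z, [/\ z \in A, z != x, z != y & orient x y z < 0].
  move=> yA yx; apply: contrapT => N; apply: (H y); apply/hullP; split=> //.
    by rewrite eq_sym.
  move=> z zA zx zy; have : orient x y z != 0 by apply: gA; rewrite // eq_sym.
  case: (ltgtP (orient x y z) 0) => // l _; case: N; by exists z.
have [y [yA yx _]] := fset3_third x x A2.
have [z0 [z0A z0x z0y z0r]] := right y yA yx.
pose dy v := dot (y - x) (v - x); pose ny v := orient x v y.
pose S := [seq v <- A | 0 < ny v].
have SP v : v \in S = (v \in A) && (0 < ny v) by rewrite mem_filter andbC.
have nyE v : ny v = - orient x y v by rewrite /ny /orient; ring.
have z0S : z0 \in S by rewrite SP z0A nyE oppr_gt0.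
have [z zS Hz] := seq_argmax (fun v => - (dy v / ny v)) z0S.
move: zS; rewrite SP => /andP[zA nz].
have zx : z != x by apply: contraTneq nz => ->; rewrite /ny orientxx ltxx.
have [u [uA ux uz uo]] := right z zA zx.
have yx2 : 0 < dot (y - x) (y - x).
  rewrite /dot lt_neqAle addr_ge0 -?expr2 ?sqr_ge0 // andbT eq_sym paddr_eq0 ?sqr_ge0 //.
  rewrite !sqrf_eq0 !pE !subr_eq0; apply: contra yx => /andP[/eqP h1 /eqP h2].
  by apply/eqP; apply: plane_eq.
have uy : u != y.
  apply: contraTneq uo => E; rewrite -leNgt E; exact: ltW.
have uL : 0 < orient x y u.
  have : orient x y u != 0 by apply: gA; rewrite // eq_sym.
  case: (ltgtP (orient x y u) 0) => // l _.
  have uS : u \in S by rewrite SP uA nyE oppr_gt0.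
  have nu : 0 < ny u by rewrite nyE oppr_gt0.
  have := Hz _ uS; rewrite lerN2 ler_pdivrMr // mulrAC ler_pdivlMr //.
  have -> : dy z * ny u = dy u * ny z - orient x z u * dot (y - x) (y - x).
    by rewrite /dy /ny /orient /dot !pE; ring.
  have : orient x z u * dot (y - x) (y - x) < 0 by rewrite nmulr_rlt0.
  by move=> l1 l2; exfalso; lra.
have h1 : orient u z x = - orient x z u by rewrite /orient; ring.
apply: (@interior_triangle A y u z x) => //; last 3 first.
- by rewrite -orientC.
- by rewrite h1 oppr_gt0.
- by rewrite -orientC.
have -> : orient y u z = orient x z y + orient x y u - orient x z u by rewrite /orient; ring.
by rewrite /ny in nz; lra.
Qed.

Lemma interior_pointsP A x : general_position A -> (2 < #|` A|)%N ->
  x \in interior_points A <-> (x \in A /\ forall y, ~ hull A x y).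
Proof.
move=> gA A2; rewrite !inE /=; split.
  move=> /andP[xA /asboolP ix]; split=> // y /hull_not_interior[]; by [].
by move=> [xA H]; rewrite xA; apply/asboolP; exact: interior_of_nohull.
Qed.

End ConvexHull.

(** * Generic points and the chain of a family of polygons *)

Section Chains.
Local Open Scope fset_scope.
Local Open Scope classical_set_scope.
Local Open Scope ring_scope.
Context {R : realType}.
Implicit Types (x y z a b c d h m v u p q w : plane R) (s : seq (plane R)).
Implicit Types (A : {fset plane R}) (P Q : polygon R) (T : {fset polygon R}).

(** Finitely many conditions, each excluding at most one parameter. *)
Lemma avoid (I : eqType) (S : seq I) (B : I -> R -> Prop) (lo hi : R) : lo < hi ->
  (forall i, i \in S -> forall t t' : R, B i t -> B i t' -> t = t') ->
  exists2 t : R, lo < t < hi & forall i, i \in S -> ~ B i t.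
Proof.
move=> lohi H.
suff [lo' [hi' [l1 l2 l3 K]]] : exists lo' hi', [/\ lo <= lo', hi' <= hi, lo' < hi' &
    forall i (t : R), i \in S -> lo' < t < hi' -> ~ B i t].
  exists ((lo' + hi') / 2); first by apply/andP; split; lra.
  by move=> i iS; apply: K => //; apply/andP; split; lra.
elim: S H => [|i S IH] H; first by exists lo, hi; split.
have [lo' [hi' [l1 l2 l3 K]]] : exists lo' hi', [/\ lo <= lo', hi' <= hi, lo' < hi' &
    forall i (t : R), i \in S -> lo' < t < hi' -> ~ B i t].
  by apply: IH => j jS; apply: H; rewrite inE jS orbT.
have [[t [/andP[t1 t2] Bt]]|N] := pselect (exists t, lo' < t < hi' /\ B i t).
  exists lo', t; split=> //; first by lra.
  move=> j t' ; rewrite inE => /orP[/eqP->|jS] /andP[t1' t2'].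
    by move=> Bt'; have := H i (mem_head _ _) _ _ Bt Bt'; lra.
  by apply: K => //; apply/andP; split; lra.
exists lo', hi'; split=> // j t; rewrite inE => /orP[/eqP->|jS] tt'; last exact: K.
by move=> Bt; apply: N; exists t.
Qed.

Definition pairs A : seq (plane R * plane R) := [seq (x, y) | x <- A, y <- A].

Lemma mem_pairs A x y : ((x, y) \in pairs A) = (x \in A) && (y \in A).
Proof.
apply/allpairsP/andP => [[[a b] [/= aA bA [-> ->]]] //|[xA yA]].
by exists (x, y).
Qed.

Definition generic A z : Prop :=
  (forall u v, u \in A -> v \in A -> u != v -> orient u v z != 0) /\
  (forall u, u \in A -> u.1 != z.1).

(** A short step from z in a direction that is parallel to none of the lines
    spanned by A; the slope and the length are chosen by [avoid]. *)
Lemma generic_near A z (B : set (plane R)) : (\forall y \near z, B y) ->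
  exists2 y, B y & generic A y.
Proof.
move=> nB.
have [k _ Hk] : exists2 k : R, 0 < k < 1 & forall e, e \in pairs A ->
    ~ (e.1 != e.2 /\ (e.2.1 - e.1.1) * k - (e.2.2 - e.1.2) = 0).
  apply: avoid; first exact: ltr01.
  move=> [u v] _ t t' /= [uv E1] [_ E2].
  have [E|ne] := eqVneq v.1 u.1.
    move: E1; rewrite E subrr mul0r sub0r => /eqP; rewrite oppr_eq0 subr_eq0 => /eqP E'.
    by case/eqP: uv; apply: plane_eq.
  have ne' : v.1 - u.1 != 0 by rewrite subr_eq0.
  by apply/(mulfI ne'); lra.
have [e e0 He] := near_ray (1, k) nB.
pose S := [seq (i, j) | i <- pairs A, j <- [:: true; false]].
pose V (i : (plane R * plane R) * bool) (t : R) :=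
  if i.2 then i.1.1 != i.1.2 /\ orient i.1.1 i.1.2 (z + t *: (1, k)) = 0
  else i.1.1.1 = z.1 + t.
have [t /andP[t0 te] Ht] : exists2 t : R, 0 < t < e & forall i, i \in S -> ~ V i t.
  apply: avoid => // -[[u v] []]; rewrite /V /=; last first.
    move=> _ t t' E1 E2; lra.
  move=> /allpairsP[[i j] [/= iA _ [iE _]]] t t' [uv E1] [_ E2].
  have oE (w : R) : orient u v (z + w *: (1, k)) =
      orient u v z + w * ((v.1 - u.1) * k - (v.2 - u.2)).
    by rewrite /orient !pE /=; ring.
  rewrite -iE in iA.
  have ne : (v.1 - u.1) * k - (v.2 - u.2) != 0.
    by apply/eqP => E; apply: (Hk (u, v) iA).
  by apply/(mulIf ne); move: E1 E2; rewrite !oE; lra.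
have mS i (j : bool) : i \in pairs A -> (i, j) \in S.
  by move=> iA; apply/allpairsP; exists (i, j); split=> //; case: j.
exists (z + t *: (1, k)); first by apply: He; rewrite ger0_norm // ltW.
split.
  move=> u v uA vA uv; apply/eqP => E; apply: (Ht ((u, v), true)).
    by apply: mS; rewrite mem_pairs uA.
  by [].
move=> u uA; apply/eqP => E; apply: (Ht ((u, u), false)).
  by apply: mS; rewrite mem_pairs uA.
by rewrite /V /= E pD1 pZ1 mulr1.
Qed.

Lemma generic_seg A z u v : generic A z -> u \in A -> v \in A -> ~ seg u v z.
Proof.
move=> [H1 H2] uA vA hz; have [E|uv] := eqVneq u v.
  move: hz; rewrite E => -[t [_ _]]; rewrite subrr scaler0 addr0 => zE.
  by have := H2 v vA; rewrite zE eqxx.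
case: hz => t [_ _ E]; have := H1 u v uA vA uv.
by rewrite E orient_cvx orientxyx orientxyy !mulr0 addr0 eqxx.
Qed.

Lemma generic_bd A z s : generic A z -> {subset s <= A} -> ~ bd s z.
Proof. by move=> gz sA [e /arcs_mem[h1 h2]]; apply: generic_seg; eauto. Qed.

(** Every other segment spanned by A meets xy in at most one point. *)
Lemma generic_on A x y : general_position A -> x \in A -> y \in A -> x != y ->
  exists t0 : R, [/\ 0 < t0, t0 < 1 & forall u v, u \in A -> v \in A ->
    [fset u; v]%fset != [fset x; y]%fset -> ~ seg u v (x + t0 *: (y - x))].
Proof.
move=> gA xA yA xy.
have [t /andP[t0 t1] Ht] : exists2 t : R, 0 < t < 1 & forall e, e \in pairs A ->
    ~ ([fset e.1; e.2]%fset != [fset x; y]%fset /\ seg e.1 e.2 (x + t *: (y - x))).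
  apply: avoid; first exact: ltr01.
  move=> [u v]; rewrite mem_pairs => /andP[uA vA] t t' /= [ne h1] [_ h2].
  have inj : x + t *: (y - x) = x + t' *: (y - x) -> t = t'.
    move=> /addrI /eqP; rewrite -subr_eq0 -scalerBl scaler_eq0 !subr_eq0.
    by rewrite (eq_sym y) (negbTE xy) orbF => /eqP.
  have [E|uv] := eqVneq u v.
    apply: inj; move: h1 h2; rewrite E => -[k [_ _]]; rewrite subrr scaler0 addr0 => ->.
    by move=> [k' [_ _ ->]]; rewrite subrr scaler0 addr0.
  have lin k : seg u v (x + k *: (y - x)) -> (1 - k) * orient u v x + k * orient u v y = 0.
    by move=> [k' [_ _ E]]; rewrite -orient_cvx E orient_cvx orientxyx orientxyy !mulr0 addr0.
  have E1 := lin _ h1; have E2 := lin _ h2.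
  have [E|oxy] := eqVneq (orient u v x) (orient u v y); last first.
    have ne' : orient u v y - orient u v x != 0 by rewrite subr_eq0 eq_sym.
    by apply/(mulIf ne'); lra.
  have oy : orient u v y = 0 by rewrite E in E1; lra.
  have ox : orient u v x = 0 by rewrite E.
  have mem p : p \in A -> orient u v p = 0 -> p = u \/ p = v.
    move=> pA op; apply: contrapT => /not_orP[/eqP pu /eqP pv].
    have : orient u v p != 0 by apply: gA; rewrite // eq_sym.
    by rewrite op eqxx.
  exfalso; case/negP: ne; apply/eqP.
  case: (mem x xA ox) (mem y yA oy) xy => -> [] ->; rewrite ?eqxx // => _.
  by rewrite fset2C.
exists t; split=> // u v uA vA ne hz; apply: (Ht (u, v)); first by rewrite mem_pairs uA.
by split.
Qed.

(** The counterclockwise traversal of a polygon that is known by its edges only. *)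
Definition arcP P x y : bool :=
  `[< exists s, [/\ psi s, P = edges s & (x, y) \in arcs s] >].

Definition ins P z : int := Posz `[< inside P z >].

Lemma ins_wind s z : psi s -> ~ bd s z -> ins (edges s) z = wind s z.
Proof.
move=> [ss cs _] nz; rewrite /ins; have [H _] := ccw_values ss cs.
case: asboolP => [/(inside_edges _ ss cs)[_ ->]//|N].
by case: (H z nz) => // E; case: N; apply/(inside_edges _ ss cs).
Qed.

(** Traversals in opposite directions would put the inside on both sides of an
    edge. *)
Lemma arcP_edges s x y : psi s -> arcP (edges s) x y = ((x, y) \in arcs s).
Proof.
move=> ps; have [ss cs _] := ps; have us := simple_uniq ss; have s1 := simple_size1 ss.
apply/asboolP/idP => [[s' [ps' E xy]]|h]; last by exists s.
have [ss' cs' _] := ps'; have us' := simple_uniq ss'; have s1' := simple_size1 ss'.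
have : [fset x; y]%fset \in edges s by rewrite E; apply/mem_edges => //; exists (x, y).
move=> /(mem_edges _ us s1)[[a b] ab /fset2_eq[/=[-> ->]//|/=[xE yE]]].
rewrite -xE -yE in ab; exfalso.
have bdE : bd s = bd s' by rewrite -!boundary_edges // E.
have wE z : ~ bd s z -> wind s z = wind s' z.
  by move=> nz; rewrite -ins_wind // E ins_wind // -bdE.
have half0 : 0 < 1 / 2 :> R by lra.
have half1 : 1 / 2 < 1 :> R by lra.
have E2 : x + (1 / 2) *: (y - x) = y + (1 / 2) *: (x - y).
  by apply: plane_eq; rewrite !pE; field.
have xy' : x != y by apply: contraTneq ab => ->; rewrite arcs_next // ?E;
  apply/negP => /andP[h1 /eqP h2]; have [n [t Et]] := rot_head h1; have := us;
  move: h2; rewrite -(next_rot n us) -(rot_uniq n) Et; case: t Et => [Et|v t _] /=;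
  [by move: s1; rewrite -(size_rot n) Et|rewrite eqxx => <-; rewrite inE eqxx].
have N1 := near_arc ss' cs' xy half0 half1 erefl.
have N2 := near_arc ss cs ab half0 half1 E2.
have N : \forall z \near x + (1 / 2) *: (y - x),
    ((bd s' z <-> orient x y z = 0) /\ (~ bd s' z -> wind s' z = Posz (0 < orient x y z)%R))
    /\ ((bd s z <-> orient y x z = 0) /\ (~ bd s z -> wind s z = Posz (0 < orient y x z)%R)).
  by near=> z; split; near: z.
have [e e0 He] := near_ray (onorm x y) N.
have e2 : `|e / 2| < e by rewrite ger0_norm; lra.
have [[H1 H2] [H3 H4]] := He _ e2.
have n0 := onorm_gt0 xy'.
have oz : 0 < orient x y (x + (1 / 2) *: (y - x) + (e / 2) *: onorm x y).
  rewrite orient_onorm orient_cvx orientxyx orientxyy !mulr0 !add0r mulr_gt0 //; lra.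
have nb' : ~ bd s' (x + (1 / 2) *: (y - x) + (e / 2) *: onorm x y).
  by rewrite H1; apply/eqP; rewrite gt_eqF.
have nb : ~ bd s (x + (1 / 2) *: (y - x) + (e / 2) *: onorm x y) by rewrite bdE.
have := wE _ nb; rewrite (H2 nb') (H4 nb) oz orientN oppr_gt0 lt_gtF //.
Unshelve. all: by end_near. Qed.

Definition chi P x y : int := Posz (arcP P x y) - Posz (arcP P y x).

Definition chull A x y : int := Posz (hull A x y) - Posz (hull A y x).

(** The boundaries of the polygons add up, as 1-chains, to that of the hull. *)
Definition chain A T : Prop := forall x y, \sum_(P <- T) chi P x y = chull A x y.

Definition psi_family A T : Prop := forall P, P \in T ->
  exists s, [/\ psi s, P = edges s & {subset s <= A}].

Lemma pairs_uniq A : uniq (pairs A).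
Proof.
apply: allpairs_uniq; rewrite ?fset_uniq //.
by move=> [? ?] [? ?] _ _ /= [-> ->].
Qed.

Lemma wind_pairs A s z : psi s -> {subset s <= A} ->
  wind s z = \sum_(e <- pairs A) Posz (arcP (edges s) e.1 e.2) * kap e.1 e.2 z.
Proof.
move=> ps sA; have [ss _ _] := ps.
have pE : perm_eq (arcs s) [seq e <- pairs A | arcP (edges s) e.1 e.2].
  apply: uniq_perm; rewrite ?filter_uniq ?pairs_uniq ?arcs_uniq ?(simple_uniq ss) //.
  move=> [x y]; rewrite mem_filter mem_pairs arcP_edges //=.
  by case xy: ((x, y) \in arcs s) => //=; have [/= /sA -> /sA ->] := arcs_mem xy.
rewrite /wind (perm_big _ pE) big_filter big_mkcond /=.
apply: eq_bigr => e _; case: ifP => _; by rewrite ?mul1r ?mul0r.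
Qed.

Lemma sum_swap A (F : plane R -> plane R -> int) :
  \sum_(e <- pairs A) F e.1 e.2 = \sum_(e <- pairs A) F e.2 e.1.
Proof. by rewrite !big_allpairs exchange_big. Qed.

(** Since [kap] is antisymmetric, only differences of opposite arcs matter. *)
Lemma sum_antisym A (f : plane R -> plane R -> int) z :
  \sum_(e <- pairs A) (f e.1 e.2 - f e.2 e.1) * kap e.1 e.2 z =
  2 * \sum_(e <- pairs A) f e.1 e.2 * kap e.1 e.2 z.
Proof.
rewrite (eq_bigr (fun e => f e.1 e.2 * kap e.1 e.2 z + f e.2 e.1 * kap e.2 e.1 z)); last first.
  by move=> e _; rewrite (kapC e.1 e.2); ring.
rewrite big_split /= -(sum_swap A (fun x y => f x y * kap x y z)).
by rewrite mulr2n mulrDl mul1r.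
Qed.

(** The winding number around z is linear in the chain. *)
Lemma chain_wind A T z : psi_family A T -> chain A T -> generic A z ->
  \sum_(P <- T) ins P z = \sum_(e <- pairs A) Posz (hull A e.1 e.2) * kap e.1 e.2 z.
Proof.
move=> fT cT gz.
have E : \sum_(P <- T) ins P z =
    \sum_(P <- T) \sum_(e <- pairs A) Posz (arcP P e.1 e.2) * kap e.1 e.2 z.
  rewrite big_seq [RHS]big_seq; apply: eq_bigr => P /fT[s [ps -> sA]].
  by rewrite (ins_wind ps (generic_bd gz sA)); exact: wind_pairs.
have two : (2 : int) != 0 by [].
apply/(mulfI two); rewrite -(sum_antisym A (fun x y => Posz (hull A x y))).
rewrite E mulr_sumr (eq_bigr (fun P => \sum_(e <- pairs A) chi P e.1 e.2 * kap e.1 e.2 z));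
  last by move=> P _; rewrite -(sum_antisym A (fun x y => Posz (arcP P x y))).
rewrite exchange_big /=; apply: eq_bigr => e _.
by rewrite -mulr_suml cT.
Qed.

(** The hull polygon has exactly one upper edge above a generic point of its
    interior: the highest segment there. *)
Lemma hull_count A z : general_position A -> conv A z -> generic A z ->
  \sum_(e <- pairs A) Posz (hull A e.1 e.2) * kap e.1 e.2 z = 1.
Proof.
move=> gA cz [g1 g2].
have [y0 y0A y0z] : exists2 y, y \in A & y.1 < z.1.
  apply: contrapT => N.
  have : dot (1, 0) z < dot (1, 0) z; last by rewrite ltxx.
  apply: conv_gt cz => a aA; rewrite /dot /= !mul1r !mul0r !addr0 lt_neqAle eq_sym g2 //.
  by rewrite leNgt; apply/negP => l; apply: N; exists a.
have [x0 x0A x0z] : exists2 x, x \in A & z.1 < x.1.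
  apply: contrapT => N.
  have : dot (-1, 0) z < dot (-1, 0) z; last by rewrite ltxx.
  apply: conv_gt cz => a aA; rewrite /dot /= !mulN1r !mul0r !addr0 ltrN2 lt_neqAle g2 //.
  by rewrite leNgt; apply/negP => l; apply: N; exists a.
pose up (e : plane R * plane R) := (e.2.1 < z.1) && (z.1 < e.1.1).
pose H (e : plane R * plane R) : R :=
  e.2.2 + (e.1.2 - e.2.2) * (z.1 - e.2.1) / (e.1.1 - e.2.1).
have oH e (k : R) : up e -> orient e.1 e.2 (z.1, k) = (e.2.1 - e.1.1) * (k - H e).
  move=> /andP[l1 l2]; have ne : e.1.1 - e.2.1 != 0 by rewrite subr_eq0 gt_eqF //; lra.
  by rewrite /H /orient /=; field.
have segH e : up e -> seg e.2 e.1 (z.1, H e).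
  move=> /andP[l1 l2]; have p : 0 < e.1.1 - e.2.1 by lra.
  have ne : e.1.1 - e.2.1 != 0 by rewrite gt_eqF.
  exists ((z.1 - e.2.1) / (e.1.1 - e.2.1)); split.
  - by rewrite divr_ge0 //; lra.
  - by rewrite ler_pdivrMr // mul1r; lra.
  by apply: plane_eq; rewrite !pE /= /H; field.
have segHp e : up e -> exists t : R, [/\ 0 < t, t < 1 & (z.1, H e) = e.1 + t *: (e.2 - e.1)].
  move=> /andP[l1 l2]; have p : 0 < e.1.1 - e.2.1 by lra.
  have ne : e.1.1 - e.2.1 != 0 by rewrite gt_eqF.
  exists ((e.1.1 - z.1) / (e.1.1 - e.2.1)); split.
  - by rewrite divr_gt0 //; lra.
  - by rewrite ltr_pdivrMr // mul1r; lra.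
  by apply: plane_eq; rewrite !pE /= /H; field.
have e0S : (x0, y0) \in [seq e <- pairs A | up e].
  by rewrite mem_filter mem_pairs x0A y0A /up /= y0z x0z.
have [[x y] + Hmax] := seq_argmax H e0S.
rewrite mem_filter mem_pairs => /and3P[upe xA yA].
have ltxy : y.1 < x.1 by move: upe => /andP[/=]; exact: lt_trans.
have xy : x != y by apply: contraTneq ltxy => ->; rewrite ltxx.
have better u : u \in A -> u != x -> u != y -> 0 < orient x y u.
  move=> uA ux uy.
  have : orient x y u != 0 by apply: gA; rewrite // eq_sym.
  case: (ltgtP (orient x y u) 0) => // l _; exfalso.
  have [upx upy] := andP upe; simpl in upx, upy.
  have [uz|uz|uz] := ltgtP u.1 z.1; last by move: (g2 u uA); rewrite uz eqxx.
    have upe' : up (x, u) by rewrite /up /= uz.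
    have [t [t0 t1 E]] := segHp _ upe'; simpl in E.
    have := Hmax (x, u); rewrite mem_filter upe' mem_pairs xA uA => /(_ isT).
    have := oH (x, y) (H (x, u)) upe; rewrite E /= orient_cvx orientxyx mulr0 add0r.
    have : t * orient x y u < 0 by rewrite pmulr_rlt0.
    move=> l1 l2; rewrite l2 in l1; rewrite leNgt => /negP; apply.
    by move: l1; rewrite nmulr_rlt0 ?subr_gt0 // subr_lt0.
  have upe' : up (u, y) by rewrite /up /= uz upx.
  have [t [t0 t1 E]] := segHp _ upe'; simpl in E.
  have := Hmax (u, y); rewrite mem_filter upe' mem_pairs uA yA => /(_ isT).
  have := oH (x, y) (H (u, y)) upe; rewrite E /= orient_cvx orientxyy mulr0 addr0.
  have : (1 - t) * orient x y u < 0 by rewrite pmulr_rlt0 // subr_gt0.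
  move=> l1 l2; rewrite l2 in l1; rewrite leNgt => /negP; apply.
  by move: l1; rewrite nmulr_rlt0 ?subr_gt0 // subr_lt0.
have hxy : hull A x y by apply/hullP.
have kapE e : hull A e.1 e.2 -> kap e.1 e.2 z = Posz (up e).
  move=> he; have o1 : 0 < orient e.1 e.2 z.
    rewrite lt_neqAle (hull_conv_ge0 he cz) andbT eq_sym.
    by case/hullP: he => ? ? ? _; apply: g1.
  have [e1A e2A] : e.1 \in A /\ e.2 \in A by case/hullP: he.
  rewrite /kap /up o1 orientN oppr_gt0 (lt_gtF o1).
  have := g2 _ e1A; have := g2 _ e2A.
  by case: (ltgtP e.1.1 z.1) => // h1; case: (ltgtP e.2.1 z.1).
rewrite (bigD1_seq (x, y)) ?pairs_uniq ?mem_pairs ?xA //= hxy mul1r (kapE (x, y)) // upe.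
rewrite big_seq_cond big1 ?addr0 // => -[x' y']; rewrite mem_pairs => /andP[/andP[x'A y'A] ne] /=.
case h' : (hull A x' y'); rewrite ?mul0r // mul1r (kapE (x', y')) //.
case up' : (up (x', y')) => //; exfalso.
have cH e : e.1 \in A -> e.2 \in A -> up e -> conv A (z.1, H e).
  by move=> h1 h2 /segH; exact: conv_seg.
have le1 : H (x, y) <= H (x', y').
  have := hull_conv_ge0 h' (cH (x, y) xA yA upe).
  rewrite (oH (x', y')) //= nmulr_rge0 ?subr_le0 // subr_lt0.
  by move: up' => /andP[/=]; exact: lt_trans.
have le2 : H (x', y') <= H (x, y).
  have := hull_conv_ge0 hxy (cH (x', y') x'A y'A up').
  by rewrite (oH (x, y)) //= nmulr_rge0 ?subr_le0 // subr_lt0.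
have HE : H (x, y) = H (x', y') by apply: le_anti; rewrite le1.
have := oH (x', y') (H (x, y)) up'; rewrite HE subrr mulr0 -HE.
have [t [t0 t1 ->]] := segHp _ upe; rewrite /= orient_cvx => E.
have gx := hull_ge0 h' xA; have gy := hull_ge0 h' yA.
have p1 : 0 <= (1 - t) * orient x' y' x by rewrite mulr_ge0 // subr_ge0 ltW.
have p2 : 0 <= t * orient x' y' y by rewrite mulr_ge0 // ltW.
have oz1 : orient x' y' x = 0.
  have /eqP : (1 - t) * orient x' y' x = 0 by lra.
  by rewrite mulf_eq0 subr_eq0 eq_sym (lt_eqF t1) => /eqP.
have oz2 : orient x' y' y = 0.
  have /eqP : t * orient x' y' y = 0 by lra.
  by rewrite mulf_eq0 (gt_eqF t0) => /eqP.
have mem u : u \in A -> orient x' y' u = 0 -> u = x' \/ u = y'.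
  move=> uA ou; apply: contrapT => /not_orP[/eqP n1 /eqP n2].
  by case/hullP: h' => _ _ _ /(_ u uA n1 n2); rewrite ou ltxx.
move: up' ne => /andP[/= u1 u2] /negP; apply; apply/eqP.
case: (mem x xA oz1) => xE; case: (mem y yA oz2) => yE; rewrite xE yE //.
- by move: xy; rewrite xE yE eqxx.
- by move: ltxy; rewrite xE yE => l; exfalso; lra.
by move: xy; rewrite xE yE eqxx.
Qed.

End Chains.

(** * A family tiles the hull iff its chain is that of the hull *)

Section Tilings.
Local Open Scope fset_scope.
Local Open Scope classical_set_scope.
Local Open Scope ring_scope.
Context {R : realType}.
Implicit Types (x y z a b c d h m v u p q w : plane R) (s : seq (plane R)).
Implicit Types (A : {fset plane R}) (P Q : polygon R) (T : {fset polygon R}).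

Lemma arcs_irr s x : simple s -> (x, x) \in arcs s = false.
Proof.
move=> ss; apply/negP => xx.
have [n [t E]] := rot_arc (simple_uniq ss) (simple_size1 ss) xx.
have := simple_uniq ss; rewrite -(rot_uniq n) E /= inE eqxx.
by [].
Qed.

Lemma arcP_fam A T P x y : psi_family A T -> P \in T -> arcP P x y ->
  [/\ x \in A, y \in A & x != y].
Proof.
move=> fT /fT[s [ps -> sA]]; rewrite arcP_edges // => xy.
have [/= /sA xA /sA yA] := arcs_mem xy; split=> //.
by apply: contraTneq xy => ->; rewrite arcs_irr //; case: ps.
Qed.

(** From a point off the hull one escapes along the ray leading away from a point
    of A, without meeting any segment spanned by A. *)
Lemma inside_conv A s z : {subset s <= A} -> ~ bd s z -> wind s z <> 0 -> conv A z.
Proof.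
move=> sA nz wz; apply: contrapT => ncz; apply: wz.
case: s sA nz => [|c s] sA nz; first by rewrite /wind big_nil.
have cA : conv A c by apply: conv_pt; apply: sA; rewrite mem_head.
have zc : z != c by apply: contra_not_neq ncz => ->.
pose w := z - c.
have w0 : 0 < dot w w.
  rewrite /dot lt_neqAle addr_ge0 -?expr2 ?sqr_ge0 // andbT eq_sym.
  rewrite paddr_eq0 ?sqr_ge0 // !sqrf_eq0 /w !pE !subr_eq0.
  by apply: contra zc => /andP[/eqP h1 /eqP h2]; apply/eqP; apply: plane_eq.
have off (k : R) : 0 <= k -> ~ conv A (z + k *: w).
  move=> k0 cz; apply: ncz; apply: (conv_cvx cA cz).
  have k1 : 0 < 1 + k by lra.
  have k1' : 1 + k != 0 by rewrite gt_eqF.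
  exists ((1 + k)^-1); split; first by rewrite invr_ge0 ltW.
    by rewrite invf_le1 //; lra.
  by apply: plane_eq; rewrite !pE; field.
have nb (k : R) : 0 <= k -> ~ bd (c :: s) (z + k *: w).
  move=> /off N [e /arcs_mem[/sA h1 /sA h2] hz]; exact/N/(conv_seg h1 h2).
have [M M0 HM] := seq_bound (dot w) (c :: s).
pose k := (M + `|dot w z|) / dot w w.
have k0 : 0 <= k.
  by apply: divr_ge0; [apply: addr_ge0; [exact: ltW|exact: normr_ge0]|exact: ltW].
have -> : wind (c :: s) z = wind (c :: s) (z + k *: w).
  apply: wind_invariant => v [t [t0 t1 ->]].
  have -> : z + t *: (z + k *: w - z) = z + (t * k) *: w.
    by apply: plane_eq; rewrite !pE; ring.
  by apply: nb; exact: mulr_ge0.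
apply: (@wind_halfplane _ w) => v /HM; rewrite dotD dotZ divfK ?gt_eqF //.
by have := ler_norm (- dot w z); rewrite normrN; lra.
Qed.

Lemma tile_count A T z : psi_family A T ->
  \bigcup_(P in [set` T]) region P = conv A ->
  {in T &, forall P Q, P != Q -> inside P `&` inside Q = set0} ->
  (forall P, P \in T -> ~ boundary P z) ->
  \sum_(P <- T) ins P z = Posz `[< conv A z >].
Proof.
move=> fT UT dT nz.
have sub P : P \in T -> inside P z -> conv A z.
  by move=> PT iz; rewrite -UT; exists P => //; right.
case: asboolP => [|N].
  rewrite -UT => -[P /= PT [/(nz P PT)//|iz]].
  rewrite (bigD1_seq P) ?fset_uniq //= big_seq_cond big1 ?addr0.
    by rewrite /ins asboolT.
  move=> Q /andP[QT QP]; rewrite /ins asboolF // => iQ.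
  by have := dT _ _ QT PT QP; rewrite -subset0 => /(_ z); apply.
rewrite big_seq big1 // => P PT; rewrite /ins asboolF //.
by move/(sub P PT).
Qed.

(** Near a generic point of the segment xy, only an edge xy of P can matter. *)
Lemma ins_near A T P x y (t0 : R) m : psi_family A T -> P \in T ->
  x \in A -> y \in A -> x != y -> 0 < t0 -> t0 < 1 -> m = x + t0 *: (y - x) ->
  (forall u v, u \in A -> v \in A -> [fset u; v]%fset != [fset x; y]%fset -> ~ seg u v m) ->
  exists K : int, \forall z \near m, orient x y z <> 0 ->
    ~ boundary P z /\ ins P z = K + chi P x y * Posz (0 < orient x y z)%R.
Proof.
move=> fT PT xA yA xy h0 h1 mE Hm.
have [s [ps PE sA]] := fT P PT; have [ss cs _] := ps.
have us := simple_uniq ss; have s1 := simple_size1 ss.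
have h0' : 0 < 1 - t0 by rewrite subr_gt0.
have h1' : 1 - t0 < 1 by rewrite ltrBlDr ltrDl.
have mE' : m = y + (1 - t0) *: (x - y).
  by rewrite mE; apply: plane_eq; rewrite !pE; ring.
rewrite /chi PE !arcP_edges // boundary_edges //.
have [axy|naxy] := boolP ((x, y) \in arcs s).
  have [_ s2 _ _] := ss; rewrite (arcs_antisym us s2 axy); exists 0.
  apply: filterS (near_arc ss cs axy h0 h1 mE) => z [H1 H2] oz.
  have nz : ~ bd s z by rewrite H1.
  by split=> //; rewrite ins_wind // (H2 nz) /= add0r subr0 mul1r.
have [ayx|nayx] := boolP ((y, x) \in arcs s).
  exists 1; apply: filterS (near_arc ss cs ayx h0' h1' mE') => z [H1 H2] oz.
  have nz : ~ bd s z by rewrite H1 orientN; apply/eqP; rewrite oppr_eq0; apply/eqP.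
  split=> //; rewrite ins_wind // (H2 nz) orientN oppr_gt0 /=.
  by case: (ltgtP (orient x y z) 0) oz.
have nm : ~ bd s m.
  move=> [e es hz]; have [/sA e1 /sA e2] := arcs_mem es.
  have [/fset2_eq|ne] := eqVneq [fset e.1; e.2]%fset [fset x; y]%fset; last first.
    exact: (Hm _ _ e1 e2 ne).
  case: e es {hz e1 e2} => a b /= es [[E1 E2]|[E1 E2]]; subst.
    by rewrite es in naxy.
  by rewrite es in nayx.
exists (wind s m); near=> z => _.
have nz : ~ bd s z by near: z; exact: near_notin_bd.
split=> //; rewrite ins_wind // /= subrr mul0r addr0.
by near: z; exact: wind_near.
Unshelve. all: by end_near. Qed.

Lemma conv_near A x y (t0 : R) m : general_position A -> x \in A -> y \in A -> x != y ->
  0 < t0 -> t0 < 1 -> m = x + t0 *: (y - x) ->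
  \forall z \near m,
    (0 < orient x y z -> Posz `[< conv A z >] = 1 - Posz (hull A y x)) /\
    (orient x y z < 0 -> Posz `[< conv A z >] = 1 - Posz (hull A x y)).
Proof.
have main (x' y' : plane R) (t : R) (m' : plane R) : general_position A -> x' \in A -> y' \in A ->
    x' != y' -> 0 < t -> t < 1 -> m' = x' + t *: (y' - x') ->
    \forall z \near m', 0 < orient x' y' z -> Posz `[< conv A z >] = 1 - Posz (hull A y' x').
  move=> gA xA yA xy h0 h1 mE.
  have [h|h] := boolP (hull A y' x').
    apply: filterE => z oz; rewrite asboolF // => /(hull_conv_ge0 h).
    by rewrite orientN oppr_ge0 leNgt oz.
  have [u [uA ux uy uo]] : exists u, [/\ u \in A, u != x', u != y' & 0 < orient x' y' u].
    apply: contrapT => N; case/negP: h; apply/hullP; split=> //; first by rewrite eq_sym.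
    move=> u uA uy ux; rewrite orientN oppr_gt0.
    have : orient x' y' u != 0 by apply: gA; rewrite // eq_sym.
    by case: (ltgtP (orient x' y' u) 0) => // l _; case: N; exists u.
  have N1 : \forall z \near m', 0 < orient y' u z.
    apply: near_orient_gt0; rewrite mE orient_cvx orientxyx mulr0 addr0 -(orientC x' y' u).
    by rewrite mulr_gt0 // subr_gt0.
  have N2 : \forall z \near m', 0 < orient u x' z.
    apply: near_orient_gt0; rewrite mE orient_cvx orientxyy mulr0 add0r (orientC u x' y').
    by rewrite mulr_gt0.
  near=> z => oz; have cz : conv A z.
    by apply: (conv_tri xA yA uA) => //; apply: ltW => //; near: z.
  by rewrite asboolT // (negbTE h).
move=> gA xA yA xy h0 h1 mE.
have h0' : 0 < 1 - t0 by rewrite subr_gt0.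
have h1' : 1 - t0 < 1 by rewrite ltrBlDr ltrDl.
have mE' : m = y + (1 - t0) *: (x - y).
  by rewrite mE; apply: plane_eq; rewrite !pE; ring.
have yx : y != x by rewrite eq_sym.
have N1 := main x y t0 m gA xA yA xy h0 h1 mE.
have N2 := main y x (1 - t0) m gA yA xA yx h0' h1' mE'.
near=> z; split; first by near: z.
rewrite -oppr_gt0 -orientN; by near: z.
Unshelve. all: by end_near. Qed.

(** Compare the number of polygons on both sides of a generic point of the
    segment xy with the indicator function of the hull. *)
Lemma chain_of_tile A T : general_position A -> psi_family A T ->
  \bigcup_(P in [set` T]) region P = conv A ->
  {in T &, forall P Q, P != Q -> inside P `&` inside Q = set0} ->
  chain A T.
Proof.
move=> gA fT UT dT x y.
have [/and3P[xA yA xy]|N] := boolP [&& x \in A, y \in A & x != y]; last first.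
  have nul P : P \in T -> chi P x y = 0.
    move=> PT; rewrite /chi.
    have -> : arcP P x y = false.
      by apply: contraNF N => /(arcP_fam fT PT)[-> -> ->].
    have -> // : arcP P y x = false.
    by apply: contraNF N => /(arcP_fam fT PT)[-> ->]; rewrite eq_sym => ->.
  rewrite big_seq big1 // /chull.
  have -> : hull A x y = false by apply: contraNF N => /hullP[-> -> -> _].
  have -> // : hull A y x = false.
  by apply: contraNF N => /hullP[-> ->]; rewrite eq_sym => -> _.
have [t0 [h0 h1 Hm]] := generic_on gA xA yA xy.
set m := x + t0 *: (y - x) in Hm.
have /choice[K HK] P : exists K : int, P \in T -> \forall z \near m, orient x y z <> 0 ->
    ~ boundary P z /\ ins P z = K + chi P x y * Posz (0 < orient x y z)%R.
  have [PT|] := boolP (P \in T); last by exists 0.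
  by have [K HK] := ins_near fT PT xA yA xy h0 h1 erefl Hm; exists K.
have N1 := near_all (s := enum_fset T) HK.
have N2 := conv_near gA xA yA xy h0 h1 (erefl m).
have N : \forall z \near m, (forall P, P \in enum_fset T -> orient x y z <> 0 ->
    ~ boundary P z /\ ins P z = K P + chi P x y * Posz (0 < orient x y z)%R) /\
    ((0 < orient x y z -> Posz `[< conv A z >] = 1 - Posz (hull A y x)) /\
    (orient x y z < 0 -> Posz `[< conv A z >] = 1 - Posz (hull A x y))).
  by near=> z; split; near: z.
have [e e0 He] := near_ray (onorm x y) N.
have e2 : 0 < e / 2 by lra.
have om : orient x y m = 0 by rewrite orient_cvx orientxyx orientxyy !mulr0 addr0.
have n0 := onorm_gt0 xy.
have [H1 [H2 _]] := He (e / 2) ltac:(rewrite ger0_norm; lra).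
have [H3 [_ H4]] := He (- (e / 2)) ltac:(rewrite normrN ger0_norm; lra).
set z1 := m + (e / 2) *: onorm x y in H1 H2.
set z2 := m + - (e / 2) *: onorm x y in H3 H4.
have z1p : 0 < orient x y z1 by rewrite orient_onorm om add0r mulr_gt0.
have z2n : orient x y z2 < 0 by rewrite orient_onorm om add0r mulNr oppr_lt0 mulr_gt0.
have z1n : orient x y z1 <> 0 by apply/eqP; rewrite gt_eqF.
have z2n' : orient x y z2 <> 0 by apply/eqP; rewrite lt_eqF.
have E1 : \sum_(P <- T) ins P z1 = 1 - Posz (hull A y x).
  by rewrite (tile_count fT UT dT) ?H2 // => P PT; have [] := H1 P PT z1n.
have E2 : \sum_(P <- T) ins P z2 = 1 - Posz (hull A x y).
  by rewrite (tile_count fT UT dT) ?H4 // => P PT; have [] := H3 P PT z2n'.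
have -> : \sum_(P <- T) chi P x y = \sum_(P <- T) (ins P z1 - ins P z2).
  rewrite big_seq [RHS]big_seq; apply: eq_bigr => P PT.
  have [_ ->] := H1 P PT z1n; have [_ ->] := H3 P PT z2n'.
  by rewrite z1p (lt_gtF z2n) mulr1 mulr0 addr0 addrAC subrr add0r.
by rewrite sumrB E1 E2 /chull; ring.
Unshelve. all: by end_near. Qed.

Lemma fam_conv A T P z : psi_family A T -> P \in T -> region P z -> conv A z.
Proof.
move=> fT /fT[s [ps -> sA]]; have [ss cs _] := ps.
have us := simple_uniq ss; have s1 := simple_size1 ss.
move=> [|/(inside_edges _ ss cs)[nz wz]].
  rewrite boundary_edges // => -[e /arcs_mem[/sA h1 /sA h2]]; exact: conv_seg.
by apply: (inside_conv sA nz); rewrite wz.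
Qed.

Lemma inside_near s z : psi s -> inside (edges s) z -> \forall y \near z, inside (edges s) y.
Proof.
move=> [ss cs _] /(inside_edges _ ss cs)[nz wz].
near=> y; apply/(inside_edges _ ss cs); split; near: y; first exact: near_notin_bd.
by apply: filterS (wind_near nz) => y ->.
Unshelve. all: by end_near. Qed.

Lemma region_compl_near s z : psi s -> ~ region (edges s) z ->
  \forall y \near z, ~ region (edges s) y.
Proof.
move=> [ss cs _] N; have us := simple_uniq ss; have s1 := simple_size1 ss.
have nz : ~ bd s z by move=> h; apply: N; left; rewrite boundary_edges.
have wz : wind s z <> 1 by move=> h; apply: N; right; apply/(inside_edges _ ss cs).
near=> y => -[|/(inside_edges _ ss cs)[_]].
  by rewrite boundary_edges //; near: y; exact: near_notin_bd.
have -> : wind s y = wind s z by near: y; exact: wind_near.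
by [].
Unshelve. all: by end_near. Qed.

Lemma conv_box A : general_position A -> (2 < #|` A|)%N ->
  exists c (e : R), 0 < e /\ box c e `<=` conv A.
Proof.
move=> gA A2.
have [x xA] : exists x, x \in A by have [u []] := fset3_third 0 0 A2; exists u.
have [y [yA yx _]] := fset3_third x x A2.
have [u [uA ux uy]] := fset3_third x y A2.
have main (x' y' u' : plane R) : x' \in A -> y' \in A -> u' \in A -> 0 < orient x' y' u' ->
    exists c (e : R), 0 < e /\ box c e `<=` conv A.
  move=> x'A y'A u'A o0; pose c := 3^-1 *: (x' + y' + u').
  have oc1 : orient x' y' c = 3^-1 * orient x' y' u' by rewrite /orient /c !pE; field.
  have oc2 : orient y' u' c = 3^-1 * orient x' y' u' by rewrite /orient /c !pE; field.
  have oc3 : orient u' x' c = 3^-1 * orient x' y' u' by rewrite /orient /c !pE; field.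
  have p : 0 < 3^-1 * orient x' y' u' by rewrite mulr_gt0 // invr_gt0.
  have := @interior_triangle R A x' y' u' c x'A y'A u'A o0.
  rewrite oc1 oc2 oc3 => /(_ p p p).
  by rewrite /interior /= => /nearP[e e0 He]; exists c, e.
have : orient x y u != 0 by apply: gA; rewrite // eq_sym.
case: (ltgtP (orient x y u) 0) => // l _; last exact: (main x y u).
by apply: (main y x u) => //; rewrite orientN oppr_gt0.
Qed.

(** By [chain_wind] and [hull_count] a generic point of the hull lies in exactly
    one polygon. An overlap or a gap would contain an open set, hence generic
    points. *)
Lemma tile_of_chain A T : general_position A -> (2 < #|` A|)%N -> psi_family A T ->
  chain A T ->
  \bigcup_(P in [set` T]) region P = conv A /\
  {in T &, forall P Q, P != Q -> inside P `&` inside Q = set0}.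
Proof.
move=> gA A2 fT cT.
have count z : generic A z -> conv A z -> \sum_(P <- T) ins P z = 1.
  by move=> gz cz; rewrite (chain_wind fT cT gz) hull_count.
have ins0 P z : 0 <= ins P z by rewrite /ins.
split; last first.
  move=> P Q PT QT PQ; rewrite -subset0 => z [iP iQ].
  have [s [ps PE sA]] := fT P PT; have [s' [ps' QE s'A]] := fT Q QT.
  have N : \forall y \near z, inside P y /\ inside Q y.
    by near=> y; split; near: y; rewrite ?PE ?QE; apply: inside_near; rewrite -?PE -?QE.
  have [y [iPy iQy] gy] := generic_near A N.
  have cy : conv A y by apply: (fam_conv fT PT); right.
  have := count y gy cy.
  have QT' : Q \in (T `\ P)%fset by rewrite !inE eq_sym PQ.
  rewrite (big_fsetD1 P) //= (big_fsetD1 Q) //=.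
  set S := (X in _ + (_ + X)); have S0 : 0 <= S by apply: sumr_ge0.
  by rewrite {1 2}/ins !asboolT //; lia.
apply/seteqP; split=> z; first by move=> [P /= PT]; exact: fam_conv fT PT.
move=> cz; apply: contrapT => N.
have N1 : \forall y \near z, forall P, P \in enum_fset T -> ~ region P y.
  apply: near_all => P PT; have [s [ps PE sA]] := fT P PT; rewrite PE.
  by apply: region_compl_near => // rz; apply: N; exists P; rewrite // PE.
have [c [e [e0 He]]] := conv_box gA A2.
(* points of conv A near z fill a box close to the segment from z to c *)
have [e' e'0 He'] := near_ray (c - z) (nbhs_interior N1).
pose k := Num.min (e' / 2) (1 / 2).
have k0 : 0 < k by rewrite lt_min; apply/andP; split; lra.
have k1 : k <= 1 by rewrite ge_min; apply/orP; right; lra.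
have ke : k < e' by rewrite gt_min; apply/orP; left; lra.
have N2 : nbhs (z + k *: (c - z)) (fun y => forall P, P \in enum_fset T -> ~ region P y).
  by apply: He'; rewrite ger0_norm // ltW.
have kn : k != 0 by rewrite gt_eqF.
have N3 : \forall y \near z + k *: (c - z), conv A y.
  apply/nearP; exists (k * e); first exact: mulr_gt0.
  move=> y [b1 b2]; rewrite !pE in b1 b2.
  have cv : conv A (c + k^-1 *: (y - (z + k *: (c - z)))).
    apply: He; split.
      have -> : (c + k^-1 *: (y - (z + k *: (c - z)))).1 - c.1 =
        k^-1 * (y.1 - (z.1 + k * (c.1 - z.1))) by rewrite !pE; ring.
      by rewrite normrM gtr0_norm ?invr_gt0 // -(mulKf kn e) ltr_pM2l ?invr_gt0.
    have -> : (c + k^-1 *: (y - (z + k *: (c - z)))).2 - c.2 =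
      k^-1 * (y.2 - (z.2 + k * (c.2 - z.2))) by rewrite !pE; ring.
    by rewrite normrM gtr0_norm ?invr_gt0 // -(mulKf kn e) ltr_pM2l ?invr_gt0.
  apply: (conv_cvx cz cv); exists k; split=> //; first exact: ltW.
  by apply: plane_eq; rewrite !pE; field.
have N4 : \forall y \near z + k *: (c - z), conv A y /\
    forall P, P \in enum_fset T -> ~ region P y.
  by near=> y; split; near: y.
have [y [cy Hy] gy] := generic_near A N4.
have := count y gy cy; rewrite big_seq big1 // => P PT.
by rewrite /ins asboolF // => iP; apply: (Hy P PT); right.
Unshelve. all: by end_near. Qed.

End Tilings.

(** * Pseudo-triangulations in terms of arcs *)

Section Facts.
Local Open Scope fset_scope.
Local Open Scope ring_scope.
Context {R : realType}.
Implicit Types (x y z a b c d h m v u p q w : plane R) (s t : seq (plane R)).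
Implicit Types (A W : {fset plane R}) (P Q : polygon R) (T : {fset polygon R}).

(** Membership in PT A W without topology; see [PTP]. *)
Definition pt A W T : Prop :=
  [/\ psi_family A T, chain A T, (\bigcup_(P <- T) vertices P)%fset = A
    & {in interior_points A, forall x,
        (exists2 P, P \in T & reflex_vertex P x) <-> x \in W}].

Lemma mem_cover (T : {fset polygon R}) x :
  reflect (exists2 P, P \in T & x \in vertices P) (x \in (\bigcup_(P <- T) vertices P)%fset).
Proof.
apply: (iffP (bigfcupP _ _ _ _)) => [[P]|[P PT xP]].
  by rewrite andbT => PT xP; exists P.
by exists P; rewrite ?PT.
Qed.

Lemma PTP A W T : general_position A -> (2 < #|` A|)%N -> T \in PT A W <-> pt A W T.
Proof.
move=> gA A2; rewrite /PT !inE /=; split.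
  move=> /andP[_ /asboolP[[H1 H2 H3 H4] H5]].
  have fT : psi_family A T.
    move=> P PT; apply: pseudo_triangleP => //; first exact: H1.
    by rewrite -H4; apply/fsubsetP => x xP; apply/mem_cover; exists P.
  split=> //; first exact: chain_of_tile.
  move=> x xi; rewrite -(H5 x xi) /pointed xi /=; split; first by right.
  by case.
move=> [fT cT H4 H5]; have [H2 H3] := tile_of_chain gA A2 fT cT.
apply/andP; split.
  rewrite fpowersetE; apply/fsubsetP => P /fT[s [[ss _ _] -> sA]].
  rewrite fpowersetE; apply/fsubsetP => e.
  move=> /(mem_edges _ (simple_uniq ss) (simple_size1 ss))[f /arcs_mem[f1 f2] ->].
  by rewrite fpowersetE; apply/fsubsetP => x; rewrite !inE => /orP[]/eqP->; exact: sA.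
apply/asboolP; split; first split=> //.
  by move=> P /fT[s [ps -> _]]; exact: pseudo_triangle_edges.
move=> x xi; rewrite -(H5 x xi) /pointed xi /=; split; last by right.
by case.
Qed.

Section Tiling.
Variables (A : {fset plane R}) (T : {fset polygon R}).
Hypotheses (gA : general_position A) (A2 : (2 < #|` A|)%N)
  (fT : psi_family A T) (cT : chain A T).

Lemma inside_inj s s' z : psi s -> psi s' -> edges s \in T -> edges s' \in T ->
  ~ bd s z -> wind s z = 1 -> ~ bd s' z -> wind s' z = 1 -> edges s = edges s'.
Proof.
move=> [ss cs _] [ss' cs' _] sT s'T h1 h2 h3 h4.
apply/eqP; apply: contrapT => /negP ne.
have [_ H] := tile_of_chain gA A2 fT cT.
have : (inside (edges s) `&` inside (edges s'))%classic z.
  by split; apply/inside_edges.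
by rewrite H.
Qed.

(** Polygons traversing the same arc share the points just left of it. *)
Lemma same_arc s s' x y : psi s -> psi s' -> edges s \in T -> edges s' \in T ->
  (x, y) \in arcs s -> (x, y) \in arcs s' -> edges s = edges s'.
Proof.
move=> ps ps' sT s'T xy xy'; have [ss cs _] := ps; have [ss' cs' _] := ps'.
have half0 : 0 < 1 / 2 :> R by lra.
have half1 : 1 / 2 < 1 :> R by lra.
have xney : x != y by apply: contraTneq xy => ->; rewrite arcs_irr.
have N1 := near_arc ss cs xy half0 half1 erefl.
have N2 := near_arc ss' cs' xy' half0 half1 erefl.
have [e e0 He] := near_ray (onorm x y) (filterI N1 N2).
have [[H1 H2] [H3 H4]] := He (e / 2) ltac:(rewrite ger0_norm; lra).
have oz : 0 < orient x y (x + (1 / 2) *: (y - x) + (e / 2) *: onorm x y).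
  rewrite orient_onorm orient_cvx orientxyx orientxyy !mulr0 !add0r mulr_gt0 //; first lra.
  exact: onorm_gt0.
have nb : ~ bd s (x + (1 / 2) *: (y - x) + (e / 2) *: onorm x y).
  by rewrite H1; apply/eqP; rewrite gt_eqF.
have nb' : ~ bd s' (x + (1 / 2) *: (y - x) + (e / 2) *: onorm x y).
  by rewrite H3; apply/eqP; rewrite gt_eqF.
by apply: (inside_inj ps ps' sT s'T nb _ nb'); rewrite ?H2 ?H4 // oz.
Qed.

(** Polygons whose angles at h contain a common direction share points. *)
Lemma wedge_inj s s' h a b a' b' d : psi s -> psi s' -> edges s \in T -> edges s' \in T ->
  (a, h) \in arcs s -> (h, b) \in arcs s -> (a', h) \in arcs s' -> (h, b') \in arcs s' ->
  orient a h (h + d) != 0 -> orient h b (h + d) != 0 ->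
  orient a' h (h + d) != 0 -> orient h b' (h + d) != 0 ->
  wedge a h b (h + d) -> wedge a' h b' (h + d) -> edges s = edges s'.
Proof.
move=> ps ps' sT s'T ah hb ah' hb' d1 d2 d3 d4 w1 w2.
have [ss cs _] := ps; have [ss' cs' _] := ps'.
have [e e0 He] := near_wedge_ray ss cs ah hb d1 d2.
have [e' e'0 He'] := near_wedge_ray ss' cs' ah' hb' d3 d4.
pose k := Num.min e e' / 2.
have m0 : 0 < Num.min e e' by rewrite lt_min e0.
have k0 : 0 < k by apply: divr_gt0.
have km : k < Num.min e e' by rewrite /k; lra.
have [|n1 E1] := He k; first by rewrite k0 (lt_le_trans km) // ge_min lexx.
have [|n2 E2] := He' k; first by rewrite k0 (lt_le_trans km) // ge_min lexx orbT.
by apply: (inside_inj ps ps' sT s'T n1 _ n2); rewrite ?E1 ?E2 ?w1 ?w2.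
Qed.

(** Off the hull opposite arcs cancel in the chain. *)
Lemma opp_arc s x y : psi s -> edges s \in T -> (x, y) \in arcs s -> ~~ hull A x y ->
  exists s', [/\ psi s', edges s' \in T, {subset s' <= A} & (y, x) \in arcs s'].
Proof.
move=> ps sT xy nh; apply: contrapT => N.
have N' Q : Q \in T -> arcP Q y x = false.
  move=> QT; apply/negP; have [s' [ps' E sA]] := fT QT; rewrite E arcP_edges // => h.
  by apply: N; exists s'; rewrite -E.
have := cT x y; rewrite /chull (negbTE nh) sub0r.
rewrite (big_fsetD1 (edges s)) //= {1}/chi arcP_edges // xy (N' _ sT) subr0.
set S := (X in _ + X) => E.
have : 0 <= S by rewrite /S big_seq; apply: sumr_ge0 => Q; rewrite !inE => /andP[_ /N' h];
  rewrite /chi h subr0.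
by move: E; clearbody S; case: (hull A y x); lia.
Qed.

Lemma hull_asym x y : hull A x y -> hull A y x = false.
Proof.
move=> hxy; apply/negP => hyx; have [u [uA ux uy]] := fset3_third x y A2.
have /hullP[_ _ _ /(_ u uA ux uy) h1] := hxy; have /hullP[_ _ _ /(_ u uA uy ux)] := hyx.
by rewrite orientN oppr_gt0 lt_gtF.
Qed.

Lemma hull_arc x y : hull A x y ->
  exists s, [/\ psi s, edges s \in T, {subset s <= A} & (x, y) \in arcs s].
Proof.
move=> hxy; apply: contrapT => N.
have N' Q : Q \in T -> arcP Q x y = false.
  move=> QT; apply/negP; have [s' [ps' E sA]] := fT QT; rewrite E arcP_edges // => h.
  by apply: N; exists s'; rewrite -E.
have := cT x y; rewrite /chull hxy hull_asym // subr0 => E.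
have : \sum_(P <- T) chi P x y <= 0.
  by rewrite big_seq; apply: sumr_le0 => Q /N' h; rewrite /chi h sub0r oppr_le0.
by rewrite E.
Qed.

End Tiling.

(** Tilting the outer normal of the hull edge xy slightly towards x makes x the
    only maximizer, and likewise for y. *)
Lemma hull_extreme A x y : hull A x y ->
  (exists u, {in A, forall v, v != x -> dot u v < dot u x}) /\
  (exists u, {in A, forall v, v != y -> dot u v < dot u y}).
Proof.
move=> /hullP[xA yA xy H].
have xy0 : 0 < dot (x - y) (x - y).
  rewrite /dot lt_neqAle addr_ge0 -?expr2 ?sqr_ge0 // andbT eq_sym paddr_eq0 ?sqr_ge0 //.
  rewrite !sqrf_eq0 !pE !subr_eq0; apply: contra xy => /andP[/eqP h1 /eqP h2].
  by apply/eqP; apply: plane_eq.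
have tilt (o c : plane R) : dot (onorm x y) c = dot (onorm x y) x -> exists2 k : R, 0 < k &
    forall v, v \in A -> v != x -> v != y ->
      dot (o - k *: onorm x y) v < dot (o - k *: onorm x y) c.
  move=> cE.
  have [M M0 HM] := seq_bound (fun v => `|dot o (v - c)| / orient x y v) A.
  exists M => // v vA vx vy; have ov := H v vA vx vy.
  have := HM v vA; rewrite ltr_pdivrMr // => h.
  have := ler_norm (dot o (v - c)).
  have -> : dot o (v - c) = dot o v - dot o c by rewrite /dot !pE; ring.
  have E (p : plane R) : dot (o - M *: onorm x y) p = dot o p - M * dot (onorm x y) p.
    by rewrite /dot !pE; ring.
  rewrite !E cE; move: h; rewrite orient_dot mulrBr.
  have -> : dot o (v - c) = dot o v - dot o c by rewrite /dot !pE; ring.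
  by move=> *; lra.
have nE : dot (onorm x y) y = dot (onorm x y) x.
  by apply/eqP; rewrite -subr_eq0 -orient_dot orientxyy.
have dif (o p c : plane R) (k : R) : dot (onorm x y) c = dot (onorm x y) p ->
    dot (o - k *: onorm x y) p - dot (o - k *: onorm x y) c = dot o (p - c).
  move=> E; have -> : dot (o - k *: onorm x y) p - dot (o - k *: onorm x y) c =
    dot o (p - c) - k * (dot (onorm x y) p - dot (onorm x y) c) by rewrite /dot !pE; ring.
  by rewrite E subrr mulr0 subr0.
split.
  have [k k0 Hk] := tilt (x - y) x erefl; exists (x - y - k *: onorm x y) => v vA vx.
  have [->|vy] := eqVneq v y; last exact: Hk.
  rewrite -subr_gt0 dif //.
have [k k0 Hk] := tilt (y - x) y nE; exists (y - x - k *: onorm x y) => v vA vy.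
have [->|vx] := eqVneq v x; last exact: Hk.
rewrite -subr_gt0 dif ?nE //.
by have -> : dot (y - x) (y - x) = dot (x - y) (x - y) by rewrite /dot !pE; ring.
Qed.

Lemma extreme_turn A s h u : psi s -> {subset s <= A} -> h \in s ->
  {in A, forall v, v != h -> dot u v < dot u h} -> left s h.
Proof.
move=> [ss cs _] sA hs ext; have [a [b [ah hb]]] := vertex_arcs ss hs.
rewrite (left_arcs (simple_uniq ss) (simple_size1 ss) ah hb).
apply/(ccw_transfer ss ah hb (u := u)) => //.
by move=> v /sA; exact: ext.
Qed.

Lemma hull_left A s x y : psi s -> {subset s <= A} -> hull A x y ->
  (x \in s -> left s x) /\ (y \in s -> left s y).
Proof.
move=> ps sA /hull_extreme[[u hu] [u' hu']].
by split=> h; [exact: (extreme_turn ps sA h hu)|exact: (extreme_turn ps sA h hu')].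
Qed.

(** Unlike the intersection of the segments, this depends on orientations only;
    for points in general position it says that they meet off their ends. *)
Definition cross (e f : plane R * plane R) : bool :=
  (orient e.1 e.2 f.1 * orient e.1 e.2 f.2 < 0) &&
  (orient f.1 f.2 e.1 * orient f.1 f.2 e.2 < 0).

Lemma crossC e f : cross e f = cross f e.
Proof. by rewrite /cross andbC. Qed.

Lemma cvx_eq0 (t A B : R) : 0 <= t -> t <= 1 -> A != 0 -> B != 0 ->
  (1 - t) * A + t * B = 0 -> A * B < 0.
Proof.
move=> t0 t1 A0 B0 E.
case: (ltgtP A 0) A0 => // hA _; case: (ltgtP B 0) B0 => // hB _.
- have := cvx_lt t0 t1 hA hB; rewrite E ltxx //.
- by rewrite nmulr_rlt0.
- by rewrite pmulr_rlt0.
have hA' : - A < 0 by rewrite oppr_lt0.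
have hB' : - B < 0 by rewrite oppr_lt0.
by have := cvx_lt t0 t1 hA' hB'; rewrite !mulrN -opprD E oppr0 ltxx.
Qed.

Lemma meet_share c y u : orient c y u != 0 -> meet_at_ends (c, y) (c, u).
Proof.
move=> o0 z /= [t [_ _ E1]] [t' [_ _ E2]].
have : orient c y z = 0 by rewrite E1 orient_cvx orientxyx orientxyy !mulr0 addr0.
rewrite E2 orient_cvx orientxyx mulr0 add0r => /eqP.
rewrite mulf_eq0 (negbTE o0) orbF => /eqP ->.
by rewrite scale0r addr0 !inE eqxx.
Qed.

Lemma meet_swapl x y f : meet_at_ends (x, y) f -> meet_at_ends (y, x) f.
Proof.
move=> H z /= h1 h2; have [] := H z _ h2; first by rewrite /= segC.
by rewrite /= !inE orbC.
Qed.

Lemma meet_swapr e x y : meet_at_ends e (x, y) -> meet_at_ends e (y, x).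
Proof. by move=> /meet_at_endsC H; apply/meet_at_endsC; exact: meet_swapl. Qed.

Lemma meet_cross (S : seq (plane R)) x y z u : gpos S -> x \in S -> y \in S ->
  z \in S -> u \in S -> x != y -> z != u -> [fset x; y]%fset != [fset z; u]%fset ->
  meet_at_ends (x, y) (z, u) <-> ~~ cross (x, y) (z, u).
Proof.
move=> gS xS yS zS uS xy zu ne; split.
  move=> H; apply/negP => /andP[/= c1 c2].
  have n1 : orient z u x - orient z u y != 0.
    rewrite subr_eq0; apply: contraTneq c2 => ->.
    by rewrite -leNgt -expr2 sqr_ge0.
  have n2 : orient x y z - orient x y u != 0.
    rewrite subr_eq0; apply: contraTneq c1 => ->.
    by rewrite -leNgt -expr2 sqr_ge0.
  have frac (A B : R) : A * B < 0 -> 0 < A / (A - B) /\ A / (A - B) < 1.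
    case: (ltgtP A 0) => hA; last by rewrite hA mul0r ltxx.
      rewrite nmulr_rlt0 // => hB; have h : A - B < 0 by lra.
      by rewrite nmulr_rgt0 // invr_lt0 h ltr_ndivrMr // mul1r; split=> //; lra.
    rewrite pmulr_rlt0 // => hB; have h : 0 < A - B by lra.
    by rewrite divr_gt0 // ltr_pdivrMr // mul1r; split=> //; lra.
  have [t0 t1] := frac _ _ c2; have [k0 k1] := frac _ _ c1.
  set t := orient z u x / _ in t0 t1; set k := orient x y z / _ in k0 k1.
  have E : x + t *: (y - x) = z + k *: (u - z).
    have dE : orient x y z - orient x y u = orient z u y - orient z u x.
      by rewrite /orient; ring.
    have n3 : orient z u y - orient z u x != 0 by rewrite -dE.
    rewrite /t /k dE; move: n1 n3; rewrite /orient => n1 n3.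
    by apply: plane_eq; rewrite !pE; field; rewrite n1 n3.
  have [] := H (x + t *: (y - x)).
  - by exists t; split=> //; exact: ltW.
  - by rewrite E; exists k; split=> //; exact: ltW.
  move=> + _; rewrite /= !inE => /orP[/eqP h|/eqP h].
    have /eqP : t *: (y - x) = 0 by apply/(addrI x); rewrite h addr0.
    by rewrite scaler_eq0 subr_eq0 (eq_sym y) (negbTE xy) gt_eqF.
  have /eqP : (1 - t) *: (y - x) = 0.
    by rewrite scalerBl scale1r; apply/eqP; rewrite subr_eq0 -{1}h addrAC subrr add0r.
  by rewrite scaler_eq0 !subr_eq0 (eq_sym y) (negbTE xy) gt_eqF.
move=> nc.
have g (a b c : plane R) : a \in S -> b \in S -> c \in S -> a != b -> b != c -> a != c ->
    orient a b c != 0 by exact: gS.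
have [E|xz] := eqVneq x z.
  subst z; apply: meet_share; apply: g => //.
  by apply: contra_neq ne => ->.
have [E|xu] := eqVneq x u.
  subst u; apply: meet_swapr; apply: meet_share; apply: g => //.
  by apply: contra_neq ne => ->; rewrite fset2C.
have [E|yz] := eqVneq y z.
  subst z; apply: meet_swapl; apply: meet_share; apply: g => //.
  by rewrite eq_sym.
have [E|yu] := eqVneq y u.
  subst u; apply: meet_swapl; apply: meet_swapr; apply: meet_share; apply: g => //.
  by rewrite eq_sym.
move=> w /= [t [t0 t1 E1]] [k [k0 k1 E2]]; exfalso; move/negP: nc; apply.
apply/andP; split=> /=.
  apply: (cvx_eq0 k0 k1); try exact: g.
  by rewrite -orient_cvx -E2 E1 orient_cvx orientxyx orientxyy !mulr0 addr0.
apply: (cvx_eq0 t0 t1); try (apply: g => //; by rewrite eq_sym).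
by rewrite -orient_cvx -E1 E2 orient_cvx orientxyx orientxyy !mulr0 addr0.
Qed.

Lemma simpleP s : uniq s -> (2 < size s)%N -> gpos s ->
  simple s <-> {in arcs s &, forall e f, e != f -> ~~ cross e f}.
Proof.
move=> us s2 gs.
have key e f : e \in arcs s -> f \in arcs s -> e != f ->
    meet_at_ends e f <-> ~~ cross e f.
  case: e f => [x y] [z u] es fs ne; have [/= xs ys] := arcs_mem es.
  have [/= zs ws] := arcs_mem fs.
  have irr c : (c, c) \in arcs s = false.
    apply/negP => cc; have [n [t' E]] := rot_arc us (ltnW s2) cc.
    by have := us; rewrite -(rot_uniq n) E /= inE eqxx.
  apply: (meet_cross gs) => //.
  - by apply: contraTneq es => ->; rewrite irr.
  - by apply: contraTneq fs => ->; rewrite irr.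
  by apply: contra_neq ne => /(arcs_edge_inj us s2 es fs).
split=> [[_ _ _ H] e f es fs ne|H]; first by apply/key => //; exact: H.
by split=> // e f es fs ne; apply/key => //; exact: H.
Qed.

Lemma psi_tri a b c : 0 < orient a b c -> psi [:: a; b; c].
Proof.
move=> o0.
have ab : a != b by apply: contraTneq o0 => ->; rewrite orientxx ltxx.
have bc : b != c by apply: contraTneq o0 => ->; rewrite orientxyy ltxx.
have ac : a != c by apply: contraTneq o0 => ->; rewrite orientxyx ltxx.
have us : uniq [:: a; b; c] by rewrite /= !inE negb_or ab ac bc.
have o1 : 0 < orient b c a by rewrite -orientC.
have o2 : 0 < orient c a b by rewrite orientC.
have n1 : orient a c b < 0 by move: o0; rewrite /orient; lra.
have n2 : orient b a c < 0 by move: o0; rewrite /orient; lra.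
have n3 : orient c b a < 0 by move: o0; rewrite /orient; lra.
have gs : gpos [:: a; b; c].
  move=> x y z; rewrite !inE => /or3P[]/eqP-> /or3P[]/eqP-> /or3P[]/eqP->;
    rewrite ?eqxx // => _ _ _;
    by rewrite ?(gt_eqF o0) ?(gt_eqF o1) ?(gt_eqF o2) ?(lt_eqF n1) ?(lt_eqF n2) ?(lt_eqF n3).
have ss : simple [:: a; b; c].
  apply/simpleP => // e f /=; rewrite !inE => /or3P[]/eqP-> /or3P[]/eqP->; rewrite ?eqxx // => _;
    by rewrite /cross /= ?orientxx ?orientxyx ?orientxyy ?mul0r ?mulr0 ltxx ?andbF.
split=> //; first by move=> x nx; rewrite wind_tri.
rewrite /= (left_arcs us (a := c) (b := b)) //; last 2 first.
- by rewrite /= !inE eqxx ?orbT.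
- by rewrite /= !inE eqxx ?orbT.
rewrite (left_arcs us (a := a) (b := c)) //; last 2 first.
- by rewrite /= !inE eqxx ?orbT.
- by rewrite /= !inE eqxx ?orbT.
rewrite (left_arcs us (a := b) (b := a)) //; last 2 first.
- by rewrite /= !inE eqxx ?orbT.
- by rewrite /= !inE eqxx ?orbT.
by rewrite o0 o1 o2.
Qed.

(** As no segment crosses the three involved, simplicity is unaffected; by the
    balance of turns so is the number of convex vertices; and the orientation is
    read off at an extreme vertex h other than x, y, z. *)
Lemma psi_insert A x y z t h u : general_position A -> t != [::] ->
  {subset [:: x, z, y & t] <= A} -> uniq [:: x, z, y & t] ->
  {in A &, forall v w, [/\ ~~ cross (x, y) (v, w), ~~ cross (x, z) (v, w)
     & ~~ cross (z, y) (v, w)]} ->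
  h \in t -> {in [:: x, z, y & t], forall v, v != h -> dot u v < dot u h} ->
  {in t &, forall l n, ((0 < orient l x y)%R + (0 < orient x y n)%R =
    (0 < orient l x z)%R + (0 < orient x z y)%R + (0 < orient z y n)%R)%N} ->
  psi [:: x, y & t] <-> psi [:: x, z, y & t].
Proof.
move=> gA t0 sA us nc ht ext turns.
have lt' : last y t \in t by case: (t) t0 => // a t' _; rewrite /= mem_last.
have nt : head y t \in t by case: (t) t0 => // a t' _; rewrite mem_head.
have yn : (y, head y t) \in pth y (rcons t x) by case: (t) t0 => // a t' _; rewrite mem_head.
have lx : (last y t, x) \in pth y (rcons t x) by rewrite pth_rcons mem_rcons mem_head.
have t1 : (0 < size t)%N by rewrite lt0n size_eq0.
set s := [:: x, y & t]; set s' := [:: x, z, y & t].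
set C := pth y (rcons t x).
have us1 : uniq s.
  by move: us; rewrite /= !inE !negb_or => /and4P[/and3P[_ -> ->] /andP[_ _] -> ->].
have ss' v : v \in s -> v \in s' by rewrite !inE => /orP[->|->]; rewrite ?orbT.
have s2 : (2 < size s)%N by rewrite /= !ltnS.
have s2' : (2 < size s')%N by rewrite /= !ltnS ltnW.
have gs' : gpos s' by move=> a b c ha hb hc; apply: gA; exact: sA.
have gs : gpos s by move=> a b c ha hb hc; apply: gs'; exact: ss'.
have aE : arcs s = (x, y) :: C by [].
have aE' : arcs s' = [:: (x, z), (z, y) & C] by [].
have memA e : e \in arcs s' -> e.1 \in A /\ e.2 \in A.
  by move=> /arcs_mem[/sA ? /sA ?].
have CA e : e \in C -> e.1 \in A /\ e.2 \in A.
  by move=> eC; apply: memA; rewrite aE' !inE eC !orbT.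
have xA : x \in A by apply: sA; rewrite !inE eqxx.
have zA : z \in A by apply: sA; rewrite !inE eqxx orbT.
have yA : y \in A by apply: sA; rewrite !inE eqxx !orbT.
have nc1 e : e.1 \in A -> e.2 \in A -> [/\ ~~ cross (x, y) e, ~~ cross (x, z) e
     & ~~ cross (z, y) e] by case: e => v w /= vA wA; exact: nc.
have simE : simple s <-> simple s'.
  rewrite (simpleP us1) // (simpleP us) //; split=> H e f.
    rewrite aE' !inE => /or3P[/eqP->|/eqP->|eC] /or3P[/eqP->|/eqP->|fC]; rewrite ?eqxx // => ne.
    - by have [] := nc1 (z, y) zA yA.
    - by have [] := CA _ fC => h1 h2; have [] := nc1 f h1 h2.
    - by have [] := nc1 (x, z) xA zA.
    - by have [] := CA _ fC => h1 h2; have [] := nc1 f h1 h2.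
    - by rewrite crossC; have [] := CA _ eC => h1 h2; have [] := nc1 e h1 h2.
    - by rewrite crossC; have [] := CA _ eC => h1 h2; have [] := nc1 e h1 h2.
    by apply: H; rewrite ?aE ?inE ?eC ?fC ?orbT.
  rewrite aE !inE => /orP[/eqP->|eC] /orP[/eqP->|fC]; rewrite ?eqxx // => ne.
  - by have [] := CA _ fC => h1 h2; have [] := nc1 f h1 h2.
  - by rewrite crossC; have [] := CA _ eC => h1 h2; have [] := nc1 e h1 h2.
  by apply: H; rewrite ?aE' ?inE ?eC ?fC ?orbT.
have tx v : v \in t -> [/\ v != x, v != y & v != z].
  move=> vt; move: us => /= /and4P[]; rewrite !inE !negb_or => /and3P[_ _ n1] /andP[_ n2] n3 _.
  by split; [apply: contraNneq n1 => <-|apply: contraNneq n3 => <-|apply: contraNneq n2 => <-].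
have inC v a : v \in t -> ((a, v) \in arcs s -> (a, v) \in C) /\ ((v, a) \in arcs s -> (v, a) \in C).
  move=> /tx[vx vy vz]; rewrite aE !inE !xpair_eqE (negbTE vx) (negbTE vy) andbF.
  by [].
have Cs e : e \in C -> e \in arcs s by rewrite aE inE => ->; rewrite orbT.
have Cs' e : e \in C -> e \in arcs s' by rewrite aE' !inE => ->; rewrite !orbT.
have s1 := ltnW s2; have s1' := ltnW s2'.
have leftt v : v \in t -> left s v = left s' v.
  move=> vt; have vs : v \in s by rewrite !inE vt !orbT.
  have a1 : (prev s v, v) \in arcs s by rewrite arcs_prev // vs eqxx.
  have a2 : (v, next s v) \in arcs s by rewrite arcs_next // vs eqxx.
  have [/(_ a1) c1 _] := inC v (prev s v) vt; have [_ /(_ a2) c2] := inC v (next s v) vt.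
  by rewrite (left_arcs us s1' (Cs' _ c1) (Cs' _ c2)) (left_arcs us1 s1 a1 a2).
have cnt : count (left s) s = count (left s') s'.
  rewrite /s /s' /= -/s -/s'.
  have -> : count (left s) t = count (left s') t by apply: eq_in_count => v; exact: leftt.
  rewrite (left_arcs us1 s1 (Cs _ lx) (b := y)) ?aE ?inE ?eqxx //.
  rewrite (left_arcs us1 s1 (a := x) _ (Cs _ yn)) ?aE ?inE ?eqxx //.
  rewrite (left_arcs us s1' (Cs' _ lx) (b := z)) ?aE' ?inE ?eqxx //.
  rewrite (left_arcs us s1' (a := x) (b := y) (x := z)) ?aE' ?inE ?eqxx ?orbT //.
  rewrite (left_arcs us s1' (a := z) _ (Cs' _ yn)) ?aE' ?inE ?eqxx ?orbT //.
  by rewrite addnA (turns _ _ lt' nt) !addnA.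
have ccwE : simple s -> simple s' -> ccw s <-> ccw s'.
  move=> si si'; have hs : h \in s by rewrite !inE ht !orbT.
  have a1 : (prev s h, h) \in arcs s by rewrite arcs_prev // hs eqxx.
  have a2 : (h, next s h) \in arcs s by rewrite arcs_next // hs eqxx.
  have [/(_ a1) c1 _] := inC h (prev s h) ht; have [_ /(_ a2) c2] := inC h (next s h) ht.
  have ext1 : {in s, forall v, v != h -> dot u v < dot u h} by move=> v /ss'; exact: ext.
  by rewrite (ccw_transfer si a1 a2 ext1) (ccw_transfer si' (Cs' _ c1) (Cs' _ c2) ext).
by split=> -[h1 h2 h3]; have h4 := h1; move: h4 => /simE h4; split=> //;
  rewrite -?cnt ?h3 //; rewrite ?cnt ?h3 //; apply/ccwE.
Qed.

End Facts.

(** * A point next to a hull edge *)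

Section Ear.
Local Open Scope fset_scope.
Local Open Scope ring_scope.
Context {R : realType}.
Implicit Types (x y z a b c d h m v u w : plane R) (s t : seq (plane R)).
Implicit Types (A W : {fset plane R}) (P Q : polygon R) (T : {fset polygon R}).

Lemma count_left_ge s (L : seq (plane R)) : uniq L -> {subset L <= s} ->
  {in L, forall x, left s x} -> (size L <= count (left s) s)%N.
Proof.
move=> uL sub H; rewrite -size_filter; apply: uniq_leq_size => // x xL.
by rewrite mem_filter H // sub.
Qed.

(** Both parts into which the chord cuts the polygon are ccw again, so the one
    with t1 has a convex vertex off the chord. *)
Lemma chord A s x y t1 t2 : general_position A -> simple s -> ccw s ->
  {subset s <= A} -> s = x :: t1 ++ y :: t2 -> t1 != [::] -> t2 != [::] ->
  {in A &, forall u v, ~~ cross (x, y) (u, v)} ->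
  ~ bd s (x + (1 / 2) *: (y - x)) -> wind s (x + (1 / 2) *: (y - x)) = 1 ->
  exists h, [/\ h \in t1, orient x y h != 0 & left s h].
Proof.
move=> gA ss cs sA sE n1 n2 nc nm wm; have [us s2 gs ds] := ss.
set m := x + (1 / 2) *: (y - x) in nm wm.
have [p1 p2] : (0 < size t1)%N /\ (0 < size t2)%N by rewrite !lt0n !size_eq0.
pose D1 := x :: rcons t1 y; pose D2 := y :: rcons t2 x.
have a1 : arcs D1 = rcons (pth x (rcons t1 y)) (y, x).
  by rewrite /D1 /= -[rcons (rcons t1 y) x]cats1 pth_cat /= last_rcons cats1.
have a2 : arcs D2 = rcons (pth y (rcons t2 x)) (x, y).
  by rewrite /D2 /= -[rcons (rcons t2 x) y]cats1 pth_cat /= last_rcons cats1.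
have aE : arcs s = pth x (rcons t1 y) ++ pth y (rcons t2 x).
  by rewrite sE /= rcons_cat /= pth_cat /= (pth_rcons x t1 y) cat_rcons.
have windE z : wind s z = wind D1 z + wind D2 z.
  rewrite /wind a1 a2 aE big_cat /= -!cats1 !big_cat !big_cons !big_nil /= (kapC x y); ring.
have us' : uniq (x :: t1 ++ y :: t2) by rewrite -sE.
have [ut1 ut2 xt1 xt2 [yt1 yt2 xy]] :
  [/\ uniq t1, uniq t2, x \notin t1, x \notin t2 & [/\ y \notin t1, y \notin t2 & x != y]].
  move: us'; rewrite /= cat_uniq mem_cat inE !negb_or /= => /and4P[h1 h2 /andP[h3 _] h4].
  by case/and3P: h1 => -> -> ->; case/andP: h4 => -> ->; rewrite h2 h3.
have inter v : v \in t1 -> v \in t2 -> False.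
  move=> v1 v2; move: us'; rewrite /= cat_uniq /= negb_or => /and4P[_ _ /andP[_ /hasPn H] _].
  by have := H v v2; rewrite /= v1.
have ms v : (v \in s) = [|| v == x, v == y, v \in t1 | v \in t2].
  by rewrite sE inE mem_cat inE; case: (v == x); case: (v == y); case: (v \in t1); case: (v \in t2).
have D1s v : v \in D1 -> v \in s.
  by rewrite ms /D1 inE mem_rcons inE => /or3P[]->; rewrite ?orbT.
have D2s v : v \in D2 -> v \in s.
  by rewrite ms /D2 inE mem_rcons inE => /or3P[]->; rewrite ?orbT.
have cs0 e f : e \in arcs s -> f \in arcs s -> e != f -> ~~ cross e f.
  by move: e f; exact/(simpleP us s2 gs).
have swapl (e f : plane R * plane R) : cross (e.2, e.1) f = cross e f.
  by rewrite /cross /= (orientN e.1) (orientN e.1 e.2) mulrNN [orient f.1 f.2 e.2 * _]mulrC.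
have nc1 e : e \in arcs s -> ~~ cross (x, y) e.
  by case: e => u v /arcs_mem[/sA uA /sA vA]; exact: nc.
have nc2 e : e \in arcs s -> ~~ cross (y, x) e.
  by move=> /nc1; rewrite -(swapl (x, y)).
have simp D (e0 : plane R * plane R) C : uniq D -> (2 < size D)%N -> {subset D <= s} ->
    arcs D = rcons C e0 -> {subset C <= arcs s} ->
    (forall e, e \in arcs s -> ~~ cross e0 e) -> simple D.
  move=> uD D2' sD aD sC nD; apply/simpleP => //.
    by move=> u v w us0 vs ws; apply: gs; exact: sD.
  move=> e f; rewrite aD !mem_rcons !inE => /orP[/eqP->|/sC eC] /orP[/eqP->|/sC fC]; rewrite ?eqxx //.
  - by move=> _; exact: nD.
  - by move=> _; rewrite crossC; exact: nD.
  exact: cs0.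
have sC1 : {subset pth x (rcons t1 y) <= arcs s} by move=> e h; rewrite aE mem_cat h.
have sC2 : {subset pth y (rcons t2 x) <= arcs s} by move=> e h; rewrite aE mem_cat h orbT.
have sD1 : simple D1.
  apply: (simp D1 (y, x) _ _ _ _ a1) => //.
    by rewrite /D1 /= mem_rcons inE negb_or xy xt1 rcons_uniq yt1 ut1.
  by rewrite /D1 /= size_rcons !ltnS.
have sD2 : simple D2.
  apply: (simp D2 (x, y) _ _ _ _ a2) => //.
    by rewrite /D2 /= mem_rcons inE negb_or eq_sym xy yt2 rcons_uniq xt2 ut2.
  by rewrite /D2 /= size_rcons !ltnS.
have bdD2 z : bd D2 z -> bd s z \/ bd D1 z.
  move=> [e]; rewrite a2 mem_rcons inE => /orP[/eqP->|eC] hz.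
    right; exists (y, x); last by rewrite /= segC.
    by rewrite a1 mem_rcons mem_head.
  by left; exists e => //; exact: sC2.
have cD1 : ccw D1.
  apply: contrapT => /(cw_values sD1)[_ H].
  have bm : bd D1 m.
    exists (y, x); first by rewrite a1 mem_rcons mem_head.
    by rewrite /= segC; exists (1 / 2); split=> //; lra.
  have [_ [z [[h1 h2] h3 h4]]] := H m _ bm (filterI (near_notin_bd nm) (wind_near nm)).
  have nz : ~ bd D2 z by move=> /bdD2[].
  have [k [kE H2 _]] := wind_values sD2.
  move: h2; rewrite wm windE h4; case: (H2 z nz) => ->; first by clear; lia.
  by case: kE => ->; clear; lia.
pose v0 := head x t1.
have v0t : v0 \in t1 by rewrite /v0; case: (t1) n1 => // c t' _; exact: mem_head.
have v0x : v0 != x by apply: contraNneq xt1 => <-.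
have v0y : v0 != y by apply: contraNneq yt1 => <-.
have inD1 h : h \in t1 -> h \in D1 by rewrite /D1 inE mem_rcons inE => ->; rewrite !orbT.
have oh h : h \in t1 -> orient x y h != 0.
  move=> ht; apply: gA; rewrite ?sA ?ms ?eqxx ?ht ?orbT //.
    by apply: contraNneq yt1 => ->.
  by apply: contraNneq xt1 => ->.
have find : exists h, [/\ h \in D1, orient x y h != 0 & left D1 h].
  case: (ltgtP (orient x y v0) 0) (oh _ v0t) => // l _.
    have l' : 0 < orient y x v0 by rewrite orientN oppr_gt0.
    have [h [hD ho hl]] := extreme_left_orient sD1 cD1 (inD1 _ v0t) l'.
    by exists h; split=> //; rewrite -oppr_eq0 -orientN gt_eqF.
  have [h [hD ho hl]] := extreme_left_orient sD1 cD1 (inD1 _ v0t) l.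
  by exists h; split=> //; rewrite gt_eqF.
have [h [hD ho hl]] := find; exists h; split=> //.
  move: hD ho; rewrite /D1 inE mem_rcons inE => /or3P[/eqP->|/eqP->|//].
    by rewrite orientxyx eqxx.
  by rewrite orientxyy eqxx.
have hx : h != x by apply: contra_neq ho => ->; rewrite orientxyx.
have hy : h != y by apply: contra_neq ho => ->; rewrite orientxyy.
have uD1 := simple_uniq sD1; have D11 := simple_size1 sD1.
have b1 : (prev D1 h, h) \in arcs D1 by rewrite arcs_prev // hD eqxx.
have b2 : (h, next D1 h) \in arcs D1 by rewrite arcs_next // hD eqxx.
have b1' : (prev D1 h, h) \in arcs s.
  by move: b1; rewrite a1 mem_rcons inE xpair_eqE (negbTE hx) andbF => /sC1.
have b2' : (h, next D1 h) \in arcs s.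
  by move: b2; rewrite a1 mem_rcons inE xpair_eqE (negbTE hy) => /sC1.
by move: hl; rewrite (left_arcs uD1 D11 b1 b2) (left_arcs us (ltnW s2) b1' b2').
Qed.

(** The point p lies so close to the hull edge qr that every other point sees
    it, and sees it between q and r. *)
Definition ear A p q r : Prop :=
  [/\ general_position A, [/\ p \in A, q \in A & r \in A], 0 < orient q r p,
    forall w, w \in A -> w != p -> w != q -> w != r ->
      [/\ 0 < orient q r w, 0 < orient q p w & 0 < orient p r w]
  & exists w, [/\ w \in A, w != p, w != q & w != r]].

Section EarFacts.
Variables (A : {fset plane R}) (p q r : plane R).
Hypothesis E : ear A p q r.

Let gA : general_position A. Proof. by case: E. Qed.
Let pA : p \in A. Proof. by case: E => _ []. Qed.
Let qA : q \in A. Proof. by case: E => _ []. Qed.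
Let rA : r \in A. Proof. by case: E => _ []. Qed.
Let o0 : 0 < orient q r p. Proof. by case: E. Qed.
Let cone w : w \in A -> w != p -> w != q -> w != r ->
  [/\ 0 < orient q r w, 0 < orient q p w & 0 < orient p r w].
Proof. by case: E => _ _ _ H _; exact: H. Qed.

Lemma ear_neq : [/\ p != q, q != r & p != r].
Proof.
split; apply: contraTneq o0 => ->; by rewrite ?orientxx ?orientxyx ?orientxyy ltxx.
Qed.

Lemma ear_card : (2 < #|` A|)%N.
Proof.
have [pq qr pr] := ear_neq.
have sub : ([fset p; q; r] `<=` A)%fset.
  by apply/fsubsetP => z; rewrite !inE -orbA => /or3P[]/eqP->.
apply: leq_trans (fsubset_leq_card sub).
rewrite -[3%N]/(size [:: p; q; r]); apply: uniq_leq_size.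
  by rewrite /= !inE negb_or pq pr qr.
by move=> z; rewrite !inE -orbA.
Qed.

Lemma ear_hull : hull A q r.
Proof.
have [pq qr pr] := ear_neq.
apply/hullP; split=> // z zA zq zr; have [->//|zp] := eqVneq z p.
by have [] := cone zA zp zq zr.
Qed.

Lemma ear_p_nohull y : hull A p y = false /\ hull A y p = false.
Proof.
have [pq qr pr] := ear_neq; have [w [wA wp wq wr]] : exists w, [/\ w \in A, w != p, w != q & w != r].
  by case: E.
have [c1 c2 c3] := cone wA wp wq wr.
split; apply/negP => /hullP[hA hB hne H].
  have [yq|yq] := eqVneq y q.
    by subst y; have := H w wA wp wq; move: c2; rewrite /orient; lra.
  have [yr|yr] := eqVneq y r.
    subst y; have := H q qA; rewrite eq_sym => /(_ pq qr).
    by move: o0; rewrite /orient; lra.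
  have yp : y != p by rewrite eq_sym.
  have [_ _ d3] := cone hB yp yq yr.
  have := H r rA; rewrite eq_sym => /(_ pr); rewrite eq_sym => /(_ yr).
  by move: d3; rewrite /orient; lra.
have [yq|yq] := eqVneq y q.
  subst y; have := H r rA; rewrite eq_sym => /(_ qr); rewrite eq_sym => /(_ pr).
  by move: o0; rewrite /orient; lra.
have [yr|yr] := eqVneq y r.
  by subst y; have := H w wA wr wp; move: c3; rewrite /orient; lra.
have [_ d2 _] := cone hA hne yq yr.
have := H q qA; rewrite eq_sym => /(_ yq); rewrite eq_sym => /(_ pq).
by move: d2; rewrite /orient; lra.
Qed.

Lemma crossN (e f : plane R * plane R) : cross (e.2, e.1) f = cross e f.
Proof.
by rewrite /cross /= (orientN e.1) (orientN e.1 e.2) mulrNN [orient f.1 f.2 e.2 * _]mulrC.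
Qed.

Lemma ear_nocross : {in A &, forall u v, [/\ ~~ cross (q, r) (u, v),
  ~~ cross (q, p) (u, v) & ~~ cross (p, r) (u, v)]}.
Proof.
have [pq qr pr] := ear_neq.
have pts u : u \in A -> [\/ u = p, u = q, u = r |
    [/\ u != p, u != q, u != r & [/\ 0 < orient q r u, 0 < orient q p u & 0 < orient p r u]]].
  move=> uA; have [->|up] := eqVneq u p; first by constructor 1.
  have [->|uq] := eqVneq u q; first by constructor 2.
  have [->|ur] := eqVneq u r; first by constructor 3.
  by constructor 4; split=> //; exact: cone.
have nn (k l : R) : 0 <= k -> 0 <= l -> (k * l < 0) = false.
  by move=> h1 h2; rewrite ltNge mulr_ge0.
move=> u v uA vA; split; apply/negP => /andP[/= h1 h2].
- move: h1; rewrite nn //; exact: hull_ge0 ear_hull _.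
- have rw (w : plane R) : 0 < orient q r w -> 0 < orient p r w ->
      (orient r w q * orient r w p < 0) = false /\ (orient w r q * orient w r p < 0) = false.
    move=> w1 w3; have e1 : orient r w q = orient q r w by rewrite /orient; ring.
    have e2 : orient r w p = orient p r w by rewrite /orient; ring.
    by rewrite !(orientN r w) e1 e2 mulrNN nn // ltW.
  move: h1 h2; case: (pts u uA) => [->|->|->|[_ _ _ [u1 u2 u3]]];
    case: (pts v vA) => [->|->|->|[_ _ _ [v1 v2 v3]]];
    rewrite ?orientxx ?orientxyx ?orientxyy ?mulr0 ?mul0r ?ltxx //.
  + by move=> _; have [->] := rw v v1 v3.
  + by move=> _; have [_ ->] := rw u u1 u3.
  by rewrite nn // ltW.
have qw (w : plane R) : 0 < orient q r w -> 0 < orient q p w ->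
    (orient q w p * orient q w r < 0) = false /\ (orient w q p * orient w q r < 0) = false.
  move=> w1 w3; have e1 : orient q w p = - orient q p w by rewrite /orient; ring.
  have e2 : orient q w r = - orient q r w by rewrite /orient; ring.
  by rewrite !(orientN q w) e1 e2 !mulrNN nn // ltW.
move: h1 h2; case: (pts u uA) => [->|->|->|[_ _ _ [u1 u2 u3]]];
  case: (pts v vA) => [->|->|->|[_ _ _ [v1 v2 v3]]];
  rewrite ?orientxx ?orientxyx ?orientxyy ?mulr0 ?mul0r ?ltxx //.
+ by move=> _; have [->] := qw v v1 v2.
+ by move=> _; have [_ ->] := qw u u1 u2.
by rewrite nn // ltW.
Qed.

(** A vertex farthest from the line qr; it stays extreme whichever of the points
    p, q, r belong to the polygon. *)
Lemma ear_extreme t : t != [::] -> {subset t <= A} -> p \notin t -> q \notin t -> r \notin t ->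
  exists h u, h \in t /\ {in [:: p, q, r & t], forall v, v != h -> dot u v < dot u h}.
Proof.
move=> t0 tA pt' qt rt.
have [w wt] : exists w, w \in t by case: (t) t0 => // w t' _; exists w; exact: mem_head.
have far v : v \in t -> orient q r p < orient q r v.
  move=> vt; have [v1 v2 v3] : [/\ 0 < orient q r v, 0 < orient q p v & 0 < orient p r v].
    apply: cone; first exact: tA.
    - by apply: contraNneq pt' => <-.
    - by apply: contraNneq qt => <-.
    by apply: contraNneq rt => <-.
  have : orient q r v = orient q p v + orient p r v + orient q r p by rewrite /orient; ring.
  by move=> ->; rewrite ltrDr addr_gt0.
have [||h [u [hS hd ext]]] := @extreme_exists R [:: p, q, r & t] (onorm q r)
    (dot (onorm q r) p) w.
- by rewrite !inE wt !orbT.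
- by have := far w wt; rewrite !orient_dot ltrD2r.
exists h, u; split=> //.
have hp : orient q r p < orient q r h by rewrite !orient_dot ltrD2r.
move: hS; rewrite !inE => /or4P[/eqP hE|/eqP hE|/eqP hE|//]; move: hp; rewrite hE.
- by rewrite ltxx.
- by rewrite orientxyx => /(lt_trans o0); rewrite ltxx.
by rewrite orientxyy => /(lt_trans o0); rewrite ltxx.
Qed.

Section Inserts.
Variable t : seq (plane R).
Hypotheses (t0 : t != [::]) (ut : uniq t) (tA : {subset t <= A})
  (pt' : p \notin t) (qt : q \notin t) (rt : r \notin t).

Let conet v : v \in t -> [/\ 0 < orient q r v, 0 < orient q p v & 0 < orient p r v].
Proof.
move=> vt; apply: cone; first exact: tA.
- by apply: contraNneq pt' => <-.
- by apply: contraNneq qt => <-.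
by apply: contraNneq rt => <-.
Qed.

Let ext_perm (a b c : plane R) h u : [:: p, q, r & t] =i [:: a, b, c & t] ->
  {in [:: p, q, r & t], forall v, v != h -> dot u v < dot u h} ->
  {in [:: a, b, c & t], forall v, v != h -> dot u v < dot u h}.
Proof. by move=> H K v; rewrite -H; exact: K. Qed.

(** In this and the next two lemmas the new turn at p, and the turns it changes,
    have the signs required by [psi_insert]. *)
Lemma insert_p : psi [:: q, r & t] <-> psi [:: q, p, r & t].
Proof.
have [pq qr pr] := ear_neq; have [h [u [ht ext]]] := ear_extreme t0 tA pt' qt rt.
apply: (psi_insert (A := A) (h := h) (u := u)) => //.
- by move=> v; rewrite !inE => /or4P[/eqP->|/eqP->|/eqP->|/tA].
- by rewrite /= !inE !negb_or eq_sym pq qr pr pt' qt rt ut.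
- move=> v w vA wA; have [h1 h2 h3] := ear_nocross vA wA; split=> //.
- by apply: ext_perm ext => v; rewrite !inE orbCA.
move=> l n lt nt; have [l1 l2 l3] := conet lt; have [n1 n2 n3] := conet nt.
have -> : orient l q r = orient q r l by rewrite /orient; ring.
have -> : orient l q p = orient q p l by rewrite /orient; ring.
have -> : orient q p r = - orient q r p by rewrite /orient; ring.
by rewrite l1 l2 n1 n3 oppr_gt0 (lt_gtF o0).
Qed.

Lemma insert_r : psi [:: q, p & t] <-> psi [:: q, r, p & t].
Proof.
have [pq qr pr] := ear_neq; have [h [u [ht ext]]] := ear_extreme t0 tA pt' qt rt.
apply: (psi_insert (A := A) (h := h) (u := u)) => //.
- by move=> v; rewrite !inE => /or4P[/eqP->|/eqP->|/eqP->|/tA].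
- by rewrite /= !inE !negb_or (eq_sym q p) (eq_sym r p) pq qr pr pt' qt rt ut.
- move=> v w vA wA; have [h1 h2 h3] := ear_nocross vA wA; split=> //.
  by rewrite (crossN (p, r)).
- by apply: ext_perm ext => v; rewrite !inE; do 3!case: (_ == _).
move=> l n lt nt; have [l1 l2 l3] := conet lt; have [n1 n2 n3] := conet nt.
have -> : orient l q r = orient q r l by rewrite /orient; ring.
have -> : orient l q p = orient q p l by rewrite /orient; ring.
have -> : orient r p n = - orient p r n by rewrite /orient; ring.
by rewrite l1 l2 n2 o0 oppr_gt0 (lt_gtF n3).
Qed.

Lemma insert_q : psi [:: p, r & t] <-> psi [:: p, q, r & t].
Proof.
have [pq qr pr] := ear_neq; have [h [u [ht ext]]] := ear_extreme t0 tA pt' qt rt.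
apply: (psi_insert (A := A) (h := h) (u := u)) => //.
- by move=> v; rewrite !inE => /or4P[/eqP->|/eqP->|/eqP->|/tA].
- by rewrite /= !inE !negb_or pq qr pr pt' qt rt ut.
- move=> v w vA wA; have [h1 h2 h3] := ear_nocross vA wA; split=> //.
  by rewrite (crossN (q, p)).
move=> l n lt nt; have [l1 l2 l3] := conet lt; have [n1 n2 n3] := conet nt.
have -> : orient l p r = orient p r l by rewrite /orient; ring.
have -> : orient l p q = - orient q p l by rewrite /orient; ring.
have -> : orient p q r = orient q r p by rewrite /orient; ring.
by rewrite l3 n3 n1 o0 oppr_gt0 (lt_gtF l2).
Qed.

End Inserts.

End EarFacts.
End Ear.

(** * Angles of a tiling at a point *)

Section EarTiling.
Local Open Scope fset_scope.
Local Open Scope ring_scope.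
Context {R : realType}.
Implicit Types (x y z a b c d h m v u w : plane R) (s t : seq (plane R)).

Lemma near_wedge_open a h b z : wedge a h b z -> \forall y \near z, wedge a h b y.
Proof.
rewrite /wedge; case: ifP => _.
  move=> /andP[h1 h2]; near=> y; apply/andP; split; near: y; exact: near_orient_gt0.
move=> /orP[h1|h1]; near=> y; apply/orP; [left|right]; near: y; exact: near_orient_gt0.
Unshelve. all: by end_near. Qed.

Section Angles.
Variables (A : {fset plane R}) (T : {fset polygon R}).
Hypotheses (gA : general_position A) (A2 : (2 < #|` A|)%N)
  (fT : psi_family A T) (cT : chain A T).

(** A common point of the angles suffices, since the angles are open and one can
    pass to a generic point close by. *)
Lemma wedge_overlap s s' h a b a' b' z : psi s -> psi s' -> {subset s <= A} -> {subset s' <= A} ->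
  edges s \in T -> edges s' \in T ->
  (a, h) \in arcs s -> (h, b) \in arcs s -> (a', h) \in arcs s' -> (h, b') \in arcs s' ->
  wedge a h b z -> wedge a' h b' z -> edges s = edges s'.
Proof.
move=> ps ps' sA s'A sT s'T ah hb ah' hb' w1 w2.
have [ss _ _] := ps; have [ss' _ _] := ps'.
have [y [wy wy'] [gy _]] := generic_near A (filterI (near_wedge_open w1) (near_wedge_open w2)).
have yE : y = h + (y - h) by rewrite addrC subrK.
have [/= aA hA] := arcs_mem ah; have [/= _ bA] := arcs_mem hb.
have [/= a'A _] := arcs_mem ah'; have [/= _ b'A] := arcs_mem hb'.
have [_ n1 n2 _] := arcs_turn ss ah hb; have [_ n3 n4 _] := arcs_turn ss' ah' hb'.
have gen u v : u \in A -> v \in A -> u != v -> orient u v (h + (y - h)) != 0.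
  by rewrite -yE; exact: gy.
have [aA' hA' bA'] : [/\ a \in A, h \in A & b \in A] by split; exact: sA.
have [a'A' b'A'] : a' \in A /\ b' \in A by split; exact: s'A.
apply: (wedge_inj gA A2 fT cT ps ps' sT s'T ah hb ah' hb' (d := y - h)).
- exact: gen.
- exact: gen.
- exact: gen.
- exact: gen.
- by rewrite -yE.
by rewrite -yE.
Qed.

(** Two angles larger than pi at the same point overlap. *)
Lemma reflex_inj s s' h a b a' b' : psi s -> psi s' -> {subset s <= A} -> {subset s' <= A} ->
  edges s \in T -> edges s' \in T ->
  (a, h) \in arcs s -> (h, b) \in arcs s -> (a', h) \in arcs s' -> (h, b') \in arcs s' ->
  orient a h b < 0 -> orient a' h b' < 0 -> edges s = edges s'.
Proof.
move=> ps ps' sA s'A sT s'T ah hb ah' hb' l l'.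
have [aa|aa] := eqVneq a a'; first by subst a'; exact: (same_arc gA A2 fT cT ps ps' sT s'T ah ah').
have [/= aA hA] := arcs_mem ah; have [/= a'A _] := arcs_mem ah'.
have [ss _ _] := ps; have [ss' _ _] := ps'.
have [_ n1 _ _] := arcs_turn ss ah hb; have [_ n3 _ _] := arcs_turn ss' ah' hb'.
have c0 : orient a h a' != 0.
  by apply: gA => //; [exact: sA|exact: sA|exact: s'A|rewrite eq_sym].
pose z := h + (- orient a h a') *: (a - a').
have c2 : 0 < orient a h a' * orient a h a' by rewrite -expr2 exprn_even_gt0.
have z1 : orient a h z = orient a h a' * orient a h a'.
  by rewrite /z /orient !pE; ring.
have z2 : orient a' h z = orient a h a' * orient a h a'.
  by rewrite /z /orient !pE; ring.
apply: (wedge_overlap (z := z) ps ps' sA s'A sT s'T ah hb ah' hb').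
  by rewrite /wedge (lt_gtF l) z1 c2.
by rewrite /wedge (lt_gtF l') z2 c2.
Qed.

End Angles.

Variables (A : {fset plane R}) (p q r : plane R) (T : {fset polygon R}).
Hypotheses (E : ear A p q r) (fT : psi_family A T) (cT : chain A T).

Let gA : general_position A. Proof. by case: E. Qed.
Let pA : p \in A. Proof. by case: E => _ []. Qed.
Let qA : q \in A. Proof. by case: E => _ []. Qed.
Let rA : r \in A. Proof. by case: E => _ []. Qed.
Let o0 : 0 < orient q r p. Proof. by case: E. Qed.
Let cone w : w \in A -> w != p -> w != q -> w != r ->
  [/\ 0 < orient q r w, 0 < orient q p w & 0 < orient p r w].
Proof. by case: E => _ _ _ H _; exact: H. Qed.
Let A2 : (2 < #|` A|)%N. Proof. exact: (ear_card E). Qed.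

Let tri := [:: q; r; p].

Lemma psi_ear_tri : psi tri. Proof. exact: psi_tri. Qed.

Let triA : {subset tri <= A}.
Proof. by move=> v; rewrite !inE => /or3P[]/eqP->. Qed.

Let tri1 : (q, r) \in arcs tri. Proof. by rewrite /= !inE eqxx. Qed.
Let tri2 : (r, p) \in arcs tri. Proof. by rewrite /= !inE eqxx ?orbT. Qed.
Let tri3 : (p, q) \in arcs tri. Proof. by rewrite /= !inE eqxx ?orbT. Qed.

(** All further points lie in the cone opposite to the angle of the triangle at
    p, so an angle larger than pi that avoids the triangle ends at both its
    sides. *)
Lemma reflex_beside_tri s a b : edges tri \in T -> psi s -> {subset s <= A} -> edges s \in T ->
  (a, p) \in arcs s -> (p, b) \in arcs s -> orient a p b < 0 -> a = q /\ b = r.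
Proof.
move=> tT ps sA sT ap pb l.
have [pq qr pr] := ear_neq E; have ptri := psi_ear_tri.
have [ss _ _] := ps; have us := simple_uniq ss; have s1 := simple_size1 ss.
have no : edges s <> edges tri.
  move=> eE; have := left_arcs us s1 ap pb; rewrite (lt_gtF l).
  have : ~ reflex_vertex (edges tri) p.
    move=> /(reflex_edges _ ptri)[_ /negP]; apply.
    by rewrite (left_arcs (simple_uniq (let: And3 h _ _ := ptri in h)) _ tri2 tri3) //
      /orient; move: o0; rewrite /orient; lra.
  rewrite -eE => N lE; apply: N; apply/(reflex_edges _ ps).
  by rewrite lE; split=> //; have [] := arcs_mem ap.
have [/= aA _] := arcs_mem ap; have [/= _ bA] := arcs_mem pb.
have [_ ap' pb' ab] := arcs_turn ss ap pb.
have orpq : orient r p q = orient q r p by rewrite /orient; ring.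
have wtri z : 0 < orient r p z -> 0 < orient p q z -> wedge r p q z.
  by move=> h1 h2; rewrite /wedge h1 h2 orpq o0.
have opqr : orient p q r = orient q r p by rewrite /orient; ring.
have ar : a != r.
  by apply: contra_not_neq no => e1; subst a; exact: (same_arc gA A2 fT cT ps ptri sT tT ap tri2).
have bq : b != q.
  by apply: contra_not_neq no => e1; subst b; exact: (same_arc gA A2 fT cT ps ptri sT tT pb tri3).
have aq : a = q.
  apply: contrapT => /eqP aq; apply: no.
  have [_ Y X] := cone (sA _ aA) ap' aq ar.
  pose z := p + (2 * orient q p a) *: (r - p) + orient p r a *: (q - p).
  apply: (wedge_overlap gA A2 fT cT (z := z) ps ptri sA triA sT tT ap pb tri2 tri3).
    rewrite /wedge (lt_gtF l); apply/orP; left.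
    have -> : orient a p z = orient q p a * orient p r a by rewrite /z /orient !pE; ring.
    exact: mulr_gt0.
  apply: wtri.
    have -> : orient r p z = orient p r a * orient q r p by rewrite /z /orient !pE; ring.
    exact: mulr_gt0.
  have -> : orient p q z = 2 * orient q p a * orient q r p by rewrite /z /orient !pE; ring.
  by rewrite !mulr_gt0.
split=> //; apply: contrapT => /eqP br; apply: no.
have bp : b != p by rewrite eq_sym.
have [_ Y X] := cone (sA _ bA) bp bq br.
pose z := p + orient q p b *: (r - p) + (2 * orient p r b) *: (q - p).
apply: (wedge_overlap gA A2 fT cT (z := z) ps ptri sA triA sT tT ap pb tri2 tri3).
  rewrite /wedge (lt_gtF l); apply/orP; right.
  have -> : orient p b z = orient q p b * orient p r b by rewrite /z /orient !pE; ring.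
  exact: mulr_gt0.
apply: wtri.
  have -> : orient r p z = 2 * orient p r b * orient q r p by rewrite /z /orient !pE; ring.
  by rewrite !mulr_gt0.
have -> : orient p q z = orient q p b * orient q r p by rewrite /z /orient !pE; ring.
exact: mulr_gt0.
Qed.

End EarTiling.

(** * The polygon at the hull edge *)

Section Classes.
Local Open Scope fset_scope.
Local Open Scope ring_scope.
Context {R : realType}.
Implicit Types (x y z a b c d h m v u w : plane R) (s t : seq (plane R)).
Variables (A : {fset plane R}) (p q r : plane R) (T : {fset polygon R}).
Hypotheses (E : ear A p q r) (fT : psi_family A T) (cT : chain A T).
Hypothesis covT : (\bigcup_(P <- T) vertices P)%fset = A.

Let gA : general_position A. Proof. by case: E. Qed.
Let pA : p \in A. Proof. by case: E => _ []. Qed.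
Let qA : q \in A. Proof. by case: E => _ []. Qed.
Let rA : r \in A. Proof. by case: E => _ []. Qed.
Let o0 : 0 < orient q r p. Proof. by case: E. Qed.
Let cone w : w \in A -> w != p -> w != q -> w != r ->
  [/\ 0 < orient q r w, 0 < orient q p w & 0 < orient p r w].
Proof. by case: E => _ _ _ H _; exact: H. Qed.
Let A2 : (2 < #|` A|)%N. Proof. exact: (ear_card E). Qed.

Let orpq : orient r p q = orient q r p. Proof. by rewrite /orient; ring. Qed.
Let opqr : orient p q r = orient q r p. Proof. by rewrite /orient; ring. Qed.

Let open_tri z := [/\ 0 < orient q r z, 0 < orient r p z & 0 < orient p q z].

Let open_tri_seg u v z : u \in A -> v \in A -> open_tri z -> ~ seg u v z.
Proof.
move=> uA vA [z1 z2 z3] hz.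
have le0 a b : orient a b u <= 0 -> orient a b v <= 0 -> orient a b z <= 0.
  by case: hz => t [t0 t1 ->] h1 h2; rewrite orient_cvx; apply: ler_wnDl; apply: mulr_ge0_le0; rewrite ?subr_ge0.
have pts w : w \in A -> [\/ w = p, w = q, w = r |
    orient p q w < 0 /\ orient r p w < 0].
  move=> wA; have [->|wp] := eqVneq w p; first by constructor 1.
  have [->|wq] := eqVneq w q; first by constructor 2.
  have [->|wr] := eqVneq w r; first by constructor 3.
  constructor 4; have [_ h2 h3] := cone wA wp wq wr.
  by rewrite (orientN q p) (orientN p r) !oppr_lt0.
have no a b : 0 < orient a b z -> orient a b u <= 0 -> orient a b v <= 0 -> False.
  by move=> h h1 h2; have := le0 _ _ h1 h2; rewrite leNgt h.
have := no p q z3; have := no r p z2; have := no q r z1.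
case: (pts u uA) => [->|->|->|[u1 u2]]; case: (pts v vA) => [->|->|->|[v1 v2]];
  rewrite ?orientxx ?orientxyx ?orientxyy ?lexx ?(ltW u1) ?(ltW u2) ?(ltW v1) ?(ltW v2);
  by auto.
Qed.

Let open_tri_bd s z : {subset s <= A} -> open_tri z -> ~ bd s z.
Proof. by move=> sA oz [e /arcs_mem[/sA h1 /sA h2]]; exact: open_tri_seg. Qed.

Let open_tri_wind s z z' : {subset s <= A} -> open_tri z -> open_tri z' ->
  wind s z = wind s z'.
Proof.
move=> sA [z1 z2 z3] [z1' z2' z3']; apply: wind_invariant => y hy.
by apply: open_tri_bd => //; split; apply: orient_seg_gt0 hy.
Qed.

Let c := 3^-1 *: (q + r + p).

Let c_open x (k : R) : 0 < k -> k <= 1 -> 0 <= orient q r x -> 0 <= orient r p x ->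
  0 <= orient p q x -> open_tri (x + k *: (c - x)).
Proof.
move=> k0 k1 h1 h2 h3.
have main a b : 0 <= orient a b x -> orient a b c = 3^-1 * orient q r p ->
    0 < orient a b (x + k *: (c - x)).
  move=> h oc; rewrite orient_cvx oc; apply: ltr_wpDl.
    by rewrite mulr_ge0 // subr_ge0.
  by rewrite !mulr_gt0 // invr_gt0.
by split; apply: main => //; rewrite /orient /c !pE; field.
Qed.

(** The open triangle is crossed by no segment, so the winding number on it is
    the one just left of the arc qr. *)
Let tri_wind s : psi s -> {subset s <= A} -> (q, r) \in arcs s ->
  forall z, open_tri z -> wind s z = 1.
Proof.
move=> [ss cs _] sA qr_s z oz.
have half0 : 0 < 1 / 2 :> R by lra.
have half1 : 1 / 2 < 1 :> R by lra.
set m := q + (1 / 2) *: (r - q).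
have [e e0 He] := near_ray (c - m) (near_arc ss cs qr_s half0 half1 (erefl m)).
pose k := Num.min (e / 2) 1.
have k0 : 0 < k by rewrite lt_min ltr01 divr_gt0.
have k1 : k <= 1 by rewrite ge_min lexx orbT.
have ke : k < e by rewrite gt_min; apply/orP; left; lra.
have oz' : open_tri (m + k *: (c - m)).
  apply: c_open => //; rewrite /m orient_cvx ?orientxyx ?orientxyy ?mulr0 ?addr0 ?add0r //.
    by apply: mulr_ge0; [lra|rewrite orpq ltW].
  by apply: mulr_ge0; [lra|rewrite opqr ltW].
rewrite (open_tri_wind sA oz oz').
have [_ H] := He k ltac:(by rewrite gtr0_norm).
by rewrite (H (open_tri_bd sA oz')); have [h _ _] := oz'; rewrite h.
Qed.

Let tri_wind_closed s x : psi s -> {subset s <= A} -> (q, r) \in arcs s -> ~ bd s x ->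
  0 <= orient q r x -> 0 <= orient r p x -> 0 <= orient p q x -> wind s x = 1.
Proof.
move=> ps sA qrs nx h1 h2 h3.
have [e e0 He] := near_ray (c - x) (wind_near nx).
pose k := Num.min (e / 2) 1.
have k0 : 0 < k by rewrite lt_min ltr01 divr_gt0.
have k1 : k <= 1 by rewrite ge_min lexx orbT.
have ke : k < e by rewrite gt_min; apply/orP; left; lra.
by rewrite -(He k) ?gtr0_norm //; apply: tri_wind => //; exact: c_open.
Qed.

(** The polygon at the hull edge qr contains the triangle pqr; since p must be a
    vertex of some polygon, it is a vertex of this one. *)
Lemma ear_vertex s : psi s -> edges s \in T -> {subset s <= A} -> (q, r) \in arcs s ->
  p \in s.
Proof.
move=> ps sT sA qrs; apply: contrapT => /negP ps'.
have np : ~ bd s p.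
  move=> [[a b] ab /= hz]; have [/= as_ bs] := arcs_mem ab.
  have pa : a != p by apply: contraNneq ps' => <-.
  have pb : b != p by apply: contraNneq ps' => <-.
  have [ss _ _] := ps.
  have ab' : a != b by apply: contraTneq ab => ->; rewrite arcs_irr.
  have : orient a b p != 0 by apply: gA => //; exact: sA.
  by case: hz => t [_ _ ->]; rewrite orient_cvx orientxyx orientxyy !mulr0 addr0 eqxx.
have wp : wind s p = 1.
  by apply: tri_wind_closed => //; rewrite ?orientxyx ?orientxyy //; exact: ltW.
have : p \in (\bigcup_(P <- T) vertices P)%fset by rewrite covT.
move=> /mem_cover[P PT]; have [s' [ps2 PE s'A]] := fT PT; rewrite PE in PT *.
have [ss' cs' _] := ps2.
rewrite vertices_edges ?(simple_uniq ss') ?(simple_size1 ss') // => ps3.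
have [_ H] := ccw_values ss' cs'.
have [_ [y [[h1 h2] h3 h4]]] := H p _ (bd_vertex ps3) (filterI (near_notin_bd np) (wind_near np)).
have EE := inside_inj gA A2 fT cT ps ps2 sT PT h1 (etrans h2 wp) h3 h4.
have [ss _ _] := ps.
case/negP: ps'; rewrite -(vertices_edges (simple_uniq ss) (simple_size1 ss)) EE.
by rewrite vertices_edges ?(simple_uniq ss') ?(simple_size1 ss').
Qed.

(** If p were adjacent to neither q nor r in that polygon, cutting along the
    chords pq and pr would exhibit a convex vertex on each side of p, in
    addition to q, r: one too many. *)
Lemma ear_polygon : exists s, [/\ psi s, edges s \in T &
  [\/ s = [:: q; r; p],
      exists t, [/\ t != [::], {subset t <= A}, uniq [:: p, q, r & t] & s = [:: q, r, p & t]]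
    | exists t, [/\ t != [::], {subset t <= A}, uniq [:: p, q, r & t] & s = [:: p, q, r & t]]]].
Proof.
have [pq qr pr] := ear_neq E.
have [s0 [ps0 s0T s0A qrs0]] := hull_arc A2 fT cT (ear_hull E).
have [ss0 _ _] := ps0; have us0 := simple_uniq ss0; have s01 := simple_size1 ss0.
have [n [t st]] := rot_arc us0 s01 qrs0.
have : exists s, [/\ psi s, edges s \in T, {subset s <= A} & s = [:: q, r & t]].
  exists (rot n s0); split=> //; first exact: psi_rot.
    by rewrite edges_rot.
  by move=> v; rewrite mem_rot; exact: s0A.
move=> [s [ps sT sA sE]] {s0 ps0 s0T s0A qrs0 ss0 us0 s01 n st}.
have [ss cs ls] := ps; have us := simple_uniq ss; have s1 := simple_size1 ss.
have aqr : (q, r) \in arcs s by rewrite sE /= mem_head.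
have : p \in s by exact: ear_vertex.
rewrite sE !inE (negbTE pq) (negbTE pr) /= => pt'.
case/splitPr: pt' sE => t1 t2 sE.
have us' : uniq (q :: r :: t1 ++ p :: t2) by rewrite -sE.
have up : uniq [:: p, q, r & t1 ++ t2].
  have pe : perm_eq ([:: q, r & t1] ++ [:: p] ++ t2) ([:: p] ++ [:: q, r & t1] ++ t2).
    by rewrite perm_catCA.
  by have := perm_uniq pe; rewrite /= => <-.
have tA v : v \in t1 ++ t2 -> v \in A.
  by rewrite mem_cat => h; apply: sA; rewrite sE !inE mem_cat inE; case/orP: h => ->; rewrite ?orbT.
have [e1|n1] := eqVneq t1 [::].
  exists s; split=> //; have [e2|n2] := eqVneq t2 [::].
    by constructor 1; rewrite sE e1 e2.
  constructor 2; exists t2; split=> //.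
  - by move=> v vt; apply: tA; rewrite mem_cat vt orbT.
  - by rewrite e1 in up.
  by rewrite sE e1.
have [e2|n2] := eqVneq t2 [::].
  exists [:: p, q, r & t1]; subst t2; rewrite cats0 in up tA.
  have rE : [:: p, q, r & t1] = rot (size t1).+2 s.
    by rewrite sE; exact: esym (rot_size_cat [:: q, r & t1] [:: p]).
  split; [by rewrite rE; exact: psi_rot|by rewrite rE edges_rot|].
  by constructor 3; exists t1.
exfalso.
have ncr : {in A &, forall u v, ~~ cross (r, p) (u, v)}.
  by move=> u v uA vA; rewrite (crossN (p, r)); have [] := ear_nocross E uA vA.
have ncq : {in A &, forall u v, ~~ cross (p, q) (u, v)}.
  by move=> u v uA vA; rewrite (crossN (q, p)); have [] := ear_nocross E uA vA.
(* the midpoints of the two chords are inside the polygon *)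
have mid a b : a \in A -> b \in A -> a != b -> {in A &, forall u v, ~~ cross (a, b) (u, v)} ->
    (a, b) \notin arcs s -> (b, a) \notin arcs s ->
    0 <= orient q r (a + (1 / 2) *: (b - a)) -> 0 <= orient r p (a + (1 / 2) *: (b - a)) ->
    0 <= orient p q (a + (1 / 2) *: (b - a)) ->
    ~ bd s (a + (1 / 2) *: (b - a)) /\ wind s (a + (1 / 2) *: (b - a)) = 1.
  move=> aA bA ab nc n3 n4 h1 h2 h3.
  have nb : ~ bd s (a + (1 / 2) *: (b - a)).
    move=> [[u v] uv /= hz]; have [/= us_ vs] := arcs_mem uv.
    have uv' : u != v by apply: contraTneq uv => ->; rewrite arcs_irr.
    have gpA : gpos (enum_fset A) by move=> x y z xA yA zA; exact: gA.
    have ne : [fset a; b] != [fset u; v].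
      apply/eqP => /fset2_eq[[E1 E2]|[E1 E2]]; subst.
        by rewrite uv in n3.
      by rewrite uv in n4.
    have /(_ (nc u v (sA _ us_) (sA _ vs))) := (meet_cross gpA aA bA (sA _ us_) (sA _ vs) ab uv' ne).2.
    move=> /(_ (a + (1 / 2) *: (b - a))) [].
    - by exists (1 / 2); split=> //; lra.
    - by [].
    have half : (1 / 2 : R) != 0 by rewrite gt_eqF //; lra.
    move=> + _; rewrite /= !inE => /orP[/eqP h|/eqP h].
      have /eqP : (1 / 2) *: (b - a) = 0 by apply/(addrI a); rewrite h addr0.
      by rewrite scaler_eq0 (negbTE half) subr_eq0 (eq_sym b) (negbTE ab).
    have /eqP : (1 / 2) *: (b - a) = 0.
      have -> : (1 / 2) *: (b - a) = b - (a + (1 / 2) *: (b - a)).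
        by apply: plane_eq; rewrite !pE; field.
      by rewrite h subrr.
    by rewrite scaler_eq0 (negbTE half) subr_eq0 (eq_sym b) (negbTE ab).
  by split=> //; apply: tri_wind_closed.
have arcN x y z : (x, y) \in arcs s -> z != y -> (x, z) \notin arcs s.
  move=> xy zy; rewrite arcs_next //; move: xy; rewrite arcs_next // => /andP[_ /eqP <-].
  by rewrite (negbTE zy) andbF.
have arcN' x y z : (x, y) \in arcs s -> z != x -> (z, y) \notin arcs s.
  move=> xy zy; rewrite arcs_prev //; move: xy; rewrite arcs_prev // => /andP[_ /eqP <-].
  by rewrite (negbTE zy) andbF.
have [[pt1 pt2] [qt1 qt2] [rt1 rt2]] : [/\ p \notin t1 /\ p \notin t2,
    q \notin t1 /\ q \notin t2 & r \notin t1 /\ r \notin t2].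
  move: up; rewrite /= !inE !mem_cat !negb_or => /and4P[/and4P[_ _ u1 u2] /and3P[_ u3 u4]].
  by move=> /andP[u5 u6] _; split.
have lst (x : plane R) l : l != [::] -> last x l \in l.
  by case: l => // a l' _; rewrite /= mem_last.
have arcr : (r, head p t1) \in arcs s.
  by rewrite sE; case: (t1) n1 => // x t' _; rewrite /= !inE eqxx orbT.
have arcq : (last p t2, q) \in arcs s.
  by rewrite sE /= rcons_cat rcons_cons /= pth_cat /= pth_rcons inE mem_cat inE mem_rcons inE eqxx !orbT.
have arcp : (last r t1, p) \in arcs s.
  by rewrite sE /= rcons_cat rcons_cons /= !inE pth_cat mem_cat /= inE eqxx ?orbT.
have arcp' : (p, head q t2) \in arcs s.
  rewrite sE /= rcons_cat rcons_cons /= !inE pth_cat mem_cat /= inE.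
  by case: (t2) n2 => // x t' _; rewrite /= !inE eqxx ?orbT.
have hp1 : p != head p t1.
  by case: (t1) n1 pt1 => // x t' _; rewrite inE negb_or /= => /andP[].
have hp2 : p != last p t2.
  by apply: contraNneq pt2 => e; rewrite [X in X \in _]e; exact: lst.
have hr : r != last r t1.
  by apply: contraNneq rt1 => e; rewrite [X in X \in _]e; exact: lst.
have hq : q != head q t2.
  by case: (t2) n2 qt2 => // x t' _; rewrite inE negb_or /= => /andP[].
have hr2 : r != head q t2.
  by case: (t2) n2 rt2 => // x t' _; rewrite inE negb_or /= => /andP[].
have hq1 : q != last r t1.
  by apply: contraNneq qt1 => e; rewrite [X in X \in _]e; exact: lst.
have [m1 w1] : ~ bd s (r + (1 / 2) *: (p - r)) /\ wind s (r + (1 / 2) *: (p - r)) = 1.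
  apply: mid => //; rewrite 1?eq_sym //.
  - exact: arcN' arcp hr.
  - exact: arcN arcp' hr2.
  - by rewrite orient_cvx orientxyy mulr0 add0r mulr_ge0 ?ltW //; lra.
  - by rewrite orient_cvx orientxyx orientxyy !mulr0 addr0.
  by rewrite orient_cvx orientxyx mulr0 addr0 opqr mulr_ge0 ?ltW //; lra.
have [m2 w2] : ~ bd s (p + (1 / 2) *: (q - p)) /\ wind s (p + (1 / 2) *: (q - p)) = 1.
  apply: mid => //.
  - exact: arcN arcp' hq.
  - exact: arcN' arcp hq1.
  - by rewrite orient_cvx orientxyx mulr0 addr0 mulr_ge0 ?ltW //; lra.
  - by rewrite orient_cvx orientxyy mulr0 add0r orpq mulr_ge0 ?ltW //; lra.
  by rewrite orient_cvx orientxyx orientxyy !mulr0 addr0.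
have rotc k : [/\ simple (rot k s), ccw (rot k s) & {subset rot k s <= A}].
  have [h1 h2 _] := psi_rot k ps; split=> //.
  by move=> v; rewrite mem_rot; exact: sA.
have bdr k z : bd (rot k s) z <-> bd s z by rewrite (bd_perm (arcs_rot k s)).
have wr k z : wind (rot k s) z = wind s z by rewrite (wind_perm z (arcs_rot k s)).
have [h1 [h1t _ h1l]] : exists h, [/\ h \in t1, orient r p h != 0 & left s h].
  have [s1' c1 sA1] := rotc 1%N.
  have E1 : rot 1 s = r :: t1 ++ p :: (rcons t2 q) by rewrite sE rot1_cons /= rcons_cat.
  have [|||h [ht ho hl]] := chord gA s1' c1 sA1 E1 n1 _ ncr.
  - by case: (t2).
  - by move=> /bdr.
  - by rewrite wr.
  by exists h; rewrite -(left_rot 1).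
have [h2 [h2t _ h2l]] : exists h, [/\ h \in t2, orient p q h != 0 & left s h].
  have [s1' c1 sA1] := rotc (size t1).+2.
  have E1 : rot (size t1).+2 s = p :: t2 ++ q :: r :: t1.
    by rewrite sE; exact: (rot_size_cat [:: q, r & t1] (p :: t2)).
  have [|||h [ht ho hl]] := chord gA s1' c1 sA1 E1 n2 _ ncq => //.
  - by move=> /bdr.
  - by rewrite wr.
  by exists h; rewrite -(left_rot (size t1).+2).
have [lq lr] := hull_left ps sA (ear_hull E).
have h12 : h1 != h2.
  apply: contraTneq h2t => <-; move: up => /= /and4P[_ _ _].
  rewrite cat_uniq => /and3P[_ /hasPn H _].
  by apply/negP => h; have := H _ h; rewrite /= h1t.
have : (size [:: q; r; h1; h2] <= count (left s) s)%N.
  apply: count_left_ge.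
  - rewrite /= !inE !negb_or qr.
    have -> : q != h1 by apply: contraNneq qt1 => ->.
    have -> : q != h2 by apply: contraNneq qt2 => ->.
    have -> : r != h1 by apply: contraNneq rt1 => ->.
    have -> : r != h2 by apply: contraNneq rt2 => ->.
    by rewrite h12.
  - by move=> v; rewrite sE !inE mem_cat inE => /or4P[]/eqP->; rewrite ?eqxx ?h1t ?h2t ?orbT.
  move=> v; rewrite !inE => /or4P[]/eqP-> //; [apply: lq|apply: lr]; by rewrite sE !inE eqxx ?orbT.
by rewrite ls.
Qed.

End Classes.

(** * Bijections given by exchanging polygons *)

Section Exchange.
Local Open Scope fset_scope.
Implicit Types (K I : choiceType).

Definition swap K (T D N : {fset K}) : {fset K} := N `|` (T `\` D).

Lemma in_swap K (T D N : {fset K}) x :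
  (x \in swap T D N) = (x \in N) || ((x \notin D) && (x \in T)).
Proof. by rewrite !inE. Qed.

Lemma swapK K (T D N : {fset K}) : D `<=` T -> (forall x, x \in N -> x \notin T) ->
  swap (swap T D N) N D = T.
Proof.
move=> /fsubsetP DT NT; apply/fsetP => x; rewrite !in_swap.
case xD: (x \in D) => /=; first by rewrite DT.
by case xN: (x \in N) => //=; rewrite (negbTE (NT x xN)).
Qed.

Lemma sum_swap_fset K (V : zmodType) (F : K -> V) (T D N : {fset K}) : D `<=` T ->
  (forall x, x \in N -> x \notin T) ->
  (\sum_(x <- swap T D N) F x = \sum_(x <- T) F x - \sum_(x <- D) F x + \sum_(x <- N) F x)%R.
Proof.
move=> /fsubsetP DT NT.
have p1 : perm_eq (enum_fset (swap T D N)) (enum_fset N ++ enum_fset (T `\` D)).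
  apply: uniq_perm; rewrite ?fset_uniq ?cat_uniq ?fset_uniq //=.
    rewrite andbT; apply/hasPn => x; rewrite inE => /andP[_ xT].
    by apply/negP => /= /NT; rewrite xT.
  by move=> x; rewrite mem_cat !inE.
have p2 : perm_eq (enum_fset T) (enum_fset D ++ enum_fset (T `\` D)).
  apply: uniq_perm; rewrite ?fset_uniq ?cat_uniq ?fset_uniq //=.
    by rewrite andbT; apply/hasPn => x; rewrite inE => /andP[].
  move=> x; rewrite mem_cat !inE; case xD: (x \in D) => //=.
  exact: DT.
rewrite (perm_big _ p1) (perm_big _ p2) !big_cat /=.
by rewrite GRing.addrC [X in (X - _)%R]GRing.addrC GRing.addrK.
Qed.

Lemma card_rel K I (X : {fset K}) (Y : {fset I}) (Rel : K -> I -> Prop) :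
  (forall x, x \in X -> exists2 y, y \in Y & Rel x y) ->
  (forall y, y \in Y -> exists2 x, x \in X & Rel x y) ->
  (forall x y y', x \in X -> Rel x y -> Rel x y' -> y = y') ->
  (forall x x' y, x \in X -> x' \in X -> Rel x y -> Rel x' y -> x = x') ->
  #|` X| = #|` Y|.
Proof.
move=> H1 H2 H3 H4.
have [E|[x0 x0X]] := fset_0Vmem X.
  have [->|[y0 y0Y]] := fset_0Vmem Y; first by rewrite E !cardfs0.
  by have [x] := H2 y0 y0Y; rewrite E in_fset0.
have [y0 _ _] := H1 x0 x0X.
have /choice[f Hf] x : exists y, x \in X -> y \in Y /\ Rel x y.
  have [xX|xX] := boolP (x \in X); last by exists y0.
  by have [y yY r] := H1 x xX; exists y.
have -> : Y = [fset f x | x in X].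
  apply/fsetP => y; apply/idP/imfsetP => [yY|[x /= xX ->]]; last by have [] := Hf x xX.
  have [x xX r] := H2 y yY; exists x => //; have [_ r'] := Hf x xX; exact: H3 r r'.
rewrite card_in_imfset //= => x x' xX x'X e.
have [_ r] := Hf x xX; have [_ r'] := Hf x' x'X; rewrite -e in r'; exact: H4 r r'.
Qed.

(** Every move can be undone, so that uniqueness of the move and of the inverse
    move makes the relation given by the moves a bijection. *)
Lemma exchange K J (valid : J -> Prop) (D N : J -> {fset K}) (X Y : {fset {fset K}}) :
  (forall T, T \in X -> exists t, [/\ valid t, D t `<=` T,
     forall x, x \in N t -> x \notin T & swap T (D t) (N t) \in Y]) ->
  (forall T, T \in Y -> exists t, [/\ valid t, N t `<=` T,
     forall x, x \in D t -> x \notin T & swap T (N t) (D t) \in X]) ->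
  (forall T t t', T \in X -> valid t -> valid t' -> D t `<=` T -> D t' `<=` T ->
     D t = D t' /\ N t = N t') ->
  (forall T t t', T \in Y -> valid t -> valid t' -> N t `<=` T -> N t' `<=` T ->
     D t = D t' /\ N t = N t') ->
  #|` X| = #|` Y|.
Proof.
move=> H1 H2 H3 H4.
pose Rel T T' := exists t, [/\ valid t, D t `<=` T, forall x, x \in N t -> x \notin T,
  T' = swap T (D t) (N t) & T' \in Y].
apply: (card_rel (Rel := Rel)).
- move=> T TX; have [t [v DT NT TY]] := H1 T TX.
  by exists (swap T (D t) (N t)) => //; exists t.
- move=> T' TY; have [t [v NT DT TX]] := H2 T' TY.
  exists (swap T' (N t) (D t)) => //; exists t; split=> //.
  + by apply/fsubsetP => x xD; rewrite in_swap xD.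
  + move=> x xN; rewrite in_swap xN orbF; apply/negP => /DT.
    by rewrite (fsubsetP NT).
  by rewrite swapK.
- move=> T T1 T2 TX [t [v DT NT -> _]] [t' [v' DT' NT' -> _]].
  by have [-> ->] := H3 T t t' TX v v' DT DT'.
move=> T1 T2 T' T1X T2X [t [v DT NT E TY]] [t' [v' DT' NT' E' _]].
have sub1 : N t `<=` T' by rewrite E; apply/fsubsetP => x xN; rewrite in_swap xN.
have sub2 : N t' `<=` T' by rewrite E'; apply/fsubsetP => x xN; rewrite in_swap xN.
have [eD eN] := H4 T' t t' TY v v' sub1 sub2.
by rewrite -(swapK DT NT) -E -(swapK DT' NT') -E' eD eN.
Qed.

End Exchange.

(** * Inserting a vertex into a polygon *)

Section Insertion.
Local Open Scope fset_scope.
Local Open Scope ring_scope.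
Context {R : realType}.
Implicit Types (x y z a b c d h m v u w : plane R) (s t : seq (plane R)).
Implicit Types (A W : {fset plane R}) (P Q : polygon R) (T : {fset polygon R}).

Definition arc1 (e : plane R * plane R) a b : int := Posz (e == (a, b)) - Posz (e == (b, a)).

Lemma chi_psi s a b : psi s -> chi (edges s) a b = \sum_(e <- arcs s) arc1 e a b.
Proof.
move=> ps; have [ss _ _] := ps; rewrite /chi !arcP_edges //.
have mem e0 : Posz (e0 \in arcs s) = \sum_(e <- arcs s) Posz (e == e0).
  have [es|es] := boolP (e0 \in arcs s).
    rewrite (bigD1_seq e0) ?arcs_uniq ?(simple_uniq ss) //= eqxx big1 ?addr0 //.
    by move=> e /negbTE ->.
  rewrite big_seq big1 // => e ee; case: eqP => // E; by rewrite -E ee in es.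
by rewrite !mem -sumrB.
Qed.

Lemma arc1C x y a b : arc1 (y, x) a b = - arc1 (x, y) a b.
Proof.
rewrite /arc1 !xpair_eqE opprB; congr (Posz (nat_of_bool _) - Posz (nat_of_bool _));
  by rewrite andbC.
Qed.

Lemma arcs_insertE x y z t : arcs [:: x, y & t] = (x, y) :: pth y (rcons t x) /\
  arcs [:: x, z, y & t] = [:: (x, z), (z, y) & pth y (rcons t x)].
Proof. by []. Qed.

Lemma chi_insert x y z t a b : psi [:: x, y & t] -> psi [:: x, z, y & t] ->
  chi (edges [:: x, z, y & t]) a b = chi (edges [:: x, y & t]) a b
    + arc1 (x, z) a b + arc1 (z, y) a b - arc1 (x, y) a b.
Proof.
move=> p1 p2; have [aE aE'] := arcs_insertE x y z t.
by rewrite !chi_psi // aE aE' !big_cons; ring.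
Qed.

Lemma chi_tri x y z a b : 0 < orient x y z ->
  chi (edges [:: x; y; z]) a b = arc1 (x, y) a b + arc1 (y, z) a b + arc1 (z, x) a b.
Proof.
by move=> o; rewrite chi_psi; [rewrite /arcs /= !big_cons big_nil addr0 addrA|exact: psi_tri].
Qed.

Lemma left_insert x y z t v : t != [::] -> uniq [:: x, z, y & t] -> v \in t ->
  left [:: x, y & t] v = left [:: x, z, y & t] v.
Proof.
move=> t0 us vt; have tp : (0 < size t)%N by rewrite lt0n size_eq0.
have us1 : uniq [:: x, y & t].
  by move: us; rewrite /= !inE !negb_or => /and4P[/and3P[_ -> ->] /andP[_ _] -> ->].
have [vx vy vz] : [/\ v != x, v != y & v != z].
  move: us => /= /and4P[]; rewrite !inE !negb_or => /and3P[_ _ n1] /andP[_ n2] n3 _.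
  by split; [apply: contraNneq n1 => <-|apply: contraNneq n3 => <-|apply: contraNneq n2 => <-].
have s1 : (1 < size [:: x, y & t])%N by [].
have s1' : (1 < size [:: x, z, y & t])%N by [].
have vs : v \in [:: x, y & t] by rewrite !inE vt !orbT.
have a1 : (prev [:: x, y & t] v, v) \in arcs [:: x, y & t] by rewrite arcs_prev // vs eqxx.
have a2 : (v, next [:: x, y & t] v) \in arcs [:: x, y & t] by rewrite arcs_next // vs eqxx.
have [aE aE'] := arcs_insertE x y z t.
rewrite (left_arcs us1 s1 a1 a2); apply/esym/left_arcs => //.
  move: a1; rewrite aE aE' !inE !xpair_eqE (negbTE vy) andbF /= => ->.
  by rewrite !orbT.
move: a2; rewrite aE aE' !inE !xpair_eqE (negbTE vx) /= => ->.
by rewrite !orbT.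
Qed.

Lemma edges_arcs s : uniq s -> (1 < size s)%N ->
  edges s = [fset [fset e.1; e.2] | e in arcs s].
Proof.
move=> us s1; apply/fsetP => f; apply/mem_edges/imfsetP => // -[e es ->];
  by exists e.
Qed.

(** Either polygon determines the other one. *)
Lemma edges_ins x y z t : psi [:: x, y & t] -> psi [:: x, z, y & t] ->
  edges [:: x, z, y & t] =
    [fset x; z] |` ([fset z; y] |` (edges [:: x, y & t] `\ [fset x; y])) /\
  edges [:: x, y & t] =
    [fset x; y] |` ((edges [:: x, z, y & t] `\ [fset x; z]) `\ [fset z; y]).
Proof.
move=> [ss _ _] [ss' _ _].
have us := simple_uniq ss; have us' := simple_uniq ss'.
have [_ s2 _ _] := ss; have [_ s2' _ _] := ss'.
have s1 := ltnW s2; have s1' := ltnW s2'.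
set C := [fset [fset e.1; e.2] | e in pth y (rcons t x)].
have E1 : edges [:: x, y & t] = [fset x; y] |` C.
  rewrite edges_arcs //; apply/fsetP => f; rewrite !inE.
  apply/imfsetP/orP => [[e /=]|].
    rewrite inE => /orP[/eqP->|eC] ->; [by left|right].
    by apply/imfsetP; exists e.
  move=> [/eqP->|/imfsetP[e /= eC ->]]; [exists (x, y)|exists e];
    by rewrite //= inE ?eqxx ?eC ?orbT.
have E2 : edges [:: x, z, y & t] = [fset x; z] |` ([fset z; y] |` C).
  rewrite edges_arcs //; apply/fsetP => f; rewrite !inE.
  apply/imfsetP/or3P => [[e /=]|].
    rewrite !inE => /or3P[/eqP->|/eqP->|eC] ->; [constructor 1|constructor 2|constructor 3] => //.
    by apply/imfsetP; exists e.
  move=> [/eqP->|/eqP->|/imfsetP[e /= eC ->]]; [exists (x, z)|exists (z, y)|exists e];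
    by rewrite //= !inE ?eqxx ?eC ?orbT.
have [aE aE'] := arcs_insertE x y z t.
have nC e0 s : uniq s -> (2 < size s)%N -> uniq (arcs s) -> e0 \in arcs s ->
    {subset pth y (rcons t x) <= arcs s} -> e0 \notin pth y (rcons t x) ->
    [fset e0.1; e0.2] \notin C.
  move=> u sz ua e0s sub n; apply/imfsetP => -[e /= eC] /(arcs_edge_inj u sz e0s (sub e eC)) E.
  by rewrite E eC in n.
have ua := arcs_uniq us; have ua' := arcs_uniq us'.
have sub1 : {subset pth y (rcons t x) <= arcs [:: x, y & t]}.
  by move=> e; rewrite aE inE => ->; rewrite orbT.
have sub2 : {subset pth y (rcons t x) <= arcs [:: x, z, y & t]}.
  by move=> e; rewrite aE' !inE => ->; rewrite !orbT.
have n1 : [fset x; y] \notin C.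
  apply: (nC (x, y) _ us s2 ua _ sub1); first by rewrite aE mem_head.
  by move: ua; rewrite aE /= => /andP[].
have n2 : [fset x; z] \notin C.
  apply: (nC (x, z) _ us' s2' ua' _ sub2); first by rewrite aE' mem_head.
  by move: ua'; rewrite aE' /= inE negb_or => /andP[/andP[]].
have n3 : [fset z; y] \notin C.
  apply: (nC (z, y) _ us' s2' ua' _ sub2); first by rewrite aE' !inE eqxx orbT.
  by move: ua'; rewrite aE' /= => /and3P[].
split; apply/fsetP => f.
  rewrite E1 E2 !inE; case: (f == [fset x; z]) => //=; case: (f == [fset z; y]) => //=.
  by case: eqP => //= ->; rewrite (negbTE n1).
rewrite E1 E2 !inE; case: (f == [fset x; y]) => //=.
have [->|_] := eqVneq f [fset z; y]; first by rewrite (negbTE n3).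
by have [->|_] := eqVneq f [fset x; z]; first by rewrite (negbTE n2).
Qed.

Lemma cover_fam A T : psi_family A T -> (forall x, x \in A -> exists2 P, P \in T & x \in vertices P) ->
  (\bigcup_(P <- T) vertices P)%fset = A.
Proof.
move=> fT H; apply/fsetP => x; apply/mem_cover/idP => [[P /fT[s [[ss _ _] -> sA]]]|]; last exact: H.
by rewrite vertices_edges ?(simple_uniq ss) ?(simple_size1 ss) //; exact: sA.
Qed.

Lemma vertices_psi s : psi s -> vertices (edges s) =i s.
Proof. by move=> [ss _ _]; exact: (vertices_edges (simple_uniq ss) (simple_size1 ss)). Qed.

Lemma chain_swap A A' T (D N : {fset polygon R}) : chain A T -> D `<=` T ->
  (forall P, P \in N -> P \notin T) ->
  (forall x y, \sum_(P <- N) chi P x y = \sum_(P <- D) chi P x y + (chull A' x y - chull A x y)) ->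
  chain A' (swap T D N).
Proof. by move=> cT DT NT H x y; rewrite sum_swap_fset // H cT; ring. Qed.

Lemma big_fset2 (V : zmodType) (K : choiceType) (F : K -> V) (a b : K) : a != b ->
  \sum_(i <- [fset a; b]) F i = F a + F b.
Proof. by move=> ab; rewrite big_fsetU1 ?inE //= big_seq_fset1. Qed.

End Insertion.

(** * Exchanging polygons of a pseudo-triangulation *)

Section Surgery.
Local Open Scope fset_scope.
Local Open Scope ring_scope.
Context {R : realType}.
Implicit Types (x y z a b c d h m v u w : plane R) (s t : seq (plane R)).
Implicit Types (A W : {fset plane R}) (P Q : polygon R) (T : {fset polygon R}).

Lemma in_comprehension (K : choiceType) (X : {fset K}) (C : K -> Prop) (x : K) :
  x \in [fset x in X | `[< C x >]] <-> x \in X /\ C x.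
Proof. by rewrite !inE; split=> [/andP[-> /asboolP]|[-> h]] //; apply/asboolP. Qed.

Lemma psi_uniq s : psi s -> uniq s.
Proof. by case=> ss _ _; exact: simple_uniq. Qed.

Lemma psi_size2 s : psi s -> (2 < size s)%N.
Proof. by case=> [[]]. Qed.

Lemma psi_size1 s : psi s -> (1 < size s)%N.
Proof. by move=> /psi_size2/ltnW. Qed.

Lemma edges_mem s s' : psi s -> psi s' -> edges s = edges s' -> s =i s'.
Proof. by move=> ps ps' e x; rewrite -(vertices_psi ps) e (vertices_psi ps'). Qed.

Lemma edges_arc s s' : psi s -> psi s' -> edges s = edges s' -> arcs s =i arcs s'.
Proof. by move=> ps ps' e [x y]; rewrite -(arcP_edges _ _ ps) e (arcP_edges _ _ ps'). Qed.

Lemma rot_fam A T s a b : psi s -> edges s \in T -> {subset s <= A} -> (a, b) \in arcs s ->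
  exists t, [/\ psi [:: a, b & t], edges [:: a, b & t] = edges s, {subset t <= A},
    t != [::] & uniq [:: a, b & t]].
Proof.
move=> ps sT sA ab; have [ss _ _] := ps.
have [n [t E]] := rot_arc (psi_uniq ps) (psi_size1 ps) ab.
have ps' := psi_rot n ps; rewrite E in ps'; exists t; split=> //.
- by rewrite -E edges_rot ?psi_uniq ?psi_size1.
- by move=> v vt; apply: sA; rewrite -(mem_rot n) E !inE vt !orbT.
- by have := psi_size2 ps'; rewrite /= -size_eq0 !ltnS lt0n.
exact: psi_uniq.
Qed.

(** The chain condition has to be checked on the exchanged polygons only, and
    pointedness only at the points where these differ. *)
Lemma pt_swap A A' W W' T (D N : {fset polygon R}) : pt A W T -> D `<=` T -> (forall P, P \in N -> P \notin T) ->
  (forall P, P \in N -> exists s, [/\ psi s, P = edges s & {subset s <= A'}]) ->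
  (forall P, P \in T -> P \notin D -> {subset vertices P <= A'}) ->
  (forall x y, \sum_(P <- N) chi P x y = \sum_(P <- D) chi P x y + (chull A' x y - chull A x y)) ->
  (forall x, x \in A' -> (exists2 P, P \in N & x \in vertices P) \/
     (x \in A /\ forall P, P \in D -> x \notin vertices P) \/
     (exists P, [/\ P \in T, P \notin D & x \in vertices P])) ->
  (forall x, x \in interior_points A' ->
     [/\ x \in interior_points A, x \in W <-> x \in W' &
         (exists2 P, P \in D & reflex_vertex P x) <-> (exists2 P, P \in N & reflex_vertex P x)] \/
     ((exists2 P, P \in swap T D N & reflex_vertex P x) <-> x \in W')) ->
  pt A' W' (swap T D N).
Proof.
move=> [fT cT covT pT] DT NT fN TA ch cov ptd.
have fam' : psi_family A' (swap T D N).
  move=> P; rewrite in_swap => /orP[/fN//|/andP[PD PT]].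
  have [s [ps E sA]] := fT P PT; exists s; split=> // v vs.
  by apply: (TA P) => //; rewrite E vertices_psi.
split=> //; first exact: chain_swap cT DT NT ch.
  apply: (cover_fam fam') => x /cov[[P PN xP]|[[xA xD]|[P [PT PD xP]]]].
  - by exists P; rewrite ?in_swap ?PN.
  - move: xA; rewrite -covT => /mem_cover[P PT xP]; exists P => //.
    by rewrite in_swap PT andbT orbC; apply/orP; left; apply: contraL xP; exact: xD.
  by exists P; rewrite // in_swap PD PT orbT.
move=> x /ptd[[xi xW DN]|//]; rewrite -xW -(pT x xi); split=> -[P].
  rewrite in_swap => /orP[PN rP|/andP[_ PT] rP]; last by exists P.
  by have [|Q QD rQ] := DN.2; [exists P|exists Q => //; exact: (fsubsetP DT)].
move=> PT rP; have [PD|PD] := boolP (P \in D).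
  by have [|Q QN rQ] := DN.1; [exists P|exists Q; rewrite // in_swap QN].
by exists P; rewrite // in_swap PD PT orbT.
Qed.

(** A vertex of t keeps its two neighbours when z is inserted between x and y. *)
Lemma reflex_insert x y z t v : psi [:: x, y & t] -> psi [:: x, z, y & t] ->
  v \notin [:: x; y; z] ->
  reflex_vertex (edges [:: x, y & t]) v <-> reflex_vertex (edges [:: x, z, y & t]) v.
Proof.
move=> p1 p2 vn; rewrite !reflex_edges //.
have E : (v \in [:: x, z, y & t]) = (v \in [:: x, y & t]).
  by move: vn; rewrite !inE !negb_or => /and3P[/negbTE-> /negbTE-> /negbTE->].
have [vt|vt] := boolP (v \in t); last first.
  suff -> : (v \in [:: x, z, y & t]) = false.
    suff -> : (v \in [:: x, y & t]) = false by split=> -[].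
    by move: vn; rewrite !inE !negb_or (negbTE vt) => /and3P[/negbTE-> /negbTE-> _].
  by rewrite E; move: vn; rewrite !inE !negb_or (negbTE vt) => /and3P[/negbTE-> /negbTE-> _].
have t0 : t != [::] by apply: contraTneq vt => ->.
by rewrite E (left_insert t0 (psi_uniq p2) vt).
Qed.

Lemma reflex_tri x y z v : 0 < orient x y z -> v \notin [:: x; y; z] ->
  ~ reflex_vertex (edges [:: x; y; z]) v.
Proof. by move=> o vn /(reflex_edges _ (psi_tri o))[]; rewrite (negbTE vn). Qed.

Lemma left_tri x y z : 0 < orient x y z -> forall v, v \in [:: x; y; z] -> left [:: x; y; z] v.
Proof.
move=> o v vt; have [_ _ /eqP] := psi_tri o.
by rewrite -[3%N]/(size [:: x; y; z]) -all_count => /allP; exact.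
Qed.

End Surgery.

(** * Cutting the triangle off along one of its inner edges *)

Section Flip.
Local Open Scope fset_scope.
Local Open Scope ring_scope.
Context {R : realType}.
Implicit Types (x y z a b c d h m v u w : plane R) (s t : seq (plane R)).
Implicit Types (A W : {fset plane R}) (P Q : polygon R) (T : {fset polygon R}).
Variables (A : {fset plane R}) (p x y z : plane R) (W : {fset plane R}).
Hypotheses (gA : general_position A) (A2 : (2 < #|` A|)%N).
Hypotheses (o0 : 0 < orient x z y) (xA : x \in A) (yA : y \in A) (zA : z \in A).
Hypothesis pxy : p \in [:: x; y].
Hypothesis ni : forall v, v \in interior_points A -> v != p -> v \notin [:: x; y; z].
Hypothesis pW : p \notin W.

Definition flippable t := [/\ t != [::], {subset t <= A}, uniq [:: x, z, y & t],
  psi [:: x, y & t] & psi [:: x, z, y & t]].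

Hypothesis pleft : forall t, flippable t ->
  left [:: x, y & t] p /\ ~~ left [:: x, z, y & t] p.
Hypothesis find : forall T, pt A W T -> exists t, [/\ flippable t,
  edges [:: x; z; y] \in T & edges [:: x, y & t] \in T].

Let tri := edges [:: x; z; y].
Let small t := edges [:: x, y & t].
Let big t := edges [:: x, z, y & t].

Let zsmall t : flippable t -> z \notin [:: x, y & t].
Proof.
move=> [_ _ us _ _]; move: us; rewrite /= !inE !negb_or.
by move=> /and4P[/and3P[n1 _ _] /andP[n2 n3] _ _]; rewrite eq_sym n1 n2 n3.
Qed.

Let tri_small t : flippable t -> tri != small t.
Proof.
move=> vt; have [_ _ _ p1 _] := vt; apply/eqP => /(edges_mem (psi_tri o0) p1) e.
by have := zsmall vt; rewrite -e !inE eqxx orbT.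
Qed.

Let tri_big t : flippable t -> tri != big t.
Proof.
move=> [t0 _ us p1 p2]; apply/eqP => /(edges_mem (psi_tri o0) p2) e.
have [w wt] : exists w, w \in t by case: (t) t0 => // w t' _; exists w; exact: mem_head.
move: us => /= /and4P[]; rewrite !inE !negb_or => /and3P[_ _ n1] /andP[_ n2] n3 _.
have := e w; rewrite !inE wt !orbT => /or3P[]/eqP E; subst w.
- by rewrite wt in n1.
- by rewrite wt in n2.
by rewrite wt in n3.
Qed.

Let arc_yt t : flippable t -> (y, head y t) \in arcs [:: x, y & t] /\
  (y, head y t) \in arcs [:: x, z, y & t].
Proof.
move=> [t0 _ _ _ _]; have [-> ->] := arcs_insertE x y z t.
by case: (t) t0 => // c t' _; rewrite /= !inE eqxx !orbT.
Qed.

Let arc_tri : (x, z) \in arcs [:: x; z; y]. Proof. by rewrite /= !inE eqxx. Qed.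
Let arc_big t : (x, z) \in arcs [:: x, z, y & t].
Proof. by have [_ ->] := arcs_insertE x y z t; rewrite mem_head. Qed.
Let arc_small t : (x, y) \in arcs [:: x, y & t].
Proof. by have [-> _] := arcs_insertE x y z t; rewrite mem_head. Qed.

Let sub_small t : flippable t -> {subset [:: x, y & t] <= A}.
Proof. by move=> [_ tA _ _ _] v; rewrite !inE => /or3P[/eqP->|/eqP->|/tA]. Qed.
Let sub_big t : flippable t -> {subset [:: x, z, y & t] <= A}.
Proof. by move=> [_ tA _ _ _] v; rewrite !inE => /or4P[/eqP->|/eqP->|/eqP->|/tA]. Qed.
Let sub_tri : {subset [:: x; z; y] <= A}.
Proof. by move=> v; rewrite !inE => /or3P[/eqP->|/eqP->|/eqP->]. Qed.

Let chiE t a b : flippable t ->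
  chi (big t) a b = chi tri a b + chi (small t) a b.
Proof.
move=> [_ _ _ p1 p2]; rewrite (chi_insert _ _ p1 p2) (chi_tri _ _ o0) (arc1C x y); ring.
Qed.

(** Removing the triangle xzy and widening the polygon behind its edge xy turns
    p from a non-pointed into a pointed vertex; conversely, the polygon with its
    large angle at p is unique, so that the move can be undone. *)
Lemma card_flip : #|` PT A W| =
  #|` [fset T in PT A (p |` W) | `[< exists t, flippable t /\ big t \in T >]]|.
Proof.
pose D t := [fset tri; small t]; pose N t := [fset big t].
have inD t P : (P \in D t) = (P == tri) || (P == small t) by rewrite !inE.
have inN t P : (P \in N t) = (P == big t) by rewrite !inE.
have rfx t v : flippable t -> v \notin [:: x; y; z] ->
    (exists2 P, P \in D t & reflex_vertex P v) <-> (exists2 P, P \in N t & reflex_vertex P v).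
  move=> [_ _ _ p1 p2] vn; have ri := reflex_insert p1 p2 vn; split=> -[P].
    rewrite inD => /orP[]/eqP-> rP.
      exfalso; apply: (reflex_tri o0 _ rP).
      by move: vn; rewrite !inE !negb_or => /and3P[-> -> ->].
    by exists (big t); [rewrite inN|apply/ri].
  by rewrite inN => /eqP-> rP; exists (small t); [rewrite inD eqxx orbT|apply/ri].
have mW v : v != p -> v \in W <-> v \in p |` W.
  by move=> vp; rewrite !inE (negbTE vp).
apply: (exchange (valid := flippable) (D := D) (N := N)).
- move=> T /(PTP _ _ gA A2) ptT; have [t [vt tT sT]] := find ptT; exists t.
  have [fT cT covT pT] := ptT; have [t0 tA us p1 p2] := vt.
  have DT : D t `<=` T by apply/fsubsetP => P; rewrite inD => /orP[]/eqP->.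
  have NT P : P \in N t -> P \notin T.
    rewrite inN => /eqP->; apply/negP => bT.
    have := same_arc gA A2 fT cT (psi_tri o0) p2 tT bT arc_tri (arc_big t).
    by move/eqP; rewrite (negbTE (tri_big vt)).
  split=> //; apply/in_comprehension; split; last first.
    by exists t; split=> //; rewrite in_swap inN eqxx.
  apply/(PTP _ _ gA A2); apply: (pt_swap ptT DT NT).
  + by move=> P; rewrite inN => /eqP->; exists [:: x, z, y & t]; split=> //; exact: sub_big.
  + move=> P PT _ v vP; rewrite -covT; apply/mem_cover; by exists P.
  + move=> a b; rewrite subrr addr0 big_seq_fset1 big_fset2 ?tri_small //; exact: chiE.
  + move=> v vA; have [vb|vb] := boolP (v \in [:: x, z, y & t]).
      by left; exists (big t); rewrite ?inN // vertices_psi.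
    right; left; split=> // P; rewrite inD => /orP[]/eqP->.
      rewrite vertices_psi; last exact: psi_tri.
      by apply: contra vb; rewrite !inE => /or3P[]->; rewrite ?orbT.
    by rewrite vertices_psi //; apply: contra vb; rewrite !inE => /or3P[]->; rewrite ?orbT.
  move=> v vi; have [->|vp] := eqVneq v p; [right|left].
    split=> _; first by rewrite !inE eqxx.
    exists (big t); first by rewrite in_swap inN eqxx.
    apply/(reflex_edges _ p2); split; last by have [] := pleft vt.
    by move: pxy; rewrite !inE => /orP[]->; rewrite ?orbT.
  by split=> //; [exact: mW|apply: rfx; last exact: ni].
- move=> T /in_comprehension[/(PTP _ _ gA A2) ptT [t [vt bT]]]; exists t.
  have [fT cT covT pT] := ptT; have [t0 tA us p1 p2] := vt.
  have NT : N t `<=` T by apply/fsubsetP => P; rewrite inN => /eqP->.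
  have DT P : P \in D t -> P \notin T.
    rewrite inD => /orP[]/eqP->; apply/negP => tT.
      have := same_arc gA A2 fT cT (psi_tri o0) p2 tT bT arc_tri (arc_big t).
      by move/eqP; rewrite (negbTE (tri_big vt)).
    have [a1 a2] := arc_yt vt.
    have := edges_mem p1 p2 (same_arc gA A2 fT cT p1 p2 tT bT a1 a2).
    by move=> /(_ z); rewrite (negbTE (zsmall vt)) !inE eqxx !orbT.
  split=> //; apply/(PTP _ _ gA A2); apply: (pt_swap ptT NT DT).
  + move=> P; rewrite inD => /orP[]/eqP->.
      by exists [:: x; z; y]; split=> //; exact: psi_tri.
    by exists [:: x, y & t]; split=> //; exact: sub_small.
  + move=> P PT _ v vP; rewrite -covT; apply/mem_cover; by exists P.
  + by move=> a b; rewrite subrr addr0 big_seq_fset1 big_fset2 ?tri_small // chiE.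
  + move=> v vA; have [vb|vb] := boolP (v \in [:: x; z; y]).
      by left; exists tri; rewrite ?inD ?eqxx // vertices_psi //; exact: psi_tri.
    have [vs|vs] := boolP (v \in [:: x, y & t]).
      by left; exists (small t); rewrite ?inD ?eqxx ?orbT // vertices_psi.
    right; left; split=> // P; rewrite inN => /eqP->; rewrite vertices_psi //.
    move: vb vs; rewrite !inE !negb_or => /and3P[-> -> ->] /and3P[_ _ ->] //.
  move=> v vi; have [->|vp] := eqVneq v p; [right|left].
    split=> [[P]|]; last by rewrite (negbTE pW).
    rewrite in_swap => /orP[|/andP[PN PT]].
      rewrite inD => /orP[]/eqP-> /reflex_edges; case/(_ _).
      - exact: psi_tri.
      - by move=> pt0; rewrite left_tri.
      - by [].
      by move=> _; have [-> _] := pleft vt.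
    have [s [ps PE sA]] := fT P PT; rewrite PE => /(reflex_edges _ ps)[ps' nl].
    have [ss _ _] := ps; have [sb _ _] := p2.
    have pb : p \in [:: x, z, y & t] by move: pxy; rewrite !inE => /orP[]->; rewrite ?orbT.
    have [a [b [ap pb1]]] := vertex_arcs ss ps'; have [a' [b' [ap' pb']]] := vertex_arcs sb pb.
    have [_ nlb] := pleft vt.
    have neg a0 b0 s0 : psi s0 -> {subset s0 <= A} -> (a0, p) \in arcs s0 -> (p, b0) \in arcs s0 ->
        ~~ left s0 p -> orient a0 p b0 < 0.
      move=> ps0 s0A h1 h2; rewrite (left_arcs (psi_uniq ps0) (psi_size1 ps0) h1 h2).
      have [ss0 _ _] := ps0; have [_ n1 n2 n3] := arcs_turn ss0 h1 h2.
      rewrite -leNgt le_eqVlt => /orP[/eqP E|//].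
      have [/= i1 i2] := arcs_mem h1; have [/= _ i3] := arcs_mem h2.
      by have := gA (s0A _ i1) (s0A _ i2) (s0A _ i3) n1 n2 n3; rewrite E eqxx.
    case/negP: PN; rewrite inN PE; apply/eqP.
    rewrite PE in PT; have bA := sub_big vt.
    apply: (reflex_inj gA A2 fT cT ps p2 sA bA PT bT ap pb1 ap' pb').
      exact: neg ap pb1 nl.
    exact: neg ap' pb' nlb.
  split=> //; first by have := mW v vp; tauto.
  by have := rfx t v vt (ni vi vp); tauto.
- move=> T t t' /(PTP _ _ gA A2)[fT cT _ _] vt vt' DT DT'.
  have [_ _ _ p1 p2] := vt; have [_ _ _ p1' p2'] := vt'.
  have sT : small t \in T by apply: (fsubsetP DT); rewrite inD eqxx orbT.
  have sT' : small t' \in T by apply: (fsubsetP DT'); rewrite inD eqxx orbT.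
  have e := same_arc gA A2 fT cT p1 p1' sT sT' (arc_small t) (arc_small t').
  have [e1 _] := edges_ins p1 p2; have [e1' _] := edges_ins p1' p2'.
  by rewrite /D /N /small /big e1 e1' e.
move=> T t t' /in_comprehension[/(PTP _ _ gA A2)[fT cT _ _] _] vt vt' NT NT'.
have [_ _ _ p1 p2] := vt; have [_ _ _ p1' p2'] := vt'.
have bT : big t \in T by apply: (fsubsetP NT); rewrite inN.
have bT' : big t' \in T by apply: (fsubsetP NT'); rewrite inN.
have e := same_arc gA A2 fT cT p2 p2' bT bT' (arc_big t) (arc_big t').
have [_ e1] := edges_ins p1 p2; have [_ e1'] := edges_ins p1' p2'.
by rewrite /D /N /small /big e1 e1' e.
Qed.

End Flip.

(** * Removing the point next to the hull edge *)

Section EarBase.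
Local Open Scope fset_scope.
Local Open Scope ring_scope.
Context {R : realType}.
Implicit Types (x y z a b c d h m v u w : plane R) (s t : seq (plane R)).
Implicit Types (A W : {fset plane R}) (P Q : polygon R) (T : {fset polygon R}).

Lemma hull_exterior A x y : hull A x y -> x \notin interior_points A /\ y \notin interior_points A.
Proof.
by move=> /hull_not_interior[nx ny]; split; rewrite !inE /=; apply/negP => /andP[_ /asboolP].
Qed.

Lemma interior_sub A x : x \in interior_points A -> x \in A.
Proof. by rewrite inE => /andP[]. Qed.

Lemma gp_sub A B : general_position A -> {subset B <= A} -> general_position B.
Proof. by move=> gA BA x y z xB yB zB; apply: gA; exact: BA. Qed.

Variables (A : {fset plane R}) (p q r : plane R).
Hypothesis E : ear A p q r.

Let gA : general_position A. Proof. by case: E. Qed.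
Let pA : p \in A. Proof. by case: E => _ []. Qed.
Let qA : q \in A. Proof. by case: E => _ []. Qed.
Let rA : r \in A. Proof. by case: E => _ []. Qed.
Let o0 : 0 < orient q r p. Proof. by case: E. Qed.
Let cone w : w \in A -> w != p -> w != q -> w != r ->
  [/\ 0 < orient q r w, 0 < orient q p w & 0 < orient p r w].
Proof. by case: E => _ _ _ H _; exact: H. Qed.
Let A2 : (2 < #|` A|)%N. Proof. exact: (ear_card E). Qed.
Let B := A `\ p.

Lemma ear_BA : {subset B <= A}. Proof. by move=> v; rewrite !inE => /andP[]. Qed.

Lemma ear_gpB : general_position B. Proof. exact: gp_sub gA ear_BA. Qed.

Lemma ear_qrB : q \in B /\ r \in B.
Proof.
by have [pq _ pr] := ear_neq E; rewrite !inE qA rA (eq_sym q) (eq_sym r) pq pr.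
Qed.

Lemma ear_B2 : (2 < #|` B|)%N.
Proof.
have [pq qr pr] := ear_neq E; have [qB rB] := ear_qrB.
have [w [wA wp wq wr]] : exists w, [/\ w \in A, w != p, w != q & w != r] by case: E.
have sub : ([fset w; q; r] `<=` B)%fset.
  by apply/fsubsetP => z; rewrite !inE -orbA => /or3P[]/eqP->; rewrite ?wp ?wA //;
    move: qB rB; rewrite !inE.
apply: leq_trans (fsubset_leq_card sub).
rewrite -[3%N]/(size [:: w; q; r]); apply: uniq_leq_size.
  by rewrite /= !inE negb_or wq wr qr.
by move=> z; rewrite !inE -orbA.
Qed.

(** Since p is a convex combination of q, r and any other point, it does not
    affect the convex hull. *)
Lemma ear_hullB x y : hull B x y = hull A x y.
Proof.
have [pq qr pr] := ear_neq E; have [qB rB] := ear_qrB.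
have [w [wA wp wq wr]] : exists w, [/\ w \in A, w != p, w != q & w != r] by case: E.
have wB : w \in B by rewrite !inE wp.
apply/idP/idP => h; last first.
  have /hullP[xA yA xy H] := h; apply/hullP.
  have xp : x != p.
    by apply: contraTneq h => ->; have [->] := ear_p_nohull E y.
  have yp : y != p.
    by apply: contraTneq h => ->; have [_ ->] := ear_p_nohull E x.
  by rewrite !inE xp yp; split=> // z /ear_BA; exact: H.
have /hullP[xB yB xy H] := h; apply/hullP; split=> //; try exact: ear_BA.
move=> z zA zx zy; have [->|zp] := eqVneq z p; last by apply: H => //; rewrite !inE zp.
have [c1 c2 c3] := cone wA wp wq wr.
have I : orient q r w * orient x y p =
  orient p r w * orient x y q + orient q p w * orient x y r + orient q r p * orient x y w.
  by rewrite /orient; ring.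
have [i1 i2 i3] := And3 (hull_ge0 h qB) (hull_ge0 h rB) (hull_ge0 h wB).
rewrite -(pmulr_rgt0 _ c1) I.
have [k1 k2 k3] : [/\ 0 <= orient p r w * orient x y q, 0 <= orient q p w * orient x y r &
    0 <= orient q r p * orient x y w] by split; apply: mulr_ge0 => //; exact: ltW.
have pos v (k : R) : 0 < k -> v \in B -> v != x -> v != y -> 0 < k * orient x y v.
  by move=> k0 vB vx vy; apply: mulr_gt0 => //; exact: H.
have [qx|qx] := eqVneq q x.
  have [ry|ry] := eqVneq r y.
    have := pos w _ o0 wB; rewrite -qx -ry => /(_ wq wr).
    by move: k1 k2; rewrite -qx -ry; lra.
  have := pos r _ c2 rB; rewrite -{1}qx eq_sym qr ry => /(_ isT isT); lra.
have [qy|qy] := eqVneq q y; last by have := pos q _ c3 qB qx qy; lra.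
have [rx|rx] := eqVneq r x.
  by have := pos w _ o0 wB; rewrite -qy -rx => /(_ wr wq); move: k1 k2; rewrite -qy -rx; lra.
have := pos r _ c2 rB rx; rewrite -{1}qy eq_sym qr => /(_ isT); lra.
Qed.

Lemma ear_chullB x y : chull B x y = chull A x y.
Proof. by rewrite /chull !ear_hullB. Qed.

Lemma ear_interior : p \in interior_points A.
Proof.
apply/interior_pointsP => //; split=> // y.
by have [-> _] := ear_p_nohull E y.
Qed.

Lemma ear_interiorB : interior_points B = interior_points A `\ p.
Proof.
apply/fsetP => x; apply/idP/idP.
  move=> /(interior_pointsP _ ear_gpB ear_B2)[]; rewrite !inE => /andP[xp xA] H.
  have : x \in interior_points A.
    by apply/interior_pointsP => //; split=> // y; rewrite -ear_hullB; exact: H.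
  by rewrite !inE xp.
rewrite in_fsetD1 => /andP[xp /(interior_pointsP _ gA A2)[xA H]].
apply/(interior_pointsP _ ear_gpB ear_B2); split; first by rewrite !inE xp.
by move=> y; rewrite ear_hullB; exact: H.
Qed.

Lemma ear_exterior : q \notin interior_points A /\ r \notin interior_points A.
Proof. exact: hull_exterior (ear_hull E). Qed.

End EarBase.

(** * Pseudo-triangulations in which p is not pointed *)

Section EarCount.
Local Open Scope fset_scope.
Local Open Scope ring_scope.
Context {R : realType}.
Implicit Types (x y z a b c d h m v u w : plane R) (s t : seq (plane R)).
Implicit Types (A : {fset plane R}) (P Q : polygon R) (T : {fset polygon R}).
Variables (A : {fset plane R}) (p q r : plane R) (W : {fset plane R}).
Hypotheses (E : ear A p q r) (pW : p \notin W).

Let gA : general_position A. Proof. by case: E. Qed.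
Let pA : p \in A. Proof. by case: E => _ []. Qed.
Let qA : q \in A. Proof. by case: E => _ []. Qed.
Let rA : r \in A. Proof. by case: E => _ []. Qed.
Let o0 : 0 < orient q r p. Proof. by case: E. Qed.
Let cone w : w \in A -> w != p -> w != q -> w != r ->
  [/\ 0 < orient q r w, 0 < orient q p w & 0 < orient p r w].
Proof. by case: E => _ _ _ H _; exact: H. Qed.
Let A2 : (2 < #|` A|)%N. Proof. exact: (ear_card E). Qed.
Let orpq : orient r p q = orient q r p. Proof. by rewrite /orient; ring. Qed.
Let oqpr : orient q p r = - orient q r p. Proof. by rewrite /orient; ring. Qed.
Let tri := [:: q; r; p].
Let ptri : psi tri. Proof. exact: psi_tri. Qed.

Let triE2 : edges [:: p; q; r] = edges tri.
Proof. exact: (edges_rot 2 (psi_uniq ptri) (psi_size1 ptri)). Qed.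

Let outside t : t != [::] -> {subset t <= A} -> uniq [:: p, q, r & t] ->
  forall v, v \in t -> [/\ v \in A, v != p, v != q, v != r &
    [/\ 0 < orient q r v, 0 < orient q p v & 0 < orient p r v]].
Proof.
move=> t0 tA /= /and4P[]; rewrite !inE !negb_or => /and3P[_ _ n1] /andP[_ n2] n3 _ v vt.
have vp : v != p by apply: contraNneq n1 => <-.
have vq : v != q by apply: contraNneq n2 => <-.
have vr : v != r by apply: contraNneq n3 => <-.
by split=> //; [exact: tA|apply: cone => //; exact: tA].
Qed.

(** With q, r and p convex, the vertex found beyond the line pr would be a fourth
    convex one. *)
Let four_left s v : psi s -> {subset s <= A} -> p \in s -> left s p -> q \in s -> r \in s ->
  v \in s -> v \in [:: p; q; r].
Proof.
move=> ps sA ps' lp qs rs vs; apply: contraT; rewrite !inE !negb_or => /and3P[vp vq vr].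
have [pq qr pr] := ear_neq E; have [ss cs ls] := ps.
have [_ _ c3] := cone (sA _ vs) vp vq vr.
have [h [hs ho hl]] := extreme_left_orient ss cs vs c3.
have [lq lr] := hull_left ps sA (ear_hull E).
have : (size [:: p; q; r; h] <= count (left s) s)%N; last by rewrite ls.
apply: count_left_ge.
- have oprq : orient p r q < 0 by rewrite orientN orpq oppr_lt0.
  have hp : p != h by apply: contraTneq ho => <-; rewrite orientxyx ltxx.
  have hr : r != h by apply: contraTneq ho => <-; rewrite orientxyy ltxx.
  have hq : q != h by apply: contraTneq ho => <-; rewrite lt_gtF.
  by rewrite /= !inE !negb_or pq pr qr hp hq hr.
- by move=> x; rewrite !inE => /or4P[]/eqP->.
by move=> x; rewrite !inE => /or4P[]/eqP-> //; [exact: lq|exact: lr].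
Qed.

(** In the other cases of [ear_polygon] the angle at p is larger than pi. *)
Lemma nonpointed_tri T : pt A W T -> edges tri \in T.
Proof.
move=> [fT cT covT pT]; have [s [ps sT]] := ear_polygon E fT cT covT.
have [pq qr pr] := ear_neq E.
have np : ~~ (p \in s) || left s p.
  apply: contraT; rewrite negb_or negbK => /andP[ps' nl].
  case/negP: pW; apply/(pT p (ear_interior E)); exists (edges s) => //.
  exact/(reflex_edges _ ps).
case=> [E1|[t [t0 tA ut E1]]|[t [t0 tA ut E1]]]; first by rewrite /tri -E1.
- exfalso; move: np; rewrite E1 !inE eqxx !orbT /=.
  have nt : head p t \in t by case: (t) t0 => // a t' _; rewrite mem_head.
  have us := psi_uniq ps; have s1 := psi_size1 ps; rewrite E1 in us s1.
  rewrite (left_arcs us s1 (a := r) (b := head p t)).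
  + have [_ _ _ _ [_ _ h]] := outside t0 tA ut nt.
    by move: h; rewrite /orient; lra.
  + by rewrite /= !inE eqxx ?orbT.
  by case: (t) t0 => // c t' _; rewrite /= !inE eqxx ?orbT.
exfalso; move: np; rewrite E1 !inE eqxx /=.
have lt' : last p t \in t by case: (t) t0 => // a t' _; rewrite /= mem_last.
have us := psi_uniq ps; have s1 := psi_size1 ps; rewrite E1 in us s1.
rewrite (left_arcs us s1 (a := last p t) (b := q)).
+ have [_ _ _ _ [_ h _]] := outside t0 tA ut lt'.
  by move: h; rewrite /orient; lra.
+ rewrite /= !inE pth_rcons mem_rcons inE.
  by case: (t) t0 => // c t' _; rewrite eqxx ?orbT.
by rewrite /= !inE eqxx.
Qed.

Lemma nonpointed_left T s : pt A W T -> psi s -> edges s \in T -> p \in s -> left s p.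
Proof.
move=> [fT cT covT pT] ps sT ps'; apply: contraT => nl.
case/negP: pW; apply/(pT p (ear_interior E)); exists (edges s) => //.
exact/(reflex_edges _ ps).
Qed.

(** The polygon behind the edge qp of the triangle avoids r by [four_left], so
    that the triangle can be cut off, or attached, along qp. *)
Lemma card_flip_q : #|` PT A W| = #|` [fset T in PT A (p |` W) |
  `[< exists t, flippable A q p r t /\ edges [:: q, r, p & t] \in T >]]|.
Proof.
have [pq qr pr] := ear_neq E; have [qi ri] := ear_exterior E.
have perm t : uniq [:: q, r, p & t] = uniq [:: p, q, r & t].
  apply: perm_uniq; rewrite -[[:: q, r, p & t]]/([:: q; r] ++ [:: p] ++ t).
  by rewrite perm_catCA.
apply: (@card_flip R A p q p r W) => //.
- by rewrite !inE eqxx orbT.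
- move=> v vi vp; rewrite !inE (negbTE vp) /=; apply/norP; split.
    by apply: contraNneq qi => <-.
  by apply: contraNneq ri => <-.
- move=> t [t0 tA us p1 p2].
  have nt : head p t \in t by case: (t) t0 => // a t' _; rewrite mem_head.
  have [_ _ _ _ [_ h1 h2]] := outside t0 tA (etrans (esym (perm t)) us) nt.
  have a1 : (p, head p t) \in arcs [:: q, p & t].
    by case: (t) t0 => // c t' _; rewrite /= !inE eqxx ?orbT.
  have a2 : (p, head p t) \in arcs [:: q, r, p & t].
    by case: (t) t0 => // c t' _; rewrite /= !inE eqxx ?orbT.
  rewrite (left_arcs (psi_uniq p1) (psi_size1 p1) (a := q) _ a1); last by rewrite /= inE eqxx.
  rewrite (left_arcs (psi_uniq p2) (psi_size1 p2) (a := r) _ a2); last by rewrite /= !inE eqxx ?orbT.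
  by rewrite h1; split=> //; rewrite -leNgt ltW //; move: h2; rewrite /orient; lra.
move=> T ptT; have tT := nonpointed_tri ptT; have [fT cT covT pT] := ptT.
have a0 : (p, q) \in arcs tri by rewrite /= !inE eqxx ?orbT.
have [|s [ps sT sA qp]] := opp_arc A2 fT cT ptri tT a0.
  by have [-> _] := ear_p_nohull E q.
have [t [ps' E1 tA t0 us]] := rot_fam ps sT sA qp.
have sub : {subset [:: q, p & t] <= A} by move=> v; rewrite !inE => /or3P[/eqP->|/eqP->|/tA].
rewrite -E1 in sT; have lp : left [:: q, p & t] p.
  by apply: nonpointed_left ptT ps' sT _; rewrite !inE eqxx orbT.
have nt : head p t \in t by case: (t) t0 => // a t' _; rewrite mem_head.
have [pt' qt] : p \notin t /\ q \notin t.
  by move: us; rewrite /= !inE !negb_or => /and3P[/andP[_ ->] -> _].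
have nr : head p t != r.
  apply: contraTneq lp => e1.
  rewrite (left_arcs us (psi_size1 ps') (a := q) (b := head p t)); last 2 first.
  - by rewrite /= inE eqxx.
  - by case: (t) t0 => // c t' _; rewrite /= !inE eqxx ?orbT.
  by rewrite e1 oqpr oppr_gt0 lt_gtF.
have rt : r \notin t.
  apply/negP => rt.
  have := four_left ps' sub _ lp _ _ (v := head p t).
  rewrite !inE !eqxx rt nt !orbT => /(_ isT isT isT isT).
  rewrite (negbTE nr) orbF => /orP[]/eqP e1; first by rewrite -e1 nt in pt'.
  by rewrite -e1 nt in qt.
have ut : uniq t by move: us => /= /and3P[].
exists t; split=> //; split=> //.
  by rewrite perm /= !inE !negb_or pq pr qr pt' qt rt.
exact/(insert_r E t0 ut tA pt' qt rt).
Qed.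

(** As [card_flip_q], along the edge pr. *)
Lemma card_flip_r : #|` PT A W| = #|` [fset T in PT A (p |` W) |
  `[< exists t, flippable A p r q t /\ edges [:: p, q, r & t] \in T >]]|.
Proof.
have [pq qr pr] := ear_neq E; have [qi ri] := ear_exterior E.
apply: (@card_flip R A p p r q W) => //.
- by rewrite orientC.
- by rewrite !inE eqxx.
- move=> v vi vp; rewrite !inE (negbTE vp) /=; apply/norP; split.
    by apply: contraNneq ri => <-.
  by apply: contraNneq qi => <-.
- move=> t [t0 tA us p1 p2].
  have lt' : last p t \in t by case: (t) t0 => // a t' _; rewrite /= mem_last.
  have [_ _ _ _ [_ h1 h2]] := outside t0 tA us lt'.
  have a1 : (last p t, p) \in arcs [:: p, r & t].
    rewrite /= !inE pth_rcons mem_rcons inE.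
    by case: (t) t0 => // c t' _; rewrite eqxx ?orbT.
  have a2 : (last p t, p) \in arcs [:: p, q, r & t].
    rewrite /= !inE pth_rcons mem_rcons inE.
    by case: (t) t0 => // c t' _; rewrite eqxx ?orbT.
  rewrite (left_arcs (psi_uniq p1) (psi_size1 p1) (b := r) a1); last by rewrite /= inE eqxx.
  rewrite (left_arcs (psi_uniq p2) (psi_size1 p2) (b := q) a2); last by rewrite /= !inE eqxx ?orbT.
  by rewrite orientC h2; split=> //; rewrite -leNgt ltW //; move: h1; rewrite /orient; lra.
move=> T ptT; have tT := nonpointed_tri ptT; have [fT cT covT pT] := ptT.
have a0 : (r, p) \in arcs tri by rewrite /= !inE eqxx ?orbT.
have [|s [ps sT sA qp]] := opp_arc A2 fT cT ptri tT a0.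
  by have [_ ->] := ear_p_nohull E r.
have [t [ps' E1 tA t0 us]] := rot_fam ps sT sA qp.
have sub : {subset [:: p, r & t] <= A} by move=> v; rewrite !inE => /or3P[/eqP->|/eqP->|/tA].
rewrite -E1 in sT; have lp : left [:: p, r & t] p.
  by apply: nonpointed_left ptT ps' sT _; rewrite !inE eqxx.
have lt' : last p t \in t by case: (t) t0 => // a t' _; rewrite /= mem_last.
have [pt' rt] : p \notin t /\ r \notin t.
  by move: us; rewrite /= !inE !negb_or => /and3P[/andP[_ ->] -> _].
have nq : last p t != q.
  apply: contraTneq lp => e1.
  rewrite (left_arcs us (psi_size1 ps') (a := last p t) (b := r)); last 2 first.
  - rewrite /= !inE pth_rcons mem_rcons inE.
    by case: (t) t0 => // c t' _; rewrite eqxx ?orbT.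
  - by rewrite /= inE eqxx.
  by rewrite e1 oqpr oppr_gt0 lt_gtF.
have qt : q \notin t.
  apply/negP => qt.
  have := four_left ps' sub _ lp _ _ (v := last p t).
  rewrite !inE !eqxx qt lt' !orbT => /(_ isT isT isT isT).
  rewrite (negbTE nq) => /orP[]/eqP e1; first by rewrite -e1 lt' in pt'.
  by rewrite -e1 lt' in rt.
have ut : uniq t by move: us => /= /and3P[].
have us' : uniq [:: p, q, r & t] by rewrite /= !inE !negb_or pq pr qr pt' qt rt.
exists t; split=> //; last by rewrite -triE2 in tT.
by split=> //; exact/(insert_q E t0 ut tA pt' qt rt).
Qed.

End EarCount.

(** * Pseudo-triangulations in which p is pointed *)

Section EarPointed.
Local Open Scope fset_scope.
Local Open Scope ring_scope.
Context {R : realType}.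
Implicit Types (x y z a b c d h m v u w : plane R) (s t : seq (plane R)).
Implicit Types (A : {fset plane R}) (P Q : polygon R) (T : {fset polygon R}).
Variables (A : {fset plane R}) (p q r : plane R) (W : {fset plane R}).
Hypotheses (E : ear A p q r) (pW : p \notin W).

Let gA : general_position A. Proof. by case: E. Qed.
Let pA : p \in A. Proof. by case: E => _ []. Qed.
Let qA : q \in A. Proof. by case: E => _ []. Qed.
Let rA : r \in A. Proof. by case: E => _ []. Qed.
Let o0 : 0 < orient q r p. Proof. by case: E. Qed.
Let cone w : w \in A -> w != p -> w != q -> w != r ->
  [/\ 0 < orient q r w, 0 < orient q p w & 0 < orient p r w].
Proof. by case: E => _ _ _ H _; exact: H. Qed.
Let A2 : (2 < #|` A|)%N. Proof. exact: (ear_card E). Qed.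
Let B := A `\ p.
Let BA : {subset B <= A} := @ear_BA R A p.
Let gB : general_position B. Proof. exact: ear_gpB E. Qed.
Let B2 : (2 < #|` B|)%N. Proof. exact: ear_B2 E. Qed.
Let oqpr : orient q p r < 0. Proof. by move: o0; rewrite /orient; lra. Qed.
Let tri := [:: q; r; p].
Let ptri : psi tri. Proof. exact: psi_tri. Qed.
Let tri1 : (q, r) \in arcs tri. Proof. by rewrite /= !inE eqxx. Qed.
Let tri2 : (r, p) \in arcs tri. Proof. by rewrite /= !inE eqxx ?orbT. Qed.

(** The triangle and s fill the whole angle at p: the first edge at p of a third
    polygon would start inside the angle of s. *)
Lemma ear_two_polygons T s s' : psi_family A T -> chain A T -> edges tri \in T ->
  psi s -> {subset s <= A} -> edges s \in T -> (q, p) \in arcs s -> (p, r) \in arcs s ->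
  psi s' -> {subset s' <= A} -> edges s' \in T -> p \in s' ->
  edges s' = edges tri \/ edges s' = edges s.
Proof.
move=> fT cT tT ps sA sT qp pr ps' s'A s'T ps1.
have [ss' _ _] := ps'; have [a [b [ap pb]]] := vertex_arcs ss' ps1.
have [e1|aq] := eqVneq a q.
  by right; rewrite e1 in ap; exact: (same_arc gA A2 fT cT ps' ps s'T sT ap qp).
have [e1|ar] := eqVneq a r.
  by left; rewrite e1 in ap; exact: (same_arc gA A2 fT cT ps' ptri s'T tT ap tri2).
right; have [/= aA _] := arcs_mem ap; have [_ ap' pb' ab] := arcs_turn ss' ap pb.
have [_ c2 c3] := cone (s'A _ aA) ap' aq ar.
have [e e0 He] := near_ray (onorm a p) (filterI (near_orient_gt0 c2) (near_orient_gt0 c3)).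
have n0 := onorm_gt0 ap'.
have oz (k : R) : 0 < k -> 0 < orient a p (a + k *: onorm a p).
  by move=> k0; rewrite orient_onorm orientxyx add0r mulr_gt0.
have wq (k : R) : `|k| < e -> wedge q p r (a + k *: onorm a p).
  by move=> ke; have [h _] := He k ke; rewrite /wedge (lt_gtF oqpr); apply/orP; left.
have e2 : 0 < e / 2 by rewrite divr_gt0.
have ee : `|e / 2| < e by rewrite gtr0_norm //; lra.
have [l|l] := boolP (0 < orient a p b); last first.
  apply: (wedge_overlap gA A2 fT cT (z := a + (e / 2) *: onorm a p) ps' ps s'A sA s'T sT ap pb qp pr).
    by rewrite /wedge (negbTE l); apply/orP; left; exact: oz.
  exact: wq.
have l' : 0 < orient p b a by rewrite -orientC.
have [e' e'0 He'] := near_ray (onorm a p) (near_orient_gt0 l').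
pose k := Num.min e e' / 2.
have m0 : 0 < Num.min e e' by rewrite lt_min e0.
have k0 : 0 < k by apply: divr_gt0.
have km : k < Num.min e e' by rewrite /k; lra.
have k1 : `|k| < e by rewrite gtr0_norm // (lt_le_trans km) // ge_min lexx.
have k2 : `|k| < e' by rewrite gtr0_norm // (lt_le_trans km) // ge_min lexx orbT.
apply: (wedge_overlap gA A2 fT cT (z := a + k *: onorm a p) ps' ps s'A sA s'T sT ap pb qp pr).
  by rewrite /wedge l; apply/andP; split; [exact: oz|exact: He'].
exact: wq.
Qed.

Definition fillable t := [/\ t != [::], {subset t <= A}, uniq [:: q, p, r & t],
  psi [:: q, r & t] & psi [:: q, p, r & t]].

Let permu t : uniq [:: q, p, r & t] = uniq [:: p, q, r & t].
Proof. by rewrite -[[:: q, p, r & t]]/([:: q] ++ [:: p] ++ [:: r & t]) uniq_catCA. Qed.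

Let pt_ t : fillable t -> p \notin [:: q, r & t].
Proof. by move=> [_ _ us _ _]; move: us; rewrite permu /= => /andP[]. Qed.

Let arc_big t : (q, p) \in arcs [:: q, p, r & t] /\ (p, r) \in arcs [:: q, p, r & t].
Proof. by rewrite /= !inE !eqxx ?orbT. Qed.
Let arc_small t : (q, r) \in arcs [:: q, r & t].
Proof. by rewrite /= inE eqxx. Qed.

Let subB t : fillable t -> {subset [:: q, r & t] <= B}.
Proof.
move=> ft v vs; rewrite in_fsetD1; apply/andP; split.
  by apply: contraTneq vs => ->; exact: pt_.
by have [_ tA _ _ _] := ft; move: vs; rewrite !inE => /or3P[/eqP->|/eqP->|/tA].
Qed.

(** If the triangle is present, its complementary angle at p belongs to a polygon
    q p r t by [reflex_beside_tri]; merging both gives a polygon without p. *)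
Lemma card_carve : #|` PT B W| =
  #|` [fset T in PT A (p |` W) | `[< edges tri \in T >]]|.
Proof.
have [pq qr pr] := ear_neq E; have [qi ri] := ear_exterior E.
pose D t := [fset edges [:: q, r & t]]; pose N t := [fset edges tri; edges [:: q, p, r & t]].
have inD t P : (P \in D t) = (P == edges [:: q, r & t]) by rewrite !inE.
have inN t P : (P \in N t) = (P == edges tri) || (P == edges [:: q, p, r & t]) by rewrite !inE.
have tri_big t : fillable t -> edges tri != edges [:: q, p, r & t].
  move=> [t0 _ us p1 p2]; apply/eqP => /(edges_mem ptri p2) e.
  have [w wt] : exists w, w \in t by case: (t) t0 => // w t' _; exists w; exact: mem_head.
  move: us => /= /and4P[]; rewrite !inE !negb_or => /and3P[_ _ n1] /andP[_ n2] n3 _.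
  have := e w; rewrite !inE wt !orbT => /or3P[]/eqP E'; subst w.
  - by rewrite wt in n1.
  - by rewrite wt in n3.
  by rewrite wt in n2.
have pI := ear_interior E; have IB := ear_interiorB E.
have vn v : v \in interior_points A -> v != p -> v \notin [:: q; r; p].
  move=> vi vp; rewrite !inE (negbTE vp) orbF; apply/norP; split.
    by apply: contraNneq qi => <-.
  by apply: contraNneq ri => <-.
have rfx t v : fillable t -> v \in interior_points A -> v != p ->
    (exists2 P, P \in D t & reflex_vertex P v) <-> (exists2 P, P \in N t & reflex_vertex P v).
  move=> [_ _ _ p1 p2] vi vp; have ri' := reflex_insert p1 p2 (vn v vi vp); split=> -[P].
    by rewrite inD => /eqP-> rP; exists (edges [:: q, p, r & t]); [rewrite inN eqxx orbT|apply/ri'].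
  rewrite inN => /orP[]/eqP-> rP; last by exists (edges [:: q, r & t]); [rewrite inD|apply/ri'].
  by exfalso; apply: (reflex_tri o0 (vn v vi vp) rP).
have chiE t a b : fillable t -> chi (edges tri) a b + chi (edges [:: q, p, r & t]) a b =
    chi (edges [:: q, r & t]) a b.
  by move=> [_ _ _ p1 p2]; rewrite (chi_insert _ _ p1 p2) (chi_tri _ _ o0)
    (arc1C p r) (arc1C q p); ring.
apply: (exchange (valid := fillable) (D := D) (N := N)).
- move=> T /(PTP _ _ gB B2) ptT; have [fT cT covT pT] := ptT.
  have hqr : hull B q r by rewrite (ear_hullB E) (ear_hull E).
  have [s [ps sT sB aqr]] := hull_arc B2 fT cT hqr.
  have [t [ps' E1 tB t0 us]] := rot_fam ps sT sB aqr.
  rewrite -E1 in sT.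
  have tA : {subset t <= A} by move=> v /tB/BA.
  have ptn : p \notin t by apply/negP => /tB; rewrite !inE eqxx.
  have [qt rt ut] : [/\ q \notin t, r \notin t & uniq t].
    by move: us; rewrite /= !inE !negb_or => /and3P[/andP[_ ->] -> ->].
  have ft : fillable t.
    split=> //; last exact/(insert_p E t0 ut tA ptn qt rt).
    by rewrite permu /= !inE !negb_or pq pr qr ptn qt rt.
  have [_ _ _ _ p2] := ft; exists t.
  have noP P : P \in T -> p \notin vertices P.
    by move=> /fT[s' [ps2 -> s'B]]; rewrite vertices_psi //; apply/negP => /s'B; rewrite !inE eqxx.
  have NT P : P \in N t -> P \notin T.
    rewrite inN => /orP[]/eqP->; apply/negP => /noP; rewrite vertices_psi // !inE eqxx ?orbT //.
  have DT : D t `<=` T by apply/fsubsetP => P; rewrite inD => /eqP->.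
  split=> //; apply/in_comprehension; split; last by rewrite in_swap inN eqxx.
  apply/(PTP _ _ gA A2); apply: (pt_swap ptT DT NT).
  + move=> P; rewrite inN => /orP[]/eqP->.
      by exists tri; split=> // v; rewrite !inE => /or3P[]/eqP->.
    by exists [:: q, p, r & t]; split=> // v; rewrite !inE => /or4P[/eqP->|/eqP->|/eqP->|/tA].
  + by move=> P /fT[s' [ps2 -> s'B]] _ v; rewrite vertices_psi // => /s'B/BA.
  + move=> a b; rewrite -(ear_chullB E) subrr addr0 big_seq_fset1 big_fset2 ?tri_big //.
    exact: chiE.
  + move=> v vA; have [vb|vb] := boolP (v \in [:: q, p, r & t]).
      by left; exists (edges [:: q, p, r & t]); rewrite ?inN ?eqxx ?orbT // vertices_psi.
    right; left; split.
      by rewrite in_fsetD1 vA andbT; move: vb; rewrite !inE !negb_or => /and4P[].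
    move=> P; rewrite inD => /eqP->; rewrite vertices_psi //.
    by apply: contra vb; rewrite !inE => /or3P[]->; rewrite ?orbT.
  move=> v vi; have [->|vp] := eqVneq v p; [right|left].
    split=> _; first by rewrite !inE eqxx.
    exists (edges [:: q, p, r & t]); first by rewrite in_swap inN eqxx orbT.
    apply/(reflex_edges _ p2); split; first by rewrite !inE eqxx orbT.
    have [a1 a2] := arc_big t.
    by rewrite (left_arcs (psi_uniq p2) (psi_size1 p2) a1 a2) lt_gtF.
  split; [by rewrite IB in_fsetD1 vp|by rewrite !inE (negbTE vp)|exact: rfx].
- move=> T /in_comprehension[/(PTP _ _ gA A2) ptT tT].
  have [fT cT covT pT] := ptT.
  have [P PT] : exists2 P, P \in T & reflex_vertex P p by apply/(pT p pI); rewrite !inE eqxx.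
  have [s [ps PE sA]] := fT P PT; rewrite PE in PT * => /(reflex_edges _ ps)[ps' nl].
  have [ss _ _] := ps; have [a [b [ap pb]]] := vertex_arcs ss ps'.
  have neg : orient a p b < 0.
    move: nl; rewrite (left_arcs (psi_uniq ps) (psi_size1 ps) ap pb).
    have [_ n1 n2 n3] := arcs_turn ss ap pb; rewrite -leNgt le_eqVlt => /orP[/eqP e1|//].
    have [/= i1 i2] := arcs_mem ap; have [/= _ i3] := arcs_mem pb.
    by have := gA (sA _ i1) (sA _ i2) (sA _ i3) n1 n2 n3; rewrite e1 eqxx.
  have [e1 e2] := reflex_beside_tri E fT cT tT ps sA PT ap pb neg; subst a b.
  have [n [t st]] := rot_arcs2 ss ap pb.
  have p2 : psi [:: q, p, r & t] by rewrite -st; exact: psi_rot.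
  have E1 : edges [:: q, p, r & t] = edges s.
    by rewrite -st edges_rot ?psi_uniq ?psi_size1.
  have us := psi_uniq p2.
  have t0 : t != [::].
    apply: contraNneq nl => t0; rewrite t0 in st p2.
    have [_ _ /eqP] := p2; rewrite -[3%N]/(size [:: q; p; r]) -all_count => /allP H.
    by rewrite -(left_rot n) ?psi_uniq // ?psi_size1 // st H // !inE eqxx orbT.
  have tA : {subset t <= A}.
    by move=> v vt; apply: sA; rewrite -(mem_rot n) st !inE vt !orbT.
  have [ptn qt rt ut] : [/\ p \notin t, q \notin t, r \notin t & uniq t].
    move: (us); rewrite permu /= !inE !negb_or => /and4P[/and3P[_ _ ->] /andP[_ ->] -> ->] //.
  have p1 : psi [:: q, r & t] by apply/(insert_p E t0 ut tA ptn qt rt).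
  have ft : fillable t by split.
  have bT : edges [:: q, p, r & t] \in T by rewrite E1.
  have NT : N t `<=` T by apply/fsubsetP => Q; rewrite inN => /orP[]/eqP->.
  have DT Q : Q \in D t -> Q \notin T.
    rewrite inD => /eqP->; apply/negP => sT.
    have := edges_mem p1 ptri (same_arc gA A2 fT cT p1 ptri sT tT (arc_small t) tri1).
    by move=> /(_ p); rewrite (negbTE (pt_ ft)) !inE eqxx !orbT.
  exists t; split=> //; apply/(PTP _ _ gB B2); apply: (pt_swap ptT NT DT).
  + by move=> Q; rewrite inD => /eqP->; exists [:: q, r & t]; split=> //; exact: subB.
  + move=> Q QT QN v vQ; have [s' [ps2 QE s'A]] := fT Q QT; rewrite QE in QT QN vQ.
    rewrite vertices_psi // in vQ; rewrite in_fsetD1 s'A // andbT.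
    apply: contraNneq QN => vp; rewrite vp in vQ.
    have bA : {subset [:: q, p, r & t] <= A}.
      by move=> u; rewrite !inE => /or4P[/eqP->|/eqP->|/eqP->|/tA].
    have [a1 a2] := arc_big t.
    by rewrite inN; have [->|->] := ear_two_polygons fT cT tT p2 bA bT a1 a2 ps2 s'A QT vQ;
      rewrite eqxx ?orbT.
  + by move=> a b; rewrite (ear_chullB E) subrr addr0 big_seq_fset1 big_fset2 ?tri_big // chiE.
  + move=> v; rewrite in_fsetD1 => /andP[vp vA].
    have [vs|vs] := boolP (v \in [:: q, r & t]).
      by left; exists (edges [:: q, r & t]); rewrite ?inD ?eqxx // vertices_psi.
    right; left; split=> // Q; rewrite inN => /orP[]/eqP->; rewrite vertices_psi //.
      by move: vs; rewrite !inE !negb_or vp => /and3P[-> -> _].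
    by move: vs; rewrite !inE !negb_or vp => /and3P[-> -> ->].
  move=> v; rewrite IB in_fsetD1 => /andP[vp vi]; left; split=> //.
    by rewrite !inE (negbTE vp).
  by have := rfx t v ft vi vp; tauto.
- move=> T t t' /(PTP _ _ gB B2)[fT cT _ _] ft ft' DT DT'.
  have [_ _ _ p1 p2] := ft; have [_ _ _ p1' p2'] := ft'.
  have sT : edges [:: q, r & t] \in T by apply: (fsubsetP DT); rewrite inD.
  have sT' : edges [:: q, r & t'] \in T by apply: (fsubsetP DT'); rewrite inD.
  have e := same_arc gB B2 fT cT p1 p1' sT sT' (arc_small t) (arc_small t').
  have [e1 _] := edges_ins p1 p2; have [e1' _] := edges_ins p1' p2'.
  by rewrite /D /N e1 e1' e.
move=> T t t' /in_comprehension[/(PTP _ _ gA A2)[fT cT _ _] _] ft ft' NT NT'.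
have [_ _ _ p1 p2] := ft; have [_ _ _ p1' p2'] := ft'.
have bT : edges [:: q, p, r & t] \in T by apply: (fsubsetP NT); rewrite inN eqxx orbT.
have bT' : edges [:: q, p, r & t'] \in T by apply: (fsubsetP NT'); rewrite inN eqxx orbT.
have [a1 _] := arc_big t; have [a1' _] := arc_big t'.
have e := same_arc gA A2 fT cT p2 p2' bT bT' a1 a1'.
have [_ e1] := edges_ins p1 p2; have [_ e1'] := edges_ins p1' p2'.
by rewrite /D /N e1 e1' e.
Qed.

(** The three forms of the polygon at the hull edge, in the order of
    [card_flip_q], [card_flip_r] and [card_carve]. *)
Lemma count_pointed : #|` PT A (p |` W)| = (2 * #|` PT A W| + #|` PT B W|)%N.
Proof.
have [pq qr pr] := ear_neq E.
rewrite card_carve mul2n -addnn {1}(card_flip_q E pW) (card_flip_r E pW).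
set Y := PT A (p |` W); set Y1 := (X in (_ + _ + #|` X|)%N).
set Y2 := (X in (#|` X| + _ + _)%N); set Y3 := (X in (_ + #|` X| + _)%N).
have same T s s' : T \in Y -> psi s -> psi s' -> edges s \in T -> edges s' \in T ->
    (q, r) \in arcs s -> (q, r) \in arcs s' -> arcs s =i arcs s'.
  move=> /(PTP _ _ gA A2)[fT cT _ _] ps ps' sT s'T h h'.
  exact: edges_arc (same_arc gA A2 fT cT ps ps' sT s'T h h').
have nxt s x y z : psi s -> (x, y) \in arcs s -> (x, z) \in arcs s -> y = z.
  move=> ps; rewrite !arcs_next ?psi_uniq ?psi_size1 // => /andP[_ /eqP ->].
  by move=> /andP[_ /eqP ->].
have arcq t : (q, r) \in arcs [:: q, r, p & t] by rewrite /= inE eqxx.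
have arcr t : (q, r) \in arcs [:: p, q, r & t] by rewrite /= !inE eqxx orbT.
have headq t : t != [::] -> (p, head p t) \in arcs [:: q, r, p & t].
  by case: t => // c t' _; rewrite /= !inE eqxx !orbT.
have headr t : t != [::] -> (r, head p t) \in arcs [:: p, q, r & t].
  by case: t => // c t' _; rewrite /= !inE eqxx !orbT.
have d12 : [disjoint Y1 & Y2]%fset.
  apply/fdisjointP => T /in_comprehension[TY tT]; apply/negP => /in_comprehension[_].
  move=> [t [[t0 tA us p1 p2] bT]]; have H := same T _ _ TY ptri p2 tT bT tri1 (arcq t).
  have := headq t t0; rewrite -H => h.
  have := nxt _ _ _ q ptri h; rewrite /= !inE eqxx !orbT => /(_ isT) e.
  by move: us; rewrite /= !inE -e => /andP[]; case: (t) t0 => // c t' _; rewrite /= inE eqxx !orbT.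
have d13 : [disjoint Y1 & Y3]%fset.
  apply/fdisjointP => T /in_comprehension[TY tT]; apply/negP => /in_comprehension[_].
  move=> [t [[t0 tA us p1 p2] bT]]; have H := same T _ _ TY ptri p2 tT bT tri1 (arcr t).
  have := headr t t0; rewrite -H => h; have e := nxt _ _ _ _ ptri h tri2.
  by move: us; rewrite /= !inE -e => /andP[]; case: (t) t0 => // c t' _; rewrite /= inE eqxx !orbT.
have d23 : [disjoint Y2 & Y3]%fset.
  apply/fdisjointP => T /in_comprehension[TY [t [[t0 tA us p1 p2] bT]]].
  apply/negP => /in_comprehension[_ [t' [[t0' tA' us' p1' p2'] bT']]].
  have H := same T _ _ TY p2 p2' bT bT' (arcq t) (arcr t').
  have h := headr t' t0'; rewrite -H in h.
  have := nxt _ _ _ p p2 h; rewrite /= !inE eqxx !orbT => /(_ isT) e.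
  by move: us'; rewrite /= !inE -e => /andP[]; case: (t') t0' => // c t'' _; rewrite /= inE eqxx !orbT.
have -> : Y = Y1 `|` (Y2 `|` Y3).
  apply/fsetP => T; apply/idP/idP => [TY|]; last first.
    by rewrite !inE => /or3P[]/andP[].
  have /(PTP _ _ gA A2)[fT cT covT pT] := TY.
  have [s [ps sT]] := ear_polygon E fT cT covT; rewrite !in_fsetU.
  case=> [E1|[t [t0 tA ut E1]]|[t [t0 tA ut E1]]].
  - by apply/orP; left; apply/in_comprehension; split=> //; rewrite /tri -E1.
  - have [ptn qt rt ut'] : [/\ p \notin t, q \notin t, r \notin t & uniq t].
      by move: ut; rewrite /= !inE !negb_or => /and4P[/and3P[_ _ ->] /andP[_ ->] -> ->].
    apply/orP; right; apply/orP; left; apply/in_comprehension; split=> //.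
    exists t; rewrite -E1; split=> //; rewrite E1 in ps; split=> //; first exact: psi_uniq ps.
    exact/(insert_r E t0 ut' tA ptn qt rt).
  have [ptn qt rt ut'] : [/\ p \notin t, q \notin t, r \notin t & uniq t].
    by move: ut; rewrite /= !inE !negb_or => /and4P[/and3P[_ _ ->] /andP[_ ->] -> ->].
  apply/orP; right; apply/orP; right; apply/in_comprehension; split=> //.
  exists t; rewrite -E1; split=> //; rewrite E1 in ps; split=> //.
  exact/(insert_q E t0 ut' tA ptn qt rt).
have cardD (K : choiceType) (X X' : {fset K}) : [disjoint X & X']%fset ->
    #|` X `|` X'| = (#|` X| + #|` X'|)%N.
  by rewrite cardfsU -fsetI_eq0 => /eqP->; rewrite cardfs0 subn0.
rewrite cardD ?cardD //; first by rewrite addnC.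
by rewrite fdisjointXU d12 d13.
Qed.

End EarPointed.

(** * Polygons under a renaming of the points *)

Section Renaming.
Local Open Scope fset_scope.
Local Open Scope ring_scope.
Context {R : realType}.
Implicit Types (x y z a b c d h m v u w : plane R) (s t : seq (plane R)).
Implicit Types (A W : {fset plane R}) (P Q : polygon R) (T : {fset polygon R}).
Implicit Types (f g : plane R -> plane R).

Definition arc_map f (e : plane R * plane R) := (f e.1, f e.2).

Lemma arcs_map f s : arcs (map f s) = map (arc_map f) (arcs s).
Proof.
case: s => // x s; rewrite /= -map_rcons.
suff H y t : pth (f y) (map f t) = map (arc_map f) (pth y t) by exact: H.
by elim: t y => [|w t IH] y //=; rewrite IH.
Qed.

(** Everything that makes a list of points a pseudo-triangle, except for the
    direction of traversal, is expressed by orientations; and the direction can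
    be read off at a single extreme vertex. *)
Lemma psi_map f s : uniq s -> (2 < size s)%N -> {in s &, injective f} ->
  gpos s -> gpos (map f s) ->
  (forall a x b, (a, x) \in arcs s -> (x, b) \in arcs s ->
     (0 < orient (f a) (f x) (f b)) = (0 < orient a x b)) ->
  {in arcs s &, forall e e', cross (arc_map f e) (arc_map f e') = cross e e'} ->
  (exists h u u', [/\ h \in s, {in s, forall v, v != h -> dot u v < dot u h} &
     {in map f s, forall v, v != f h -> dot u' v < dot u' (f h)}]) ->
  (psi s <-> psi (map f s)) /\ {in s, forall v, left (map f s) (f v) = left s v}.
Proof.
move=> us s2 inj gs gs' turns cr [h [u [u' [hs ext ext']]]].
have us' : uniq (map f s) by rewrite map_inj_in_uniq.
have s2' : (2 < size (map f s))%N by rewrite size_map.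
have s1 := ltnW s2; have s1' := ltnW s2'.
have amem a b : (a, b) \in arcs s -> (f a, f b) \in arcs (map f s).
  by move=> ab; rewrite arcs_map; apply/mapP; exists (a, b).
have nb v : v \in s -> (prev s v, v) \in arcs s /\ (v, next s v) \in arcs s.
  by move=> vs; rewrite arcs_prev // arcs_next // vs !eqxx.
have lE v : v \in s -> left (map f s) (f v) = left s v.
  move=> /nb[h1 h2]; rewrite (left_arcs us' s1' (amem _ _ h1) (amem _ _ h2)).
  by rewrite (left_arcs us s1 h1 h2) turns.
have cnt : count (left (map f s)) (map f s) = count (left s) s.
  by rewrite count_map; apply: eq_in_count => v /= /lE.
have simE : simple s <-> simple (map f s).
  rewrite (simpleP us) // (simpleP us') // arcs_map; split=> H e e'.
    move=> /mapP[e1 h1 ->] /mapP[e1' h1' ->] ne; rewrite cr //; apply: H => //.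
    by apply: contra_neq ne => ->.
  move=> h1 h1' ne; rewrite -cr //; apply: H; try exact: map_f.
  apply: contra_neq ne; case: e h1 => a b h1; case: e' h1' => a' b' h1' [E1 E2].
  have [/= i1 i2] := arcs_mem h1; have [/= i1' i2'] := arcs_mem h1'.
  by rewrite (inj _ _ i1 i1' E1) (inj _ _ i2 i2' E2).
have [h1 h2] := nb h hs.
have ccwE : simple s -> simple (map f s) -> ccw s <-> ccw (map f s).
  move=> si si'; rewrite (ccw_transfer si h1 h2 ext).
  by rewrite (ccw_transfer si' (amem _ _ h1) (amem _ _ h2) ext') turns.
split=> //; rewrite /psi cnt; split=> -[k1 k2 k3]; split=> //.
- exact/simE.
- by apply/ccwE => //; apply/simE.
- exact/simE.
by apply/ccwE => //; apply/simE.
Qed.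

Definition rename f P : polygon R :=
  [fset [fset f v | v in (e : {fset plane R})] | e in P].

Lemma rename_edges f s : uniq s -> (1 < size s)%N -> {in s &, injective f} ->
  rename f (edges s) = edges (map f s).
Proof.
move=> us s1 inj; rewrite !edges_arcs ?size_map ?map_inj_in_uniq // arcs_map /rename.
have pairE x y : [fset f v | v in [fset x; y]] = [fset f x; f y].
  apply/fsetP => v; rewrite !inE; apply/imfsetP/orP => /= [[w]|].
    by rewrite !inE => /orP[]/eqP-> ->; [left|right].
  by move=> [/eqP->|/eqP->]; [exists x|exists y]; rewrite ?inE ?eqxx ?orbT.
apply/fsetP => e; apply/imfsetP/imfsetP => /= [[e0 /imfsetP[a /= aa ->] ->]|[a]].
  by exists (arc_map f a); [exact: map_f|rewrite pairE].
move=> /mapP[a0 aa ->] ->; exists [fset a0.1; a0.2]; last by rewrite pairE.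
by apply/imfsetP; exists a0.
Qed.

Lemma map_cancel f g s : {in s, cancel f g} -> map g (map f s) = s.
Proof. by move=> K; rewrite -map_comp -[RHS]map_id; apply/eq_in_map => v /K. Qed.

Definition alike f s := [/\ psi s, psi (map f s) &
  {in s, forall v, left (map f s) (f v) = left s v}].

Lemma chi_out A T a b : psi_family A T -> ~~ ((a \in A) && (b \in A)) ->
  \sum_(P <- T) chi P a b = 0.
Proof.
move=> fT ab; rewrite big_seq; apply: big1 => P /fT[s [ps -> sA]].
rewrite /chi !arcP_edges //.
have -> : ((a, b) \in arcs s) = false.
  by apply: contraNF ab => /arcs_mem[/sA-> /sA->].
have -> // : ((b, a) \in arcs s) = false.
by apply: contraNF ab => /arcs_mem[/sA-> /sA->].
Qed.

Lemma chull_out A a b : ~~ ((a \in A) && (b \in A)) -> chull A a b = 0.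
Proof.
move=> ab; rewrite /chull.
have -> : hull A a b = false by apply: contraNF ab => /hullP[-> ->].
by have -> : hull A b a = false by apply: contraNF ab => /hullP[-> ->].
Qed.

Section RenameFamily.
Variables (S S' : {fset plane R}) (f g : plane R -> plane R) (T : {fset polygon R}).
Hypothesis fS : {in S, forall v, f v \in S'}.
Hypotheses (fK : {in S, cancel f g}) (gK : {in S', cancel g f}).
Hypothesis TE : forall P, P \in T -> exists s, [/\ P = edges s, {subset s <= S} & alike f s].

Let inj s : {subset s <= S} -> {in s &, injective f}.
Proof. by move=> sS x y /sS xS /sS yS e; rewrite -(fK xS) e fK. Qed.

Let renE s : {subset s <= S} -> alike f s -> rename f (edges s) = edges (map f s).
Proof. by move=> sS [ps _ _]; apply: rename_edges; [exact: psi_uniq|exact: psi_size1|exact: inj]. Qed.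

Let mapS s : {subset s <= S} -> {subset map f s <= S'}.
Proof. by move=> sS v /mapP[w /sS/fS h ->]. Qed.

Let renK s : {subset s <= S} -> alike f s -> rename g (edges (map f s)) = edges s.
Proof.
move=> sS [ps ps' _]; rewrite rename_edges ?psi_uniq ?psi_size1 //.
  by rewrite map_cancel // => v /sS/fK.
by move=> x y /(mapS sS)xS /(mapS sS)yS e; rewrite -(gK xS) e gK.
Qed.

Lemma renameK : [fset rename g Q | Q in [fset rename f P | P in T]] = T.
Proof.
apply/fsetP => P; apply/imfsetP/idP => /= [[Q /imfsetP[P0 /= P0T ->] ->]|PT].
  by have [s [E sS a]] := TE P0T; rewrite E renE // renK // -E.
have [s [E sS a]] := TE PT; exists (rename f P); last by rewrite E renE // renK.
by apply/imfsetP; exists P.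
Qed.

Let U := [fset rename f P | P in T].

Lemma rename_mem Q : Q \in U -> exists s, [/\ edges s \in T, {subset s <= S}, alike f s &
  Q = edges (map f s)].
Proof.
move=> /imfsetP[P /= PT ->]; have [s [E sS a]] := TE PT.
by exists s; rewrite -E; split=> //; rewrite E renE.
Qed.

Lemma mem_rename P : P \in T -> exists s, [/\ P = edges s, {subset s <= S}, alike f s &
  edges (map f s) \in U].
Proof.
move=> PT; have [s [E sS a]] := TE PT; exists s; split=> //.
by apply/imfsetP; exists P => //=; rewrite E renE.
Qed.

Lemma rename_family : psi_family S' U.
Proof.
move=> Q /rename_mem[s [_ sS [_ ps' _] ->]]; exists (map f s); split=> //.
exact: mapS.
Qed.

Let mem_map s v : {subset s <= S} -> v \in S' -> (v \in map f s) = (g v \in s).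
Proof.
move=> sS vS; apply/mapP/idP => [[w ws ->]|h]; first by rewrite fK // sS.
by exists (g v); rewrite // gK.
Qed.

Lemma rename_chi a b : a \in S' -> b \in S' ->
  \sum_(Q <- U) chi Q a b = \sum_(P <- T) chi P (g a) (g b).
Proof.
move=> aS bS; rewrite big_imfset /=; last first.
  move=> P P' PT P'T; have [s [-> sS al]] := TE PT; have [s' [-> s'S al']] := TE P'T.
  by move=> e; rewrite -(renK sS al) -renE // e renE // renK.
rewrite big_seq [RHS]big_seq; apply: eq_bigr => P PT.
have [s [-> sS al]] := TE PT; rewrite renE //; have [ps ps' _] := al.
have arcE x y : x \in S' -> y \in S' -> ((x, y) \in arcs (map f s)) = ((g x, g y) \in arcs s).
  move=> xS yS; rewrite arcs_map; apply/mapP/idP => [[[c d] cd [-> ->]]|h].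
    by have [/= cs ds] := arcs_mem cd; rewrite !fK //; exact: sS.
  by exists (g x, g y); rewrite // /arc_map /= !gK.
by rewrite /chi !arcP_edges // !arcE.
Qed.

Lemma rename_vertex v : v \in S' -> (exists2 Q, Q \in U & v \in vertices Q) <->
  (exists2 P, P \in T & g v \in vertices P).
Proof.
move=> vS; split=> [[Q /rename_mem[s [sT sS [ps ps' _] ->]]]|[P /mem_rename[s [-> sS [ps ps' _] sU]]]].
  by rewrite vertices_psi // mem_map // => h; exists (edges s); rewrite ?vertices_psi.
by rewrite vertices_psi // => h; exists (edges (map f s)); rewrite ?vertices_psi ?mem_map.
Qed.

Lemma rename_reflex v : v \in S' -> (exists2 Q, Q \in U & reflex_vertex Q v) <->
  (exists2 P, P \in T & reflex_vertex P (g v)).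
Proof.
move=> vS; split=> [[Q /rename_mem[s [sT sS [ps ps' l] ->]]]|[P /mem_rename[s [-> sS [ps ps' l] sU]]]].
  move=> /(reflex_edges _ ps')[]; rewrite mem_map // => h; rewrite -{1}(gK vS) l // => nl.
  by exists (edges s) => //; apply/(reflex_edges _ ps).
move=> /(reflex_edges _ ps)[h nl]; exists (edges (map f s)) => //.
by apply/(reflex_edges _ ps'); rewrite mem_map // -{2}(gK vS) l.
Qed.

End RenameFamily.

End Renaming.

(** * Moving p across the hull edge *)

Section Moved.
Local Open Scope fset_scope.
Local Open Scope ring_scope.
Context {R : realType}.
Implicit Types (x y z a b c d h m v u w : plane R) (s t : seq (plane R)).
Implicit Types (P Q : polygon R) (T : {fset polygon R}).
Variables (A : {fset plane R}) (p q r p' : plane R).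
Hypotheses (E : ear A p q r) (M : moved_across A p q r p').

Let gA : general_position A. Proof. by case: E. Qed.
Let pA : p \in A. Proof. by case: E => _ []. Qed.
Let qA : q \in A. Proof. by case: E => _ []. Qed.
Let rA : r \in A. Proof. by case: E => _ []. Qed.
Let o0 : 0 < orient q r p. Proof. by case: E. Qed.
Let cone w : w \in A -> w != p -> w != q -> w != r ->
  [/\ 0 < orient q r w, 0 < orient q p w & 0 < orient p r w].
Proof. by case: E => _ _ _ H _; exact: H. Qed.
Let A2 : (2 < #|` A|)%N. Proof. exact: (ear_card E). Qed.
Let B := A `\ p.
Let BA : {subset B <= A} := @ear_BA R A p.
Let gB : general_position B. Proof. exact: ear_gpB E. Qed.
Let B2 : (2 < #|` B|)%N. Proof. exact: ear_B2 E. Qed.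
Let qB : q \in B. Proof. by case: (ear_qrB E). Qed.
Let rB : r \in B. Proof. by case: (ear_qrB E). Qed.
Let pq : p != q. Proof. by case: (ear_neq E). Qed.
Let qr : q != r. Proof. by case: (ear_neq E). Qed.
Let pr : p != r. Proof. by case: (ear_neq E). Qed.
Let C := p' |` B.

Let oqrp' : orient q r p' < 0.
Proof.
have [M1 _] := M; rewrite -sgr_lt0 (_ : orient q r p' = orient p' q r); last by rewrite -orientC.
by rewrite M1 oppr_lt0 sgr_gt0 orientC.
Qed.

Let oqp'r : 0 < orient q p' r. Proof. by move: oqrp'; rewrite /orient; lra. Qed.

Let p'q : p' != q. Proof. by apply: contraTneq oqrp' => ->; rewrite orientxyx ltxx. Qed.
Let p'r : p' != r. Proof. by apply: contraTneq oqrp' => ->; rewrite orientxyy ltxx. Qed.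

Let p'B : p' \notin B.
Proof.
apply/negP => p'B; have [_ M2] := M.
have ne : [fset p'; q] != [fset q; r].
  by apply/eqP => /fset2_eq[[e _]|[e _]]; [move: p'q|move: p'r]; rewrite e eqxx.
have := M2 p' q p'B qB ne; rewrite orientxx sgr0 => /esym/eqP; rewrite sgr_eq0.
have pp' : p != p' by move: p'B; rewrite !inE eq_sym => /andP[].
by rewrite (negbTE (gA pA (BA p'B) qA pp' p'q pq)).
Qed.

Let p'C : p' \in C. Proof. by rewrite !inE eqxx. Qed.
Let BC : {subset B <= C}. Proof. by move=> v vB; rewrite in_fset1U vB orbT. Qed.

Let inC v : v \in C -> v = p' \/ v \in B.
Proof. by rewrite in_fset1U => /orP[/eqP|]; [left|right]. Qed.

Let out v := if v == p then p' else v.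
Let back v := if v == p' then p else v.

Let out_p : out p = p'. Proof. by rewrite /out eqxx. Qed.
Let outB v : v \in B -> out v = v.
Proof. by rewrite /out !inE => /andP[/negbTE->]. Qed.
Let back_p : back p' = p. Proof. by rewrite /back eqxx. Qed.
Let backB v : v \in B -> back v = v.
Proof. by move=> vB; rewrite /back; case: eqP => // e; move: p'B; rewrite -e vB. Qed.

Let inA v : v \in A -> v = p \/ v \in B.
Proof. by move=> vA; have [->|vp] := eqVneq v p; [left|right; rewrite !inE vp]. Qed.

Let outC : {in A, forall v, out v \in C}.
Proof. by move=> v /inA[->|vB]; [rewrite out_p|rewrite outB // BC]. Qed.
Let backA : {in C, forall v, back v \in A}.
Proof. by move=> v /inC[->|vB]; [rewrite back_p|rewrite backB // BA]. Qed.
Let outK : {in A, cancel out back}.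
Proof. by move=> v /inA[->|vB]; [rewrite out_p back_p|rewrite outB // backB]. Qed.
Let backK : {in C, cancel back out}.
Proof. by move=> v /inC[->|vB]; [rewrite back_p out_p|rewrite backB // outB]. Qed.
Let out_inj : {in A &, injective out}.
Proof. by move=> x y xA yA e; rewrite -(outK xA) e outK. Qed.

(** The triples whose orientation is reversed. *)
Let bad x y z := [&& x \in [:: p; q; r], y \in [:: p; q; r], z \in [:: p; q; r] & uniq [:: x; y; z]].

Let badC x y z : bad x y z = bad y z x.
Proof.
rewrite /bad -[uniq [:: y; z; x]]/(uniq (rot 1 [:: x; y; z])) rot_uniq.
by case: (x \in _); case: (y \in _); case: (z \in _).
Qed.

Let sg_out1 y z : y \in A -> z \in A ->
  Num.sg (orient p' (out y) (out z)) = if bad p y z then - Num.sg (orient p y z) else Num.sg (orient p y z).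
Proof.
have [M1 M2] := M => /inA[->|yB].
  by rewrite out_p !orientxx !sgr0 oppr0 if_same.
move=> /inA[->|zB]; first by rewrite out_p !orientxyx !sgr0 oppr0 if_same.
rewrite !outB //; have [yp zp] : y != p /\ z != p.
  by move: yB zB; rewrite !inE => /andP[-> _] /andP[-> _].
have [e|ne] := eqVneq [fset y; z] [fset q; r].
  have -> : bad p y z.
    rewrite /bad /= !inE eqxx !negb_or (eq_sym p y) (eq_sym p z) yp zp.
    by have [[-> ->]|[-> ->]] := fset2_eq e; rewrite !eqxx ?orbT ?(eq_sym r q) ?qr.
  have [[-> ->]|[-> ->]] := fset2_eq e; first exact: M1.
  have sw u : orient u r q = - orient u q r by rewrite /orient; ring.
  by rewrite !sw !sgrN M1.
rewrite M2 //; case: ifP => // /and4P[_]; rewrite !inE (negbTE yp) (negbTE zp) /=.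
move=> /orP[]/eqP ey /orP[]/eqP ez; rewrite ey ez /= !inE ?eqxx ?andbF //; move: ne;
  by rewrite ey ez 1?fset2C ?eqxx.
Qed.

Let sg_out x y z : x \in A -> y \in A -> z \in A ->
  Num.sg (orient (out x) (out y) (out z)) = if bad x y z then - Num.sg (orient x y z) else Num.sg (orient x y z).
Proof.
move=> xA yA zA; have [->|xp] := eqVneq x p; first by rewrite out_p sg_out1.
have [->|yp] := eqVneq y p.
  by rewrite orientC out_p sg_out1 // (badC x) (orientC x).
have [->|zp] := eqVneq z p.
  by rewrite -orientC out_p sg_out1 // (orientC p) (badC p).
have -> : bad x y z = false.
  apply/negP => /and4P[]; rewrite !inE (negbTE xp) (negbTE yp) (negbTE zp) /=.
  by move=> /orP[]/eqP-> /orP[]/eqP-> /orP[]/eqP->; rewrite /= !inE ?eqxx ?orbT ?andbF.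
by rewrite !outB // !inE ?xp ?yp ?zp.
Qed.

Lemma moved_gp : general_position C.
Proof.
move=> x y z xC yC zC xy yz xz; rewrite -(backK xC) -(backK yC) -(backK zC).
have bij v w : v \in C -> w \in C -> v != w -> back v != back w.
  by move=> vC wC; apply: contra_neq => e; rewrite -(backK vC) e backK.
rewrite -sgr_eq0 sg_out ?backA //.
have h : Num.sg (orient (back x) (back y) (back z)) != 0.
  by rewrite sgr_eq0; apply: gA; rewrite ?backA ?bij.
by case: ifP => // _; rewrite oppr_eq0.
Qed.

Let C2 : (2 < #|` C|)%N.
Proof. by rewrite cardfsU1 p'B add1n ltnS ltnW. Qed.

Let conec w : w \in B -> w != q -> w != r ->
  [/\ 0 < orient q r w, 0 < orient q p' w & 0 < orient p' r w].
Proof.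
move=> wB wq wr; have [_ M2] := M.
have wp : w != p by move: wB; rewrite !inE => /andP[].
have [h1 h2 h3] := cone (BA wB) wp wq wr; split=> //.
  rewrite orientC -sgr_gt0 M2 //; first by rewrite sgr_gt0 -orientC.
  by apply/eqP => /fset2_eq[[e _]|[e _]]; [move: wq|move: wr]; rewrite e eqxx.
rewrite -sgr_gt0 M2 //; first by rewrite sgr_gt0.
by apply/eqP => /fset2_eq[[e _]|[_ e]]; [move: qr; rewrite e eqxx|move: wq; rewrite e eqxx].
Qed.

Let hullB : hull B q r. Proof. by rewrite (ear_hullB E) (ear_hull E). Qed.

Lemma moved_hull1 : hull C q p'.
Proof.
apply/hullP; split=> //; [exact: BC|by rewrite eq_sym|move=> z].
move=> /inC[->|zB] zq; [by rewrite eqxx|move=> _].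
by have [->//|zr] := eqVneq z r; have [] := conec zB zq zr.
Qed.

Lemma moved_hull2 : hull C p' r.
Proof.
apply/hullP; split=> //; [exact: BC|move=> z].
move=> /inC[->|zB]; [by rewrite eqxx|move=> _ zr].
 have [->|zq] := eqVneq z q; first by rewrite -orientC.
by have [] := conec zB zq zr.
Qed.

Lemma moved_hull x y : hull C x y =
  [|| hull B x y && ((x, y) != (q, r)), (x, y) == (q, p') | (x, y) == (p', r)].
Proof.
apply/idP/idP => [h|]; last first.
  case/or3P; last 2 first.
  - by case/eqP => -> ->; exact: moved_hull1.
  - by case/eqP => -> ->; exact: moved_hull2.
  move=> /andP[h ne]; have /hullP[xB yB xy H] := h; apply/hullP.
  split; rewrite ?BC // => z /inC[->|zB] zx zy; last exact: H.
  have [_ M2] := M; rewrite -orientC -sgr_gt0 M2 //.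
    rewrite sgr_gt0 orientC; have /hullP[_ _ _ H'] : hull A x y by rewrite -(ear_hullB E).
    apply: H' => //; first by move: xB; rewrite !inE eq_sym => /andP[].
    by move: yB; rewrite !inE eq_sym => /andP[].
  apply/eqP => /fset2_eq[[e1 e2]|[e1 e2]]; first by rewrite e1 e2 eqxx in ne.
  by move: h; rewrite e1 e2 (hull_asym B2).
have /hullP[xC yC xy H] := h.
have [ex|xB] := inC xC; have [ey|yB] := inC yC.
- by rewrite ex ey eqxx in xy.
- subst x; have [->|yr] := eqVneq y r; first by rewrite eqxx !orbT.
  exfalso; have := H r (BC rB); rewrite eq_sym p'r eq_sym => /(_ isT yr).
  have [->|yq] := eqVneq y q; first by rewrite orientC lt_gtF.
  have [_ _ c3] := conec yB yq yr.
  by move: c3; rewrite /orient; lra.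
- subst y; have [->|xq] := eqVneq x q; first by rewrite eqxx !orbT.
  exfalso; have := H q (BC qB); rewrite eq_sym (eq_sym q) p'q => /(_ xq isT).
  have [->|xr] := eqVneq x r; first by rewrite -orientC lt_gtF.
  have [_ c2 _] := conec xB xq xr.
  by move: c2; rewrite /orient; lra.
have -> : hull B x y by apply/hullP; split=> // z zB; apply: H; exact: BC.
rewrite /=; apply/orP; left; apply/eqP => -[e1 e2]; subst x y.
by have := H p' p'C p'q p'r; rewrite lt_gtF.
Qed.

Lemma moved_interior : interior_points C = interior_points B.
Proof.
apply/fsetP => x; apply/idP/idP.
  move=> /(interior_pointsP _ moved_gp C2)[xC H].
  have xB : x \in B.
    by have [e|//] := inC xC; case: (H r); rewrite e moved_hull2.
  apply/(interior_pointsP _ gB B2); split=> // y h.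
  have [[e1 e2]|ne] := eqVneq (x, y) (q, r); first by case: (H p'); rewrite e1 moved_hull1.
  by case: (H y); rewrite moved_hull h ne.
move=> /(interior_pointsP _ gB B2)[xB H]; apply/(interior_pointsP _ moved_gp C2).
split; first exact: BC.
move=> y; rewrite moved_hull => /or3P[/andP[h _]|/eqP[e _]|/eqP[e _]].
- exact: H h.
- by case: (H r); rewrite e.
by move: xB; rewrite e (negbTE p'B).
Qed.

Lemma moved_chull a b : chull C a b =
  chull B a b - arc1 (q, r) a b + arc1 (q, p') a b + arc1 (p', r) a b.
Proof.
have main x y : Posz (hull C x y) = Posz (hull B x y) - Posz ((q, r) == (x, y)) +
    Posz ((q, p') == (x, y)) + Posz ((p', r) == (x, y)).
  rewrite moved_hull !(eq_sym _ (x, y)); have [e|ne] := eqVneq (x, y) (q, r).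
    case: e => -> ->; rewrite hullB !xpair_eqE (eq_sym r) (eq_sym q p') (negbTE p'r) (negbTE p'q).
    by rewrite andbF.
  have [[-> ->]|ne1] := eqVneq (x, y) (q, p').
    have -> : hull B q p' = false by apply/negP => /hullP[_]; rewrite (negbTE p'B).
    by rewrite xpair_eqE (eq_sym q) (negbTE p'q).
  have [[-> ->]|ne2] := eqVneq (x, y) (p', r).
    by have -> : hull B p' r = false by apply/negP => /hullP[]; rewrite (negbTE p'B).
  by rewrite andbT !orbF subr0 !addr0.
by rewrite /chull !main /arc1; ring.
Qed.

Let tri' := [:: q; p'; r].
Let ptri' : psi tri'. Proof. exact: psi_tri. Qed.
Let tri'C : {subset tri' <= C}.
Proof. by move=> v; rewrite /tri' mem_seq3 => /or3P[]/eqP-> //; exact: BC. Qed.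

Let tri'1 : (q, p') \in arcs tri'. Proof. by rewrite mem_head. Qed.
Let tri'2 : (p', r) \in arcs tri'. Proof. by rewrite inE mem_head orbT. Qed.
Let tri'3 : (r, q) \in arcs tri'. Proof. by rewrite !inE eqxx !orbT. Qed.

(** The triangle fills the angle of the hull at p'. *)
Lemma moved_one_polygon T s : psi_family C T -> chain C T -> edges tri' \in T ->
  psi s -> {subset s <= C} -> edges s \in T -> p' \in s -> edges s = edges tri'.
Proof.
move=> fT cT tT ps sC sT ps1; have [ss _ _] := ps.
have [a [b [ap pb]]] := vertex_arcs ss ps1.
have [/= aC _] := arcs_mem ap; have [/= _ bC] := arcs_mem pb.
have [_ ap' pb' ab] := arcs_turn ss ap pb.
have [lp _] := hull_left ps sC moved_hull2.
have := lp ps1; rewrite (left_arcs (psi_uniq ps) (psi_size1 ps) ap pb) => l.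
pose z := a + b - p'.
have [aC' bC'] := (sC _ aC, sC _ bC).
have zE u v : orient u v z = orient u v a + orient u v b - orient u v p'.
  by rewrite /z /orient !pE; ring.
apply: (wedge_overlap moved_gp C2 fT cT (z := z) ps ptri' sC tri'C sT tT ap pb tri'1 tri'2).
  rewrite /wedge l !zE !orientxyx !orientxyy add0r addr0 !subr0 l.
  by rewrite -orientC l.
have [/hullP[_ _ _ H1] /hullP[_ _ _ H2]] := (moved_hull1, moved_hull2).
have g1 := hull_ge0 moved_hull1; have g2 := hull_ge0 moved_hull2.
rewrite /wedge oqp'r !zE !orientxyy !orientxyx !subr0; apply/andP; split.
  have [e|aq] := eqVneq a q.
    rewrite e orientxyx add0r; apply: H1 => //; last by rewrite eq_sym.
    by rewrite -e eq_sym.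
  by apply: ltr_pwDl; [exact: H1|exact: g1].
have [e|ar] := eqVneq a r.
  rewrite e orientxyy add0r; apply: H2 => //; first by rewrite eq_sym.
  by rewrite -e eq_sym.
by apply: ltr_pwDl; [exact: H2|exact: g2].
Qed.

Variable W : {fset plane R}.

(** The triangle over the edge qr is the only polygon at p', so that it can be
    removed together with p'. *)
Lemma card_fill : #|` PT B W| = #|` [fset T in PT C W | `[< edges tri' \in T >]]|.
Proof.
pose N (_ : unit) := [fset edges tri'].
have inN P : (P \in N tt) = (P == edges tri') by rewrite inE.
have chiE a b : \sum_(P <- N tt) chi P a b = chull C a b - chull B a b.
  rewrite big_seq_fset1 (chi_tri _ _ oqp'r) moved_chull (arc1C q r); ring.
have nr v : v \in interior_points B -> v \notin tri'.
  move=> vi; have [qi ri] := hull_exterior hullB; have vB := interior_sub vi.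
  rewrite !inE; apply/or3P => -[]/eqP e; move: vi vB; rewrite e ?(negbTE qi) ?(negbTE ri) //.
  by rewrite (negbTE p'B).
apply: (exchange (valid := fun=> True) (D := fun=> fset0) (N := N)).
- move=> T /(PTP _ _ gB B2) ptT; exists tt; have [fT cT covT pT] := ptT.
  have NT P : P \in N tt -> P \notin T.
    rewrite inN => /eqP->; apply/negP => /fT[s [ps e sB]].
    by move: p'B; rewrite sB // -(edges_mem ptri' ps e) !inE eqxx orbT.
  split=> //; apply/in_comprehension; split; last by rewrite in_swap inN eqxx.
  apply/(PTP _ _ moved_gp C2); apply: (pt_swap ptT _ NT); first by rewrite fsub0set.
  + by move=> P; rewrite inN => /eqP->; exists tri'.
  + by move=> P /fT[s [ps -> sB]] _ v; rewrite vertices_psi // => /sB/BC.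
  + by move=> a b; rewrite chiE big_nil add0r.
  + move=> v /inC[->|vB]; last by right; left; split=> // P; rewrite in_fset0.
    by left; exists (edges tri'); rewrite ?inN // vertices_psi // !inE eqxx orbT.
  move=> v; rewrite moved_interior => vi; left; split=> //; split=> -[P]; first by rewrite in_fset0.
  by rewrite inN => /eqP-> /(reflex_tri oqp'r (nr v vi)).
- move=> T /in_comprehension[/(PTP _ _ moved_gp C2) ptT tT]; exists tt.
  have [fT cT covT pT] := ptT.
  have NT : N tt `<=` T by apply/fsubsetP => P; rewrite inN => /eqP->.
  split=> //; apply/(PTP _ _ gB B2); apply: (pt_swap ptT NT) => //.
  + move=> P PT PN v vP; have [s [ps PE sC]] := fT P PT; rewrite PE in PT PN vP.
    rewrite vertices_psi // in vP; have [e|//] := inC (sC _ vP).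
    by move: PN; rewrite inN (moved_one_polygon fT cT tT ps sC PT) ?eqxx // -e.
  + by move=> a b; rewrite chiE big_nil; ring.
  + move=> v vB; right.
    have [vt|vt] := boolP (v \in tri'); last first.
      by left; split; [exact: BC|move=> P; rewrite inN => /eqP->; rewrite vertices_psi].
    have [|s [ps sT sC qrs]] := opp_arc C2 fT cT ptri' tT tri'3.
      rewrite moved_hull (hull_asym B2 hullB) /= !xpair_eqE (eq_sym r q) (negbTE qr) /=.
      by rewrite (eq_sym r p') (negbTE p'r).
    have p's : p' \notin s.
      apply/negP => /(moved_one_polygon fT cT tT ps sC sT) e.
      have := edges_arc ps ptri' e (q, r).
      rewrite qrs /= !inE !xpair_eqE eqxx (eq_sym r p') (negbTE p'r) (eq_sym q p') (negbTE p'q).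
      by rewrite (negbTE qr).
    right; exists (edges s); split=> //.
      rewrite inN; apply: contra p's => /eqP e.
      by rewrite (edges_mem ps ptri' e) !inE eqxx orbT.
    have [/= qs rs] := arcs_mem qrs; rewrite vertices_psi //.
    by move: vt; rewrite !inE => /or3P[]/eqP e; [rewrite e|move: p'B; rewrite -e vB|rewrite e].
  move=> v vi; left; split=> //; first by rewrite moved_interior.
  split=> -[P]; last by rewrite in_fset0.
  by rewrite inN => /eqP-> /(reflex_tri oqp'r (nr v vi)).
- by move=> T [] [].
by move=> T [] [].
Qed.

(** A side of the triangle xqr, or a path of two sides, whose crossings or turns
    depend on the orientation of this triangle does not occur in s. *)
Definition tame x s := x \in s -> [/\ (q, r) \notin arcs s, (r, q) \notin arcs s,
  ~ ((q, x) \in arcs s /\ (x, r) \in arcs s) & ~ ((r, x) \in arcs s /\ (x, q) \in arcs s)].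

Lemma rename_list s : uniq s -> (2 < size s)%N -> {subset s <= A} -> tame p s ->
  (psi s <-> psi (map out s)) /\ {in s, forall v, left (map out s) (out v) = left s v}.
Proof.
move=> us s2 sA tm; have s1 := ltnW s2.
have [ps|ps] := boolP (p \in s); last first.
  have -> : map out s = s.
    rewrite -[RHS]map_id; apply/eq_in_map => v vs.
    by rewrite /out; case: eqP => // e; rewrite -e vs in ps.
  split=> // v vs; rewrite /out; case: eqP => // e; by rewrite -e vs in ps.
have [n1 n2 n3 n4] := tm ps.
have gs : gpos s by move=> x y z xs ys zs; apply: gA; exact: sA.
have gs' : gpos (map out s).
  by move=> x y z /mapP[a /sA/outC h ->] /mapP[b /sA/outC h' ->] /mapP[c /sA/outC h'' ->];
    exact: moved_gp.
have neg (e : plane R * plane R) : e \in arcs s -> e != (q, r) /\ e != (r, q).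
  by move=> es; split; apply: contraTneq es => ->.
have adj e w : e \in arcs s -> bad e.1 e.2 w ->
    e \in [:: (q, p); (p, q); (p, r); (r, p)].
  move=> /neg[h1 h2]; case: e h1 h2 => a b /= h1 h2 /and4P[ha hb _ /andP[hab _]].
  move: ha hb h1 h2 hab; rewrite !inE => /or3P[]/eqP-> /or3P[]/eqP->;
    by rewrite !xpair_eqE ?eqxx ?orbT.
have pos0 (k l : R) : 0 <= k -> 0 <= l -> (k * l < 0) = false.
  by move=> h1 h2; rewrite ltNge mulr_ge0.
have nocr e e' : e \in arcs s -> e' \in arcs s -> e \in [:: (q, p); (p, q); (p, r); (r, p)] ->
    cross (arc_map out e) (arc_map out e') = cross e e'.
  move=> es; case: e' => u v /arcs_mem[/= /sA uA /sA vA] he.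
  have [c1 c2 c3] := ear_nocross E uA vA.
  have d1 : ~~ cross (q, p') (out u, out v).
    by rewrite /cross /= pos0 // (hull_ge0 moved_hull1) // outC.
  have d2 : ~~ cross (p', r) (out u, out v).
    by rewrite /cross /= pos0 // (hull_ge0 moved_hull2) // outC.
  move: he; rewrite /arc_map !inE => /or4P[]/eqP-> /=; rewrite ?out_p ?(outB qB) ?(outB rB).
  - by rewrite (negbTE c2) (negbTE d1).
  - by rewrite (crossN (q, p')) (crossN (q, p)) (negbTE c2) (negbTE d1).
  - by rewrite (negbTE c3) (negbTE d2).
  by rewrite (crossN (p', r)) (crossN (p, r)) (negbTE c3) (negbTE d2).
have lt0E (k l k' l' : R) : Num.sg k = Num.sg k' -> Num.sg l = Num.sg l' ->
    (k * l < 0) = (k' * l' < 0).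
  by move=> e1 e2; rewrite -sgr_lt0 -[RHS]sgr_lt0 !sgrM e1 e2.
apply: psi_map => //.
- by move=> x y /sA xA /sA yA; exact: out_inj.
- move=> a x b ax xb; have [/= as_ xs] := arcs_mem ax; have [/= _ bs] := arcs_mem xb.
  rewrite -sgr_gt0 sg_out ?sA //; case: ifP; last by rewrite sgr_gt0.
  have [h1 h2] := neg _ ax; have [h3 h4] := neg _ xb.
  move=> /and4P[]; rewrite !inE => /or3P[]/eqP ea /or3P[]/eqP ex /or3P[]/eqP eb;
    move: ax xb h1 h2 h3 h4; rewrite ea ex eb => ax xb h1 h2 h3 h4;
    rewrite /= !inE ?eqxx ?orbT ?andbF //= => _;
    exfalso; try (by case: n3); try (by case: n4); by move: h1 h2 h3 h4; rewrite ?eqxx.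
- move=> e e' es es'.
  have [h1|h1] := boolP (e \in [:: (q, p); (p, q); (p, r); (r, p)]); first exact: nocr.
  have [h2|h2] := boolP (e' \in [:: (q, p); (p, q); (p, r); (r, p)]).
    by rewrite crossC [RHS]crossC; exact: nocr.
  have [/sA i1 /sA i2] := arcs_mem es; have [/sA i1' /sA i2'] := arcs_mem es'.
  have nb e0 w : e0 \in arcs s -> e0 \notin [:: (q, p); (p, q); (p, r); (r, p)] ->
      bad e0.1 e0.2 w = false.
    by move=> h; apply: contraNF; exact: adj.
  by rewrite /cross /arc_map /=; congr (_ && _); apply: lt0E; rewrite sg_out // nb.
(* an extreme vertex outside p, p', q and r *)
have [w [ws wp wq wr]] : exists w, [/\ w \in s, w != p, w != q & w != r].
  have ap : (prev s p, p) \in arcs s by rewrite arcs_prev // ps eqxx.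
  have pb : (p, next s p) \in arcs s by rewrite arcs_next // ps eqxx.
  have [/= as_ _] := arcs_mem ap; have [/= _ bs] := arcs_mem pb.
  have irr e : e \in arcs s -> e.1 != e.2.
    move=> es; have [n [t st]] := rot_arc us s1 (etrans (congr1 (fun e => e \in arcs s) (esym (surjective_pairing e))) es).
    by move: us; rewrite -(rot_uniq n) st /= inE negb_or => /andP[/andP[]].
  have ap' := irr _ ap; have pb' := irr _ pb; move: ap' pb' => /= ap' pb'.
  have [eq1|aq] := eqVneq (prev s p) q; last first.
    have [eq2|ar] := eqVneq (prev s p) r; last by exists (prev s p).
    have [eq3|bq] := eqVneq (next s p) q; first by case: n4; rewrite -{1}eq2 -eq3.
    have [eq4|br] := eqVneq (next s p) r; last by exists (next s p); rewrite eq_sym.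
    by move: ap; rewrite eq2 -eq4 (arcs_antisym us s2 pb).
  have [eq3|br] := eqVneq (next s p) r; first by case: n3; rewrite -{1}eq1 -eq3.
  have [eq4|bq] := eqVneq (next s p) q; last by exists (next s p); rewrite eq_sym.
  by move: ap; rewrite eq1 -eq4 (arcs_antisym us s2 pb).
have far : orient q r p < orient q r w.
  have [v1 v2 v3] := cone (sA _ ws) wp wq wr.
  have -> : orient q r w = orient q p w + orient p r w + orient q r p by rewrite /orient; ring.
  by rewrite ltrDr addr_gt0.
have [||h [u [hS hd ext]]] := @extreme_exists R [:: p', p, q, r & s] (onorm q r)
    (dot (onorm q r) p) w.
- by rewrite !inE ws !orbT.
- by move: far; rewrite !orient_dot ltrD2r.
have ho : orient q r p < orient q r h by rewrite !orient_dot ltrD2r.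
have hne v : orient q r v <= orient q r p -> h != v.
  by move=> hv; apply: contraTneq ho => ->; rewrite -leNgt.
have hp : h != p by apply: hne.
have hp' : h != p' by apply: hne; rewrite ltW // (lt_trans oqrp').
have hq : h != q by apply: hne; rewrite orientxyx ltW.
have hr : h != r by apply: hne; rewrite orientxyy ltW.
have hs : h \in s by move: hS; rewrite !inE (negbTE hp) (negbTE hp') (negbTE hq) (negbTE hr).
have hE : out h = h by rewrite /out (negbTE hp).
exists h, u, u; split=> //.
  by move=> v vs; apply: ext; rewrite !inE vs !orbT.
move=> v /mapP[v0 v0s ->]; rewrite hE; apply: ext.
by rewrite /out; case: ifP => _; rewrite !inE ?eqxx ?v0s ?orbT.
Qed.

Let out_arcs s x y : {subset s <= A} -> x \in A -> y \in A ->
  ((out x, out y) \in arcs (map out s)) = ((x, y) \in arcs s).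
Proof.
move=> sA xA yA; rewrite arcs_map; apply/mapP/idP => [[[a b] ab [e1 e2]]|h]; last by exists (x, y).
have [/= /sA aA /sA bA] := arcs_mem ab.
by rewrite (out_inj xA aA e1) (out_inj yA bA e2).
Qed.

Let alike_out s : psi s -> {subset s <= A} -> tame p s -> alike out s.
Proof.
move=> ps sA tm; have [h1 h2] := rename_list (psi_uniq ps) (psi_size2 ps) sA tm.
by split=> //; exact/h1.
Qed.

Let alike_back s : psi s -> {subset s <= C} -> tame p' s -> alike back s.
Proof.
move=> ps sC tm; pose s0 := map back s.
have s0A : {subset s0 <= A} by move=> v /mapP[w /sC/backA h ->].
have E0 : map out s0 = s by rewrite map_cancel // => v /sC/backK.
have us0 : uniq s0.
  rewrite map_inj_in_uniq; first exact: psi_uniq.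
  by move=> x y /sC xC /sC yC e; rewrite -(backK xC) e backK.
have s02 : (2 < size s0)%N by rewrite size_map psi_size2.
have aE x y : x \in A -> y \in A -> ((x, y) \in arcs s0) = ((out x, out y) \in arcs s).
  by move=> xA yA; rewrite -(out_arcs s0A xA yA) E0.
have tm0 : tame p s0.
  move=> /mapP[v vs e]; have vp : v = p' by rewrite -(backK (sC _ vs)) -e out_p.
  rewrite vp in vs; have [n1 n2 n3 n4] := tm vs.
  by split; rewrite !aE // ?out_p !(outB qB, outB rB).
have [h1 h2] := rename_list us0 s02 s0A tm0; rewrite E0 in h1 h2.
split=> //; first exact/h1.
move=> v vs; have vE := backK (sC _ vs).
by rewrite -{2}vE h2 // map_f.
Qed.

(** Since q p' and p' r are hull edges, each excluded pattern would make s the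
    triangle q p' r, make it cross itself, or give it four convex vertices. *)
Let tame_moved s : psi s -> {subset s <= C} -> edges s != edges tri' -> tame p' s.
Proof.
move=> ps sC ne p's; have [ss cs ls] := ps.
have us := psi_uniq ps; have s1 := psi_size1 ps; have s2 := psi_size2 ps.
have [lq lp'] := hull_left ps sC moved_hull1; have [_ lr] := hull_left ps sC moved_hull2.
have F1 : (r, p') \notin arcs s.
  apply/negP => rp'; have pb : (p', next s p') \in arcs s by rewrite arcs_next // p's eqxx.
  have [/= _ /sC bC] := arcs_mem pb.
  have := lp' p's; rewrite (left_arcs us s1 rp' pb); have := hull_ge0 moved_hull2 bC.
  by rewrite (orientN p' r) oppr_gt0 => h1 /(le_lt_trans h1); rewrite ltxx.
have F2 : (p', q) \notin arcs s.
  apply/negP => p'q_; have ap : (prev s p', p') \in arcs s by rewrite arcs_prev // p's eqxx.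
  have [/= /sC aC _] := arcs_mem ap.
  have := lp' p's; rewrite (left_arcs us s1 ap p'q_); have := hull_ge0 moved_hull1 aC.
  move: (prev s p') => a; rewrite /orient; lra.
have only w : w \in C -> 0 < orient r q w -> w = p'.
  move=> /inC[//|wB]; have := hull_ge0 hullB wB; rewrite (orientN q r) oppr_gt0.
  by move=> h1 h2; have := le_lt_trans h1 h2; rewrite ltxx.
have F3 : (r, q) \notin arcs s.
  apply/negP => rq; have [/= rs qs] := arcs_mem rq.
  have qn : (q, next s q) \in arcs s by rewrite arcs_next // qs eqxx.
  have ln : (prev s r, r) \in arcs s by rewrite arcs_prev // rs eqxx.
  have [/= _ /sC nC] := arcs_mem qn; have [/= /sC lC _] := arcs_mem ln.
  have := lq qs; rewrite (left_arcs us s1 rq qn) => /(only _ nC) e1.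
  have := lr rs; rewrite (left_arcs us s1 ln rq) orientC => /(only _ lC) e2.
  rewrite e1 in qn; rewrite e2 in ln; have [n [t st]] := rot_arcs2 ss qn ln.
  case: t st => [|c t] st.
    by case/negP: ne; rewrite -(edges_rot n us s1) st.
  have us' : uniq [:: q, p', r, c & t] by rewrite -st rot_uniq.
  have rc : (r, c) \in arcs s.
    by rewrite -(perm_mem (arcs_rot n s)) st /= !inE eqxx !orbT.
  move: rc rq; rewrite !arcs_next // => /andP[_ /eqP i1] /andP[_ /eqP i2].
  by move: us'; rewrite i1 -i2 /= !inE eqxx !orbT.
have F4 : ~ ((q, p') \in arcs s /\ (p', r) \in arcs s).
  move=> [qp' p'r_]; have [n [t st]] := rot_arcs2 ss qp' p'r_.
  case: t st => [|c t] st.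
    by case/negP: ne; rewrite -(edges_rot n us s1) st.
  have us' : uniq [:: q, p', r, c & t] by rewrite -st rot_uniq.
  have cs_ : c \in s by rewrite -(mem_rot n) st !inE eqxx !orbT.
  have [cp' cq cr] : [/\ c != p', c != q & c != r].
    move: us'; rewrite /= !inE !negb_or => /and4P[/and4P[_ _ h1 _] /and3P[_ h2 _] /andP[h3 _] _].
    by split; rewrite eq_sym.
  have cB : c \in B by have [e|//] := inC (sC _ cs_); rewrite e eqxx in cp'.
  have [c1 _ _] := conec cB cq cr.
  have [h [hs ho hl]] := extreme_left_orient ss cs cs_ c1.
  have [/= qs _] := arcs_mem qp'; have [/= _ rs] := arcs_mem p'r_.
  have : (size [:: p'; q; r; h] <= count (left s) s)%N; last by rewrite ls.
  apply: count_left_ge.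
  - have hp : p' != h by apply: contraTneq ho => <-; rewrite lt_gtF.
    have hq : q != h by apply: contraTneq ho => <-; rewrite orientxyx ltxx.
    have hr : r != h by apply: contraTneq ho => <-; rewrite orientxyy ltxx.
    by rewrite /= !inE !negb_or p'q p'r qr hp hq hr.
  - by move=> x; rewrite !inE => /or4P[]/eqP->.
  by move=> x; rewrite !inE => /or4P[]/eqP-> //; [exact: lp'|exact: lq|exact: lr].
split=> //; last by case=> h _; rewrite h in F1.
apply/negP => qr_; have [a [b [ap pb]]] := vertex_arcs ss p's.
have [/= _ bs] := arcs_mem pb.
have bq : b != q by apply: contraNneq F2 => <-.
have br : b != r.
  apply/eqP => e; rewrite e in pb; move: pb qr_; rewrite !arcs_prev // => /andP[_ /eqP i1].
  by move=> /andP[_ /eqP i2]; move: p'q; rewrite i1 -i2 eqxx.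
have [_ _ pb' _] := arcs_turn ss ap pb.
have bB : b \in B by have [e|//] := inC (sC _ bs); rewrite e eqxx in pb'.
have [c1 c2 c3] := conec bB bq br.
have gs : gpos s by case: ss.
have /(_ ss) H := (simpleP us s2 gs).1.
have ne' : (q, r) != (p', b) by rewrite xpair_eqE (eq_sym q) (negbTE p'q).
case/negP: (H _ _ qr_ pb ne'); rewrite /cross /=.
rewrite nmulr_rlt0 // c1 /=.
have -> : orient p' b q = orient q p' b by rewrite /orient; ring.
have -> : orient p' b r = - orient p' r b by rewrite /orient; ring.
by rewrite pmulr_rlt0 // oppr_lt0.
Qed.

Hypothesis pW : p \notin W.

Let tri := [:: q; r; p].
Let ptri : psi tri. Proof. exact: psi_tri. Qed.
Let triA : {subset tri <= A}.
Proof. by move=> v; rewrite mem_seq3 => /or3P[]/eqP->. Qed.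
Let tri1 : (q, r) \in arcs tri. Proof. by rewrite mem_head. Qed.
Let tri2 : (r, p) \in arcs tri. Proof. by rewrite inE mem_head orbT. Qed.
Let tri3 : (p, q) \in arcs tri. Proof. by rewrite !inE eqxx !orbT. Qed.

(** The arcs of the triangle qrp are taken, and p has no large angle. *)
Let tame_ear T s : pt A W T -> psi s -> edges s \in T -> {subset s <= A} ->
  edges s != edges tri -> tame p s.
Proof.
move=> ptT ps sT sA ne ps1; have tT := nonpointed_tri E pW ptT.
have [fT cT covT pT] := ptT; have [ss _ _] := ps.
have us := psi_uniq ps; have s1 := psi_size1 ps.
have no x y : (x, y) \in arcs tri -> (x, y) \notin arcs s.
  move=> xy; apply: contra ne => xy'.
  by apply/eqP; exact: (same_arc gA A2 fT cT ps ptri sT tT xy' xy).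
have [lq _] := hull_left ps sA (ear_hull E).
split; first exact: no tri1.
- apply/negP => rq; have [/= _ qs] := arcs_mem rq.
  have qn : (q, next s q) \in arcs s by rewrite arcs_next // qs eqxx.
  have [/= _ /sA nA] := arcs_mem qn.
  have := lq qs; rewrite (left_arcs us s1 rq qn); have := hull_ge0 (ear_hull E) nA.
  by rewrite (orientN q r) oppr_gt0 => h1 /(le_lt_trans h1); rewrite ltxx.
- move=> [qp pr_]; have := nonpointed_left E pW ptT ps sT ps1.
  by rewrite (left_arcs us s1 qp pr_); move: o0; rewrite /orient; lra.
by move=> [rp _]; move: (no _ _ tri2); rewrite rp.
Qed.

(** The hull of C exceeds the image of the one of A by a reversed triangle. *)
Let chull_out_eq x y : x \in A -> y \in A ->
  chull C (out x) (out y) = chull A x y - chi (edges tri) x y.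
Proof.
move=> xA yA; rewrite moved_chull (chi_tri _ _ o0).
have arcE u v : u \in A -> v \in A -> arc1 (out u, out v) (out x) (out y) = arc1 (u, v) x y.
  by move=> uA vA; rewrite /arc1 !xpair_eqE !(inj_in_eq out_inj).
have -> : chull B (out x) (out y) = chull A x y.
  have [e|xB] := inA xA.
    rewrite e out_p [LHS]chull_out ?(negbTE p'B) // /chull.
    by have [-> ->] := ear_p_nohull E y.
  have [e|yB] := inA yA.
    rewrite e out_p [LHS]chull_out ?(negbTE p'B) ?andbF // /chull.
    by have [-> ->] := ear_p_nohull E x.
  by rewrite !outB // (ear_chullB E).
have := arcE q r qA rA; have := arcE q p qA pA; have := arcE p r pA rA.
rewrite out_p (outB qB) (outB rB) => -> -> ->.
by rewrite (arc1C p r) (arc1C q p); ring.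
Qed.

Let rename_tri : rename out (edges tri) = edges tri'.
Proof.
rewrite rename_edges; last by move=> x y /triA xA /triA yA; exact: out_inj.
- rewrite /= (outB qB) (outB rB) out_p !edges_arcs //.
  + apply/fsetP => e; apply/imfsetP/imfsetP => /= -[a]; rewrite !inE => /or3P[]/eqP-> ->.
    * by exists (r, q); rewrite ?inE ?eqxx ?orbT //= fset2C.
    * by exists (p', r); rewrite ?inE ?eqxx ?orbT //= fset2C.
    * by exists (q, p'); rewrite ?inE ?eqxx ?orbT //= fset2C.
    * by exists (p', q); rewrite ?inE ?eqxx ?orbT //= fset2C.
    * by exists (r, p'); rewrite ?inE ?eqxx ?orbT //= fset2C.
    by exists (q, r); rewrite ?inE ?eqxx ?orbT //= fset2C.
  + exact: psi_uniq ptri'.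
  by rewrite /= !inE !negb_or qr (eq_sym q) p'q (eq_sym r) p'r.
- exact: psi_uniq ptri.
by [].
Qed.

Let back_out s : psi s -> {subset s <= A} -> rename back (rename out (edges s)) = edges s.
Proof.
move=> ps sA; have inj : {in s &, injective out} by move=> x y /sA xA /sA yA; exact: out_inj.
rewrite rename_edges ?psi_uniq ?psi_size1 // rename_edges.
- by rewrite map_cancel // => v /sA/outK.
- by rewrite map_inj_in_uniq // psi_uniq.
- by rewrite size_map psi_size1.
by move=> x y /mapP[a /sA/outK ka ->] /mapP[b /sA/outK kb ->] h; rewrite -ka -kb h.
Qed.

(** The pseudo-triangulations in which the notch at p' is not a triangle of its
    own survive pushing p' back to p, where the triangle qrp appears. *)
Lemma card_rename : #|` [fset T in PT C W | `[< edges tri' \notin T >]]| = #|` PT A W|.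
Proof.
have gC := moved_gp.
have iC : interior_points C = interior_points A `\ p.
  by rewrite moved_interior (ear_interiorB E).
have pI := ear_interior E.
have TEC T : psi_family C T -> edges tri' \notin T ->
    forall P, P \in T -> exists s, [/\ P = edges s, {subset s <= C} & alike back s].
  move=> fT tT P PT; have [s [ps e sC]] := fT P PT; exists s; split=> //.
  apply: alike_back => //; apply: tame_moved => //; rewrite -e.
  by apply: contraNneq tT => <-.
have TEA T : pt A W T -> forall P, P \in T `\ edges tri ->
    exists s, [/\ P = edges s, {subset s <= A} & alike out s].
  move=> ptT P; rewrite in_fsetD1 => /andP[Pt PT]; have [fT _ _ _] := ptT.
  have [s [ps e sA]] := fT P PT; exists s; split=> //.
  by apply: alike_out => //; apply: (tame_ear ptT) => //; rewrite -e.
have tri_new T : psi_family C T -> edges tri' \notin T ->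
    edges tri \notin [fset rename back P | P in T].
  move=> fT tT; apply: contra (tT) => tU.
  rewrite -(renameK backA backK outK (TEC T fT tT)).
  by apply/imfsetP; exists (edges tri) => //=; rewrite rename_tri.
pose Rel T T' := T' = edges tri |` [fset rename back P | P in T].
apply: (card_rel (Rel := Rel)).
- move=> T /in_comprehension[/(PTP _ _ gC C2)[fT cT covT pT] tT].
  set U := [fset rename back P | P in T]; exists (edges tri |` U) => //.
  have TE := TEC T fT tT; have tU := tri_new T fT tT.
  have fU : psi_family A (edges tri |` U).
    move=> P; rewrite in_fset1U => /orP[/eqP->|]; first by exists tri.
    exact: (rename_family backA backK TE).
  apply/(PTP _ _ gA A2); split=> //.
  + move=> x y; have [/andP[xA yA]|n] := boolP ((x \in A) && (y \in A)); last first.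
      by rewrite (chi_out fU n) (chull_out n).
    rewrite big_fsetU1 //= (rename_chi backA backK outK TE xA yA) cT chull_out_eq //.
    by rewrite addrC subrK.
  + apply: (cover_fam fU) => x /inA[->|xB].
      exists (edges tri); first by rewrite in_fset1U eqxx.
      by rewrite vertices_psi // !inE eqxx !orbT.
    have : out x \in (\bigcup_(P <- T) vertices P)%fset by rewrite covT outB // BC.
    move=> /mem_cover/(rename_vertex backK outK TE (BA xB))[P PU xP].
    by exists P => //; rewrite in_fset1U PU orbT.
  move=> x xi; have xA := interior_sub xi.
  have E1 : (exists2 P, P \in edges tri |` U & reflex_vertex P x) <->
      (exists2 P, P \in T & reflex_vertex P (out x)).
    rewrite -(rename_reflex backK outK TE xA); split=> -[P].
      rewrite in_fset1U => /orP[/eqP->|PU rP]; last by exists P.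
      move=> /(reflex_edges _ ptri)[xt]; by rewrite (left_tri o0).
    by move=> PU rP; exists P; rewrite // in_fset1U PU orbT.
  rewrite E1; have [->|xp] := eqVneq x p.
    split=> [[P /fT[s [ps -> sC]]]|]; last by rewrite (negbTE pW).
    move=> /(reflex_edges _ ps)[]; rewrite out_p => p's.
    by have [-> //] := hull_left ps sC moved_hull2.
  have xB : x \in B by rewrite in_fsetD1 xp.
  by rewrite outB //; apply: pT; rewrite iC in_fsetD1 xp.
- move=> T' /(PTP _ _ gA A2) ptT'; have [fT' cT' covT' pT'] := ptT'.
  have tT' := nonpointed_tri E pW ptT'; have TE := TEA T' ptT'.
  set T0 := T' `\ edges tri in TE; set U := [fset rename out P | P in T0].
  exists U; last first.
    by rewrite /Rel /U (renameK outC outK backK TE) fsetD1K.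
  have fU : psi_family C U by exact: (rename_family outC outK TE).
  apply/in_comprehension; split; last first.
    apply/negP => tU; have : edges tri \in T0; last by rewrite in_fsetD1 eqxx.
    have [s [sT0 sA al e]] := rename_mem outK TE tU.
    have [ps _ _] := al; rewrite -(back_out ptri triA) rename_tri e.
    by rewrite -rename_edges ?psi_uniq ?psi_size1 ?back_out // => x y /sA xA /sA yA; exact: out_inj.
  apply/(PTP _ _ gC C2); split=> //.
  + move=> x y; have [/andP[xC yC]|n] := boolP ((x \in C) && (y \in C)); last first.
      by rewrite (chi_out fU n) (chull_out n).
    rewrite (rename_chi outC outK backK TE xC yC).
    rewrite -{2}(backK xC) -{2}(backK yC) chull_out_eq ?backA // -cT'.
    by rewrite [in RHS](big_fsetD1 (edges tri)) //= addrAC subrr add0r.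
  + have opp x y : (x, y) \in arcs tri -> ~~ hull A x y -> exists2 P, P \in T0 &
        x \in vertices P /\ y \in vertices P.
      move=> xy nh; have [s [ps sT sA yx]] := opp_arc A2 fT' cT' ptri tT' xy nh.
      have [/= ys xs] := arcs_mem yx; exists (edges s); last by rewrite !vertices_psi.
      rewrite in_fsetD1 sT andbT; apply/eqP => e.
      have := edges_arc ps ptri e (y, x); rewrite yx (arcs_antisym _ _ xy) //.
      exact: psi_uniq.
    apply: (cover_fam fU) => x xC; apply/(rename_vertex outK backK TE xC).
    have [|P PT0 [pP qP]] := opp p q tri3; first by have [-> _] := ear_p_nohull E q.
    have [|Q QT0 [rQ _]] := opp r p tri2; first by have [_ ->] := ear_p_nohull E r.
    have : back x \in (\bigcup_(P <- T') vertices P)%fset by rewrite covT' backA.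
    move=> /mem_cover[P' P'T xP']; have [e|ne] := eqVneq P' (edges tri); last first.
      by exists P'; rewrite // in_fsetD1 ne.
    move: xP'; rewrite e vertices_psi // !inE => /or3P[]/eqP->;
      by [exists P|exists Q|exists P].
  move=> x xi; have xC := interior_sub xi; move: xi; rewrite iC in_fsetD1 => /andP[xp xi].
  have xB : x \in B by rewrite in_fsetD1 xp interior_sub.
  rewrite (rename_reflex outK backK TE xC) backB // -(pT' x xi).
  split=> -[P PT rP]; exists P => //; first by move: PT; rewrite in_fsetD1 => /andP[].
  rewrite in_fsetD1 PT andbT; apply: contraPneq rP => -> /(reflex_edges _ ptri)[xt].
  by rewrite (left_tri o0).
- by move=> T T1 T2 _ -> ->.
move=> T1 T2 T' /in_comprehension[/(PTP _ _ gC C2)[fT1 _ _ _] t1].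
move=> /in_comprehension[/(PTP _ _ gC C2)[fT2 _ _ _] t2] e1 e2.
rewrite -(renameK backA backK outK (TEC _ fT1 t1)) -(renameK backA backK outK (TEC _ fT2 t2)).
have U1 := fsetU1K (tri_new _ fT1 t1); have U2 := fsetU1K (tri_new _ fT2 t2).
by rewrite -U1 -U2 -e1 -e2.
Qed.

Lemma count_moved : #|` PT C W| = (#|` PT A W| + #|` PT B W|)%N.
Proof.
rewrite card_fill -card_rename addnC; set X1 := (X in (#|` X| + _)%N); set X2 := (X in (_ + #|` X|)%N).
have -> : PT C W = X1 `|` X2.
  apply/fsetP => T; rewrite in_fsetU; apply/idP/orP => [TC|].
    by have [h|h] := boolP (edges tri' \in T); [left|right]; apply/in_comprehension.
  by move=> []/in_comprehension[].
rewrite cardfsU (_ : X1 `&` X2 = fset0) ?cardfs0 ?subn0 //.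
apply/eqP; rewrite fsetI_eq0; apply/fdisjointP => T /in_comprehension[_ h].
by apply/negP => /in_comprehension[_]; rewrite h.
Qed.

End Moved.

(** * Almost convex position *)

Section AlmostConvex.
Local Open Scope fset_scope.
Local Open Scope ring_scope.
Context {R : realType}.
Implicit Types (p q r w : plane R) (A : {fset plane R}).

Lemma close_to_edgeC A p q r : close_to_edge A p q r -> close_to_edge A p r q.
Proof. by rewrite /close_to_edge -!fsetUA [[fset r; q]]fset2C. Qed.

Lemma moved_acrossC A p q r p' : moved_across A p q r p' -> moved_across A p r q p'.
Proof.
move=> [M1 M2]; split; last by move=> x y xB yB; rewrite [X in _ != X]fset2C; exact: M2.
have sw w : orient w r q = - orient w q r by rewrite /orient; ring.
by rewrite !sw !sgrN M1.
Qed.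

(** A point w beyond the line through q and p would span with q a segment that
    enters the triangle qrp, separating p from the edge. *)
Lemma hull_ear A p q r : general_position A -> (2 < #|` A `\` interior_points A|)%N ->
  p \in interior_points A -> hull A q r -> close_to_edge A p q r -> ear A p q r.
Proof.
move=> gA v3 pI hqr cl; have pA := interior_sub pI.
have /hullP[qA rA qr H] := hqr; have [qi ri] := hull_exterior hqr.
have pq : p != q by apply: contraNneq qi => <-.
have pr : p != r by apply: contraNneq ri => <-.
have o0 := H p pA pq pr.
have [w0 [w0A w0q w0r]] := fset3_third q r v3.
split=> //; last first.
  exists w0; move: w0A; rewrite in_fsetD => /andP[w0i ->]; split=> //.
  by apply: contraNneq w0i => ->.
move=> w wA wp wq wr; have c1 := H w wA wq wr.
have small (k l : R) : 0 < k -> exists m, [/\ 0 < m, m < 1 & 0 < (1 - m) * k + m * l].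
  move=> k0; have s0 : 0 < k + `|l| by rewrite ltr_wpDr.
  have E : k / (2 * (k + `|l|)) * (k + `|l|) = k / 2 by field; rewrite gt_eqF.
  have m0 : 0 < k / (2 * (k + `|l|)) by rewrite divr_gt0 // mulr_gt0.
  move: E m0; set m := k / _ => E m0; exists m.
  have l1 : - `|l| <= l by rewrite lerNl ler_normr lexx orbT.
  have l2 : m * (- `|l|) <= m * l by rewrite ler_pM2l.
  have l3 : m * k <= k / 2 by rewrite -E ler_pM2l // lerDl.
  split=> //; first by rewrite -(ltr_pM2r k0); lra.
  by move: E l2; rewrite mulrDr mulrN; lra.
have inside u z : u \in A -> seg u w z -> 0 < orient q r z -> 0 < orient r p z ->
    0 < orient p q z -> False.
  move=> uA uz z1 z2 z3; suff : (set0 : set (plane R)) z by [].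
  rewrite -(cl u w uA wA); split.
    by apply: conv_seg uz; rewrite !inE eqxx ?orbT.
  by apply: (interior_triangle (x := q) (y := r) (u := p)); rewrite // !inE eqxx ?orbT.
have pt u (m : R) : 0 < m -> m < 1 -> seg u w (u + m *: (w - u)).
  by move=> m0 m1; exists m; split=> //; exact: ltW.
have orpq : orient r p q = orient q r p by rewrite /orient; ring.
have opqr : orient p q r = orient q r p by rewrite /orient; ring.
have [wq' wr' wp'] : [/\ q != w, r != w & p != w] by split; rewrite eq_sym.
split=> //.
  have := gA q p w qA pA wA; rewrite eq_sym => /(_ pq wp' wq').
  case: (ltgtP (orient q p w) 0) => // neg _; exfalso.
  have [m [m0 m1 mp]] := small (orient r p q) (orient r p w) ltac:(by rewrite orpq).
  apply: (inside q (q + m *: (w - q)) qA (pt _ _ m0 m1)); rewrite orient_cvx //.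
  - by rewrite orientxyx mulr0 add0r mulr_gt0.
  by rewrite orientxyy mulr0 add0r mulr_gt0 // orientN oppr_gt0.
have := gA p r w pA rA wA pr wr' wp'.
case: (ltgtP (orient p r w) 0) => // neg _; exfalso.
have [m [m0 m1 mp]] := small (orient p q r) (orient p q w) ltac:(by rewrite opqr).
apply: (inside r (r + m *: (w - r)) rA (pt _ _ m0 m1)); rewrite orient_cvx //.
- by rewrite orientxyy mulr0 add0r mulr_gt0.
by rewrite orientxyx mulr0 add0r mulr_gt0 // orientN oppr_gt0.
Qed.

Lemma close_ear A p q r : general_position A -> (2 < #|` A `\` interior_points A|)%N ->
  p \in interior_points A -> hull_edge A q r -> close_to_edge A p q r ->
  ear A p q r \/ ear A p r q.
Proof.
move=> gA v3 pI he cl; have [qA rA qr H] := he.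
have [w [wA wq wr]] := fset3_third q r v3.
have wA' : w \in A by move: wA; rewrite in_fsetD => /andP[].
have wn : w \notin [fset q; r] by rewrite !inE negb_or wq.
have side x : x \in A -> x != q -> x != r -> 0 < orient q r w * orient q r x.
  by move=> xA xq xr; apply: H => //; rewrite !inE negb_or xq.
case: (ltgtP 0 (orient q r w)) => o.
- left; apply: hull_ear => //; apply/hullP; split=> // z zA zq zr.
  by rewrite -(pmulr_rgt0 _ o) side.
- right; apply: hull_ear => //; last exact: close_to_edgeC.
  apply/hullP; split=> //; first by rewrite eq_sym.
  move=> z zA zr zq; have := side z zA zq zr.
  have -> : orient r q z = - orient q r z by rewrite /orient; ring.
  by rewrite nmulr_rgt0 // oppr_gt0.
by have := side w wA' wq wr; rewrite -o mul0r ltxx.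
Qed.

Lemma almost_convex_ear A v i e p : (2 < v)%N -> almost_convex A v i e ->
  p \in interior_points A -> exists q r, e p = [fset q; r] /\ ear A p q r.
Proof.
move=> v3 [gA vA _ _ H] pI; have [q [r [ep he cl]]] := H p pI.
rewrite -vA in v3; have [E|E] := close_ear gA v3 pI he cl; first by exists q, r.
by exists r, q; rewrite fset2C.
Qed.

Lemma ear_moved A p q r p' W : ear A p q r -> moved_across A p q r p' ->
  W `<=` interior_points A -> p \notin W ->
  let B := A `\ p in let C := p' |` B in
  [/\ W `<=` interior_points B /\ W `<=` interior_points C,
      #|` PT A W|%:Z = #|` PT C W|%:Z - #|` PT B W|%:Z
    & #|` PT A (p |` W)|%:Z = 2 * #|` PT C W|%:Z - #|` PT B W|%:Z].
Proof.
move=> E M WA pW /=.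
have WB : W `<=` interior_points (A `\ p).
  by rewrite (ear_interiorB E) fsubsetD1 WA.
have nC := count_moved E M pW; have nA := count_pointed E pW.
split; first by rewrite (moved_interior E M).
  by rewrite nC PoszD addrK.
rewrite nA nC mul2n -addnn !PoszD; ring.
Qed.

End AlmostConvex.


Local Open Scope fset_scope.

Theorem lemma2 (R : realType) (v i : nat) (A : {fset plane R})
    (e : plane R -> {fset plane R}) (p q r : plane R)
    (hv : (3 <= v)%N) (hi : (1 <= i <= v)%N)
    (hA : almost_convex A v i e)
    (hp : p \in interior_points A) (hqr : e p = [fset q; r]) :
  let B := A `\ p in
  [/\ forall (p' : plane R) (W : {fset plane R}),
        moved_across A p q r p' ->
        W `<=` interior_points A -> p \notin W ->
        let C := p' |` B in
        [/\ W `<=` interior_points B /\ W `<=` interior_points C,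
            (#|` PT A W|%:Z = #|` PT C W|%:Z - #|` PT B W|%:Z)%R
          & (#|` PT A (p |` W)|%:Z
               = 2 * #|` PT C W|%:Z - #|` PT B W|%:Z)%R],
      forall W : {fset plane R},
        W `<=` interior_points A -> p \notin W ->
        #|` PT A (p |` W)| = (2 * #|` PT A W| + #|` PT B W|)%N
    & forall (U : {fset plane R}) (s : plane R),
        U `<=` interior_points A -> s \in U ->
        (#|` PT A (U `\ s)| <= #|` PT A U|)%N].
Proof.
have v3 : (2 < v)%N by [].
have [q' [r' [e1 E]]] := almost_convex_ear v3 hA hp.
have qrE : [fset q; r] = [fset q'; r'] by rewrite -hqr.
move=> B; split.
- move=> p' W M WA pW /=; apply: (ear_moved E _ WA pW).
  have [[<- <-]|[<- <-]] := fset2_eq qrE; first exact: M.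
  exact: moved_acrossC.
- by move=> W WA pW; exact: (count_pointed E pW).
move=> U s UA sU.
have sI : s \in interior_points A by apply: (fsubsetP UA).
have [q0 [r0 [_ E0]]] := almost_convex_ear v3 hA sI.
have := count_pointed E0 (_ : s \notin U `\ s); rewrite fsetD1K // => -> //.
  by rewrite mul2n -addnn -addnA leq_addr.
by rewrite in_fsetD1 eqxx.
Qed.
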